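(* Let $h_1,h_2\in C^\infty(\mathbb{S}^2)$ be positive functions. If the system $$\begin{cases} -\Delta u = h_1 e^{2u} - 1 + h_2 e^{u}|\psi|^2, & \text{on } \mathbb{S}^2,\\ D\psi = h_2 e^{u}\psi, & \text{on } \mathbb{S}^2,\end{cases}$$ admits a solution $(u,\psi)$ with $\psi\not\equiv0$, then $$\min_{\mathbb{S}^2}h_1<\Bigl(\max_{\mathbb{S}^2}h_2\Bigr)^2 .$$
   Context: $\mathbb{S}^2$ has its standard round metric $g_0$ and its unique spin structure; $\Delta$ is the (nonpositive) Laplace–Beltrami operator and $D\psi=\sum_{\alpha=1}^2 e_\alpha\cdot\nabla_{e_\alpha}\psi$ the Dirac operator on the spinor bundle $\mathcal{S}\mathbb{S}^2$ (with $X\cdot Y+Y\cdot X=-2g_0(X,Y)$). Solutions are weak solutions $(u,\psi)\in H^1(\mathbb{S}^2)\times H^{1/2}(\mathcal{S}\mathbb{S}^2)$, $u$ real-valued, where $H^{1/2}(\mathcal{S}\mathbb{S}^2)$ is the domain in $L^2$ of $|D|^{1/2}$; such solutions are smooth. *)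

(* Defs.v *)
From HB Require Import structures.
From mathcomp Require Import all_boot all_order all_algebra.
From mathcomp Require Import complex ring.
From mathcomp Require Import all_classical all_reals all_analysis.

Set Implicit Arguments.
Unset Strict Implicit.
Unset Printing Implicit Defensive.

Import Order.TTheory GRing.Theory Num.Theory.
Import numFieldNormedType.Exports.

Local Open Scope classical_set_scope.
Local Open Scope ring_scope.
Local Open Scope complex_scope.

(* The round sphere is the unit sphere of R^3 = 'rV[R]_3 with the induced
   metric.  A function on the sphere is represented by a function on R^3;
   every notion below depends only on its values on the unit sphere. *)

Section Sphere.
Context {R : realType}.
Implicit Types (x X Y : 'rV[R]_3) (f u : 'rV[R]_3 -> R).

Definition dot X Y : R := \sum_j X 0 j * Y 0 j.

Definition sphere : set 'rV[R]_3 := [set x | dot x x = 1].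

Definition e_ (j : 'I_3) : 'rV[R]_3 := delta_mx 0 j.

(* orthogonal projection of R^3 onto the tangent plane at x, for x in sphere *)
Definition tproj x X : 'rV[R]_3 := X - dot X x *: x.

(* extension of f|sphere to R^3 \ {0}, homogeneous of degree 0 *)
Definition radial f : 'rV[R]_3 -> R :=
  fun y => f ((Num.sqrt (dot y y))^-1 *: y).

(* df_x(X), for x in sphere and X tangent at x *)
Definition sder f x X : R := 'D_X (radial f) x.

(* C^oo on an open set U: all iterated directional derivatives are
   differentiable at each point of U *)
Definition smooth_on (U : set 'rV[R]_3) f : Prop :=
  forall (s : seq 'rV[R]_3) x, U x ->
    differentiable (foldr (fun v g => 'D_v g) f s) x.

Definition smooth f : Prop := smooth_on [set y | y != 0] (radial f).

Definition grad f x : 'rV[R]_3 :=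
  \sum_j sder f x (tproj x (e_ j)) *: tproj x (e_ j).

Definition smooth_field (Y : 'rV[R]_3 -> 'rV[R]_3) : Prop :=
  (forall j, smooth (fun x => Y x 0 j)) /\
  (forall x, sphere x -> dot (Y x) x = 0).

(* For Y tangent this is sum_alpha <nabla_{e_alpha} Y, e_alpha>: nabla_X Y is
   the tangential part of the R^3-derivative of Y along X. *)
Definition div (Y : 'rV[R]_3 -> 'rV[R]_3) x : R :=
  \sum_j dot (\row_k sder (fun y => Y y 0 k) x (tproj x (e_ j)))
             (tproj x (e_ j)).

(* Measure theory on the sphere is expressed in spherical coordinates
   (theta, phi) in [0, pi] x [0, 2 pi], where the area form is
   sin theta dtheta dphi. *)
Definition coord (p : R * R) : 'rV[R]_3 :=
  \row_(j < 3) [:: sin p.1 * cos p.2; sin p.1 * sin p.2; cos p.1]`_j.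

Definition rect : set (R * R) := `[0, pi] `*` `[0, 2 * pi].

Definition leb2 := (@lebesgue_measure R \x @lebesgue_measure R)%E.

Definition smeasurable f : Prop := measurable_fun rect (f \o coord).

Definition sint f : \bar R :=
  (\int[leb2]_(p in rect) (f (coord p) * sin p.1)%:E)%E.

Definition sae (P : 'rV[R]_3 -> Prop) : Prop :=
  {ae leb2, forall p, rect p -> P (coord p)}.

Definition L2 f : Prop :=
  smeasurable f /\ (sint (fun x => (f x ^+ 2)%R) < +oo)%E.

Definition weak_gradient u (V : 'rV[R]_3 -> 'rV[R]_3) : Prop :=
  [/\ forall j, L2 (fun x => V x 0%R j),
      forall x, sphere x -> dot (V x) x = 0 &
      forall W, smooth_field W ->
        sint (fun x => dot (V x) (W x)) = sint (fun x => - (u x * div W x))].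

Definition H1 u : Prop := L2 u /\ exists V, weak_gradient u V.

End Sphere.

(* The spinor bundle of the sphere is the trivial bundle with fibre C^2, the
   restriction of the spinor bundle of R^3.  With the Pauli matrices sigma_j
   and sigma(X) = sum_j X_j sigma_j, a tangent vector X at x acts by
     X . s = i sigma(X) s,
   and the spin connection is
     nabla_X psi = d_X psi + 1/2 sigma(x) sigma(X) psi.
   The connection is metric; for tangent Y, lemma [conn_clifford] below and
   the Gauss formula d_X Y = nabla_X Y - <X, Y> x give the Leibniz rule
   nabla_X (Y . psi) = (nabla_X Y) . psi + Y . nabla_X psi.  The connection
   form sigma(x) sigma(X) / 2 is su(2)-valued for tangent X, so no line bundle
   twists the spin connection. *)

Section Spinors.
Context {R : realType}.
Notation C := R[i].
Notation spinor := ('rV[R]_3 -> 'cV[R[i]]_2).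
Implicit Types (x X Y : 'rV[R]_3) (psi phi : spinor) (s t : 'cV[C]_2).

Definition pauli X : 'M[C]_2 :=
  \matrix_(i < 2, j < 2)
    if i == 0 then
      if j == 0 then X 0 2%:R +i* 0 else X 0 0 +i* (- X 0 1)
    else
      if j == 0 then X 0 0 +i* X 0 1 else (- X 0 2%:R) +i* 0.

Lemma pauliAC X Y :
  pauli X *m pauli Y + pauli Y *m pauli X = (2 * dot X Y)%:C%:M.
Proof.
have E3 (F : 'I_3 -> R) : \sum_j F j = F 0 + F 1 + F 2%:R.
  rewrite !big_ord_recr big_ord0 /= add0r.
  by congr (F _ + F _ + F _); apply: val_inj.
apply/matrixP => i j; rewrite !mxE !big_ord_recr !big_ord0 /= !mxE /= /dot E3.
by case: i j => -[|[|//]] ? [[|[|//]] ?] /=; simpc; congr (_ +i* _); ring.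
Qed.

Definition clifford X s : 'cV[C]_2 := (0 +i* 1) *: (pauli X *m s).

Definition conn x X s : 'cV[C]_2 := 2%:R^-1 *: (pauli x *m (pauli X *m s)).

(* a hermitian product, linear in the first argument *)
Definition hdot s t : C := \sum_k s k 0 * (t k 0)^*.

Definition sqnorm s : R := complex.Re (hdot s s).

Definition spinor_der psi x X : 'cV[C]_2 :=
  \col_k (sder (fun y => complex.Re (psi y k 0)) x X +i*
          sder (fun y => complex.Im (psi y k 0)) x X).

Definition nabla psi x X : 'cV[C]_2 := spinor_der psi x X + conn x X (psi x).

(* sum_alpha e_alpha . nabla_{e_alpha} psi over an orthonormal basis of the
   tangent plane; the projections of the standard basis of R^3 give the same
   sum, since sum_j (P e_j) (x) (P e_j) = sum_alpha e_alpha (x) e_alpha. *)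
Definition dirac psi : spinor := fun x =>
  \sum_j clifford (tproj x (e_ j)) (nabla psi x (tproj x (e_ j))).

Definition smooth_spinor psi : Prop := forall k,
  smooth (fun x => complex.Re (psi x k 0)) /\
  smooth (fun x => complex.Im (psi x k 0)).

Definition L2_spinor psi : Prop := forall k,
  L2 (fun x => complex.Re (psi x k 0)) /\
  L2 (fun x => complex.Im (psi x k 0)).

Definition csint (F : 'rV[R]_3 -> C) : C :=
  fine (sint (fun x => complex.Re (F x))) +i*
  fine (sint (fun x => complex.Im (F x))).

Definition L2dot psi phi : C := csint (fun x => hdot (psi x) (phi x)).

Definition eigenspinor (l : R) phi : Prop :=
  smooth_spinor phi /\ forall x, sphere x -> dirac phi x = l%:C *: phi x.

(* The domain of |D|^{1/2} in L^2.  D is self-adjoint with discrete spectrum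
   and smooth eigenspinors, so psi is in the domain iff the sum of
   |l_i| |<psi, phi_i>|^2 over an orthonormal eigenbasis (phi_i) is finite,
   i.e. iff the sums over finite orthonormal families of eigenspinors are
   bounded. *)
Definition Hhalf psi : Prop :=
  L2_spinor psi /\
  exists M : R, forall (n : nat) (l : 'I_n -> R) (phi : 'I_n -> spinor),
    (forall i, eigenspinor (l i) (phi i)) ->
    (forall i j, L2dot (phi i) (phi j) = (i == j)%:R) ->
    \sum_i `|l i| * (complex.Re (L2dot psi (phi i)) ^+ 2 +
                     complex.Im (L2dot psi (phi i)) ^+ 2) <= M.

(* Both equations are tested against smooth functions and spinors.  The first
   is an equality in \bar R: for f = 1 it makes h1 e^{2u} and
   h2 e^u |psi|^2 integrable, for positive h1 and h2, and then all the
   integrands below are integrable. *)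
Definition weak_solution (h1 h2 u : 'rV[R]_3 -> R) psi : Prop :=
  [/\ H1 u,
      Hhalf psi,
      (exists2 V, weak_gradient u V & forall f, smooth f ->
         sint (fun x => dot (V x) (grad f x)) =
         sint (fun x => (h1 x * expR (2 * u x) - 1 +
                         h2 x * expR (u x) * sqnorm (psi x)) * f x)) &
      forall phi, smooth_spinor phi ->
        L2dot psi (dirac phi) =
        csint (fun x => (h2 x * expR (u x))%:C * hdot (psi x) (phi x))].

Lemma clifford_rel X Y s :
  clifford X (clifford Y s) + clifford Y (clifford X s) =
  (- 2 * dot X Y)%:C *: s.
Proof.
rewrite /clifford -!scalemxAr !scalerA -scalerDr !mulmxA -mulmxDl pauliAC.
by rewrite mul_scalar_mx scalerA; congr (_ *: _); simpc; congr (_ +i* _); ring.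
Qed.

Lemma conn_clifford x X Y s : dot Y x = 0 ->
  conn x X (clifford Y s) - clifford Y (conn x X s) =
  (dot X Y)%:C *: clifford x s.
Proof.
move=> Yx.
have Yx' : pauli Y *m pauli x = - (pauli x *m pauli Y).
  by apply/eqP; rewrite -addr_eq0 pauliAC Yx mulr0 raddf0.
rewrite /conn /clifford -!scalemxAr !scalerA (mulrC _ 2%:R^-1) -scalerBr.
rewrite !mulmxA Yx' !mulNmx opprK -!mulmxA -mulmxDr !mulmxA -mulmxDl pauliAC.
rewrite mul_scalar_mx -scalemxAr scalerA; congr (_ *: _).
rewrite [(2 * _)%:C]rmorphM /= mulrA mulrC; congr (_ * _).
by rewrite mulrAC rmorph_nat mulVf ?pnatr_eq0// mul1r.
Qed.

End Spinors.

(* Main.v *)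
(* Let [P = h2 e^u] and [f = h1 e^(2u) + P |psi|^2], so that [- Delta u = f - 1].
   With [I(X)] the Clifford multiplication by a vector [X] of R^3, [I_j = I(e_j)]
   and [R_j] the derivative along the rotation field [e_j x x], put
   [S = 1 - sum_j I_j R_j].  The Dirac equation gives [|S psi| = P |psi|].
   The constraint [sum_j x_j R_j = 0] improves Cauchy-Schwarz to
   [|sum_j I_j v_j|^2 <= 2 sum_j |v_j|^2], and an integration by parts yields
     int e^(-s) (1 - Delta s) |psi|^2 <= int e^(-s) |S psi|^2
   for all functions [s] and spinors [psi].  For [s = u] the left side is
   [int e^(-u) f |psi|^2 >= int h1 e^u |psi|^2 + int h2 |psi|^4], while the right
   side is at most [(max h2)^2 int e^u |psi|^2].  If [(max h2)^2 <= min h1], this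
   forces [int h2 |psi|^4 <= 0], hence [psi = 0].

   A weak solution is not known to be smooth, so the inequality is applied to
   mollifications.  Testing the equations against [ln (t + 1 - <x, y>)] and
   [(y - x) eta / (t + 1 - <x, y>)] shows that averaging [u] and [psi] with the
   kernel [t (2 + t) / (t + 1 - <x, y>)^2] gives logarithmic and Riesz potentials
   of [f - 1] and [P psi], for which [1 - Delta s] and [S psi] are averages of [f]
   and [P psi].  The limit [t -> 0] rests on the integrability of [e^(12 u)],
   obtained from Jensen's inequality after splitting off a small part of [f]. *)

Require Import Defs.
From HB Require Import structures.
From mathcomp Require Import all_boot all_order all_algebra.
From mathcomp Require Import complex ring lra.
From mathcomp Require Import all_classical all_reals all_analysis.
From mathcomp Require Import measurable_realfun.
Set Implicit Arguments.
Unset Strict Implicit.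
Unset Printing Implicit Defensive.
Import Order.TTheory GRing.Theory Num.Theory.
Import numFieldNormedType.Exports.
Import Defs.
Local Open Scope classical_set_scope.
Local Open Scope ring_scope.

(** * Integration against a finite measure *)

(** [S] is [I(x) D]: since [I(cross x X) = - I(x) I(X)] for tangent [X], the sum of the [I_j R_j] is
    [1 - I(x) D], so [|S psi| = |D psi|]. The inequality for [s] is Friedrich's estimate for the
    metric [e^(2s) g_0], of Gauss curvature [e^(-2s) (1 - Delta s)], carried to the round sphere by
    conformal covariance. The factor 2 is the dimension of the sphere; three unconstrained
    derivatives would give 3. Rotation fields replace local frames because they are global and
    preserve area, so that derivatives along them integrate to zero. The obstacle is integrability:
    the potentials start from [u], [e^(2u)], [f] and [|psi|^2] in L1, while the right side needs
    [P^2 |psi|^2]. Equality of [(max h2)^2] and [min h1] must be excluded too, so mollifying may not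
    cost a factor in that term. The regularizations [b] of [u] and [t] of [psi] are kept apart; [t]
    tends to 0 first, while the weight [e^(-s)] is Lipschitz. This part lives on a finite measure
    space mapped to the unit sphere, and sees the geometry only through a few facts about
    kernels. *)

Lemma cvg_EFin_comp (R : realType) (u : nat -> R) (l : R) :
  u @ \oo --> l -> (fun n => (u n)%:E) @ \oo --> l%:E.
Proof. by move=> ul; apply/fine_cvgP; split => //; exact: nearW. Qed.

Section Integrable.
Context d (T : measurableType d) (R : realType).
Variable mu : {finite_measure set T -> \bar R}.
Implicit Types f g h : T -> R.

Definition L1fun f : Prop := mu.-integrable setT (EFin \o f).
(* Sealed so that unification never unfolds an integral. *)
Fact Lint_sig : {I : (T -> R) -> R | I = fun f => (\int[mu]_x f x)%R}.
Proof. by eexists. Qed.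
Definition Lint f : R := sval Lint_sig f.

Lemma LintE f : Lint f = (\int[mu]_x f x)%R.
Proof. by rewrite /Lint; case: Lint_sig => I /= ->. Qed.

Local Notation L1 := L1fun.
Local Notation Int := Lint.

Lemma L1_measurable f : L1 f -> measurable_fun setT f.
Proof. by move=> /integrableP[/measurable_EFinP]. Qed.

Lemma eq_L1 f g : f =1 g -> L1 f -> L1 g.
Proof. by move=> /funext ->. Qed.

Lemma eq_Int f g : f =1 g -> Int f = Int g.
Proof. by move=> /funext ->. Qed.

Lemma L1_le f g : measurable_fun setT f -> (forall x, `|f x| <= g x) -> L1 g ->
  L1 f.
Proof.
move=> mf fg; apply: le_integrable => //; first exact/measurable_EFinP.
by move=> x _; rewrite /= lee_fin (le_trans (fg x))// ler_norm.
Qed.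

Lemma L1_cst c : L1 (cst c).
Proof. exact: finite_measure_integrable_cst. Qed.

Lemma L1_bounded f c : measurable_fun setT f -> (forall x, `|f x| <= c) -> L1 f.
Proof. by move=> mf fc; apply: (L1_le mf fc); exact: L1_cst. Qed.

Lemma L1D f g : L1 f -> L1 g -> L1 (fun x => f x + g x).
Proof. exact: (@integrableD _ _ _ mu setT measurableT (EFin \o f) (EFin \o g)). Qed.

Lemma L1B f g : L1 f -> L1 g -> L1 (fun x => f x - g x).
Proof. exact: (@integrableB _ _ _ mu setT measurableT (EFin \o f) (EFin \o g)). Qed.

Lemma L1Z c f : L1 f -> L1 (fun x => c * f x).
Proof. exact: (@integrableZl _ _ _ mu setT measurableT c (EFin \o f)). Qed.

Lemma L1N f : L1 f -> L1 (fun x => - f x).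
Proof. exact: (@integrableN _ _ _ mu setT (EFin \o f)). Qed.

Lemma L1_norm f : L1 f -> L1 (fun x => `|f x|).
Proof. exact: integrable_norm. Qed.

Lemma L1_sum (I : finType) (F : I -> T -> R) :
  (forall i, L1 (F i)) -> L1 (fun x => \sum_i F i x).
Proof.
move=> h; rewrite /L1fun.
have -> : EFin \o (fun x => \sum_i F i x) =
          (fun x => \sum_(i <- index_enum I | true) (F i x)%:E)%E.
  by apply/funext => x /=; rewrite sumEFin.
by apply: (@integrable_sum _ _ _ mu setT measurableT _ _ _ (fun i x => (F i x)%:E)) => i _; exact: h.
Qed.

Lemma L1M_bounded f g c : L1 f -> measurable_fun setT g ->
  (forall x, `|g x| <= c) -> L1 (fun x => g x * f x).
Proof.
move=> Lf mg gc; apply: (@L1_le _ (fun x => c * `|f x|)).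
- by apply: measurable_funM => //; exact: L1_measurable.
- by move=> x; rewrite normrM ler_wpM2r.
- by apply: L1Z; exact: L1_norm.
Qed.

Lemma IntD f g : L1 f -> L1 g -> Int (fun x => f x + g x) = Int f + Int g.
Proof. by move=> ? ?; rewrite ?LintE; exact: RintegralD. Qed.

Lemma IntB f g : L1 f -> L1 g -> Int (fun x => f x - g x) = Int f - Int g.
Proof. by move=> ? ?; rewrite ?LintE; exact: RintegralB. Qed.

Lemma IntZ c f : L1 f -> Int (fun x => c * f x) = c * Int f.
Proof. by move=> ?; rewrite ?LintE; exact: RintegralZl. Qed.

Lemma IntN f : L1 f -> Int (fun x => - f x) = - Int f.
Proof.
move=> Lf; rewrite -mulN1r -IntZ//; apply: eq_Int => x; by rewrite mulN1r.
Qed.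

Lemma Int_cst c : Int (cst c) = c * fine (mu setT).
Proof. rewrite ?LintE; exact: Rintegral_cst. Qed.

Lemma Int_sum (I : finType) (F : I -> T -> R) : (forall i, L1 (F i)) ->
  Int (fun x => \sum_i F i x) = \sum_i Int (F i).
Proof.
move=> h; rewrite -!big_enum /=.
under eq_Int do rewrite -big_enum /=.
elim: (enum I) => [|i s ih].
  rewrite big_nil; under eq_Int do rewrite big_nil.
  by rewrite (Int_cst 0) mul0r.
rewrite big_cons -ih -IntD//; first by apply: eq_Int => x; rewrite big_cons.
elim: s {ih} => [|j s ih].
  by apply: eq_L1 (L1_cst 0) => x; rewrite big_nil.
by apply: eq_L1 (L1D (h j) ih) => x; rewrite big_cons.
Qed.

Lemma Int_le f g : L1 f -> L1 g -> (forall x, f x <= g x) -> Int f <= Int g.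
Proof. by move=> ? ? ?; rewrite ?LintE; apply: le_Rintegral. Qed.

Lemma Int_ge0 f : (forall x, 0 <= f x) -> 0 <= Int f.
Proof. by move=> ?; rewrite ?LintE; apply: Rintegral_ge0. Qed.

Lemma Int_norm f : L1 f -> `|Int f| <= Int (fun x => `|f x|).
Proof. by move=> ?; rewrite ?LintE; apply: le_normr_Rintegral. Qed.

Lemma Int_EFin f : L1 f -> (Int f)%:E = (\int[mu]_x (f x)%:E)%E.
Proof. by move=> h; rewrite LintE /Rintegral fineK// integrable_fin_num. Qed.

Lemma L1_bound f C : measurable_fun setT f -> (forall x, 0 <= f x) ->
  (\int[mu]_x (f x)%:E <= C%:E)%E -> L1 f /\ Int f <= C.
Proof.
move=> mf f0 fC.
have Lf : L1 f.
  apply/integrableP; split; first exact/measurable_EFinP.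
  apply: le_lt_trans (ltry C); apply: le_trans fC.
  by under eq_integral do rewrite gee0_abs ?lee_fin ?f0 //=.
by split => //; rewrite -lee_fin Int_EFin.
Qed.

Lemma ae_Int f g : measurable_fun setT f -> measurable_fun setT g ->
  {ae mu, forall x, f x = g x} -> Int f = Int g.
Proof.
move=> mf mg fg; rewrite !LintE /Rintegral; congr fine; apply: ae_eq_integral => //.
- exact/measurable_EFinP.
- exact/measurable_EFinP.
- by apply: filterS fg => x -> _.
Qed.

Lemma ae_L1 f g : measurable_fun setT g ->
  {ae mu, forall x, f x = g x} -> L1 f -> L1 g.
Proof.
move=> mg fg Lf; have mf := L1_measurable Lf.
move/integrableP : (Lf) => [_ fi]; apply/integrableP; split.
  exact/measurable_EFinP.
rewrite (_ : (\int[mu]_x _)%E = (\int[mu]_x `|(EFin \o f) x|)%E)//.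
apply: ge0_ae_eq_integral => //.
- by apply: measurableT_comp => //; exact/measurable_EFinP.
- by apply: measurableT_comp => //; exact/measurable_EFinP.
- by apply: filterS fg => x /= -> _.
Qed.

Lemma Int_ae_le f g : L1 f -> L1 g -> {ae mu, forall x, f x <= g x} ->
  Int f <= Int g.
Proof.
move=> Lf Lg fg.
have mf := L1_measurable Lf; have mg := L1_measurable Lg.
have mm : measurable_fun setT (fun x => Num.max (f x) (g x)).
  exact: measurable_maxr.
have e : {ae mu, forall x, g x = Num.max (f x) (g x)}.
  by apply: filterS fg => x /max_idPr ->.
rewrite (ae_Int mg mm e); apply: Int_le => //; first exact: ae_L1 Lg.
by move=> x; rewrite le_max lexx.
Qed.

Lemma Int_eq0_ae f : L1 f -> (forall x, 0 <= f x) -> Int f = 0 ->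
  {ae mu, forall x, f x = 0}.
Proof.
move=> Lf f0 If; have mf := L1_measurable Lf.
have [h _] := ae_eq_integral_abs mu measurableT
  ((measurable_EFinP setT f).2 mf).
have : (\int[mu]_x `|(EFin \o f) x| = 0)%E.
  under eq_integral do rewrite /= ger0_norm ?f0//.
  by rewrite -Int_EFin// If.
by move=> /h; apply: filterS => x /(_ Logic.I)[].
Qed.

Lemma dominated_Int (f_ : nat -> T -> R) f g :
  (forall n, measurable_fun setT (f_ n)) -> measurable_fun setT f -> L1 g ->
  {ae mu, forall x, forall n, `|f_ n x| <= g x} ->
  {ae mu, forall x, (fun n => f_ n x) @ \oo --> f x} ->
  L1 f /\ (fun n => Int (f_ n)) @ \oo --> Int f.
Proof.
move=> mf_ mf Lg fg fcv.
have [|||//||Lf _ cv] := @dominated_convergence _ _ _ mu setT measurableT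
  (fun n => EFin \o f_ n) (EFin \o f) (EFin \o g).
- by move=> n; exact/measurable_EFinP.
- exact/measurable_EFinP.
- apply: filterS fcv => x cvx _; exact/cvg_EFin_comp.
- by apply: filterS fg => x h n _ /=; rewrite lee_fin.
split => //; rewrite LintE; under eq_fun do rewrite LintE.
rewrite /Rintegral; apply: (fine_cvg _).
by rewrite fineK//; exact: integrable_fin_num.
Qed.

(** The bound is asked only eventually and up to every [e], so that a majorant which merely
    converges to [C] is enough. *)
Lemma fatou_Int (f_ : nat -> T -> R) f C :
  (forall n, L1 (f_ n)) -> measurable_fun setT f ->
  (forall n x, 0 <= f_ n x) -> (forall x, 0 <= f x) ->
  {ae mu, forall x, (fun n => f_ n x) @ \oo --> f x} ->
  (forall e : R, 0 < e -> \forall n \near \oo, Int (f_ n) <= C + e) ->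
  L1 f /\ Int f <= C.
Proof.
move=> Lf mf f_0 f0 fcv fC; apply: L1_bound => //.
have mf_ n : measurable_fun setT (EFin \o f_ n).
  by apply/measurable_EFinP; exact: L1_measurable.
have := @fatou _ _ _ mu setT measurableT (fun n => EFin \o f_ n) mf_
  (fun n x _ => f_0 n x).
have -> : (\int[mu]_x limn_einf (fun n => (EFin \o f_ n) x) = \int[mu]_x (f x)%:E)%E.
  have mL : measurable_fun setT (fun x => limn_einf (fun n => (EFin \o f_ n) x)).
    apply: (emeasurable_fun_cvg (fun n x => einfs (fun k => (EFin \o f_ k) x) n)).
      by move=> n; exact: measurable_fun_einfs.
    by move=> x _; rewrite limn_einf_lim; exact: is_cvg_einfs.
  have mfE : measurable_fun setT (fun x => (f x)%:E) by exact/measurable_EFinP.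
  apply: (ae_eq_integral _ _ _ mL mfE) => //.
  apply: filterS fcv => x cvx _.
  have /cvg_limn_einf_sup[] : (fun n => (f_ n x)%:E) @ \oo --> (f x)%:E.
    exact/cvg_EFin_comp.
  by [].
move=> /le_trans; apply.
apply/lee_addgt0Pr => e e0.
rewrite limn_einf_lim; apply: lime_le.
  exact: is_cvg_einfs.
have /= [N _ hN] := fC e e0; exists N => // n /= Nn.
apply: (@le_trans _ _ (\int[mu]_x (f_ n x)%:E)%E).
  by apply: ereal_inf_lbound; exists n => //=.
by rewrite -Int_EFin// -EFinD lee_fin hN.
Qed.

Definition L1prod (f : T -> T -> R) : Prop :=
  (mu \x mu)%E.-integrable setT (fun z => (f z.1 z.2)%:E).

(** Tonelli: integrating the absolute value in the first variable leaves a function of the second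
    that [h] dominates. *)
Lemma L1prod_bound (f : T -> T -> R) h :
  measurable_fun setT (fun z : T * T => f z.1 z.2) -> L1 h ->
  (forall y, L1 (f^~ y)) -> (forall y, Int (fun x => `|f x y|) <= h y) ->
  L1prod f.
Proof.
move=> mf Lh Lf fh.
have mfE : measurable_fun setT (fun z : T * T => (f z.1 z.2)%:E).
  exact/measurable_EFinP.
apply/(integrable21ltyP _ _ mfE).
apply: (@le_lt_trans _ _ (\int[mu]_y (`|h y|)%:E)%E).
  apply: ge0_le_integral => //.
  - by move=> y _; apply: integral_ge0.
  - apply: (measurable_fun_fubini_tonelli_G (fun z => `|(f z.1 z.2)%:E|%E)) => //.
    exact: measurableT_comp.
  - by apply/measurable_EFinP; apply: measurableT_comp => //; exact: L1_measurable.
  - move=> y _ /=; rewrite -Int_EFin; last exact: L1_norm (Lf y).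
    by rewrite lee_fin (le_trans (fh y))// ler_norm.
by rewrite -Int_EFin ?ltry//; exact: L1_norm.
Qed.

Lemma ae_fine_Int (F : T -> T -> R) :
  {ae mu, forall x, mu.-integrable setT (fun y => (F x y)%:E)} ->
  {ae mu, forall x, (\int[mu]_y (F x y)%:E)%E = (Int (F x))%:E}.
Proof. by apply: filterS => x h; rewrite Int_EFin. Qed.

(** [Lint] is total, and takes a default value on sections that are not integrable. These form a
    null set, so the identity in [\bar R] is transferred almost everywhere. *)
Lemma Fubini_Int (f : T -> T -> R) : L1prod f ->
  [/\ L1 (fun x => Int (f x)), L1 (fun y => Int (f^~ y)) &
      Int (fun x => Int (f x)) = Int (fun y => Int (f^~ y))].
Proof.
move=> Lf.
have a1 := ae_fine_Int (ae_integrable1 Lf).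
have a2 := ae_fine_Int (ae_integrable2 Lf).
have i1 := integrable_fubini_F Lf.
have mfE := measurable_int _ Lf.
have i2 : mu.-integrable setT (fubini_G mu (fun z => (f z.1 z.2)%:E)).
  have mA : measurable_fun setT (fun y => (\int[mu]_x `|(f x y)%:E|)%E).
    apply: (measurable_fun_fubini_tonelli_G (fun z => `|(f z.1 z.2)%:E|%E)) => //.
    exact: measurableT_comp.
  apply/integrableP; split; first exact: (measurable_fubini_G Lf).
  apply: (le_lt_trans _ ((integrable21ltyP _ _ mfE).1 Lf)).
  apply: ge0_le_integral => //.
    by apply: measurableT_comp => //; exact: (measurable_fubini_G Lf).
  move=> y _; apply: le_abse_integral => //.
  exact: (measurableT_comp mfE (measurable_pair2 _)).
have := Fubini Lf.
have m1 := measurable_int _ i1; have m2 := measurable_int _ i2.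
have mm1 : measurable_fun setT (fun x => Int (f x)).
  under eq_fun do rewrite LintE.
  by apply: measurableT_comp m1 => //; exact: measurable_fine.
have mm2 : measurable_fun setT (fun y => Int (f^~ y)).
  under eq_fun do rewrite LintE.
  by apply: measurableT_comp m2 => //; exact: measurable_fine.
have I1 : L1 (fun x => Int (f x)).
  apply/integrableP; split; first exact/measurable_EFinP.
  move/integrableP : i1 => [_]; congr (_ < _)%E.
  apply: ge0_ae_eq_integral => //.
  - exact: measurableT_comp.
  - by apply: measurableT_comp => //; exact/measurable_EFinP.
  - by apply: filterS a1 => x; rewrite /fubini_F /= => -> _.
have I2 : L1 (fun y => Int (f^~ y)).
  apply/integrableP; split; first exact/measurable_EFinP.
  move/integrableP : i2 => [_]; congr (_ < _)%E.
  apply: ge0_ae_eq_integral => //.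
  - exact: measurableT_comp.
  - by apply: measurableT_comp => //; exact/measurable_EFinP.
  - by apply: filterS a2 => x; rewrite /fubini_G /= => -> _.
move=> H; split; [exact: I1|exact: I2|].
apply: EFin_inj; rewrite (Int_EFin I1) (Int_EFin I2).
transitivity (\int[mu]_x \int[mu]_y (f x y)%:E)%E.
  apply: ae_eq_integral => //; first exact/measurable_EFinP.
  by apply: filterS a1 => x; rewrite /fubini_F /= => -> _.
rewrite H; apply: ae_eq_integral => //; first exact/measurable_EFinP.
by apply: filterS a2 => x; rewrite /fubini_G /= => -> _.
Qed.

Lemma L1prod_ae1 (f : T -> T -> R) : L1prod f -> {ae mu, forall x, L1 (f x)}.
Proof. by move=> Lf; apply: ae_integrable1 Lf. Qed.

End Integrable.

#[global] Opaque L1fun L1prod.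

(** * Measures with a density *)

Import HBNNSimple.

Section Density.
Context d (T : measurableType d) (R : realType).
Variables (m : {measure set T -> \bar R}) (w : T -> R).
Hypotheses (mw : measurable_fun setT w) (w0 : forall x, 0 <= w x)
  (wfin : (\int[m]_x (w x)%:E < +oo)%E).

Definition density_measure (A : set T) : \bar R := (\int[m]_(x in A) (w x)%:E)%E.

Let mwE : measurable_fun setT (EFin \o w).
Proof. exact/measurable_EFinP. Qed.

Let density0 : density_measure set0 = 0%E.
Proof. by rewrite /density_measure integral_set0. Qed.

Let density_ge0 A : (0 <= density_measure A)%E.
Proof. by apply: integral_ge0 => x _; rewrite lee_fin. Qed.

Let density_sigma_additive : semi_sigma_additive density_measure.
Proof.
move=> F mF tF mUF; rewrite /density_measure ge0_integral_bigcup//; last 2 first.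
- exact: measurable_funTS.
- by move=> x _; rewrite lee_fin.
- by apply: is_cvg_ereal_nneg_natsum => n _; exact: density_ge0.
Qed.

HB.instance Definition _ := isMeasure.Build _ _ _ density_measure
  density0 density_ge0 density_sigma_additive.

Let density_fin : fin_num_fun density_measure.
Proof.
move=> A mA; rewrite ge0_fin_numE//; apply: le_lt_trans wfin.
by apply: ge0_subset_integral => //; move=> x _; rewrite lee_fin.
Qed.

HB.instance Definition _ := @Measure_isFinite.Build _ _ _ density_measure
  density_fin.

Definition density : {finite_measure set T -> \bar R} := density_measure.

(** Additivity settles simple functions, and monotone convergence along [nnsfun_approx] the
    nonnegative ones. *)
Lemma ge0_integral_density (f : T -> \bar R) : measurable_fun setT f ->
  (forall x, 0 <= f x)%E ->
  (\int[density]_x f x = \int[m]_x (f x * (w x)%:E))%E.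
Proof.
move=> mf f0.
pose g := nnsfun_approx measurableT mf.
have gf (x : T) : (fun n => (g n x)%:E) @ \oo --> f x.
  exact: (cvg_nnsfun_approx measurableT mf (fun t _ => f0 t)).
have ndg (x : T) : {homo (fun n => g n x) : a b / (a <= b)%N >-> a <= b}.
  by move=> a b ab; have /lefP := nd_nnsfun_approx measurableT mf ab; exact.
transitivity (limn (fun n => \int[density]_x (g n x)%:E))%E.
  rewrite -monotone_convergence//.
  - by apply: eq_integral => x _; apply/esym/cvg_lim => //; exact: gf.
  - by move=> n; exact/measurable_EFinP.
  - by move=> n x _; rewrite lee_fin.
  - by move=> x _ a b ab; rewrite lee_fin ndg.
transitivity (limn (fun n => \int[m]_x ((g n x)%:E * (w x)%:E)))%E; last first.
  rewrite -monotone_convergence//.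
  - apply: eq_integral => x _; apply/cvg_lim => //.
    by apply: cvgeZr => //; exact: gf.
  - by move=> n; apply: emeasurable_funM => //; exact/measurable_EFinP.
  - by move=> n x _; rewrite mule_ge0// lee_fin.
  - by move=> x _ a b ab; rewrite lee_wpmul2r ?lee_fin// ndg.
congr (limn _); apply/funext => n.
(* One expansion serves both sides: the measure [density] with weight 1, and the measure [m] with
   weight [w]. *)
have expand (nu : {measure set T -> \bar R}) (v : T -> R) :
    measurable_fun setT v -> (forall x, 0 <= v x) ->
    (\int[nu]_x ((g n x)%:E * (v x)%:E) = \sum_(y \in range (g n))
       y%:E * \int[nu]_x (\1_(g n @^-1` [set y]) x * v x)%:E)%E.
  move=> mv v0.
  transitivity (\int[nu]_x \sum_(y \in range (g n))
      (y * (\1_(g n @^-1` [set y]) x * v x))%:E)%E.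
    apply: eq_integral => x _.
    rewrite [in LHS]fimfunE -fsumEFin// ge0_mule_fsuml//; last first.
      by move=> y; exact: nnfun_muleindic_ge0.
    by apply: eq_fsbigr => y _; rewrite -EFinM mulrA.
  rewrite ge0_integral_fsum//; last 2 first.
  - move=> y; apply/measurable_EFinP; apply: measurable_funM => //.
    by apply: measurable_funM.
  - move=> y x _; rewrite mulrA EFinM mule_ge0 ?lee_fin//.
    exact: nnfun_muleindic_ge0.
  apply: eq_fsbigr => y; rewrite inE => -[x _ <-].
  under eq_integral do rewrite EFinM.
  rewrite ge0_integralZl//.
  - by apply/measurable_EFinP; apply: measurable_funM.
  - by move=> t _; rewrite lee_fin mulr_ge0.
  - by rewrite lee_fin.
transitivity (\int[density]_x ((g n x)%:E * (cst 1 x)%:E))%E.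
  by apply: eq_integral => x _; rewrite mule1.
rewrite (expand _ (cst 1))// expand//; apply: eq_fsbigr => y _.
congr (_ * _)%E; under eq_integral do rewrite mulr1.
rewrite integral_indic// setIT /= /density_measure integral_mkcond.
apply: eq_integral => t _; rewrite patchE indicE.
by case: ifPn => _; rewrite ?mul1r ?mul0r.
Qed.

Lemma integral_density (f : T -> R) : measurable_fun setT f ->
  (\int[density]_x (f x)%:E = \int[m]_x (f x * w x)%:E)%E.
Proof.
move=> mf; rewrite [X in X = _]integralE [X in _ = X]integralE.
have mfE : measurable_fun setT (EFin \o f) by exact/measurable_EFinP.
rewrite !ge0_integral_density//; [|exact: measurable_funeneg|exact: measurable_funepos].
congr (_ - _)%E; apply: eq_integral => x _.
- by rewrite !funepos.unlock -!EFin_max -EFinM maxr_pMl// mul0r.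
- by rewrite !funeneg.unlock -!EFinN -!EFin_max -EFinM maxr_pMl// mul0r mulNr.
Qed.

End Density.

(** * Clifford multiplication in real coordinates *)

Section Quaternion.
Context {R : realType}.
Implicit Types (X Y : 'rV[R]_3) (v w : 'cV[R]_4).

Lemma big_ord3 (V : nmodType) (F : 'I_3 -> V) : \sum_j F j = F 0 + F 1 + F 2%:R.
Proof.
rewrite !big_ord_recr big_ord0 /= add0r.
by congr (F _ + F _ + F _); apply: val_inj.
Qed.

Lemma big_ord4 (V : nmodType) (F : 'I_4 -> V) :
  \sum_j F j = F 0 + F 1 + F 2%:R + F 3%:R.
Proof.
rewrite !big_ord_recr big_ord0 /= add0r.
by congr (F _ + F _ + F _ + F _); apply: val_inj.
Qed.

Lemma ord4P (P : 'I_4 -> Prop) : P 0 -> P 1 -> P 2%:R -> P 3%:R -> forall k, P k.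
Proof.
move=> p0 p1 p2 p3 [[|[|[|[|//]]]] h].
- by rewrite (_ : Ordinal h = 0)//; apply: val_inj.
- by rewrite (_ : Ordinal h = 1)//; apply: val_inj.
- by rewrite (_ : Ordinal h = 2%:R)//; apply: val_inj.
- by rewrite (_ : Ordinal h = 3%:R)//; apply: val_inj.
Qed.

(* [i sigma(X)] on C^2, read in the real coordinates (Re s_0, Im s_0, Re s_1,
   Im s_1): up to sign, the left multiplication of a quaternion by the
   imaginary quaternion X. *)
Definition qmul X v : 'cV[R]_4 := \col_k
  [:: - X 0 2%:R * v 1 0 + X 0 1 * v 2%:R 0 - X 0 0 * v 3%:R 0;
      X 0 2%:R * v 0 0 + X 0 0 * v 2%:R 0 + X 0 1 * v 3%:R 0;
      - X 0 1 * v 0 0 - X 0 0 * v 1 0 + X 0 2%:R * v 3%:R 0;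
      X 0 0 * v 0 0 - X 0 1 * v 1 0 - X 0 2%:R * v 2%:R 0]`_k.

Definition ip v w : R := \sum_k v k 0 * w k 0.
Definition nsq v : R := ip v v.

Lemma ip4 v w : ip v w = v 0 0 * w 0 0 + v 1 0 * w 1 0 + v 2%:R 0 * w 2%:R 0 +
  v 3%:R 0 * w 3%:R 0.
Proof. by rewrite /ip big_ord4. Qed.

Lemma dot3 X Y : dot X Y = X 0 0 * Y 0 0 + X 0 1 * Y 0 1 + X 0 2%:R * Y 0 2%:R.
Proof. by rewrite /dot big_ord3. Qed.

Lemma nsq_ge0 v : 0 <= nsq v.
Proof. by apply: sumr_ge0 => k _; rewrite -expr2 sqr_ge0. Qed.

Lemma nsq_eq0 v : nsq v = 0 -> v = 0.
Proof.
move=> /eqP; rewrite psumr_eq0 => [/allP h|k _]; last by rewrite -expr2 sqr_ge0.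
apply/matrixP => k j; rewrite (ord1 j) mxE.
by have := h k (mem_index_enum k); rewrite /= -expr2 sqrf_eq0 => /eqP.
Qed.

Lemma le_nsq v k : v k 0 ^+ 2 <= nsq v.
Proof.
rewrite /nsq /ip (bigD1 k)//= -expr2 lerDl.
by apply: sumr_ge0 => j _; rewrite -expr2 sqr_ge0.
Qed.

Lemma nsqZ c v : nsq (c *: v) = c ^+ 2 * nsq v.
Proof. by rewrite /nsq !ip4 !mxE; ring. Qed.

Lemma ipZr c v w : ip v (c *: w) = c * ip v w.
Proof. by rewrite !ip4 !mxE; ring. Qed.

Lemma nsqB_ge0 (a : R) v w : 0 < a -> 2 * ip v w <= a * nsq v + a^-1 * nsq w.
Proof.
move=> a0.
have := nsq_ge0 (a *: v - w).
have -> : nsq (a *: v - w) = a * (a * nsq v + a^-1 * nsq w - 2 * ip v w).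
  by rewrite /nsq !ip4 !mxE; field; rewrite gt_eqF.
by rewrite pmulr_rge0// subr_ge0.
Qed.

Lemma qmulDl X Y v : qmul (X + Y) v = qmul X v + qmul Y v.
Proof. by apply/colP; apply: ord4P; rewrite !mxE /=; ring. Qed.

Lemma qmulBl X Y v : qmul (X - Y) v = qmul X v - qmul Y v.
Proof. by apply/colP; apply: ord4P; rewrite !mxE /=; ring. Qed.

Lemma qmulDr X v w : qmul X (v + w) = qmul X v + qmul X w.
Proof. by apply/colP; apply: ord4P; rewrite !mxE /=; ring. Qed.

Lemma qmulBr X v w : qmul X (v - w) = qmul X v - qmul X w.
Proof. by apply/colP; apply: ord4P; rewrite !mxE /=; ring. Qed.

Lemma qmulZl c X v : qmul (c *: X) v = c *: qmul X v.
Proof. by apply/colP; apply: ord4P; rewrite !mxE /=; ring. Qed.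

Lemma qmulZr c X v : qmul X (c *: v) = c *: qmul X v.
Proof. by apply/colP; apply: ord4P; rewrite !mxE /=; ring. Qed.

Lemma qmulAC X Y v : qmul X (qmul Y v) + qmul Y (qmul X v) =
  (- 2 * dot X Y) *: v.
Proof. by rewrite dot3; apply/colP; apply: ord4P; rewrite !mxE /=; ring. Qed.

Lemma qmul_sq X v : qmul X (qmul X v) = - dot X X *: v.
Proof. by rewrite dot3; apply/colP; apply: ord4P; rewrite !mxE /=; ring. Qed.

Lemma ip_qmul X v w : ip (qmul X v) w = - ip v (qmul X w).
Proof. by rewrite !ip4 !mxE /=; ring. Qed.

Lemma nsq_qmul X v : nsq (qmul X v) = dot X X * nsq v.
Proof. by rewrite /nsq !ip4 dot3 !mxE /=; ring. Qed.

Lemma dotDl X Y Z : dot (X + Y) Z = dot X Z + dot Y Z.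
Proof. by rewrite !dot3 !mxE; ring. Qed.

Lemma dotC X Y : dot X Y = dot Y X.
Proof. by rewrite !dot3; ring. Qed.

Lemma dotZl c X Y : dot (c *: X) Y = c * dot X Y.
Proof. by rewrite !dot3 !mxE; ring. Qed.

Lemma dotBB X Y : dot (X - Y) (X - Y) = dot X X + dot Y Y - 2 * dot X Y.
Proof. by rewrite !dot3 !mxE; ring. Qed.

Lemma dotDD X Y : dot (X + Y) (X + Y) = dot X X + dot Y Y + 2 * dot X Y.
Proof. by rewrite !dot3 !mxE; ring. Qed.

Lemma dot_ge0 X : 0 <= dot X X.
Proof. by rewrite dot3 -!expr2 !addr_ge0 ?sqr_ge0. Qed.

Lemma sphere_dot_le1 X Y : dot X X = 1 -> dot Y Y = 1 -> dot X Y <= 1.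
Proof. by move=> hX hY; have := dot_ge0 (X - Y); rewrite dotBB hX hY; lra. Qed.

Lemma sphere_dot_geN1 X Y : dot X X = 1 -> dot Y Y = 1 -> -1 <= dot X Y.
Proof. by move=> hX hY; have := dot_ge0 (X + Y); rewrite dotDD hX hY; lra. Qed.

(** Since [I(Y)^2 = -1], the spinor is [- I(Y) I(X + Y) v], and Clifford multiplication by a vector
    scales norms by its length. *)
Lemma nsq_conj_qmul X Y v : dot X X = 1 -> dot Y Y = 1 ->
  nsq (v - qmul Y (qmul X v)) = 2 * (1 + dot X Y) * nsq v.
Proof.
move=> hX hY.
have e : v - qmul Y (qmul X v) = - qmul Y (qmul (X + Y) v).
  by rewrite qmulDl qmulDr (qmul_sq Y) hY scaleN1r opprD opprK addrC.
rewrite e -scaleN1r nsqZ sqrrN expr1n mul1r !nsq_qmul hY mul1r dotDD hX hY.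
ring.
Qed.

End Quaternion.

(** * Singular kernels *)

Section Convergence.
Context {R : realType}.

Lemma cvg_sqrt (u : nat -> R) (l : R) :
  u @ \oo --> l -> (fun n => Num.sqrt (u n)) @ \oo --> Num.sqrt l.
Proof. by move=> h; exact: (cvg_comp _ _ h (@sqrt_continuous R l)). Qed.

Lemma cvg_expn (u : nat -> R) (l : R) k :
  u @ \oo --> l -> (fun n => u n ^+ k) @ \oo --> l ^+ k.
Proof. by move=> h; exact: (cvg_comp _ _ h (@exprn_continuous R k l)). Qed.

Lemma cvg_expR (u : nat -> R) (l : R) :
  u @ \oo --> l -> (fun n => expR (u n)) @ \oo --> expR l.
Proof. by move=> h; exact: (cvg_comp _ _ h (@continuous_expR R l)). Qed.

Lemma cvg_le (u : nat -> R) (l c : R) :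
  u @ \oo --> l -> (forall n, u n <= c) -> l <= c.
Proof.
move=> ul uc; have cc : (fun=> c) @ \oo --> c by exact: cvg_cst.
by apply: (ler_cvg_to ul cc); exact: nearW.
Qed.

Lemma cvg_ge (u : nat -> R) (l c : R) :
  u @ \oo --> l -> (forall n, c <= u n) -> c <= l.
Proof.
move=> ul uc; have cc : (fun=> c) @ \oo --> c by exact: cvg_cst.
by apply: (ler_cvg_to cc ul); exact: nearW.
Qed.

Lemma cvg_of_norm_le (u v : nat -> R) (l : R) :
  v @ \oo --> (0 : R) -> (forall n, `|u n - l| <= v n) -> u @ \oo --> l.
Proof.
move=> v0 uv; apply/cvgrPdist_le => eps eps0.
have /cvgrPdist_le/(_ _ eps0) := v0; apply: filterS => n.
rewrite sub0r normrN => h; rewrite distrC (le_trans (uv n))//.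
by rewrite (le_trans _ h)// ler_norm.
Qed.

Lemma cvg_subr (u : nat -> R) (l c : R) :
  (fun n => u n - c) @ \oo --> l - c -> u @ \oo --> l.
Proof.
move=> h; have c0 : (fun=> c) @ \oo --> c by exact: cvg_cst.
have e : u = (fun n => u n - c) \+ (fun=> c) by apply/funext => n /=; rewrite subrK.
by rewrite e -(subrK c l); exact: cvgD.
Qed.

Lemma measurable_sqrt : measurable_fun setT (@Num.sqrt R).
Proof. by apply: continuous_measurable_fun; exact: sqrt_continuous. Qed.

End Convergence.

Section Kernels.
Context d (T : measurableType d) (R : realType).
Variable mu : {finite_measure set T -> \bar R}.
Variable e : T -> 'rV[R]_3.
Hypothesis e_sphere : forall p, dot (e p) (e p) = 1.
Hypothesis measurable_e : forall j, measurable_fun setT (fun p => e p 0 j).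
Implicit Types (p q : T) (t : R) (f g w : T -> R).

Local Notation L1 := (L1fun mu).
Local Notation Int := (Lint mu).
Let A : R := fine (mu setT).

(* [gap] and [rr] are sealed so that unification never unfolds them. *)
Fact gap_sig : {g : T -> T -> R | forall p q, g p q = 1 - dot (e p) (e q)}.
Proof. by eexists. Qed.
Definition gap p q : R := sval gap_sig p q.

Lemma gapE p q : gap p q = 1 - dot (e p) (e q).
Proof. exact: (svalP gap_sig). Qed.

Lemma gapC p q : gap p q = gap q p.
Proof. by rewrite !gapE dotC. Qed.

Lemma gap_ge0 p q : 0 <= gap p q.
Proof. by rewrite gapE subr_ge0 sphere_dot_le1. Qed.

Lemma gap_le2 p q : gap p q <= 2.
Proof.
by have := @sphere_dot_geN1 R _ _ (e_sphere p) (e_sphere q); rewrite gapE; lra.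
Qed.

(* rr t p q = (1 + t - <p, q>) ^ (-1/8); all the kernels are polynomials in it
   and its logarithm. *)
Fact rr_sig : {r : R -> T -> T -> R |
  forall t p q, r t p q = expR (- (ln (t + gap p q) / 8))}.
Proof. by eexists. Qed.
Definition rr t p q : R := sval rr_sig t p q.

Lemma rrE t p q : rr t p q = expR (- (ln (t + gap p q) / 8)).
Proof. exact: (svalP rr_sig). Qed.

Lemma rr6E t p q : rr t p q ^+ 6 = expR (- (3 / 4) * ln (t + gap p q)).
Proof. by rewrite rrE -expRM_natl; congr expR; field. Qed.

Lemma rrC t p q : rr t p q = rr t q p.
Proof. by rewrite !rrE gapC. Qed.

Lemma rr_gt0 t p q : 0 < rr t p q.
Proof. by rewrite rrE expR_gt0. Qed.

Lemma rrX_ge0 t p q n : 0 <= rr t p q ^+ n.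
Proof. by rewrite exprn_ge0// ltW// rr_gt0. Qed.

Lemma rr8 t p q : 0 < t -> rr t p q ^+ 8 = (t + gap p q)^-1.
Proof.
move=> t0; have z0 : 0 < t + gap p q by rewrite ltr_wpDr ?gap_ge0.
rewrite rrE -expRM_natl (_ : _ * _ = - ln (t + gap p q)); last by field.
by rewrite expRN lnK.
Qed.

Lemma rr8M t p q : 0 < t -> (t + gap p q) * rr t p q ^+ 8 = 1.
Proof.
move=> t0; rewrite rr8// mulfV// gt_eqF// ltr_wpDr ?gap_ge0//.
Qed.

Lemma rr8_le t p q : 0 < t -> rr t p q ^+ 8 <= t^-1.
Proof.
by move=> t0; rewrite rr8// lef_pV2 ?posrE ?lerDl ?gap_ge0// ltr_wpDr ?gap_ge0.
Qed.

Lemma rr_le t p q : 0 < t -> rr t p q <= 1 + t^-1.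
Proof.
move=> t0; have := rr8_le p q t0; have := rr_gt0 t p q.
move: (rr t p q) => r r0 h.
have [r1|r1] := leP r 1; first by rewrite (le_trans r1)// lerDl invr_ge0 ltW.
have : r <= r ^+ 8 by rewrite ler_eXnr// ltW.
by move: h; have := invr_gt0 t; rewrite t0; lra.
Qed.

Lemma measurable_gap : measurable_fun setT (fun z : T * T => gap z.1 z.2).
Proof.
under eq_fun do rewrite gapE dot3.
apply: measurable_funB => //.
have h j : measurable_fun setT (fun z : T * T => e z.1 0 j * e z.2 0 j).
  apply: measurable_funM.
  - exact: (measurableT_comp (measurable_e j) measurable_fst).
  - exact: (measurableT_comp (measurable_e j) measurable_snd).
by apply: measurable_funD => //; exact: measurable_funD.
Qed.

Lemma measurable_rr t : measurable_fun setT (fun z : T * T => rr t z.1 z.2).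
Proof.
under eq_fun do rewrite rrE.
apply: measurableT_comp => //; apply: measurableT_comp => //.
apply: measurable_funM => //; apply: measurableT_comp => //.
by apply: measurable_funD => //; exact: measurable_gap.
Qed.

Lemma measurable_section1 (F : T -> T -> R) q :
  measurable_fun setT (fun z : T * T => F z.1 z.2) ->
  measurable_fun setT (F^~ q).
Proof. by move=> mF; exact: (measurableT_comp mF (measurable_pair2 q)). Qed.

Lemma measurable_section2 (F : T -> T -> R) p :
  measurable_fun setT (fun z : T * T => F z.1 z.2) ->
  measurable_fun setT (F p).
Proof. by move=> mF; exact: (measurableT_comp mF (measurable_pair1 p)). Qed.

Lemma measurable_flip (F : T -> T -> R) :
  measurable_fun setT (fun z : T * T => F z.1 z.2) ->
  measurable_fun setT (fun z : T * T => F z.2 z.1).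
Proof.
move=> mF.
have ms : measurable_fun setT (fun z : T * T => (z.2, z.1)).
  by apply: measurable_fun_pair; [exact: measurable_snd|exact: measurable_fst].
exact: (measurableT_comp mF ms).
Qed.

Lemma measurable_lift1 f : measurable_fun setT f ->
  measurable_fun setT (fun z : T * T => f z.1).
Proof. by move=> mf; exact: measurableT_comp mf measurable_fst. Qed.

Lemma measurable_lift2 f : measurable_fun setT f ->
  measurable_fun setT (fun z : T * T => f z.2).
Proof. by move=> mf; exact: measurableT_comp mf measurable_snd. Qed.

Lemma L1prod_bounded (K : T -> T -> R) N c :
  measurable_fun setT (fun z : T * T => K z.1 z.2) ->
  (forall p q, `|K p q| <= c * N p) -> L1 N -> L1prod mu K.
Proof.
move=> mK Kc LN.
have Lq q : L1 (K^~ q).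
  apply: (@L1_le _ _ _ _ _ (fun p => c * N p)) => //; last exact: L1Z.
  exact: measurable_section1.
apply: (@L1prod_bound _ _ _ _ _ (cst (c * Int N))) => //; first exact: L1_cst.
move=> q /=; rewrite -IntZ//; apply: Int_le => //; last exact: L1Z.
exact: L1_norm.
Qed.

(** * Concentration of the averaging kernel *)

Variable C : R.
(** The singularity is [z^(-3/4)] with [z] of the order of a squared distance, on a surface: below
    the critical power [z^(-1)], hence integrable uniformly in [t]. *)
Hypothesis rr6_bound : forall t q, 0 < t <= 1 ->
  Int (fun p => rr t p q ^+ 6) <= C.
Hypothesis mass1 : forall t q, 0 < t <= 1 ->
  Int (fun p => t * (2 + t) * rr t p q ^+ 16) = A.

(* On the sphere, [kappa t p q - 1] is the Laplacian of [ln (t + gap p q)]. *)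
Definition kappa t p q : R := t * (2 + t) * rr t p q ^+ 16.

Lemma kappaE t p q : kappa t p q = t * (2 + t) * rr t p q ^+ 16.
Proof. by []. Qed.

Lemma Int_kappa t q : 0 < t <= 1 -> Int (fun p => kappa t p q) = A.
Proof. exact: mass1. Qed.

Lemma measurable_kappa t :
  measurable_fun setT (fun z : T * T => kappa t z.1 z.2).
Proof.
apply: measurable_funM => //; apply: measurable_funX; exact: measurable_rr.
Qed.

Lemma kappaC t p q : kappa t p q = kappa t q p.
Proof. by rewrite /kappa rrC. Qed.

Lemma kappa_ge0 t p q : 0 < t -> 0 <= kappa t p q.
Proof. by move=> t0; rewrite !mulr_ge0 ?exprn_ge0 ?(ltW (rr_gt0 _ _ _))//; lra. Qed.

Lemma rrX_le t p q n : 0 < t -> rr t p q ^+ n <= (1 + t^-1) ^+ n.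
Proof. by move=> t0; rewrite lerXn2r ?nnegrE ?rr_le// ltW// ?rr_gt0 ?addr_gt0 ?invr_gt0. Qed.

Lemma kappa_le t p q : 0 < t -> kappa t p q <= t * (2 + t) * (1 + t^-1) ^+ 16.
Proof. by move=> t0; rewrite ler_wpM2l ?rrX_le// mulr_ge0//; lra. Qed.

Lemma L1_rrX t q n : 0 < t -> L1 (fun p => rr t p q ^+ n).
Proof.
move=> t0; apply: (@L1_bounded _ _ _ _ _ ((1 + t^-1) ^+ n)).
  by apply: measurable_funX; apply: (measurable_section1 q (measurable_rr t)).
by move=> p; rewrite ger0_norm ?rrX_le// exprn_ge0// ltW// rr_gt0.
Qed.

Lemma L1_kappa t q : 0 < t -> L1 (fun p => kappa t p q).
Proof. by move=> t0; apply: L1Z; exact: L1_rrX. Qed.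

(** The scale of the Young splitting in [kappa_concentration]. It is [t^(1/4)] because the integral
    of [gap] against [kappa] is of order [t^(1/2)]. *)
Definition root4 t : R := Num.sqrt (Num.sqrt t).

Lemma root4_gt0 t : 0 < t -> 0 < root4 t.
Proof. by move=> t0; rewrite /root4 !sqrtr_gt0. Qed.

(** From [gap * rr ^+ 8 <= 1] and [t * rr ^+ 2 <= t^(1/2)]: what is left of the kernel is the
    integrable singularity [rr ^+ 6]. *)
Lemma kappa_gap t p q : 0 < t <= 1 ->
  kappa t p q * gap p q <= 3 * (root4 t ^+ 2 * rr t p q ^+ 6).
Proof.
move=> /andP[t0 t1]; rewrite /kappa.
have e2 : root4 t ^+ 2 = Num.sqrt t by rewrite /root4 sqr_sqrtr ?sqrtr_ge0.
(* Compare fourth powers: [t^4 rr^8 <= t^3 <= t^2]. *)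
have h1 : t * rr t p q ^+ 2 <= Num.sqrt t.
  rewrite -(@ler_pXn2r _ 4) ?nnegrE ?sqrtr_ge0//; last first.
    by rewrite mulr_ge0 ?sqr_ge0// ltW.
  rewrite -[4%N]/(2 * 2)%N [in X in _ <= X]exprM sqr_sqrtr ?(ltW t0)//.
  rewrite exprMn -!exprM -[(2 * (2 * 2))%N]/8%N -[(2 * 2)%N]/4%N.
  have h : t * rr t p q ^+ 8 <= 1 by rewrite -ler_pdivlMl// mulr1 rr8_le.
  have t3 : 0 <= t ^+ 3 by rewrite exprn_ge0// ltW.
  have := ler_wpM2l t3 h; rewrite mulr1 mulrA -exprSr => /le_trans; apply.
  by rewrite exprS ler_piMl ?sqr_ge0.
have h2 : gap p q * rr t p q ^+ 8 <= 1.
  by rewrite -(rr8M p q t0) ler_wpM2r ?exprn_ge0 ?lerDr ?(ltW (rr_gt0 _ _ _)) ?(ltW t0).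
have h3 := rrX_ge0 t p q 8.
have h6 := rrX_ge0 t p q 6.
have hg := gap_ge0 p q.
rewrite e2 (_ : t * (2 + t) * rr t p q ^+ 16 * gap p q =
  (2 + t) * ((gap p q * rr t p q ^+ 8) * (t * rr t p q ^+ 2)) * rr t p q ^+ 6);
  last by ring.
rewrite [leRHS]mulrA ler_wpM2r//.
have h4 : 0 <= t * rr t p q ^+ 2 by rewrite mulr_ge0 ?sqr_ge0// ltW.
have h5 : 0 <= gap p q * rr t p q ^+ 8 by rewrite mulr_ge0.
have h7 : gap p q * rr t p q ^+ 8 * (t * rr t p q ^+ 2) <= Num.sqrt t.
  by apply: le_trans h1; rewrite ler_piMl.
apply: (@le_trans _ _ ((2 + t) * Num.sqrt t)); first by rewrite ler_wpM2l//; lra.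
by rewrite ler_wpM2r ?sqrtr_ge0//; lra.
Qed.

Lemma Int_kappa_gap t q : 0 < t <= 1 ->
  Int (fun p => kappa t p q * gap p q) <= 3 * root4 t ^+ 2 * C.
Proof.
move=> t01; have /andP[t0 t1] := t01.
apply: (@le_trans _ _ (Int (fun p => 3 * root4 t ^+ 2 * rr t p q ^+ 6))).
  apply: Int_le => [||p].
  - apply: (@L1M_bounded _ _ _ mu (fun p => gap p q) _
      (t * (2 + t) * (1 + t^-1) ^+ 16)).
    + apply: (@L1_bounded _ _ _ _ _ 2).
        exact: measurable_section1 measurable_gap.
      by move=> p; rewrite ger0_norm ?gap_ge0 ?gap_le2.
    + exact: measurable_section1 (measurable_kappa t).
    + by move=> p; rewrite ger0_norm ?kappa_ge0 ?kappa_le.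
  - by apply: L1Z; exact: L1_rrX.
  - by rewrite -mulrA kappa_gap.
rewrite IntZ; last exact: L1_rrX.
by rewrite ler_wpM2l ?rr6_bound// mulr_ge0// sqr_ge0.
Qed.

(** The hypothesis on [Th] is what Young's inequality makes of a bound by [sqrt (l * gap) * N]. The
    mass of [kappa] controls its first term, [Int_kappa_gap] its second, and both come out of order
    [root4 t]. *)
Lemma kappa_concentration t (Th : T -> T -> R) N (l : R) : 0 < t <= 1 -> 0 <= l ->
  measurable_fun setT (fun z : T * T => Th z.1 z.2) -> L1 N ->
  (forall p, 0 <= N p) ->
  (forall p q, `|Th p q| <= (root4 t + l * gap p q / root4 t) * N p) ->
  L1prod mu (fun p q => kappa t p q * Th p q) /\
  `|Int (fun q => Int (fun p => kappa t p q * Th p q))| <=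
    root4 t * (A + 3 * l * C) * Int N.
Proof.
move=> t01 l0 mTh LN N0 Thb; have /andP[t0 t1] := t01.
have s0 := root4_gt0 t0.
have mK : measurable_fun setT (fun z : T * T => kappa t z.1 z.2 * Th z.1 z.2).
  by apply: measurable_funM => //; exact: measurable_kappa.
have LK : L1prod mu (fun p q => kappa t p q * Th p q).
  apply: (@L1prod_bounded _ N (t * (2 + t) * (1 + t^-1) ^+ 16 *
           (root4 t + l * 2 / root4 t))) => // p q.
  rewrite normrM (ger0_norm (kappa_ge0 p q t0)) -[leRHS]mulrA.
  apply: ler_pM; rewrite ?kappa_ge0 ?kappa_le//.
  apply: (le_trans (Thb p q)); rewrite ler_wpM2r// lerD2l.
  by rewrite ler_pM2r ?invr_gt0// ler_wpM2l ?gap_le2.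
split => //; have [L1a L1b <-] := Fubini_Int LK.
have LKp p : L1 (fun q => kappa t p q * Th p q).
  apply: (@L1_bounded _ _ _ _ _ (t * (2 + t) * (1 + t^-1) ^+ 16 *
           ((root4 t + l * 2 / root4 t) * N p))).
    exact: (@measurable_section2 (fun p q => kappa t p q * Th p q) p mK).
  move=> q; rewrite normrM (ger0_norm (kappa_ge0 p q t0)).
  apply: ler_pM; rewrite ?kappa_ge0 ?kappa_le//.
  apply: (le_trans (Thb p q)); rewrite ler_wpM2r// lerD2l.
  by rewrite ler_pM2r ?invr_gt0// ler_wpM2l ?gap_le2.
apply: (le_trans (Int_norm L1a)); rewrite -IntZ//.
apply: Int_le => [||p]; [exact: L1_norm|exact: L1Z|].
apply: (le_trans (Int_norm (LKp p))).
have Lk : L1 (fun q => kappa t q p) by exact: L1_kappa.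
have Lg : L1 (fun q => kappa t q p * gap q p).
  apply: (@L1M_bounded _ _ _ mu (fun q => gap q p) _
    (t * (2 + t) * (1 + t^-1) ^+ 16)).
  - apply: (@L1_bounded _ _ _ _ _ 2).
      exact: measurable_section1 measurable_gap.
    by move=> q; rewrite ger0_norm ?gap_ge0 ?gap_le2.
  - exact: measurable_section1 (measurable_kappa t).
  - by move=> q; rewrite ger0_norm ?kappa_ge0 ?kappa_le.
have Lk2 : L1 (fun q => root4 t * kappa t q p) by exact: L1Z.
have Lg2 : L1 (fun q => l / root4 t * (kappa t q p * gap q p)) by exact: L1Z.
apply: (@le_trans _ _ (Int (fun q => N p * (root4 t * kappa t q p +
    l / root4 t * (kappa t q p * gap q p))))).
  apply: Int_le => [||q]; [exact: L1_norm|by apply: L1Z; exact: L1D|].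
  rewrite normrM (ger0_norm (kappa_ge0 p q t0)).
  apply: (le_trans (ler_wpM2l (kappa_ge0 p q t0) (Thb p q))).
  by rewrite (kappaC t q p) (gapC q p) le_eqVlt; apply/orP; left; apply/eqP; ring.
rewrite IntZ; last exact: L1D.
rewrite (IntD Lk2 Lg2) (IntZ _ Lk) (IntZ _ Lg) mulrC ler_wpM2r//.
rewrite (Int_kappa _ t01).
have := Int_kappa_gap p t01.
have ls : 0 <= l / root4 t by rewrite divr_ge0// ltW.
move=> /(ler_wpM2l ls) h; rewrite mulrDr lerD2l (le_trans h)//.
rewrite le_eqVlt; apply/orP; left; apply/eqP; field.
by rewrite gt_eqF.
Qed.

(** * Removing the regularization off the diagonal *)

Definition tn (n : nat) : R := n.+1%:R^-1.

Lemma tn01 n : 0 < tn n <= 1.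
Proof. by rewrite invr_gt0 ltr0n /= invf_le1 ?ltr0n// ler1n. Qed.

Lemma tn_gt0 n : 0 < tn n.
Proof. by have /andP[] := tn01 n. Qed.

Lemma cvg_tn : tn @ \oo --> (0 : R).
Proof. exact: cvg_harmonic. Qed.

Lemma rr_le_diag t p q : 0 < t -> 0 < gap p q -> rr t p q <= rr 0 p q.
Proof.
move=> t0 g0; rewrite !rrE ler_expR lerN2 ler_wpM2r ?invr_ge0// add0r.
have h : gap p q <= t + gap p q by rewrite lerDr ltW.
by rewrite ler_ln ?posrE// addr_gt0.
Qed.

Lemma cvg_rr p q : 0 < gap p q -> (fun n => rr (tn n) p q) @ \oo --> rr 0 p q.
Proof.
move=> g0; under eq_fun do rewrite rrE; rewrite rrE.
apply: continuous_cvg; first exact: continuous_expR.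
apply: cvgN; apply: cvgMl; apply: continuous_cvg.
  by apply: continuous_ln; rewrite add0r.
by apply: cvgD; [exact: cvg_tn|exact: cvg_cst].
Qed.

Lemma cvg_root4 : (fun n => root4 (tn n)) @ \oo --> (0 : R).
Proof.
rewrite -(@sqrtr0 R) -[X in Num.sqrt X](@sqrtr0 R).
exact/cvg_sqrt/cvg_sqrt/cvg_tn.
Qed.

(** Cuts out the diagonal, where [rr 0] is a default value, due to [ln 0 = 0], and not the limit of
    [rr (tn n)]. *)
Definition offdiag p q : R := if 0 < gap p q then 1 else 0.

Lemma offdiag_ge0 p q : 0 <= offdiag p q.
Proof. by rewrite /offdiag; case: ifP. Qed.

Lemma offdiag_le1 p q : offdiag p q <= 1.
Proof. by rewrite /offdiag; case: ifP. Qed.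

Lemma measurable_offdiag :
  measurable_fun setT (fun z : T * T => offdiag z.1 z.2).
Proof.
apply: measurable_fun_ifT => //.
by apply: measurable_fun_ltr => //; exact: measurable_gap.
Qed.

(** Where [gap p q = 0] one has [rr ^+ 8 = t^-1 >= 1], so
    [sqrt t * rr ^+ 6 >= sqrt t * rr ^+ 4 = 1]. By [rr6_bound] the measure of this set is at most
    [sqrt t * C] for every [t]. *)
Lemma offdiag_ae q : {ae mu, forall p, offdiag p q = 1}.
Proof.
have mo : measurable_fun setT (fun p => 1 - offdiag p q).
  apply: measurable_funB => //; exact: measurable_section1 measurable_offdiag.
have o0 p : 0 <= 1 - offdiag p q.
  by rewrite subr_ge0 offdiag_le1.
have Lo : L1 (fun p => 1 - offdiag p q).
  apply: (@L1_bounded _ _ _ _ _ 1) => // p.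
  by rewrite ger0_norm// gerBl offdiag_ge0.
have b t : 0 < t <= 1 -> Int (fun p => 1 - offdiag p q) <= Num.sqrt t * C.
  move=> /andP[t0 t1].
  apply: (@le_trans _ _ (Int (fun p => Num.sqrt t * rr t p q ^+ 6))).
    apply: Int_le => [//||p]; first by apply: L1Z; exact: L1_rrX.
    rewrite /offdiag; case: ltP => [_|g0].
      by rewrite subrr mulr_ge0 ?sqrtr_ge0 ?exprn_ge0// ltW// rr_gt0.
    rewrite subr0.
    have gE : gap p q = 0 by apply/eqP; rewrite eq_le g0 gap_ge0.
    have := rr8M p q t0; rewrite gE addr0.
    have := rr_gt0 t p q; move: (rr t p q) => r r0 h.
    have r1 : 1 <= r.
      rewrite leNgt; apply/negP => r1.
      have : r ^+ 8 < 1 by rewrite exprn_ilt1// ltW.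
      have : 0 < r ^+ 8 by rewrite exprn_gt0.
      nra.
    have : (Num.sqrt t * r ^+ 4) ^+ 2 = 1 ^+ 2.
      by rewrite exprMn sqr_sqrtr ?(ltW t0)// -exprM h expr1n.
    move/eqP; rewrite eqrXn2 ?mulr_ge0 ?sqrtr_ge0 ?exprn_ge0 ?(ltW r0)// => /eqP <-.
    by rewrite ler_wpM2l ?sqrtr_ge0// ler_weXn2l.
  rewrite IntZ; last exact: L1_rrX.
  by rewrite ler_wpM2l ?sqrtr_ge0 ?rr6_bound// t0.
have I0 : Int (fun p => 1 - offdiag p q) = 0.
  apply/eqP; rewrite eq_le Int_ge0// andbT.
  have c : (fun n => Num.sqrt (tn n) * C) @ \oo --> (0 : R).
    rewrite -(mul0r C) -[X in X * C](@sqrtr0 R); apply: cvgMl.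
    exact/cvg_sqrt/cvg_tn.
  by apply: (cvg_ge c) => n; apply: b; exact: tn01.
by apply: filterS (Int_eq0_ae Lo o0 I0) => p /eqP; rewrite subr_eq0 => /eqP.
Qed.

Definition sing p q : R := offdiag p q * (1 + rr 0 p q ^+ 6).

Lemma measurable_sing : measurable_fun setT (fun z : T * T => sing z.1 z.2).
Proof.
apply: measurable_funM; first exact: measurable_offdiag.
by apply: measurable_funD => //; apply: measurable_funX; exact: measurable_rr.
Qed.

Lemma sing_ge0 p q : 0 <= sing p q.
Proof. by rewrite mulr_ge0 ?offdiag_ge0// addr_ge0// exprn_ge0// ltW// rr_gt0. Qed.

(** Fatou along [tn]: [rr6_bound] is uniform in [t] but only speaks of positive [t]. *)
Lemma L1_sing q : L1 (sing^~ q) /\ Int (sing^~ q) <= A + C.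
Proof.
have mo := measurable_section1 q measurable_offdiag.
have o01 p : 0 <= offdiag p q <= 1 by rewrite offdiag_ge0 offdiag_le1.
have Lr n : L1 (fun p => 1 + rr (tn n) p q ^+ 6).
  by apply: L1D; [exact: L1_cst|apply: L1_rrX; exact: tn_gt0].
have Lf n : L1 (fun p => offdiag p q * (1 + rr (tn n) p q ^+ 6)).
  apply: (@L1M_bounded _ _ _ mu (fun p => 1 + rr (tn n) p q ^+ 6) _ 1) => //.
  by move=> p; have /andP[? ?] := o01 p; rewrite ger0_norm.
apply: (fatou_Int (f_ := fun n p => offdiag p q * (1 + rr (tn n) p q ^+ 6))) => //.
- exact: measurable_section1 measurable_sing.
- by move=> n p; rewrite mulr_ge0 ?offdiag_ge0// addr_ge0// exprn_ge0// ltW// rr_gt0.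
- by move=> p; exact: sing_ge0.
- apply: aeW => p; rewrite /sing /offdiag; case: ltP => [g0|_]; last first.
    by under eq_fun do rewrite mul0r; rewrite mul0r; exact: cvg_cst.
  apply: cvgM; first exact: cvg_cst.
  apply: cvgD; first exact: cvg_cst.
  exact/cvg_expn/cvg_rr.
- move=> eps eps0; apply: nearW => n.
  have -> : A + C + eps = Int (cst 1) + C + eps by rewrite Int_cst mul1r.
  apply: (@le_trans _ _ (Int (fun p => 1 + rr (tn n) p q ^+ 6))).
    apply: Int_le => // p; have /andP[_ ?] := o01 p.
    by rewrite ler_piMl// addr_ge0// exprn_ge0// ltW// rr_gt0.
  rewrite IntD; [|exact: L1_cst|by apply: L1_rrX; exact: tn_gt0].
  have h6 := rr6_bound q (tn01 n).
  by rewrite -[leRHS]addrA lerD2l (le_trans h6)// lerDl ltW.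
Qed.

(** Bounded by 1 and Lipschitz for the chordal distance, whose square is [2 * gap]. *)
Definition admissible g : Prop := [/\ measurable_fun setT g,
  (forall p, `|g p| <= 1) &
  exists2 l : R, 0 <= l & forall p q, `|g p - g q| ^+ 2 <= l * gap p q].

Hypothesis separating : forall w, L1 w ->
  (forall g, admissible g -> Int (fun q => g q * w q) = 0) ->
  {ae mu, forall q, w q = 0}.

(* Off the diagonal the potentials converge pointwise, dominated by the
   integrable singularity [1 + rr ^+ 6]; admissible test functions then
   identify this limit with the weak one. *)
Lemma potential_cvg (H_ : nat -> T -> T -> R) (H : T -> T -> R) F w (c : R) :
  0 <= c -> L1 F -> L1 w ->
  (forall n, measurable_fun setT (fun z : T * T => H_ n z.1 z.2)) ->
  measurable_fun setT (fun z : T * T => H z.1 z.2) ->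
  (forall n p q, `|H_ n p q| <= c * (1 + rr (tn n) p q ^+ 6) * `|F p|) ->
  (forall p q, 0 < gap p q -> (fun n => H_ n p q) @ \oo --> H p q) ->
  (forall g, admissible g ->
    (fun n => Int (fun q => g q * Int (fun p => H_ n p q))) @ \oo -->
    Int (fun q => g q * w q)) ->
  {ae mu, forall q, (fun n => Int (fun p => H_ n p q)) @ \oo --> w q}.
Proof.
move=> c0 LF Lw mH_ mH Hb HH Hw.
pose D q p := sing p q * `|F p|.
have mD : measurable_fun setT (fun z : T * T => D z.1 z.2).
  apply: measurable_funM.
    exact: measurable_flip measurable_sing.
  apply: (measurable_lift2 (f := fun p => `|F p|)).
  by apply: measurableT_comp => //; exact: L1_measurable LF.
have LD : L1prod mu D.
  apply: (@L1prod_bound _ _ _ _ _ (fun p => (A + C) * `|F p|)) => //.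
  - by apply: L1Z; exact: L1_norm.
  - move=> p; rewrite /D; under eq_fun do rewrite mulrC.
    apply: L1Z; have [+ _] := L1_sing p.
    by apply: eq_L1 => q; rewrite /sing /offdiag gapC rrC.
  - move=> p; have [L I] := L1_sing p.
    rewrite (@eq_Int _ _ _ mu _ (fun q => `|F p| * sing q p)); last first.
      move=> q; rewrite /D ger0_norm; last by apply: mulr_ge0 => //; exact: sing_ge0.
      by rewrite mulrC /sing /offdiag gapC rrC.
    by rewrite IntZ// mulrC ler_wpM2r.
have aeD : {ae mu, forall q, L1 (D q)} by exact: L1prod_ae1 LD.
have [LDI _ _] := Fubini_Int LD.
pose K_ n p q := offdiag p q * H_ n p q.
pose K p q := offdiag p q * H p q.
have mK_ n : measurable_fun setT (fun z : T * T => K_ n z.1 z.2).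
  by apply: measurable_funM => //; exact: measurable_offdiag.
have mK : measurable_fun setT (fun z : T * T => K z.1 z.2).
  by apply: measurable_funM => //; exact: measurable_offdiag.
have K_b n p q : `|K_ n p q| <= c * D q p.
  rewrite /K_ /D /sing /offdiag; case: ltP => g0; last by rewrite !mul0r normr0 mulr0.
  rewrite !mul1r (le_trans (Hb n p q))// -mulrA ler_wpM2l// ler_wpM2r// lerD2l.
  by rewrite lerXn2r ?nnegrE ?(ltW (rr_gt0 _ _ _))// rr_le_diag// tn_gt0.
have K_cvg p q : (fun n => K_ n p q) @ \oo --> K p q.
  rewrite /K_ /K /offdiag; case: ltP => g0.
    by apply: cvgM; [exact: cvg_cst|exact: HH].
  by under eq_fun do rewrite mul0r; rewrite mul0r; exact: cvg_cst.
have Kb p q : `|K p q| <= c * D q p.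
  have h : (fun n => `|K_ n p q|) @ \oo --> `|K p q| by exact: cvg_norm.
  exact: cvg_le h _.
have IHK n q : Int (fun p => H_ n p q) = Int (fun p => K_ n p q).
  apply: ae_Int.
  - exact: measurable_section1.
  - exact: measurable_section1.
  - by apply: filterS (offdiag_ae q) => p; rewrite /K_ => ->; rewrite mul1r.
have aecv : {ae mu, forall q,
    (fun n => Int (fun p => H_ n p q)) @ \oo --> Int (fun p => K p q)}.
  apply: filterS aeD => q Lq.
  under eq_fun do rewrite IHK.
  have [] // := @dominated_Int _ _ _ mu (fun n p => K_ n p q) (fun p => K p q)
    (fun p => c * D q p).
  - by move=> n; exact: measurable_section1.
  - exact: measurable_section1.
  - exact: L1Z.
  - by apply: aeW => p n; exact: K_b.
  - by apply: aeW => p; exact: K_cvg.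
Transparent L1prod L1fun.
have LcD : L1prod mu (fun q p => c * D q p).
  exact: (@integrableZl _ _ _ (mu \x mu)%E setT measurableT c (fun z => (D z.1 z.2)%:E)).
have Lsw (G : T -> T -> R) : measurable_fun setT (fun z : T * T => G z.1 z.2) ->
    (forall p q, `|G p q| <= c * D q p) -> L1prod mu (fun q p => G p q).
  move=> mG Gb; apply: le_integrable LcD => //.
    by apply/measurable_EFinP; exact: measurable_flip.
  by move=> z _; rewrite /= lee_fin (le_trans (Gb _ _))// ler_norm.
Opaque L1prod L1fun.
have LK := Lsw _ mK Kb.
have LK_ n := Lsw _ (mK_ n) (K_b n).
have [LKI _ _] := Fubini_Int LK.
have LK_I n : L1 (fun q => Int (fun p => H_ n p q)).
  have [+ _ _] := Fubini_Int (LK_ n).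
  by apply: eq_L1 => q; rewrite IHK.
have aeb : {ae mu, forall q, forall n, `|Int (fun p => H_ n p q)| <= c * Int (D q)}.
  apply: filterS aeD => q Lq n; rewrite IHK -IntZ//.
  have LKq : L1 (fun p => K_ n p q).
    apply: (@L1_le _ _ _ _ _ (fun p => c * D q p)) => //; last exact: L1Z.
    exact: measurable_section1.
  by apply: (le_trans (Int_norm LKq)); apply: Int_le => //; [exact: L1_norm|exact: L1Z].
suff ae0 : {ae mu, forall q, Int (fun p => K p q) - w q = 0}.
  by apply: filterS2 ae0 aecv => q /eqP; rewrite subr_eq0 => /eqP ->.
apply: separating; first exact: L1B.
move=> g ag; have [mg g1 _] := ag.
have Lg f : L1 f -> L1 (fun q => g q * f q).
  by move=> Lf; exact: (@L1M_bounded _ _ _ mu f g 1).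
under eq_fun do rewrite mulrBr.
rewrite IntB; [|exact: Lg|exact: Lg].
apply/eqP; rewrite subr_eq0; apply/eqP.
have [|||||_] := @dominated_Int _ _ _ mu
  (fun n q => g q * Int (fun p => H_ n p q)) (fun q => g q * Int (fun p => K p q))
  (fun q => c * Int (D q)).
- by move=> n; apply: L1_measurable (Lg _ (LK_I n)).
- by apply: L1_measurable (Lg _ LKI).
- exact: L1Z.
- apply: filterS aeb => q h n; rewrite normrM.
  by rewrite -[leRHS]mul1r; apply: ler_pM.
- by apply: filterS aecv => q h; apply: cvgM => //; exact: cvg_cst.
by move=> h; exact: (cvg_unique _ h (Hw g ag)).
Qed.

(** * Discretization of integrals *)

(** The cube of side [1/n] that contains [e p]. Coordinates shifted by 1 lie in [[0, 2]], so their
    integer parts go up to [2 n] included, whence the [.+1]. *)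
Definition cell n p : {ffun 'I_3 -> 'I_(n * 2).+1} :=
  [ffun j => inord (Num.truncn (n%:R * (e p 0 j + 1)))].

Lemma e_bound p j : -1 <= e p 0 j <= 1.
Proof.
have h : e p 0 j ^+ 2 <= 1.
  rewrite -(e_sphere p) /dot (bigD1 j)//= expr2 lerDl.
  by apply: sumr_ge0 => i _; rewrite -expr2 sqr_ge0.
by rewrite -ler_norml -(ler_pXn2r (n := 2)) ?nnegrE// ?expr1n ?real_normK ?num_real.
Qed.

Lemma cell_val n p j :
  cell n p j = Num.truncn (n%:R * (e p 0 j + 1)) :> nat.
Proof.
rewrite ffunE inordK// ltnS -(ler_nat R).
have /andP[h1 h2] := e_bound p j.
have h0 : 0 <= n%:R * (e p 0 j + 1) by rewrite mulr_ge0//; lra.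
have /andP[h3 _] := truncn_itv h0.
by rewrite (le_trans h3)// natrM ler_wpM2l//; lra.
Qed.

Lemma measurable_cell n i : measurable_fun setT (fun p => (cell n p == i)%:R : R).
Proof.
have mj j : measurable_fun setT (fun p => n%:R * (e p 0 j + 1)).
  by apply: measurable_funM => //; apply: measurable_funD.
have h j : measurable [set p | cell n p j = i j].
  rewrite (_ : [set p | _] = setT `&` (fun p => n%:R * (e p 0 j + 1)) @^-1`
      `[(i j)%:R, (i j).+1%:R[).
    by apply: mj => //; exact: measurable_itv.
  apply/seteqP; split => p /=.
    move=> /(congr1 val) /=; rewrite cell_val => E; split => //.
    have /andP[h1 h2] := e_bound p j.
    have h0 : 0 <= n%:R * (e p 0 j + 1) by rewrite mulr_ge0//; lra.
    by have := truncn_itv h0; rewrite E in_itv /=.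
  move=> [_]; rewrite in_itv /= => hh; apply: val_inj => /=; rewrite cell_val.
  exact: truncn_def.
have hm : measurable [set p | cell n p = i].
  rewrite (_ : [set p | _] = [set p | cell n p 0 = i 0] `&`
    ([set p | cell n p 1 = i 1] `&` [set p | cell n p 2%:R = i 2%:R])).
    by do 2 apply: measurableI => //.
  apply/seteqP; split => p /= => [->//|[h0 [h1 h2]]].
  apply/ffunP => -[[|[|[|//]]] hj].
  - by rewrite (_ : Ordinal hj = 0) //; apply: val_inj.
  - by rewrite (_ : Ordinal hj = 1) //; apply: val_inj.
  - by rewrite (_ : Ordinal hj = 2%:R) //; apply: val_inj.
rewrite (_ : (fun p => _) = \1_[set p | cell n p = i]).
  exact: measurable_indic.
apply/funext => p; rewrite indicE; congr (_%:R).
by congr (nat_of_bool _); apply/eqP/idP; rewrite inE.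
Qed.

(** Some point of the cell. The default [point] stands in for empty cells, whose mass is zero. *)
Definition node n i : T := xget point [set p | cell n p = i].
Arguments node : clear implicits.

Lemma cell_node n p : cell n (node n (cell n p)) = cell n p.
Proof.
rewrite /node; apply: (@xgetPex _ point [set q | cell n q = cell n p]).
by exists p.
Qed.

Lemma node_close n p j : (0 < n)%N ->
  `|e (node n (cell n p)) 0 j - e p 0 j| <= n%:R^-1.
Proof.
move=> n0; have := cell_node n p => /(congr1 (fun c : {ffun 'I_3 -> 'I_(n * 2).+1} => c j : nat)).
rewrite !cell_val; set q := node _ _.
have hb r : let y := n%:R * (e r 0 j + 1) in (Num.truncn y)%:R <= y < (Num.truncn y).+1%:R.
  have /andP[h1 h2] := e_bound r j.
  by apply: truncn_itv; rewrite mulr_ge0//; lra.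
have /= /andP[a1 a2] := hb q; have /= /andP[b1 b2] := hb p.
move=> E; rewrite E in a1 a2; rewrite -natr1 in a2 b2.
have n0' : (0 : R) < n%:R by rewrite ltr0n.
rewrite -(ler_pM2l n0') mulfV ?gt_eqF// -[X in X * _](gtr0_norm n0') -normrM.
by rewrite ler_norml mulrBr; apply/andP; split; lra.
Qed.

Lemma node_cvg p j : (fun n => e (node n.+1 (cell n.+1 p)) 0 j) @ \oo --> e p 0 j.
Proof.
apply: (@cvg_of_norm_le _ _ tn _ cvg_tn) => n.
exact: node_close.
Qed.

Lemma gap_node_cvg p q : (fun n => gap (node n.+1 (cell n.+1 p)) q) @ \oo --> gap p q.
Proof.
under eq_fun do rewrite gapE dot3; rewrite gapE dot3.
apply: cvgB; first exact: cvg_cst.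
by apply: cvgD; [apply: cvgD|]; apply: cvgMl; exact: node_cvg.
Qed.

Lemma rr_node_cvg t p q : 0 < t ->
  (fun n => rr t (node n.+1 (cell n.+1 p)) q) @ \oo --> rr t p q.
Proof.
move=> t0; under eq_fun do rewrite rrE; rewrite rrE.
apply: cvg_expR; apply: cvgN; apply: cvgMl; apply: continuous_cvg.
  by apply: continuous_ln; rewrite ltr_wpDr ?gap_ge0.
by apply: cvgD; [exact: cvg_cst|exact: gap_node_cvg].
Qed.

Lemma ln_node_cvg t p q : 0 < t ->
  (fun n => ln (t + gap (node n.+1 (cell n.+1 p)) q)) @ \oo --> ln (t + gap p q).
Proof.
move=> t0; apply: continuous_cvg.
  by apply: continuous_ln; rewrite ltr_wpDr ?gap_ge0.
by apply: cvgD; [exact: cvg_cst|exact: gap_node_cvg].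
Qed.

Definition cell_mass n (F : T -> R) i : R := Int (fun p => (cell n p == i)%:R * F p).
Arguments cell_mass : clear implicits.

Lemma L1_cell n F i : L1 F -> L1 (fun p => (cell n p == i)%:R * F p).
Proof.
move=> LF; apply: (@L1M_bounded _ _ _ mu F _ 1 LF); first exact: measurable_cell.
by move=> p; rewrite ger0_norm ?ler0n// lern1 leq_b1.
Qed.

Lemma sum_cell n (K : {ffun 'I_3 -> 'I_(n * 2).+1} -> R) p :
  \sum_i (cell n p == i)%:R * K i = K (cell n p).
Proof.
rewrite (bigD1 (cell n p))//= eqxx mul1r big1 ?addr0// => i.
by rewrite eq_sym => /negbTE ->; rewrite mul0r.
Qed.

(** A finite superposition of kernels placed at the nodes is thus an exact integral, with the kernel
    frozen on each cell; estimates and limits of such sums become dominated convergence. *)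
Lemma quadrature n F (K : {ffun 'I_3 -> 'I_(n * 2).+1} -> R) : L1 F ->
  L1 (fun p => K (cell n p) * F p) /\
  \sum_i cell_mass n F i * K i = Int (fun p => K (cell n p) * F p).
Proof.
move=> LF.
have L i : L1 (fun p => K i * ((cell n p == i)%:R * F p)) by apply: L1Z; exact: L1_cell.
have E p : K (cell n p) * F p = \sum_i K i * ((cell n p == i)%:R * F p).
  rewrite -(sum_cell K) mulr_suml; apply: eq_bigr => i _.
  by rewrite mulrA (mulrC (K i)).
split; first by apply: (eq_L1 _ (L1_sum L)) => p; rewrite E.
under eq_Int do rewrite E.
rewrite (Int_sum L); apply: eq_bigr => i _.
by rewrite (IntZ _ (L1_cell i LF)) mulrC.
Qed.

Lemma quadrature_bound n F (K : {ffun 'I_3 -> 'I_(n * 2).+1} -> R) (c : R) : L1 F ->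
  (forall i, `|K i| <= c) ->
  `|\sum_i cell_mass n F i * K i| <= c * Int (fun p => `|F p|).
Proof.
move=> LF Kc; have [L ->] := quadrature K LF.
apply: (le_trans (Int_norm L)); rewrite -(IntZ _ (L1_norm LF)).
apply: Int_le => [||p]; [exact: L1_norm|by apply: L1Z; exact: L1_norm|].
by rewrite normrM ler_wpM2r.
Qed.

Lemma quadrature_cvg F (K : T -> R) (c : R) : L1 F -> measurable_fun setT K ->
  (forall p, `|K p| <= c) ->
  (forall p, (fun n => K (node n.+1 (cell n.+1 p))) @ \oo --> K p) ->
  (fun n => \sum_i cell_mass n.+1 F i * K (node n.+1 i)) @ \oo -->
  Int (fun p => K p * F p).
Proof.
move=> LF mK Kc Kcv.
under eq_fun => n do rewrite (quadrature (fun i => K (node n.+1 i)) LF).2.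
have [|||||_ H] := @dominated_Int _ _ _ mu
  (fun n p => K (node n.+1 (cell n.+1 p)) * F p) (fun p => K p * F p)
  (fun p => c * `|F p|); last exact: H.
- by move=> n; have [/L1_measurable] := quadrature (fun i => K (node n.+1 i)) LF.
- by apply: measurable_funM => //; exact: L1_measurable LF.
- by apply: L1Z; exact: L1_norm.
- by apply: aeW => p n; rewrite normrM ler_wpM2r.
- by apply: aeW => p; apply: cvgMl; exact: Kcv.
Qed.

(** * Representation formulas *)

Opaque kappa root4 tn.

Lemma L1prod_kappa t w : 0 < t -> L1 w ->
  L1prod mu (fun p q => kappa t p q * w p).
Proof.
move=> t0 Lw.
apply: (@L1prod_bounded _ (fun p => `|w p|) (t * (2 + t) * (1 + t^-1) ^+ 16)).
- apply: measurable_funM; first exact: measurable_kappa.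
  exact: (measurable_lift1 (L1_measurable Lw)).
- by move=> p q; rewrite normrM (ger0_norm (kappa_ge0 p q t0)) ler_wpM2r// kappa_le.
- exact: L1_norm.
Qed.

Lemma L1_kappaM t q w : 0 < t -> L1 w -> L1 (fun p => kappa t p q * w p).
Proof.
move=> t0 Lw.
apply: (@L1M_bounded _ _ _ mu w _ (t * (2 + t) * (1 + t^-1) ^+ 16) Lw).
  exact: measurable_section1 (measurable_kappa _).
by move=> p; rewrite ger0_norm ?kappa_ge0 ?kappa_le.
Qed.

Lemma measurable_qmul d' (S : measurableType d') (X : S -> 'rV[R]_3)
    (v : S -> 'cV[R]_4) :
  (forall j, measurable_fun setT (fun z => X z 0 j)) ->
  (forall k, measurable_fun setT (fun z => v z k 0)) ->
  forall k, measurable_fun setT (fun z => qmul (X z) (v z) k 0).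
Proof.
move=> mX mv.
have h j k : measurable_fun setT (fun z => X z 0 j * v z k 0).
  exact: measurable_funM.
have h' j k : measurable_fun setT (fun z => - X z 0 j * v z k 0).
  by apply: measurable_funM => //; exact: measurable_funN.
apply: ord4P; rewrite /qmul; under eq_fun do rewrite mxE /=.
- by apply: measurable_funB => //; exact: measurable_funD.
- by apply: measurable_funD => //; exact: measurable_funD.
- by apply: measurable_funD => //; exact: measurable_funB.
- by apply: measurable_funB => //; exact: measurable_funB.
Qed.

(** [kappa] is symmetric, so averaging can be moved from [w] to [g]. The error carries the factor
    [(g q - g p) * w p], which vanishes on the diagonal, and [kappa_concentration] makes it
    small. *)
Lemma mollify_weak w g : L1 w -> admissible g ->
  (fun n => Int (fun q => g q * Int (fun p => kappa (tn n) p q * w p))) @ \oo -->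
  A * Int (fun q => g q * w q).
Proof.
move=> Lw [mg g1 [l l0 gl]].
have Lgw : L1 (fun q => g q * w q) by exact: (@L1M_bounded _ _ _ mu w g 1).
pose Th p q := (g q - g p) * w p.
have mTh : measurable_fun setT (fun z : T * T => Th z.1 z.2).
  apply: measurable_funM; last by apply: measurable_lift1; exact: L1_measurable Lw.
  by apply: measurable_funB; [exact: measurable_lift2|exact: measurable_lift1].
have Thb s p q : 0 < s -> `|Th p q| <= (s + l * gap p q / s) * `|w p|.
  move=> s0; rewrite normrM ler_wpM2r// distrC.
  have := gl p q; move: (normr_ge0 (g p - g q)).
  move: `|g p - g q| (l * gap p q) => x y x0 xy.
  rewrite -(ler_pM2r s0) mulrDl divfK ?gt_eqF//.
  by have := sqr_ge0 (s - x); nra.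
have key n : `|Int (fun q => g q * Int (fun p => kappa (tn n) p q * w p)) -
    A * Int (fun q => g q * w q)| <=
    root4 (tn n) * ((A + 3 * l * C) * Int (fun p => `|w p|)).
  have t0 := tn_gt0 n.
  have [LK KB] := @kappa_concentration (tn n) Th (fun p => `|w p|) l (tn01 n) l0 mTh
    (L1_norm Lw) (fun p => normr_ge0 _) (fun p q => Thb _ p q (root4_gt0 t0)).
  have [_ LK2 LK3] := Fubini_Int LK.
  have Lgk : L1prod mu (fun p q => kappa (tn n) p q * (g p * w p)) by exact: L1prod_kappa.
  have [_ Lgk2 Lgk3] := Fubini_Int Lgk.
  have Lkw q : L1 (fun p => kappa (tn n) p q * w p) by exact: L1_kappaM.
  have Lkg q : L1 (fun p => kappa (tn n) p q * (g p * w p)) by exact: L1_kappaM.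
  have E1 q : g q * Int (fun p => kappa (tn n) p q * w p) =
      Int (fun p => kappa (tn n) p q * Th p q) +
      Int (fun p => kappa (tn n) p q * (g p * w p)).
    have LT : L1 (fun p => kappa (tn n) p q * Th p q).
      apply: (eq_L1 _ (L1B (L1Z (g q) (Lkw q)) (Lkg q))) => p.
      by rewrite /Th; ring.
    rewrite -(IntZ _ (Lkw q)) -(IntD LT (Lkg q)).
    by apply: eq_Int => p; rewrite /Th; ring.
  have -> : A * Int (fun q => g q * w q) =
      Int (fun q => Int (fun p => kappa (tn n) p q * (g p * w p))).
    rewrite -Lgk3 -(IntZ A Lgw); apply: eq_Int => p.
    rewrite (@eq_Int _ _ _ mu _ (fun q => g p * w p * kappa (tn n) q p)); last first.
      by move=> q; rewrite kappaC mulrC.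
    rewrite (IntZ _ (L1_kappa p t0)) (Int_kappa p (tn01 n)).
    exact: mulrC.
  under eq_Int do rewrite E1.
  rewrite (IntD LK2 Lgk2) addrK (le_trans KB)//.
  by rewrite le_eqVlt mulrA eqxx.
have c0 : (fun n => root4 (tn n) * ((A + 3 * l * C) * Int (fun p => `|w p|))) @ \oo
    --> (0 : R).
  rewrite -[X in _ --> X](mul0r ((A + 3 * l * C) * Int (fun p => `|w p|))).
  by apply: cvgMl; exact: cvg_root4.
exact: cvg_of_norm_le c0 key.
Qed.

(** * Potentials of a weak solution *)

Section Solution.
Variables (u f0 P : T -> R) (psi : T -> 'cV[R]_4) (m M c1 : R).
Hypothesis A_gt0 : 0 < A.
Hypothesis measurable_psi : forall k, measurable_fun setT (fun p => psi p k 0).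
Hypothesis measurable_P : measurable_fun setT P.
Hypothesis Lu : L1 u.
Hypothesis Lexp : L1 (fun p => expR (2 * u p)).
Hypothesis Lf0 : L1 f0.
Hypothesis Int_f0 : Int f0 = A.
Hypothesis m_ge0 : 0 <= m.
Hypothesis f0_ge : forall p, m * expR (2 * u p) + P p * nsq (psi p) <= f0 p.
Hypothesis c1_gt0 : 0 < c1.
Hypothesis P_ge : forall p, c1 * expR (u p) <= P p.
Hypothesis P_le : forall p, P p <= M * expR (u p).
Hypothesis Lpsi : L1 (fun p => nsq (psi p)).
(* The first equation tested against [ln (t + gap p q)], as functions of [p]. *)
Hypothesis u_repr : forall t q, 0 < t <= 1 ->
  Int (fun p => kappa t p q * u p) =
  Int u - Int (fun p => (f0 p - 1) * ln (t + gap p q)).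
(* The Dirac equation tested against [rr t p q ^+ 8 *: qmul (e q - e p) eta]. *)
Hypothesis psi_repr : forall t q k, 0 < t <= 1 ->
  Int (fun p => t * rr t p q ^+ 16 *
                (psi p - qmul (e q) (qmul (e p) (psi p))) k 0) =
  Int (fun p => rr t p q ^+ 8 * (P p * qmul (e p - e q) (psi p) k 0)).

Lemma P_gt0 p : 0 < P p.
Proof. by apply: lt_le_trans (P_ge p); rewrite mulr_gt0// expR_gt0. Qed.

Lemma M_gt0 p : 0 < M.
Proof.
have := lt_le_trans (P_gt0 p) (P_le p).
by rewrite pmulr_lgt0 ?expR_gt0.
Qed.

Definition nn p : R := Num.sqrt (nsq (psi p)).

Lemma nn_ge0 p : 0 <= nn p. Proof. exact: sqrtr_ge0. Qed.

Lemma nn_sq p : nn p ^+ 2 = nsq (psi p).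
Proof. by rewrite sqr_sqrtr// nsq_ge0. Qed.

Lemma nn_le p : nn p <= 1 + nsq (psi p).
Proof. by rewrite -nn_sq; have := sqr_ge0 (1 - nn p); have := nn_ge0 p; nra. Qed.

Lemma measurable_nsq : measurable_fun setT (fun p => nsq (psi p)).
Proof. exact: L1_measurable Lpsi. Qed.

Lemma measurable_nn : measurable_fun setT nn.
Proof. exact: (measurableT_comp measurable_sqrt measurable_nsq). Qed.

Lemma Lnn : L1 nn.
Proof.
apply: (@L1_le _ _ _ _ _ (fun p => 1 + nsq (psi p))) => //.
- exact: measurable_nn.
- by move=> p; rewrite ger0_norm ?nn_ge0// nn_le.
- by apply: L1D => //; exact: L1_cst.
Qed.

Lemma LPnsq : L1 (fun p => P p * nsq (psi p)).
Proof.
apply: (@L1_le _ _ _ _ _ f0) => //.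
  by apply: measurable_funM => //; exact: measurable_nsq.
move=> p; rewrite ger0_norm ?mulr_ge0 ?nsq_ge0 ?(ltW (P_gt0 p))//.
by apply: le_trans (f0_ge p); rewrite lerDr mulr_ge0 ?expR_ge0.
Qed.

Lemma expR_le2 p : expR (u p) <= 1 + expR (2 * u p).
Proof.
by rewrite expRM_natl; have := sqr_ge0 (1 - expR (u p)); have := expR_ge0 (u p); nra.
Qed.

Lemma LP : L1 P.
Proof.
apply: (@L1_le _ _ _ _ _ (fun p => M * (1 + expR (2 * u p)))) => //.
- move=> p; rewrite (ger0_norm (ltW (P_gt0 p))) (le_trans (P_le p))//.
  by rewrite ler_wpM2l ?expR_le2// ltW// (M_gt0 p).
- by apply: L1Z; apply: L1D => //; exact: L1_cst.
Qed.

Lemma LPnn : L1 (fun p => P p * nn p).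
Proof.
apply: (@L1_le _ _ _ _ _ (fun p => P p + P p * nsq (psi p))) => //.
- by apply: measurable_funM => //; exact: measurable_nn.
- move=> p; have P0 := ltW (P_gt0 p).
  rewrite ger0_norm ?mulr_ge0 ?nn_ge0// -{2}[P p]mulr1 -mulrDr.
  by rewrite ler_wpM2l ?nn_le.
- by apply: L1D; [exact: LP|exact: LPnsq].
Qed.

Lemma dotBB_gap p q : dot (e p - e q) (e p - e q) = 2 * gap p q.
Proof. by rewrite dotBB !e_sphere gapE; ring. Qed.

Lemma qmul_diff_bound p q v k :
  (qmul (e p - e q) v k 0) ^+ 2 <= 2 * gap p q * nsq v.
Proof. by apply: le_trans (le_nsq _ k) _; rewrite nsq_qmul dotBB_gap. Qed.

(** [|e p - e q|^2 = 2 * gap] and [gap * rr ^+ 8 <= 1]: the difference [e p - e q] gains half of the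
    power [z^(-1)], and the singularity is that of an inverse distance. *)
Lemma spinor_kernel_bound t p q k : 0 < t ->
  `|rr t p q ^+ 8 * qmul (e p - e q) (psi p) k 0| <= 2 * rr t p q ^+ 4 * nn p.
Proof.
move=> t0; have r0 := ltW (rr_gt0 t p q).
have b0 : 0 <= 2 * rr t p q ^+ 4 * nn p.
  by apply: mulr_ge0; [apply: mulr_ge0 => //; exact: exprn_ge0|exact: nn_ge0].
rewrite -(@ler_pXn2r _ 2) ?nnegrE//.
rewrite real_normK ?num_real//.
rewrite (_ : (2 * rr t p q ^+ 4 * nn p) ^+ 2 = 2 ^+ 2 * rr t p q ^+ 8 * nn p ^+ 2); last by ring.
rewrite nn_sq (_ : (rr t p q ^+ 8 * qmul (e p - e q) (psi p) k 0) ^+ 2 =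
  rr t p q ^+ 16 * (qmul (e p - e q) (psi p) k 0) ^+ 2); last by ring.
have h := qmul_diff_bound p q (psi p) k.
have r16 : 0 <= rr t p q ^+ 16 by rewrite exprn_ge0.
apply: (le_trans (ler_wpM2l r16 h)).
have g1 : gap p q * rr t p q ^+ 8 <= 1.
  by rewrite -(rr8M p q t0) ler_wpM2r ?exprn_ge0// lerDr ltW.
have r8 : 0 <= rr t p q ^+ 8 by rewrite exprn_ge0.
have n0 := nsq_ge0 (psi p).
rewrite (_ : rr t p q ^+ 16 * (2 * gap p q * nsq (psi p)) =
  2 * (gap p q * rr t p q ^+ 8) * (rr t p q ^+ 8 * nsq (psi p))); last by ring.
rewrite -mulrA; apply: (@le_trans _ _ (2 * (rr t p q ^+ 8 * nsq (psi p)))).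
  by rewrite ler_wpM2l// ler_piMl// mulr_ge0.
by rewrite mulrA ler_wpM2r// ler_wpM2r//; lra.
Qed.

Definition st t q : R := A^-1 * Int (fun p => kappa t p q * u p).

(** The regularized Riesz potential of [P psi]. By [psi_repr] it is also an average of [psi], up to
    an error that vanishes on the diagonal. *)
Definition pt t q : 'cV[R]_4 := \col_k
  (A^-1 * Int (fun p => rr t p q ^+ 8 * (P p * qmul (e p - e q) (psi p) k 0))).

(** Above, [ln z < z <= 3]; below, [1 + y <= e^y] at [y = - 3/4 ln z], where the exponential is
    [rr ^+ 6]. *)
Lemma ln_gap_bound t p q : 0 < t <= 1 ->
  `|ln (t + gap p q)| <= 3 * (1 + rr t p q ^+ 6).
Proof.
move=> /andP[t0 t1]; have z0 : 0 < t + gap p q by rewrite ltr_wpDr ?gap_ge0.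
have r6 := rr6E t p q.
have h1 := ltW (ln_sublinear z0).
have h2 := expR_ge1Dx (- (3 / 4) * ln (t + gap p q)); rewrite -r6 in h2.
have h3 := gap_le2 p q.
have h4 := rrX_ge0 t p q 6.
by rewrite ler_norml; apply/andP; split; lra.
Qed.

Lemma measurable_ln_gap t :
  measurable_fun setT (fun z : T * T => ln (t + gap z.1 z.2)).
Proof.
apply: measurableT_comp => //.
by apply: measurable_funD => //; exact: measurable_gap.
Qed.

Lemma L1_ln_gap t q f : 0 < t <= 1 -> L1 f ->
  L1 (fun p => f p * ln (t + gap p q)).
Proof.
move=> t01 Lf; have /andP[t0 t1] := t01; rewrite (_ : (fun _ => _) = fun p => ln (t + gap p q) * f p); last first.
  by apply/funext => p; rewrite mulrC.
apply: (@L1M_bounded _ _ _ mu f _ (3 * (1 + (1 + t^-1) ^+ 6))) => //.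
  exact: (@measurable_section1 (fun p q => ln (t + gap p q)) q (measurable_ln_gap t)).
move=> p; apply: (le_trans (ln_gap_bound p q t01)).
by rewrite ler_wpM2l// lerD2l rrX_le.
Qed.

(** [potential_cvg] is applied to [u] minus its mean, since the logarithmic potential of [f0 - 1]
    determines [u] only up to a constant. *)
Lemma st_cvg : {ae mu, forall q, (fun n => st (tn n) q) @ \oo --> u q}.
Proof.
have Lf1 : L1 (fun p => f0 p - 1) by apply: L1B => //; exact: L1_cst.
have LuB : L1 (fun p => u p - A^-1 * Int u) by apply: L1B => //; exact: L1_cst.
have Ai : 0 <= A^-1 by rewrite invr_ge0 ltW.
have stE n q : Int (fun p => - A^-1 * ((f0 p - 1) * ln (tn n + gap p q))) =
    st (tn n) q - A^-1 * Int u.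
  rewrite IntZ; last by apply: L1_ln_gap => //; exact: tn01.
  by rewrite /st u_repr ?tn01//; ring.
have := @potential_cvg (fun n p q => - A^-1 * ((f0 p - 1) * ln (tn n + gap p q)))
  (fun p q => - A^-1 * ((f0 p - 1) * ln (0 + gap p q)))
  (fun p => f0 p - 1) (fun q => u q - A^-1 * Int u) (3 * A^-1).
move=> /(_ _ Lf1 LuB) H.
have {}H : {ae mu, forall q, (fun n => Int (fun p => - A^-1 * ((f0 p - 1) *
    ln (tn n + gap p q)))) @ \oo --> u q - A^-1 * Int u}.
  apply: H.
  - by rewrite mulr_ge0.
  - move=> n; apply: measurable_funM => //; apply: measurable_funM.
      exact: (measurable_lift1 (L1_measurable Lf1)).
    exact: measurable_ln_gap.
  - apply: measurable_funM => //; apply: measurable_funM.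
      exact: (measurable_lift1 (L1_measurable Lf1)).
    exact: measurable_ln_gap.
  - move=> n p q; rewrite normrM normrN (ger0_norm Ai) normrM.
    have := ln_gap_bound p q (tn01 n) => /(ler_wpM2l (normr_ge0 (f0 p - 1))).
    by move=> /(ler_wpM2l Ai) /le_trans; apply; rewrite le_eqVlt; apply/orP; left; apply/eqP; ring.
  - move=> p q g0; apply: cvgM; first exact: cvg_cst.
    apply: cvgM; first exact: cvg_cst.
    apply: continuous_cvg; first by apply: continuous_ln; rewrite add0r.
    by apply: cvgD; [exact: cvg_tn|exact: cvg_cst].
  - move=> g ag; have [mg g1 _] := ag.
    have Lg : L1 g by apply: (@L1_bounded _ _ _ _ _ 1).
    have Lgu : L1 (fun q => g q * u q) by exact: (@L1M_bounded _ _ _ mu u g 1).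
    have Wg : (fun n => A^-1 * Int (fun q => g q * Int (fun p => kappa (tn n) p q * u p)))
        @ \oo --> A^-1 * (A * Int (fun q => g q * u q)).
      by apply: cvgMr; exact: mollify_weak.
    have E n : Int (fun q => g q * Int (fun p => - A^-1 * ((f0 p - 1) *
          ln (tn n + gap p q)))) =
        A^-1 * Int (fun q => g q * Int (fun p => kappa (tn n) p q * u p)) -
        A^-1 * Int u * Int g.
      have LK : L1prod mu (fun p q => kappa (tn n) p q * u p).
        by apply: L1prod_kappa => //; exact: tn_gt0.
      have [_ LK2 _] := Fubini_Int LK.
      have LgK : L1 (fun q => g q * Int (fun p => kappa (tn n) p q * u p)).
        exact: (@L1M_bounded _ _ _ mu _ g 1).
      rewrite -(IntZ _ LgK) -(IntZ _ Lg) -(IntB (L1Z _ LgK) (L1Z _ Lg)).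
      by apply: eq_Int => q; rewrite stE /st; ring.
    under eq_fun do rewrite E.
    have -> : Int (fun q => g q * (u q - A^-1 * Int u)) =
        A^-1 * (A * Int (fun q => g q * u q)) - A^-1 * Int u * Int g.
      rewrite (mulKf (lt0r_neq0 A_gt0)) -(IntZ _ Lg) -(IntB Lgu (L1Z _ Lg)).
      by apply: eq_Int => q; ring.
    by apply: cvgB => //; exact: cvg_cst.
apply: filterS H => q; under eq_fun do rewrite stE.
exact: cvg_subr.
Qed.

Lemma Lpsik k : L1 (fun p => psi p k 0).
Proof.
apply: (@L1_le _ _ _ _ _ nn) => //; last exact: Lnn.
move=> p; rewrite -(@ler_pXn2r _ 2) ?nnegrE ?nn_ge0//.
by rewrite real_normK ?num_real// nn_sq le_nsq.
Qed.

Lemma measurable_spinor_kernel k : measurable_fun setT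
  (fun z : T * T => qmul (e z.1 - e z.2) (psi z.1) k 0).
Proof.
apply: (@measurable_qmul _ _ (fun z : T * T => e z.1 - e z.2) (fun z => psi z.1)).
  move=> j; rewrite (_ : (fun z => _) = fun z : T * T => e z.1 0 j - e z.2 0 j).
    apply: measurable_funB.
      exact: (measurable_lift1 (measurable_e j)).
    exact: (measurable_lift2 (measurable_e j)).
  by apply/funext => z; rewrite !mxE.
by move=> j; exact: (measurable_lift1 (measurable_psi j)).
Qed.

Lemma measurable_potential t k : measurable_fun setT (fun z : T * T =>
  rr t z.1 z.2 ^+ 8 * (P z.1 * qmul (e z.1 - e z.2) (psi z.1) k 0)).
Proof.
apply: measurable_funM; first by apply: measurable_funX; exact: measurable_rr.
apply: measurable_funM; first exact: (measurable_lift1 measurable_P).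
exact: measurable_spinor_kernel.
Qed.

Lemma potential_bound t p q k : 0 < t ->
  `|rr t p q ^+ 8 * (P p * qmul (e p - e q) (psi p) k 0)| <=
  2 * rr t p q ^+ 4 * (P p * nn p).
Proof.
move=> t0; rewrite mulrCA normrM (gtr0_norm (P_gt0 p)).
have h := ler_wpM2l (ltW (P_gt0 p)) (spinor_kernel_bound p q k t0).
by rewrite (le_trans h)// le_eqVlt; apply/orP; left; apply/eqP; ring.
Qed.

Lemma L1_potential t q k : 0 < t ->
  L1 (fun p => rr t p q ^+ 8 * (P p * qmul (e p - e q) (psi p) k 0)).
Proof.
move=> t0; apply: (@L1_le _ _ _ _ _ (fun p => 2 * (1 + t^-1) ^+ 4 * (P p * nn p))).
- exact: (@measurable_section1 (fun p q => rr t p q ^+ 8 * (P p * qmul (e p - e q) (psi p) k 0)) q (measurable_potential t k)).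
- move=> p; apply: (le_trans (potential_bound p q k t0)).
  rewrite ler_wpM2r//; first by apply: mulr_ge0; [exact: ltW (P_gt0 p)|exact: nn_ge0].
  by rewrite ler_wpM2l// rrX_le.
- by apply: L1Z; exact: LPnn.
Qed.

Lemma pt_cvg k : {ae mu, forall q, (fun n => pt (tn n) q k 0) @ \oo --> psi q k 0}.
Proof.
have Ai : 0 <= A^-1 by rewrite invr_ge0 ltW.
have ptE n q : pt (tn n) q k 0 = Int (fun p => A^-1 *
    (rr (tn n) p q ^+ 8 * (P p * qmul (e p - e q) (psi p) k 0))).
  by rewrite mxE (IntZ _ (L1_potential q k (tn_gt0 n))).
suff H : {ae mu, forall q, (fun n => Int (fun p => A^-1 *
    (rr (tn n) p q ^+ 8 * (P p * qmul (e p - e q) (psi p) k 0)))) @ \oo -->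
    psi q k 0}.
  by apply: filterS H => q; under eq_fun do rewrite -ptE.
apply: (@potential_cvg (fun n p q => A^-1 *
    (rr (tn n) p q ^+ 8 * (P p * qmul (e p - e q) (psi p) k 0)))
  (fun p q => A^-1 * (rr 0 p q ^+ 8 * (P p * qmul (e p - e q) (psi p) k 0)))
  (fun p => P p * nn p) (fun q => psi q k 0) (2 * A^-1)).
- by rewrite mulr_ge0.
- exact: LPnn.
- exact: Lpsik.
- move=> n; apply: (measurable_funM (f := cst A^-1)) => //.
  exact: measurable_potential.
- apply: (measurable_funM (f := cst A^-1)) => //.
  exact: measurable_potential.
- move=> n p q; rewrite normrM (ger0_norm Ai).
  have PN : 0 <= P p * nn p by apply: mulr_ge0; [exact: ltW (P_gt0 p)|exact: nn_ge0].
  rewrite (ger0_norm PN).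
  have h := ler_wpM2l Ai (potential_bound p q k (tn_gt0 n)).
  apply: (le_trans h).
  rewrite (_ : A^-1 * _ = 2 / A * rr (tn n) p q ^+ 4 * (P p * nn p)); last by ring.
  apply: ler_wpM2r => //; apply: ler_wpM2l; first by rewrite mulr_ge0.
  have := rr_gt0 (tn n) p q; move: (rr _ _ _) => r r0.
  have [r1|r1] := leP r 1.
    by rewrite ler_wpDr ?exprn_ge0 ?(ltW r0)// exprn_ile1 ?(ltW r0).
  by rewrite ler_wpDl// ler_eXn2l.
- move=> p q g0; apply: cvgMr; apply: cvgMl; exact/cvg_expn/cvg_rr.
- move=> g ag; have [mg g1 _] := ag.
  have Lg : L1 g by apply: (@L1_bounded _ _ _ _ _ 1).
  (* Since [I(q)^2 = -1], [psi - I(q) I(p) psi = 2 psi + I(q) I(q - p) psi]. The first term is a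
     mollification of [psi]; the second is of the size of [|e q - e p|] and is handled by
     concentration. *)
  pose Th p q := g q * qmul (e q) (qmul (e q - e p) (psi p)) k 0.
  have mTh : measurable_fun setT (fun z : T * T => Th z.1 z.2).
    apply: measurable_funM; first exact: measurable_lift2.
    apply: (@measurable_qmul _ _ (fun z : T * T => e z.2)
      (fun z => qmul (e z.2 - e z.1) (psi z.1))).
      by move=> j; exact: (measurable_lift2 (measurable_e j)).
    move=> j; apply: (@measurable_qmul _ _ (fun z : T * T => e z.2 - e z.1) (fun z => psi z.1)).
      move=> i; rewrite (_ : (fun z => _) = fun z : T * T => e z.2 0 i - e z.1 0 i).
        apply: measurable_funB.
          exact: (measurable_lift2 (measurable_e i)).
        exact: (measurable_lift1 (measurable_e i)).
      by apply/funext => z; rewrite !mxE.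
    by move=> i; exact: (measurable_lift1 (measurable_psi i)).
  have Thb (s : R) p q : 0 < s -> `|Th p q| <= (s + 2 * gap p q / s) * nn p.
    move=> s0; rewrite /Th normrM.
    have h : `|qmul (e q) (qmul (e q - e p) (psi p)) k 0| ^+ 2 <= 2 * gap p q * nn p ^+ 2.
      rewrite real_normK ?num_real// nn_sq (le_trans (le_nsq _ k))//.
      by rewrite !nsq_qmul e_sphere mul1r dotBB_gap gapC.
    have := gap_ge0 p q; have := nn_ge0 p; have := g1 q; have := normr_ge0 (g q).
    move: (normr_ge0 (qmul (e q) (qmul (e q - e p) (psi p)) k 0)) h.
    move: `|qmul _ _ k 0| `|g q| (nn p) (gap p q) => x y n ga x0 h y0 y1 n0 ga0.
    apply: (@le_trans _ _ x); first by rewrite ler_piMl.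
    rewrite -(ler_pM2r s0) mulrAC mulrDl divfK ?gt_eqF//.
    have b0 : 0 <= (s * s + 2 * ga) * n.
      by apply: mulr_ge0 => //; apply: addr_ge0; [apply: mulr_ge0; exact: ltW|rewrite mulr_ge0].
    rewrite -(@ler_pXn2r _ 2) ?nnegrE ?(mulr_ge0 _ (ltW s0))//.
    rewrite exprMn (le_trans (ler_wpM2r (sqr_ge0 s) h))//.
    rewrite exprMn -subr_ge0 (_ : _ - _ = ((s * s) ^+ 2 + 2 * (s * s) * ga + 4 * ga ^+ 2) * n ^+ 2); last by ring.
    apply: mulr_ge0; last exact: sqr_ge0.
    have := sqr_ge0 (s * s); have := sqr_ge0 ga; have : 0 <= 2 * (s * s) * ga.
      by rewrite mulr_ge0// mulr_ge0// mulr_ge0// ltW.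
    by lra.
  have LK n := (@kappa_concentration (tn n) Th nn 2 (tn01 n) (ler0n R 2) mTh Lnn nn_ge0
      (fun p q => Thb _ p q (root4_gt0 (tn_gt0 n)))).
  have W1 : (fun n => Int (fun q => Int (fun p => kappa (tn n) p q * Th p q))) @ \oo --> (0 : R).
    apply: (@cvg_of_norm_le _ _ (fun n => root4 (tn n) * ((A + 3 * 2 * C) * Int nn))).
      rewrite -[X in _ --> X](mul0r ((A + 3 * 2 * C) * Int nn)).
      by apply: cvgMl; exact: cvg_root4.
    by move=> n; rewrite subr0 mulrA; have [_] := LK n.
  have W2 := mollify_weak (Lpsik k) ag.
  (* Here [t * rr ^+ 16] is [kappa / (2 + t)]; in the limit this factor cancels the 2 in front of
     [psi]. *)
  have E n : Int (fun q => g q * Int (fun p => A^-1 *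
      (rr (tn n) p q ^+ 8 * (P p * qmul (e p - e q) (psi p) k 0)))) =
      A^-1 * (2 + tn n)^-1 *
      (2 * Int (fun q => g q * Int (fun p => kappa (tn n) p q * psi p k 0)) +
       Int (fun q => Int (fun p => kappa (tn n) p q * Th p q))).
    have t0 := tn_gt0 n.
    have [_ LKp _] := Fubini_Int (L1prod_kappa t0 (Lpsik k)).
    have LgK : L1 (fun q => g q * Int (fun p => kappa (tn n) p q * psi p k 0)).
      exact: (@L1M_bounded _ _ _ mu _ g 1).
    have [_ LT _] := Fubini_Int (LK n).1.
    rewrite -(IntZ _ LgK) -(IntD (L1Z _ LgK) LT) -(IntZ _ (L1D (L1Z _ LgK) LT)).
    apply: eq_Int => q.
    have Lk := L1_kappaM q t0 (Lpsik k).
    have LT1 : L1 (fun p => kappa (tn n) p q * Th p q).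
      apply: (@L1_le _ _ _ _ _ (fun p => tn n * (2 + tn n) * (1 + (tn n)^-1) ^+ 16 * ((1 + 2 * 2) * nn p))).
      - apply: (@measurable_section1 (fun p q => kappa (tn n) p q * Th p q)).
        by apply: measurable_funM => //; exact: measurable_kappa.
      - move=> p; rewrite normrM (ger0_norm (kappa_ge0 p q t0)).
        apply: ler_pM => //; [exact: kappa_ge0|exact: kappa_le|].
        apply: (le_trans (Thb 1 p q ltr01)); rewrite ler_wpM2r ?nn_ge0//.
        by rewrite lerD2l divr1 ler_wpM2l ?gap_le2.
      - by apply: L1Z; apply: L1Z; exact: Lnn.
    rewrite (IntZ _ (L1_potential q k t0)) -(psi_repr q k (tn01 n)).
    rewrite (@eq_Int _ _ _ mu _ (fun p => (2 + tn n)^-1 * (2 * (kappa (tn n) p q * psi p k 0)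
      + kappa (tn n) p q * qmul (e q) (qmul (e q - e p) (psi p)) k 0))); last first.
      move=> p; rewrite qmulBl qmulBr qmul_sq e_sphere kappaE !mxE.
      by field; rewrite gt_eqF// addr_gt0.
    (* Integrability of the error term without [g] is obtained by dividing [Th] by [g q], hence the
       separate case. *)
    have [g0|g0] := eqVneq (g q) 0.
      rewrite g0 !mul0r mulr0 add0r.
      rewrite (@eq_Int _ _ _ mu _ (cst 0)) ?Int_cst ?mul0r ?mulr0//.
      by move=> p; rewrite /Th g0 mul0r mulr0.
    have LT2 : L1 (fun p => kappa (tn n) p q * qmul (e q) (qmul (e q - e p) (psi p)) k 0).
      apply: (eq_L1 _ (L1Z (g q)^-1 LT1)) => p.
      by rewrite /Th mulrCA mulKf.
    rewrite (IntZ _ (L1D (L1Z _ Lk) LT2)) (IntD (L1Z _ Lk) LT2) (IntZ _ Lk).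
    rewrite (_ : Int (fun p => kappa (tn n) p q * Th p q) =
      g q * Int (fun p => kappa (tn n) p q * qmul (e q) (qmul (e q - e p) (psi p)) k 0)).
      by ring.
    by rewrite -(IntZ _ LT2); apply: eq_Int => p; rewrite /Th mulrCA.
  under eq_fun do rewrite E.
  have -> : Int (fun q => g q * psi q k 0) = A^-1 * (2 + 0)^-1 *
      (2 * (A * Int (fun q => g q * psi q k 0)) + 0).
    by field; rewrite gt_eqF.
  apply: cvgM.
    apply: cvgMr; apply: cvgV; first by rewrite addr0 pnatr_eq0.
    by apply: cvgD; [exact: cvg_cst|exact: cvg_tn].
  by apply: cvgD => //; apply: cvgMr.
Qed.

(** * Exponential integrability *)

(** The pointwise hypothesis gives [2 c <= s a + b / s] for every [s > 0]. Integrate, then take the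
    optimal [s = Int c / Int a]. *)
Lemma Int_CS a b c : L1 a -> L1 b -> L1 c ->
  (forall p, 0 <= a p) -> (forall p, 0 <= b p) -> (forall p, 0 <= c p) ->
  (forall p, c p ^+ 2 <= a p * b p) -> Int c ^+ 2 <= Int a * Int b.
Proof.
move=> La Lb Lc a0 b0 c0 cab.
have key (s : R) : 0 < s -> 2 * Int c <= s * Int a + s^-1 * Int b.
  move=> s0; rewrite -(IntZ _ La) -(IntZ _ Lb) -(IntZ _ Lc).
  rewrite -(IntD (L1Z _ La) (L1Z _ Lb)); apply: Int_le => [||p].
  - exact: L1Z.
  - by apply: L1D; exact: L1Z.
  - have s1 : 0 < s^-1 by rewrite invr_gt0.
    have := cab p; have := a0 p; have := b0 p; have := c0 p.
    move: (a p) (b p) (c p) => x y z z0 y0 x0 h.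
    have d0 : 0 <= s * x + s^-1 * y by rewrite addr_ge0// mulr_ge0// ltW.
    rewrite -(@ler_pXn2r _ 2) ?nnegrE// ?mulr_ge0//.
    rewrite -subr_ge0 (_ : _ - _ = (s * x - s^-1 * y) ^+ 2 + 4 * (x * y - z ^+ 2)); last first.
      by field; rewrite gt_eqF.
    by rewrite addr_ge0 ?sqr_ge0// mulr_ge0// subr_ge0.
have := Int_ge0 mu a0; have := Int_ge0 mu b0; have := Int_ge0 mu c0.
move: (Int a) (Int b) (Int c) key => x y z key z0 y0 x0.
have [x0'|x0'] := ltP 0 x; last first.
  have xE : x = 0 by apply/eqP; rewrite eq_le x0' x0.
  have [zp|zp] := ltP 0 z; last first.
    have -> : z = 0 by apply/eqP; rewrite eq_le z0 zp.
    by rewrite expr0n /= mulr_ge0.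
  (* With [Int a = 0] there is no optimal [s]. This one is so large that [s^-1 * Int b] is at most
     [Int c], which contradicts [0 < Int c]. *)
  have := key ((y + 1) / z); rewrite xE mulr0 add0r divr_gt0//; last by lra.
  move=> /(_ isT); rewrite invf_div -mulrA mulrC.
  have : (y + 1)^-1 * y <= 1 by rewrite mulrC ler_pdivrMr ?mul1r; lra.
  by move: ((y + 1)^-1 * y) => w; nra.
have [zp|zp] := ltP 0 z; last first.
  have -> : z = 0 by apply/eqP; rewrite eq_le z0 zp.
  by rewrite expr0n /= mulr_ge0.
have := key (z / x); rewrite divr_gt0// => /(_ isT).
rewrite divfK ?gt_eqF// invf_div => h.
have : z <= x / z * y by lra.
by rewrite mulrAC ler_pdivlMr.
Qed.

Lemma f0_ge0 p : 0 <= f0 p.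
Proof.
apply: le_trans (f0_ge p); apply: addr_ge0.
  by rewrite mulr_ge0// expR_ge0.
by rewrite mulr_ge0 ?nsq_ge0// ltW// P_gt0.
Qed.

Lemma ln_gap_le t p q : 0 < t <= 1 -> ln (t + gap p q) <= 3.
Proof.
move=> /andP[t0 t1]; have z0 : 0 < t + gap p q by rewrite ltr_wpDr ?gap_ge0.
by have := ltW (ln_sublinear z0); have := gap_le2 p q; lra.
Qed.

Lemma ln_gap_ge t p q : - ln (t + gap p q) <= 4 / 3 * rr t p q ^+ 6.
Proof.
have := expR_ge1Dx (- (3 / 4) * ln (t + gap p q)); rewrite -rr6E.
by lra.
Qed.

Lemma C_ge0 q : 0 <= C.
Proof.
apply: le_trans (rr6_bound q (_ : 0 < 1 <= 1)); last by rewrite ltr01 lexx.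
by apply: Int_ge0 => p; rewrite exprn_ge0// ltW// rr_gt0.
Qed.

Lemma st_E t q : 0 < t <= 1 ->
  st t q = A^-1 * (Int u + Int (fun p => ln (t + gap p q)) -
                   Int (fun p => f0 p * ln (t + gap p q))).
Proof.
move=> t01; rewrite /st (u_repr _ t01).
have L1' := L1_ln_gap q t01 (L1_cst mu 1).
have L1'' : L1 (fun p => ln (t + gap p q)) by apply: eq_L1 L1' => p; rewrite mul1r.
have -> : Int (fun p => (f0 p - 1) * ln (t + gap p q)) =
    Int (fun p => f0 p * ln (t + gap p q)) - Int (fun p => ln (t + gap p q)).
  rewrite -(IntB (L1_ln_gap q t01 Lf0) L1''); apply: eq_Int => p; ring.
ring.
Qed.

Lemma L1_ln t q : 0 < t <= 1 -> L1 (fun p => ln (t + gap p q)).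
Proof.
move=> t01; apply: (eq_L1 _ (L1_ln_gap q t01 (L1_cst mu 1))) => p.
by rewrite mul1r.
Qed.

Lemma L1_rrM t q n f : 0 < t -> L1 f -> L1 (fun p => f p * rr t p q ^+ n).
Proof.
move=> t0 Lf; apply: (eq_L1 (f := fun p => rr t p q ^+ n * f p)).
  by move=> p; rewrite mulrC.
apply: (@L1M_bounded _ _ _ mu f _ ((1 + t^-1) ^+ n)) => //.
  by apply: measurable_funX; exact: measurable_section1 (measurable_rr t).
by move=> p; rewrite ger0_norm ?rrX_le// exprn_ge0// ltW// rr_gt0.
Qed.

(** Minus a lower bound of [st t] that is uniform in [t]. *)
Definition umin : R := - (A^-1 * (Int u - 3 * A - 4 / 3 * C)).

(** [f0 >= 0] has mass [A] and the logarithm is at most 3, so [f0] lowers the potential by at most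
    [3 * A]; the uniform background lowers it by at most [4 / 3 * C]. *)
Lemma st_ge t q : 0 < t <= 1 -> - umin <= st t q.
Proof.
move=> t01; have /andP[t0 _] := t01.
rewrite /umin opprK st_E// ler_wpM2l ?invr_ge0 ?(ltW A_gt0)//.
have h1 : Int (fun p => f0 p * ln (t + gap p q)) <= 3 * A.
  rewrite -Int_f0 -(IntZ _ Lf0); apply: Int_le => [||p].
  - exact: L1_ln_gap.
  - exact: L1Z.
  - by rewrite mulrC ler_wpM2r ?f0_ge0 ?ln_gap_le.
have h2 : - (4 / 3 * C) <= Int (fun p => ln (t + gap p q)).
  rewrite -[leRHS]opprK lerN2 -(IntN (L1_ln q t01)).
  apply: (@le_trans _ _ (4 / 3 * Int (fun p => rr t p q ^+ 6))).
    rewrite -(IntZ _ (L1_rrX q 6 t0)); apply: Int_le => [||p].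
    - by apply: L1N; exact: L1_ln.
    - by apply: L1Z; exact: L1_rrX.
    - exact: ln_gap_ge.
  by rewrite ler_wpM2l ?rr6_bound//; lra.
by move: h1 h2; lra.
Qed.

Lemma measurable_st t : 0 < t -> measurable_fun setT (st t).
Proof.
move=> t0; have [_ LK _] := Fubini_Int (L1prod_kappa t0 Lu).
exact: (measurable_funM (measurable_cst (A^-1)) (L1_measurable LK)).
Qed.

Lemma u_ge : {ae mu, forall q, - umin <= u q}.
Proof.
apply: filterS st_cvg => q h; apply: (cvg_ge h) => n.
by apply: st_ge; exact: tn01.
Qed.

(* Jensen's inequality for the sub-probability f2 / dl completed by an atom at
   which the exponent vanishes. *)
Lemma jensen_exp f2 h (dl : R) : 0 < dl -> L1 f2 -> (forall p, 0 <= f2 p) ->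
  Int f2 <= dl -> L1 (fun p => f2 p * h p) -> L1 (fun p => f2 p * expR (h p)) ->
  expR (dl^-1 * Int (fun p => f2 p * h p)) <=
  1 + dl^-1 * Int (fun p => f2 p * expR (h p)).
Proof.
move=> dl0 L2 f20 I2 Lh Le.
set c := dl^-1 * _.
have key : expR c * ((1 - c) * Int f2 + dl * c) <= Int (fun p => f2 p * expR (h p)).
  have -> : dl * c = Int (fun p => f2 p * h p) by rewrite /c mulVKf ?gt_eqF.
  rewrite -(IntZ _ L2) -(IntD (L1Z _ L2) Lh) -(IntZ _ (L1D (L1Z _ L2) Lh)).
  apply: Int_le => [||p]; [by apply: L1Z; apply: L1D => //; exact: L1Z|by []|].
  rewrite (_ : expR c * _ = f2 p * (expR c * (1 + (h p - c)))); last by ring.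
  rewrite ler_wpM2l// -[leRHS](_ : expR c * expR (h p - c) = _); last first.
    by rewrite -expRD subrKC.
  by rewrite ler_wpM2l ?expR_ge0// expR_ge1Dx.
have e1 : expR c * (1 - c) <= 1.
  by have := ler_wpM2l (expR_ge0 c) (expR_ge1Dx (- c)); rewrite expRxMexpNx_1.
have := ler_wpM2l (_ : 0 <= dl^-1) key; rewrite invr_ge0 ltW// => /(_ isT) k2.
have I20 := Int_ge0 mu f20.
have th : 0 <= dl^-1 * Int f2 <= 1.
  by rewrite mulr_ge0 ?invr_ge0 ?(ltW dl0)//= mulrC ler_pdivrMr// mul1r.
move: k2; rewrite (_ : dl^-1 * (expR c * _) =
   expR c - expR c * (1 - c) * (1 - dl^-1 * Int f2)); last first.
  by field; rewrite gt_eqF.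
move: e1 th (Int (fun p => f2 p * expR (h p))) => e1 /andP[th0 th1] I.
move: (dl^-1 * Int f2) (expR c * (1 - c)) th0 th1 e1 => x y x0 x1 y1.
by nra.
Qed.

Lemma truncation (dl : R) : 0 < dl ->
  exists2 N : R, 0 <= N & Int (fun p => f0 p - Num.min (f0 p) N) <= dl.
Proof.
move=> dl0.
have mf := L1_measurable Lf0.
have cv : (fun n : nat => Int (fun p => f0 p - Num.min (f0 p) n%:R)) @ \oo --> Int (cst (0 : R)).
  have [|||||_ h] := @dominated_Int _ _ _ mu
    (fun n p => f0 p - Num.min (f0 p) n%:R) (cst 0) f0; last exact: h.
  - by move=> n; apply: measurable_funB => //; exact: measurable_minr.
  - exact: measurable_cst.
  - exact: Lf0.
  - apply: aeW => p n; have f00 := f0_ge0 p.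
    have h : 0 <= Num.min (f0 p) n%:R by rewrite le_min f00 ler0n.
    by rewrite ger0_norm ?gerBl// subr_ge0 ge_min lexx.
  - apply: aeW => p; apply: cvg_near_cst; exists (Num.truncn (f0 p)).+1 => // n /= hn.
    have : f0 p <= n%:R.
      apply/ltW/(lt_le_trans (truncnS_gt (f0 p))).
      by rewrite ler_nat.
    by move=> /min_idPl ->; rewrite subrr.
rewrite Int_cst mul0r in cv.
have /cvgrPdist_le/(_ _ dl0)[n _ hn] := cv.
exists n%:R => //; have := hn n (leqnn n).
by rewrite /= sub0r normrN; apply: le_trans; exact: ler_norm.
Qed.

(** The Brezis-Merle decomposition: a bounded part, whose contribution to the potential is bounded
    above, and a part of mass at most [dl], small enough for the exponential of its potential to be
    integrable. *)
Lemma f0_split (dl : R) : 0 < dl -> exists f1 f2 (N : R),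
  [/\ 0 <= N, L1 f1 /\ L1 f2, forall p, 0 <= f1 p <= N, forall p, 0 <= f2 p &
      (forall p, f0 p = f1 p + f2 p) /\ Int f2 <= dl].
Proof.
move=> dl0; have [N N0 IN] := truncation dl0.
have mf := L1_measurable Lf0.
exists (fun p => Num.min (f0 p) N), (fun p => f0 p - Num.min (f0 p) N), N.
have L : L1 (fun p => Num.min (f0 p) N).
  apply: (@L1_le _ _ _ _ _ f0) => //; first exact: measurable_minr.
  by move=> p; rewrite ger0_norm ?ge_min ?lexx// le_min f0_ge0.
split => //.
- by split => //; exact: L1B.
- by move=> p; rewrite le_min f0_ge0 N0 ge_min lexx orbT.
- by move=> p; rewrite subr_ge0 ge_min lexx.
- by split => // p; rewrite subrKC.
Qed.

Lemma bounded_ln_gap f1 (N : R) t q : 0 < t <= 1 -> L1 f1 ->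
  (forall p, 0 <= f1 p <= N) ->
  - Int (fun p => f1 p * ln (t + gap p q)) <= N * (4 / 3 * C).
Proof.
move=> t01 Lf1 f1b; have /andP[t0 t1] := t01.
have N0 : 0 <= N by have /andP[a b] := f1b q; exact: le_trans b.
have h43 : 0 <= 4 / 3 :> R by lra.
apply: (@le_trans _ _ (N * (4 / 3 * Int (fun p => rr t p q ^+ 6)))); last first.
  exact: (ler_wpM2l N0 (ler_wpM2l h43 (rr6_bound q t01))).
rewrite -(IntN (L1_ln_gap q t01 Lf1)) -(IntZ _ (L1_rrX q 6 t0)).
rewrite -(IntZ _ (L1Z _ (L1_rrX q 6 t0))); apply: Int_le => [||p].
- by apply: L1N; exact: L1_ln_gap.
- by apply: L1Z; apply: L1Z; exact: L1_rrX.
- have r6 := mulr_ge0 h43 (rrX_ge0 t p q 6).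
  have /andP[a b] := f1b p.
  rewrite -mulrN; apply: (@le_trans _ _ (f1 p * (4 / 3 * rr t p q ^+ 6))).
    exact: (ler_wpM2l a (ln_gap_ge t p q)).
  exact: (ler_wpM2r r6 b).
Qed.

Lemma measurable_exp_st c t : 0 < t ->
  measurable_fun setT (fun q => expR (c * st t q)).
Proof.
move=> t0; apply: measurableT_comp => //; apply: (measurable_funM (f := cst c)) => //.
exact: measurable_st.
Qed.

Lemma exp_st_arith (a v c x y z : R) : 0 < a -> x <= 3 * a -> - y <= c ->
  12 * (a^-1 * (v + x - (y + z))) <=
  12 / a * (v + 3 * a + c) + (a / 16)^-1 * (- (3 / 4) * z).
Proof.
move=> a0 h1 h2; rewrite -subr_ge0.
rewrite (_ : _ - _ = 12 / a * ((3 * a - x) + (c + y))); last by field; rewrite gt_eqF.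
by rewrite mulr_ge0 ?divr_ge0 ?(ltW a0)//; lra.
Qed.

Lemma exp_st_bound : exists K : R, forall t, 0 < t <= 1 ->
  L1 (fun q => expR (12 * st t q)) /\ Int (fun q => expR (12 * st t q)) <= K.
Proof.
(* Chosen so that [12 / A = (3 / 4) / dl]: Jensen's inequality then turns the exponential of 12
   times the potential of [f2] into an average of [z^(-3/4)], that is of [rr ^+ 6]. *)
have [dl dlE] : exists dl : R, dl = A / 16 by eexists.
have dl0 : 0 < dl by rewrite dlE divr_gt0.
have [f1 [f2 [N [N0 [Lf1 Lf2] f1b f20 [f12 IN]]]]] := f0_split dl0.
have f10 p : 0 <= f1 p by have /andP[] := f1b p.
have f1N p : f1 p <= N by have /andP[] := f1b p.
have [K0 K0E] : exists K0 : R, K0 = expR (12 / A * (Int u + 3 * A + N * (4 / 3 * C))).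
  by eexists.
exists (K0 * (A + dl^-1 * (C * Int f2))) => t t01; have /andP[t0 t1] := t01.
have [G GE] : exists G : T -> R, G = fun q => Int (fun p => f2 p * rr t p q ^+ 6) by eexists.
have LG2 : L1prod mu (fun p q => f2 p * rr t p q ^+ 6).
  apply: (@L1prod_bounded _ f2 ((1 + t^-1) ^+ 6)) => //.
    apply: measurable_funM; first exact: (measurable_lift1 (L1_measurable Lf2)).
    by apply: measurable_funX; exact: measurable_rr.
  move=> p q; rewrite normrM (ger0_norm (f20 p)) mulrC ler_wpM2r//.
  by rewrite ger0_norm ?rrX_le// exprn_ge0// ltW// rr_gt0.
have [LG' LG FG] := Fubini_Int LG2.
have {}LG : L1 G by rewrite GE.
have {}FG : Int (fun p => Int (fun q => f2 p * rr t p q ^+ 6)) = Int G by rewrite GE.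
have IG : Int G <= C * Int f2.
  rewrite -FG -(IntZ _ Lf2); apply: Int_le => [||p].
  - exact: LG'.
  - exact: L1Z.
  - rewrite (@eq_Int _ _ _ mu _ (fun q => f2 p * rr t q p ^+ 6)); last first.
      by move=> q; rewrite rrC.
    rewrite (IntZ _ (L1_rrX p 6 t0)) (mulrC C).
    exact: (ler_wpM2l (f20 p) (rr6_bound p t01)).
have pw q : expR (12 * st t q) <= K0 * (1 + dl^-1 * G q).
  have Lh : L1 (fun p => f2 p * (- (3 / 4) * ln (t + gap p q))).
    apply: (eq_L1 _ (L1Z (- (3 / 4)) (L1_ln_gap q t01 Lf2))) => p.
    by rewrite mulrCA.
  have Le : L1 (fun p => f2 p * expR (- (3 / 4) * ln (t + gap p q))).
    by apply: (eq_L1 _ (L1_rrM q 6 t0 Lf2)) => p; rewrite rr6E.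
  have := jensen_exp dl0 Lf2 f20 IN Lh Le.
  have -> : Int (fun p => f2 p * expR (- (3 / 4) * ln (t + gap p q))) = G q.
    by rewrite GE; apply: eq_Int => p; rewrite rr6E.
  have K00 : 0 <= K0 by rewrite K0E; exact: expR_ge0.
  move=> /(ler_wpM2l K00); apply: le_trans.
  rewrite (st_E q t01) K0E.
  set X := dl^-1 * _; rewrite -(expRD _ X) ler_expR {}/X.
  have e1 : Int (fun p => f0 p * ln (t + gap p q)) =
      Int (fun p => f1 p * ln (t + gap p q)) + Int (fun p => f2 p * ln (t + gap p q)).
    rewrite -(IntD (L1_ln_gap q t01 Lf1) (L1_ln_gap q t01 Lf2)).
    by apply: eq_Int => p; rewrite f12; ring.
  have e2 : Int (fun p => f2 p * (- (3 / 4) * ln (t + gap p q))) =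
      - (3 / 4) * Int (fun p => f2 p * ln (t + gap p q)).
    rewrite -(IntZ _ (L1_ln_gap q t01 Lf2)).
    by apply: eq_Int => p; rewrite mulrCA.
  rewrite e1 e2 dlE.
  have h1 : Int (fun p => ln (t + gap p q)) <= 3 * A.
    have -> : 3 * A = Int (cst 3) by rewrite Int_cst.
    by apply: Int_le => [||p]; [exact: L1_ln|exact: L1_cst|exact: ln_gap_le].
  have h2 : - Int (fun p => f1 p * ln (t + gap p q)) <= N * (4 / 3 * C).
    exact: bounded_ln_gap.
  move: h1 h2.
  move: (Int (fun p => ln (t + gap p q))) (Int (fun p => f1 p * ln (t + gap p q)))
    (Int (fun p => f2 p * ln (t + gap p q))) => x y z h1 h2.
  exact: exp_st_arith.
have mE := measurable_exp_st 12 t0.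
have LE : L1 (fun q => expR (12 * st t q)).
  apply: (@L1_le _ _ _ _ _ (fun q => K0 * (1 + dl^-1 * G q))) => //.
    by move=> q; rewrite ger0_norm ?expR_ge0.
  by apply: L1Z; apply: L1D; [exact: L1_cst|exact: L1Z].
split => //.
have LGd : L1 (fun q => 1 + dl^-1 * G q) by apply: L1D; [exact: L1_cst|exact: L1Z].
apply: (@le_trans _ _ (Int (fun q => K0 * (1 + dl^-1 * G q)))).
  by apply: Int_le => //; exact: L1Z.
rewrite (IntZ _ LGd); apply: ler_wpM2l; first by rewrite K0E; exact: expR_ge0.
rewrite (IntD (L1_cst mu 1) (L1Z _ LG)) (IntZ _ LG) Int_cst mul1r lerD2l.
by rewrite ler_wpM2l ?invr_ge0 ?(ltW dl0).
Qed.

(** The exponent is dictated by [LPpsi], which consumes [P ^+ 12]. *)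
Lemma L1_exp12 : L1 (fun q => expR (12 * u q)).
Proof.
have [K hK] := exp_st_bound.
have mu_ := L1_measurable Lu.
have [||||||H _] := @fatou_Int _ _ _ mu (fun n q => expR (12 * st (tn n) q))
  (fun q => expR (12 * u q)) K; last exact: H.
- by move=> n; have [] := hK _ (tn01 n).
- by apply: measurableT_comp => //; apply: (measurable_funM (f := cst 12)).
- by move=> n p; exact: expR_ge0.
- by move=> p; exact: expR_ge0.
- apply: filterS st_cvg => q h; apply: cvg_expR; exact: cvgMr.
- move=> eps eps0; apply: nearW => n; have [_ h] := hK _ (tn01 n).
  by rewrite (le_trans h)// lerDl ltW.
Qed.

Lemma L1_P12 : L1 (fun q => P q ^+ 12).
Proof.
apply: (@L1_le _ _ _ _ _ (fun q => M ^+ 12 * expR (12 * u q))).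
- exact: measurable_funX.
- move=> p; rewrite ger0_norm ?exprn_ge0 ?(ltW (P_gt0 p))// expRM_natl -exprMn.
  rewrite lerXn2r ?nnegrE ?P_le ?(ltW (P_gt0 p))//.
  by rewrite (le_trans (ltW (P_gt0 p)))// P_le.
- by apply: L1Z; exact: L1_exp12.
Qed.

Lemma P_pow_le p k : (k <= 12)%N -> P p ^+ k <= 1 + P p ^+ 12.
Proof.
move=> k12; have p0 := ltW (P_gt0 p).
have [h|h] := leP (P p) 1.
  by rewrite ler_wpDr ?exprn_ge0// exprn_ile1.
by rewrite ler_wpDl// ler_weXn2l// ltW.
Qed.

Lemma L1_Ppow k : (k <= 12)%N -> L1 (fun q => P q ^+ k).
Proof.
move=> k12; apply: (@L1_le _ _ _ _ _ (fun q => 1 + P q ^+ 12)).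
- exact: measurable_funX.
- by move=> p; rewrite ger0_norm ?P_pow_le// exprn_ge0// ltW// P_gt0.
- by apply: L1D; [exact: L1_cst|exact: L1_P12].
Qed.

(** A crude Young inequality with integer exponents: replace both factors by the larger one. *)
Lemma mul_pow_le (x y : R) (a b : nat) : 0 <= x -> 0 <= y ->
  x ^+ a * y ^+ b <= x ^+ (a + b) + y ^+ (a + b).
Proof.
move=> x0 y0; have [h|h] := leP x y.
  rewrite ler_wpDl ?exprn_ge0// exprD ler_wpM2r ?exprn_ge0//.
  by rewrite lerXn2r ?nnegrE.
rewrite ler_wpDr ?exprn_ge0// exprD ler_wpM2l ?exprn_ge0//.
by rewrite lerXn2r ?nnegrE ?(ltW h).
Qed.

Lemma measurable_pt t k : 0 < t -> measurable_fun setT (fun q => pt t q k 0).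
Proof.
move=> t0; rewrite /pt; under eq_fun do rewrite mxE.
have LK : L1prod mu (fun p q => rr t p q ^+ 8 * (P p * qmul (e p - e q) (psi p) k 0)).
  apply: (@L1prod_bounded _ (fun p => P p * nn p) (2 * (1 + t^-1) ^+ 4)).
  - exact: measurable_potential.
  - move=> p q; apply: (le_trans (potential_bound p q k t0)).
    apply: ler_wpM2r; first by rewrite mulr_ge0 ?nn_ge0// ltW// P_gt0.
    by rewrite ler_wpM2l// rrX_le.
  - exact: LPnn.
have [_ LK2 _] := Fubini_Int LK.
exact: (measurable_funM (measurable_cst A^-1) (L1_measurable LK2)).
Qed.

Lemma pt_bound t q k : 0 < t ->
  `|pt t q k 0| <= A^-1 * (2 * Int (fun p => rr t p q ^+ 4 * (P p * nn p))).
Proof.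
move=> t0; rewrite mxE normrM ger0_norm ?invr_ge0 ?(ltW A_gt0)//.
rewrite ler_wpM2l ?invr_ge0 ?(ltW A_gt0)//.
have LX : L1 (fun p => rr t p q ^+ 4 * (P p * nn p)).
  by apply: (eq_L1 _ (L1_rrM q 4 t0 LPnn)) => p; rewrite mulrC.
rewrite -(IntZ _ LX); apply: (le_trans (Int_norm (L1_potential q k t0))).
apply: Int_le => [||p]; [exact/L1_norm/L1_potential|exact: L1Z|].
by rewrite [leRHS]mulrA; exact: potential_bound.
Qed.

Lemma measurable_nsq_pt t : 0 < t -> measurable_fun setT (fun q => nsq (pt t q)).
Proof.
move=> t0; rewrite /nsq; under eq_fun do rewrite ip4.
have h k : measurable_fun setT (fun q => pt t q k 0 * pt t q k 0).
  by apply: measurable_funM; exact: measurable_pt.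
by do 3 (apply: measurable_funD => //).
Qed.

Lemma nsq_pt_le t q b : (forall k, `|pt t q k 0| <= b) -> nsq (pt t q) <= 4 * b ^+ 2.
Proof.
move=> h.
have h2 k : pt t q k 0 * pt t q k 0 <= b ^+ 2.
  rewrite -expr2 -[leLHS]real_normK ?num_real// lerXn2r ?nnegrE//.
  exact: le_trans (h k).
by rewrite /nsq ip4; have := h2 0; have := h2 1; have := h2 2%:R; have := h2 3%:R; lra.
Qed.

(** A Hardy-Littlewood-Sobolev estimate by hand. Cauchy-Schwarz splits the kernel [rr ^+ 4] of [pt]
    into [rr ^+ 3] with [P ^+ 2] and [rr ^+ 5] with [|psi|^2], which is why kernels are counted in
    powers [1/8]. Both exponents are below 6, and [mul_pow_le] pays the difference with [P ^+ 4] and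
    [P ^+ 12]. The bound is uniform in [t], so it survives in the limit by Fatou. *)
Lemma LPpsi : L1 (fun q => P q ^+ 2 * nsq (psi q)).
Proof.
have [K1 K1E] : exists K1 : R, K1 = 4 * (A^-1 * 2) ^+ 2 * (C + Int (fun p => P p ^+ 4)).
  by eexists.
have [K KE] : exists K : R, K = K1 * ((C + Int (fun p => P p ^+ 12)) * Int (fun p => nsq (psi p))).
  by eexists.
have LP2 := @L1_Ppow 2 isT; have LP4 := @L1_Ppow 4 isT.
suff H n : L1 (fun q => P q ^+ 2 * nsq (pt (tn n) q)) /\
    Int (fun q => P q ^+ 2 * nsq (pt (tn n) q)) <= K.
  have [||||||H' _] := @fatou_Int _ _ _ mu (fun n q => P q ^+ 2 * nsq (pt (tn n) q))
    (fun q => P q ^+ 2 * nsq (psi q)) K; last exact: H'.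
  - by move=> n; have [] := H n.
  - by apply: measurable_funM; [exact: measurable_funX|exact: measurable_nsq].
  - by move=> n p; rewrite mulr_ge0 ?sqr_ge0 ?nsq_ge0.
  - by move=> p; rewrite mulr_ge0 ?sqr_ge0 ?nsq_ge0.
  - apply: filterS (filterI (filterI (pt_cvg 0) (pt_cvg 1)) (filterI (pt_cvg 2%:R) (pt_cvg 3%:R))).
    move=> q [[c0 c1'] [c2 c3]]; apply: cvgMr.
    rewrite /nsq; under eq_fun do rewrite ip4; rewrite ip4.
    by do 3 (apply: cvgD; last exact: cvgM); exact: cvgM.
  - by move=> eps eps0; apply: nearW => n; have [_ h] := H n; rewrite (le_trans h)// lerDl ltW.
have t0 := tn_gt0 n; have t01 := tn01 n.
set t := tn n in t0 t01 *.
have [J JE0] : exists J : T -> R, J = fun q => Int (fun p => rr t p q ^+ 5 * nsq (psi p)) by eexists.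
have r0 p q : 0 <= rr t p q by rewrite ltW// rr_gt0.
have JL q : L1 (fun p => rr t p q ^+ 5 * nsq (psi p)).
  by apply: (eq_L1 _ (L1_rrM q 5 t0 Lpsi)) => p; rewrite mulrC.
have K10 : 0 <= K1.
  rewrite K1E; apply: mulr_ge0; first by apply: mulr_ge0 => //; exact: sqr_ge0.
  apply: addr_ge0; first exact: (C_ge0 point).
  by apply: Int_ge0 => p; rewrite exprn_ge0// ltW// P_gt0.
have ptJ q : nsq (pt t q) <= K1 * J q.
  apply: (le_trans (nsq_pt_le (fun k => pt_bound q k t0))).
  have -> : 4 * (A^-1 * (2 * Int (fun p => rr t p q ^+ 4 * (P p * nn p)))) ^+ 2 =
      4 * (A^-1 * 2) ^+ 2 * Int (fun p => rr t p q ^+ 4 * (P p * nn p)) ^+ 2 by ring.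
  rewrite K1E -[leRHS]mulrA; apply: ler_wpM2l.
    by apply: mulr_ge0 => //; exact: sqr_ge0.
  have L4 : L1 (fun p => rr t p q ^+ 4 * (P p * nn p)).
    by apply: (eq_L1 _ (L1_rrM q 4 t0 LPnn)) => p; rewrite mulrC.
  have L3 : L1 (fun p => rr t p q ^+ 3 * P p ^+ 2).
    by apply: (eq_L1 _ (L1_rrM q 3 t0 LP2)) => p; rewrite mulrC.
  have := @Int_CS _ _ _ L3 (JL q) L4.
  have ge0a p : 0 <= rr t p q ^+ 3 * P p ^+ 2 by rewrite mulr_ge0 ?sqr_ge0// exprn_ge0.
  have ge0b p : 0 <= rr t p q ^+ 5 * nsq (psi p) by rewrite mulr_ge0 ?nsq_ge0// exprn_ge0.
  have ge0c p : 0 <= rr t p q ^+ 4 * (P p * nn p).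
    apply: mulr_ge0; first exact: exprn_ge0.
    by apply: mulr_ge0; [exact: ltW (P_gt0 p)|exact: nn_ge0].
  move=> /(_ ge0a ge0b ge0c) CS.
  apply: (le_trans (CS _)).
    by move=> p; rewrite -nn_sq le_eqVlt; apply/orP; left; apply/eqP; ring.
  rewrite JE0; apply: ler_wpM2r; first exact: Int_ge0.
  apply: (@le_trans _ _ (Int (fun p => rr t p q ^+ 6 + P p ^+ 4))).
    apply: Int_le => [//||p]; first by apply: L1D => //; exact: L1_rrX.
    have := @mul_pow_le (rr t p q ^+ 3) (P p ^+ 2) 1 1; rewrite -!exprM.
    by apply; [exact: exprn_ge0|exact: sqr_ge0].
  by rewrite (IntD (L1_rrX q 6 t0) LP4) lerD2r rr6_bound.
have LJ2 : L1prod mu (fun p q => P q ^+ 2 * (rr t p q ^+ 5 * nsq (psi p))).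
  apply: (@L1prod_bound _ _ _ _ _ (fun q => P q ^+ 2 *
      ((1 + t^-1) ^+ 5 * Int (fun p => nsq (psi p))))).
  - apply: measurable_funM; first by apply: (measurable_lift2 (f := fun q => P q ^+ 2)); exact: measurable_funX.
    apply: measurable_funM; first by apply: measurable_funX; exact: measurable_rr.
    exact: (measurable_lift1 measurable_nsq).
  - by apply: (eq_L1 _ (L1Z ((1 + t^-1) ^+ 5 * Int (fun p => nsq (psi p))) LP2)) => q; rewrite mulrC.
  - by move=> q; apply: L1Z.
  - move=> q; rewrite (@eq_Int _ _ _ mu _ (fun p => P q ^+ 2 * (rr t p q ^+ 5 * nsq (psi p)))); last first.
      move=> p; rewrite ger0_norm//; apply: mulr_ge0; first exact: sqr_ge0.
      by apply: mulr_ge0; [exact: exprn_ge0|exact: nsq_ge0].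
    rewrite (IntZ _ (JL q)) ler_wpM2l ?sqr_ge0// -(IntZ _ Lpsi).
    apply: Int_le => [//||p]; first exact: L1Z.
    by rewrite ler_wpM2r ?nsq_ge0// rrX_le.
have [LJa LJ FJ] := Fubini_Int LJ2.
have JE q : Int (fun p => P q ^+ 2 * (rr t p q ^+ 5 * nsq (psi p))) = P q ^+ 2 * J q.
  by rewrite (IntZ _ (JL q)) JE0.
have LJ' : L1 (fun q => P q ^+ 2 * J q) by apply: (eq_L1 _ LJ) => q; rewrite JE.
have LX : L1 (fun q => P q ^+ 2 * nsq (pt t q)).
  apply: (@L1_le _ _ _ _ _ (fun q => K1 * (P q ^+ 2 * J q))).
  - by apply: measurable_funM; [exact: measurable_funX|exact: measurable_nsq_pt].
  - move=> q; rewrite ger0_norm; last by rewrite mulr_ge0 ?sqr_ge0 ?nsq_ge0.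
    by rewrite mulrCA ler_wpM2l ?sqr_ge0.
  - exact: L1Z.
split; first exact: LX.
apply: (@le_trans _ _ (Int (fun q => K1 * (P q ^+ 2 * J q)))).
  apply: Int_le => [//||q]; first exact: L1Z.
  by rewrite mulrCA ler_wpM2l ?sqr_ge0.
rewrite (IntZ _ LJ') KE; apply: (ler_wpM2l K10).
under eq_Int do rewrite -JE.
rewrite -FJ -(IntZ _ Lpsi); apply: Int_le => [//||p]; first exact: L1Z.
have L5 : L1 (fun q => P q ^+ 2 * rr t q p ^+ 5) by exact: L1_rrM.
rewrite (@eq_Int _ _ _ mu _ (fun q => nsq (psi p) * (P q ^+ 2 * rr t q p ^+ 5))); last first.
  by move=> q; rewrite (rrC t p q); ring.
rewrite (IntZ _ L5) mulrC; apply: ler_wpM2r; first exact: nsq_ge0.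
apply: (@le_trans _ _ (Int (fun q => rr t q p ^+ 6 + P q ^+ 12))).
  apply: Int_le => [//||q]; first by apply: L1D; [exact: L1_rrX|exact: L1_P12].
  have := @mul_pow_le (rr t q p) (P q ^+ 2) 5 1 (r0 q p) (sqr_ge0 _).
  by rewrite -[(5 + 1)%N]/6%N expr1 -exprM mulrC.
by rewrite (IntD (L1_rrX p 6 t0) L1_P12) lerD2r rr6_bound.
Qed.

(** * The mollified inequality *)

Lemma qmul_delta X v k :
  qmul X v k 0 = \sum_l qmul X (delta_mx l 0) k 0 * v l 0 :> R.
Proof.
by rewrite big_ord4; move: k; apply: ord4P; rewrite !mxE /=; ring.
Qed.

Lemma dot_CS (X Y : 'rV[R]_3) : dot X X = 1 -> dot X Y ^+ 2 <= dot Y Y.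
Proof.
move=> X1; have := dot_ge0 (Y - dot X Y *: X).
by rewrite dotBB !dotZl (dotC X (_ *: X)) (dotC Y (_ *: X)) !dotZl X1; nra.
Qed.

Lemma cvg_qmul (X_ : nat -> 'rV[R]_3) (X : 'rV[R]_3) (v : 'cV[R]_4) (k : 'I_4) :
  (forall j, (fun n => X_ n 0 j) @ \oo --> X 0 j) ->
  (fun n => qmul (X_ n) v k 0) @ \oo --> (qmul X v k 0 : R).
Proof.
move=> cX.
have cZ j (a : R) : (fun n => X_ n 0 j * a) @ \oo --> X 0 j * a by apply: cvgMl; exact: cX.
have cN j (a : R) : (fun n => - X_ n 0 j * a) @ \oo --> - X 0 j * a.
  by apply: cvgMl; apply: cvgN; exact: cX.
rewrite mxE; under eq_fun do rewrite mxE; move: k; apply: ord4P => /=.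
- by apply: cvgB => //; apply: cvgD.
- by apply: cvgD => //; apply: cvgD.
- by apply: cvgD => //; apply: cvgB.
- by apply: cvgB => //; apply: cvgB.
Qed.

(** Bounded convergence. On a finite measure space integrals pass to the limit, and the class is
    stable under the operations that build the two sides of [star]. *)
Definition bcv (f_ : nat -> T -> R) f : Prop :=
  [/\ forall n, measurable_fun setT (f_ n),
      exists c : R, forall n q, `|f_ n q| <= c &
      forall q, (fun n => f_ n q) @ \oo --> f q].

Lemma eq_bcv (f_ g_ : nat -> T -> R) f g : (forall n q, g_ n q = f_ n q) ->
  (forall q, g q = f q) -> bcv f_ f -> bcv g_ g.
Proof.
move=> E1 E2; have -> : g_ = f_ by apply/funext => n; apply/funext => q.
by have -> : g = f by apply/funext.
Qed.

Lemma bcv_cst (c : R) : bcv (fun _ _ => c) (fun _ => c).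
Proof.
split; [by move=> n; exact: measurable_cst|by exists `|c| |].
by move=> q; exact: cvg_cst.
Qed.

Lemma bcvD (f_ g_ : nat -> T -> R) f g : bcv f_ f -> bcv g_ g ->
  bcv (fun n q => f_ n q + g_ n q) (fun q => f q + g q).
Proof.
move=> [mf [a fa] cf] [mg [b gb] cg]; split.
- by move=> n; exact: measurable_funD.
- by exists (a + b) => n q; rewrite (le_trans (ler_normD _ _))// lerD.
- by move=> q; exact: cvgD.
Qed.

Lemma bcvM (f_ g_ : nat -> T -> R) f g : bcv f_ f -> bcv g_ g ->
  bcv (fun n q => f_ n q * g_ n q) (fun q => f q * g q).
Proof.
move=> [mf [a fa] cf] [mg [b gb] cg]; split.
- by move=> n; exact: measurable_funM.
- by exists (a * b) => n q; rewrite normrM ler_pM.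
- by move=> q; exact: cvgM.
Qed.

Lemma bcvZ (c : R) (f_ : nat -> T -> R) f : bcv f_ f -> bcv (fun n q => c * f_ n q) (fun q => c * f q).
Proof. by move=> h; apply: (bcvM (bcv_cst c) h). Qed.

Lemma bcv_expR (f_ : nat -> T -> R) f : bcv f_ f ->
  bcv (fun n q => expR (f_ n q)) (fun q => expR (f q)).
Proof.
move=> [mf [a fa] cf]; split.
- by move=> n; exact: measurableT_comp.
- exists (expR a) => n q; rewrite ger0_norm ?expR_ge0// ler_expR.
  exact: le_trans (ler_norm _) (fa n q).
- by move=> q; exact: cvg_expR.
Qed.

Lemma bcv_nsq (v_ : nat -> T -> 'cV[R]_4) (v : T -> 'cV[R]_4) :
  (forall k, bcv (fun n q => v_ n q k 0) (fun q => v q k 0)) ->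
  bcv (fun n q => nsq (v_ n q)) (fun q => nsq (v q)).
Proof.
move=> h; apply: (eq_bcv _ _ (bcvD (bcvD (bcvD (bcvM (h 0) (h 0)) (bcvM (h 1) (h 1)))
  (bcvM (h 2%:R) (h 2%:R))) (bcvM (h 3%:R) (h 3%:R)))).
- by move=> n q; rewrite /nsq ip4.
- by move=> q; rewrite /nsq ip4.
Qed.

Lemma bcv_Int (f_ : nat -> T -> R) f : bcv f_ f ->
  [/\ forall n, L1 (f_ n), L1 f & (fun n => Int (f_ n)) @ \oo --> Int f].
Proof.
move=> [mf [c fc] cf].
have mf' : measurable_fun setT f by apply: (measurable_fun_cvg mf) => q _; exact: cf.
have [|||||H1 H2] := @dominated_Int _ _ _ mu f_ f (fun _ => c).
- exact: mf.
- exact: mf'.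
- exact: L1_cst.
- exact: aeW.
- exact: aeW.
- by split => // n; exact: (@L1_bounded _ _ _ _ _ c).
Qed.

Lemma bcv_quadrature F (K : T -> T -> R) (c : R) : L1 F ->
  measurable_fun setT (fun z : T * T => K z.1 z.2) ->
  (forall p q, `|K p q| <= c) ->
  (forall p q, (fun n => K (node n.+1 (cell n.+1 p)) q) @ \oo --> K p q) ->
  bcv (fun n q => \sum_i cell_mass n.+1 F i * K (node n.+1 i) q)
      (fun q => Int (fun p => K p q * F p)).
Proof.
move=> LF mK Kc Kcv; split.
- move=> n; apply: measurable_sum => i; apply: (measurable_funM (f := cst _)) => //.
  exact: (measurable_section2 (F := K)).
- exists (c * Int (fun p => `|F p|)) => n q.
  exact: (quadrature_bound (K := fun i => K (node n.+1 i) q)).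
- move=> q; apply: (quadrature_cvg (K := fun p => K p q) LF) => //.
  exact: (measurable_section1 (F := K)).
Qed.

Lemma LPpsik k : L1 (fun p => P p * psi p k 0).
Proof.
apply: (@L1_le _ _ _ _ _ (fun p => P p * nn p)).
- exact: measurable_funM.
- move=> p; rewrite normrM (gtr0_norm (P_gt0 p)) ler_wpM2l ?(ltW (P_gt0 p))//.
  rewrite -(@ler_pXn2r _ 2) ?nnegrE ?nn_ge0//.
  by rewrite real_normK ?num_real// nn_sq le_nsq.
- exact: LPnn.
Qed.

Lemma qmul_delta_le X (l k : 'I_4) : dot X X <= 4 ->
  `|qmul X (delta_mx l 0) k 0| <= 2 :> R.
Proof.
move=> X4; rewrite -(@ler_pXn2r _ 2) ?nnegrE// real_normK ?num_real//.
apply: (le_trans (le_nsq _ k)); rewrite nsq_qmul.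
have -> : nsq (delta_mx l 0) = 1 :> R.
  by rewrite /nsq ip4; move: l; apply: ord4P; rewrite !mxE /=; ring.
by rewrite mulr1 (le_trans X4)// -natrX.
Qed.

Lemma dot_combo_le4 (c : R) p q : c ^+ 2 = 1 ->
  dot (e p + c *: e q) (e p + c *: e q) <= 4.
Proof.
move=> c1'; rewrite dotDD (dotC (e p) (_ *: _)) !dotZl (dotC (e q) (_ *: _)) dotZl.
rewrite !e_sphere mulr1 -expr2 c1'.
have := dot_CS (e q) (e_sphere p); rewrite e_sphere (dotC (e q)) => h.
by have := sqr_ge0 (c - dot (e p) (e q)); nra.
Qed.

(** [c = -1] serves the potential and [c = 1] its image under [S]. Cell masses are scalar, so [psi]
    is treated one real coordinate at a time and reassembled by [qmul_delta]. *)
Lemma bcv_spinor (r : T -> T -> R) (c a : R) (k : 'I_4) : c ^+ 2 = 1 ->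
  measurable_fun setT (fun z : T * T => r z.1 z.2) ->
  (forall p q, `|r p q| <= a) ->
  (forall p q, (fun n => r (node n.+1 (cell n.+1 p)) q) @ \oo --> r p q) ->
  bcv (fun n q => \sum_i r (node n.+1 i) q *
        qmul (e (node n.+1 i) + c *: e q)
          (A^-1 *: \col_l cell_mass n.+1 (fun p => P p * psi p l 0) i) k 0)
      (fun q => A^-1 * Int (fun p => r p q *
        (P p * qmul (e p + c *: e q) (psi p) k 0))).
Proof.
move=> c2 mr ra rcv.
pose K l p q : R := r p q * qmul (e p + c *: e q) (delta_mx l 0) k 0.
have mK l : measurable_fun setT (fun z : T * T => K l z.1 z.2).
  apply: measurable_funM => //.
  apply: (@measurable_qmul _ _ (fun z : T * T => e z.1 + c *: e z.2) (fun z => delta_mx l 0)).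
    move=> j; rewrite (_ : (fun z => _) = fun z : T * T => e z.1 0 j + c * e z.2 0 j).
      apply: measurable_funD; first exact: (measurable_lift1 (measurable_e j)).
      apply: (measurable_funM (f := cst c)) => //.
      exact: (measurable_lift2 (measurable_e j)).
    by apply/funext => z; rewrite !mxE.
  by move=> j; exact: measurable_cst.
have Kb l p q : `|K l p q| <= a * 2.
  by rewrite normrM ler_pM// qmul_delta_le// dot_combo_le4.
have Kcv l p q : (fun n => K l (node n.+1 (cell n.+1 p)) q) @ \oo --> K l p q.
  apply: cvgM; first exact: rcv.
  have cX j : (fun n => (e (node n.+1 (cell n.+1 p)) + c *: e q) 0 j) @ \oo -->
      (e p + c *: e q) 0 j.
    rewrite mxE; under eq_fun do rewrite mxE.
    by apply: cvgD; [exact: node_cvg|exact: cvg_cst].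
  exact: cvg_qmul.
have B l := bcvZ A^-1 (bcv_quadrature (LPpsik l) (mK l) (Kb l) (Kcv l)).
apply: (eq_bcv _ _ (bcvD (bcvD (bcvD (B 0) (B 1)) (B 2%:R)) (B 3%:R))).
  move=> n q; rewrite -!mulrDr -!big_split/= mulr_sumr; apply: eq_bigr => i _.
  by rewrite qmul_delta big_ord4 /K !mxE; ring.
move=> q; rewrite -!mulrDr; congr (_ * _).
have LK l : L1 (fun p => K l p q * (P p * psi p l 0)).
  apply: (@L1M_bounded _ _ _ mu _ _ (a * 2) (LPpsik l)) => //.
  exact: (measurable_section1 (F := K l)).
rewrite -(IntD (LK 0) (LK 1)) -(IntD (L1D (LK 0) (LK 1)) (LK 2%:R)).
rewrite -(IntD (L1D (L1D (LK 0) (LK 1)) (LK 2%:R)) (LK 3%:R)).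
by apply: eq_Int => p; rewrite qmul_delta big_ord4 /K; ring.
Qed.

(* [rotation_inequality] for potentials and spinors that are finite
   superpositions of kernels; the mollifications of [u] and [psi] are limits of
   such superpositions, over finer and finer cells. *)
Hypothesis star : forall (I : finType) (x : I -> T) (ms : I -> R)
    (eta : I -> 'cV[R]_4) (cs b t : R),
  0 < b <= 1 -> 0 < t <= 1 -> \sum_i ms i = 0 ->
  let s q := cs - \sum_i ms i * ln (b + gap (x i) q) in
  Int (fun q => expR (- s q) * ((1 + \sum_i ms i * kappa b (x i) q) *
    nsq (\col_k \sum_i rr t (x i) q ^+ 8 * qmul (e (x i) - e q) (eta i) k 0))) <=
  Int (fun q => expR (- s q) *
    nsq (\col_k \sum_i t * rr t (x i) q ^+ 16 *
                       qmul (e (x i) + e q) (eta i) k 0)).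

(** The operator [S] applied to [pt t] under the integral sign, by the formula for a single
    kernel. *)
Definition Spt t q : 'cV[R]_4 := \col_k (A^-1 *
  Int (fun p => t * rr t p q ^+ 16 * (P p * qmul (e p + e q) (psi p) k 0))).

(** This is [1 - Delta (st b)]: the charge [f0 - 1] has total mass zero, so the constants of the
    kernel drop out. *)
Definition Tf b q : R := A^-1 * Int (fun p => kappa b p q * f0 p).

Lemma Lf1 : L1 (fun p => f0 p - 1).
Proof. by apply: L1B => //; exact: L1_cst. Qed.

Lemma Int_f1 : Int (fun p => f0 p - 1) = 0.
Proof.
rewrite (IntB Lf0 (L1_cst _ 1)) Int_f0 (_ : Int _ = A) ?subrr//.
by rewrite (Int_cst mu 1) mul1r.
Qed.

Lemma sum_cell_mass (n : nat) F : L1 F -> \sum_i cell_mass n F i = Int F.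
Proof.
move=> LF; have [_ h] := quadrature (n := n) (fun=> 1) LF.
under eq_bigr do rewrite -[cell_mass _ _ _]mulr1.
by rewrite h; apply: eq_Int => p; rewrite mul1r.
Qed.

(** The charges are the cell masses of [f0 - 1], whose sum vanishes as [star] demands, and the
    spinors are those of [P psi]. Both [b] and [t] stay fixed while the cells shrink, so every
    kernel is bounded. *)
Lemma star_limit (b t : R) : 0 < b <= 1 -> 0 < t <= 1 ->
  [/\ L1 (fun q => expR (- st b q) * (Tf b q * nsq (pt t q))),
      L1 (fun q => expR (- st b q) * nsq (Spt t q)) &
      Int (fun q => expR (- st b q) * (Tf b q * nsq (pt t q))) <=
      Int (fun q => expR (- st b q) * nsq (Spt t q))].
Proof.
move=> b01 t01; have b0 : 0 < b by case/andP: b01.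
have t0 : 0 < t by case/andP: t01.
pose ms n i := A^-1 * cell_mass n.+1 (fun p => f0 p - 1) i.
pose eta n i : 'cV[R]_4 :=
  A^-1 *: \col_l cell_mass n.+1 (fun p => P p * psi p l 0) i.
pose S n q := A^-1 * Int u - \sum_i ms n i * ln (b + gap (node n.+1 i) q).
pose k n q := 1 + \sum_i ms n i * kappa b (node n.+1 i) q.
pose ph n q : 'cV[R]_4 := \col_k \sum_i rr t (node n.+1 i) q ^+ 8 *
  qmul (e (node n.+1 i) - e q) (eta n i) k 0.
pose Sp n q : 'cV[R]_4 := \col_k \sum_i t * rr t (node n.+1 i) q ^+ 16 *
  qmul (e (node n.+1 i) + e q) (eta n i) k 0.
have kle p q : `|kappa b p q| <= b * (2 + b) * (1 + b^-1) ^+ 16.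
  by rewrite (ger0_norm (kappa_ge0 p q b0)) kappa_le.
have rle j p q : `|rr t p q ^+ j| <= (1 + t^-1) ^+ j.
  by rewrite (ger0_norm (rrX_ge0 t p q j)) rrX_le.
have lnle p q : `|ln (b + gap p q)| <= 3 * (1 + (1 + b^-1) ^+ 6).
  apply: (le_trans (ln_gap_bound p q b01)).
  by rewrite ler_wpM2l// lerD2l rrX_le.
have rcv j p q : (fun n => rr t (node n.+1 (cell n.+1 p)) q ^+ j) @ \oo --> rr t p q ^+ j.
  by apply: cvg_expn; exact: rr_node_cvg.
have BS : bcv S (st b).
  have B := bcvZ (- A^-1) (bcv_quadrature Lf1 (measurable_ln_gap b) lnle
    (fun p q => @ln_node_cvg b p q b0)).
  apply: (eq_bcv _ _ (bcvD (bcv_cst (A^-1 * Int u)) B)) => [n q|q].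
    rewrite /S mulNr mulr_sumr; congr (_ - _); apply: eq_bigr => i _.
    by rewrite mulrA.
  rewrite /st (u_repr q b01) mulrBr mulNr; congr (_ - _ * _).
  by apply: eq_Int => p; rewrite mulrC.
have Bk : bcv k (Tf b).
  have kcv p q : (fun n => kappa b (node n.+1 (cell n.+1 p)) q) @ \oo --> kappa b p q.
    rewrite kappaE; under eq_fun do rewrite kappaE.
    by apply: cvgMr; apply: cvg_expn; exact: rr_node_cvg.
  have B := bcvZ A^-1 (bcv_quadrature Lf1 (measurable_kappa b) kle kcv).
  apply: (eq_bcv _ _ (bcvD (bcv_cst 1) B)) => [n q|q].
    by rewrite /k mulr_sumr; congr (_ + _); apply: eq_bigr => i _; rewrite mulrA.
  have L1k := L1_kappa q b0; have Lk := L1_kappaM q b0 Lf1.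
  rewrite /Tf -[X in X + _](mulVf (lt0r_neq0 A_gt0)) -(Int_kappa q b01) -mulrDr.
  rewrite -(IntD L1k Lk); congr (_ * _); apply: eq_Int => p.
  by rewrite mulrBr mulr1 addrC subrK.
have Bph : bcv (fun n q => nsq (ph n q)) (fun q => nsq (pt t q)).
  apply: bcv_nsq => j.
  have B := @bcv_spinor (fun p q => rr t p q ^+ 8) (-1) _ j (etrans (sqrrN 1) (expr1n _ _))
    (measurable_funX _ (measurable_rr t)) (rle 8%N) (rcv 8%N).
  apply: (eq_bcv _ _ B) => [n q|q]; rewrite mxE.
    by apply: eq_bigr => i _; rewrite scaleN1r.
  by congr (_ * _); apply: eq_Int => p; rewrite scaleN1r.
have BSp : bcv (fun n q => nsq (Sp n q)) (fun q => nsq (Spt t q)).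
  apply: bcv_nsq => j.
  have mr : measurable_fun setT (fun z : T * T => t * rr t z.1 z.2 ^+ 16).
    by apply: (measurable_funM (f := cst t)) => //; apply: measurable_funX; exact: measurable_rr.
  have rb p q : `|t * rr t p q ^+ 16| <= t * (1 + t^-1) ^+ 16.
    by rewrite normrM (gtr0_norm t0) ler_wpM2l// ltW.
  have rc p q : (fun n => t * rr t (node n.+1 (cell n.+1 p)) q ^+ 16) @ \oo -->
      t * rr t p q ^+ 16 by apply: cvgMr; exact: rcv.
  have B := @bcv_spinor (fun p q => t * rr t p q ^+ 16) 1 _ j (expr1n _ _) mr rb rc.
  apply: (eq_bcv _ _ B) => [n q|q]; rewrite mxE.
    by apply: eq_bigr => i _; rewrite scale1r.
  by congr (_ * _); apply: eq_Int => p; rewrite scale1r.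
have BE : bcv (fun n q => expR (- S n q)) (fun q => expR (- st b q)).
  apply: bcv_expR; apply: (eq_bcv _ _ (bcvZ (-1) BS)) => *; exact: esym (mulN1r _).
have [_ H1 H2] := bcv_Int (bcvM BE (bcvM Bk Bph)).
have [_ H3 H4] := bcv_Int (bcvM BE BSp).
split => //; apply: (ler_cvg_to H2 H4); apply: nearW => n.
apply: star => //; rewrite -mulr_sumr sum_cell_mass ?Int_f1 ?mulr0//; exact: Lf1.
Qed.

(** * Passage to the limit *)

(* Sharp because [t * rr ^+ 16 <= kappa / 2] and [nsq Y <= 4 * N]. *)
Lemma mollify_young (Y : T -> 'cV[R]_4) (N : T -> R) (t : R) q (W : 'cV[R]_4) :
  0 < t <= 1 -> (forall k, L1 (fun p => Y p k 0)) -> L1 N ->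
  (forall p, nsq (Y p) <= 4 * N p) ->
  (forall k, W k 0 = A^-1 * Int (fun p => t * rr t p q ^+ 16 * Y p k 0)) ->
  nsq W <= A^-1 * Int (fun p => kappa t p q * N p).
Proof.
move=> t01 LY LN YN WE; have t0 : 0 < t by case/andP: t01.
have t2 : 0 < 2 + t by rewrite ltr_wpDl.
have kE p : t * rr t p q ^+ 16 = (2 + t)^-1 * kappa t p q.
  by rewrite kappaE; field; rewrite gt_eqF.
have LrY k : L1 (fun p => W k 0 * (t * rr t p q ^+ 16 * Y p k 0)).
  apply: L1Z; apply: (eq_L1 _ (L1Z (2 + t)^-1 (L1_kappaM q t0 (LY k)))) => p.
  by rewrite kE mulrA.
have LrY' k : L1 (fun p => t * rr t p q ^+ 16 * Y p k 0).
  apply: (eq_L1 _ (L1Z (2 + t)^-1 (L1_kappaM q t0 (LY k)))) => p.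
  by rewrite kE mulrA.
have LkN := L1_kappaM q t0 LN.
have Lk := L1_kappa q t0.
have AW : A * nsq W = Int (fun p => \sum_k W k 0 * (t * rr t p q ^+ 16 * Y p k 0)).
  rewrite (Int_sum LrY) /nsq /ip mulr_sumr; apply: eq_bigr => k _.
  rewrite (IntZ _ (LrY' k)) [X in _ * (_ * X)]WE mulrCA; congr (_ * _).
  by rewrite mulrA mulfV ?mul1r// gt_eqF.
have h : A * nsq W <= Int (fun p => (2 + t)^-1 * (nsq W * kappa t p q + kappa t p q * N p)).
  rewrite AW; apply: Int_le => [||p].
  - exact: L1_sum.
  - by apply: L1Z; apply: L1D => //; apply: L1Z.
  have -> : \sum_k W k 0 * (t * rr t p q ^+ 16 * Y p k 0) =
      (2 + t)^-1 * (kappa t p q * ip W (Y p)).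
    rewrite [RHS]mulrA -kE /ip mulr_sumr; apply: eq_bigr => k _; ring.
  rewrite ler_wpM2l ?invr_ge0 ?(ltW t2)// mulrC [kappa t p q * N p]mulrC -mulrDl.
  rewrite ler_wpM2r ?kappa_ge0//.
  have := nsqB_ge0 W (Y p) (ltr0n R 2); have := YN p; lra.
move: h; rewrite (IntZ _ (L1D (L1Z _ Lk) LkN)) (IntD (L1Z _ Lk) LkN) (IntZ _ Lk).
rewrite (Int_kappa q t01) => h.
rewrite -(ler_pM2l A_gt0) mulrA mulfV ?gt_eqF// mul1r.
move: (ler_wpM2l (ltW t2) h); rewrite mulVKf ?gt_eqF//.
have := nsq_ge0 W; move: (nsq W) (Int _) A_gt0 => x y a0 x0.
by have := mulr_ge0 (ltW t0) (mulr_ge0 (ltW a0) x0); lra.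
Qed.

Lemma scale_col (a : R) (v : 'cV[R]_4) k : (a *: v) k 0 = a * v k 0.
Proof. by rewrite [LHS]mxE. Qed.

Lemma expR_P2_ge0 (a : R) q : 0 <= expR a * (P q ^+ 2 * nsq (psi q)).
Proof.
apply: mulr_ge0; first exact: expR_ge0.
by apply: mulr_ge0; [exact: sqr_ge0|exact: nsq_ge0].
Qed.

Lemma nsq_qmul_le4 p q (c : R) v : c ^+ 2 = 1 ->
  nsq (qmul (e p + c *: e q) v) <= 4 * nsq v.
Proof. by move=> c2; rewrite nsq_qmul ler_wpM2r ?nsq_ge0// dot_combo_le4. Qed.

(** An average with total weight exactly 1: a larger constant would multiply [M ^+ 2] in the final
    comparison, where [M ^+ 2 = m] is allowed. *)
Lemma nsq_Spt_le t q : 0 < t <= 1 ->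
  nsq (Spt t q) <= A^-1 * Int (fun p => kappa t p q * (P p ^+ 2 * nsq (psi p))).
Proof.
move=> t01.
apply: (@mollify_young (fun p => P p *: qmul (e p + e q) (psi p))) => //.
- move=> k; apply: (@L1_le _ _ _ _ _ (fun p => 2 * (P p * nn p))).
  + rewrite (_ : (fun p => _) = fun p => P p * qmul (e p + e q) (psi p) k 0); last first.
      by apply/funext => p; rewrite mxE.
    apply: measurable_funM => //; apply: measurable_qmul => // j.
    rewrite (_ : (fun p => _) = fun p => e p 0 j + e q 0 j); last first.
      by apply/funext => p; rewrite mxE.
    by apply: measurable_funD => //; exact: measurable_cst.
  + move=> p; rewrite mxE normrM (gtr0_norm (P_gt0 p)) mulrCA.
    rewrite ler_wpM2l ?(ltW (P_gt0 p))//.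
    have h0 : 0 <= 2 * nn p by apply: mulr_ge0 => //; exact: nn_ge0.
    rewrite -(@ler_pXn2r _ 2) ?nnegrE// real_normK ?num_real//.
    rewrite exprMn nn_sq (le_trans (le_nsq _ k))//.
    by have := nsq_qmul_le4 p q (psi p) (expr1n _ 2); rewrite scale1r -natrX.
  + by apply: L1Z; exact: LPnn.
- exact: LPpsi.
- move=> p; rewrite nsqZ mulrCA ler_wpM2l ?sqr_ge0//.
  by have := nsq_qmul_le4 p q (psi p) (expr1n _ 2); rewrite scale1r.
- move=> k; rewrite mxE; congr (_ * _); apply: eq_Int => p.
  by rewrite scale_col.
Qed.

Lemma nsq_pt_young t q : 0 < t <= 1 ->
  nsq (pt t q) <= A^-1 * Int (fun p => kappa t p q * nsq (psi p)).
Proof.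
move=> t01.
have h4 p : nsq (psi p - qmul (e q) (qmul (e p) (psi p))) <= 4 * nsq (psi p).
  rewrite nsq_conj_qmul// ler_wpM2r ?nsq_ge0//.
  by have := sphere_dot_le1 (e_sphere p) (e_sphere q); lra.
apply: (@mollify_young (fun p => psi p - qmul (e q) (qmul (e p) (psi p)))) => //.
- move=> k; apply: (@L1_le _ _ _ _ _ (fun p => 2 * nn p)).
  + rewrite (_ : (fun p => _) = fun p => psi p k 0 - qmul (e q) (qmul (e p) (psi p)) k 0).
      apply: measurable_funB => //; apply: measurable_qmul => // j.
      exact: measurable_qmul.
    by apply/funext => p; rewrite !mxE.
  + move=> p; have h0 : 0 <= 2 * nn p by apply: mulr_ge0 => //; exact: nn_ge0.
    rewrite -(@ler_pXn2r _ 2) ?nnegrE// real_normK ?num_real//.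
    by rewrite exprMn nn_sq (le_trans (le_nsq _ k))// -natrX.
  + by apply: L1Z; exact: Lnn.
- by move=> k; rewrite mxE -(psi_repr q k t01).
Qed.

Lemma expR_dist (a b : R) : a <= 0 -> b <= 0 -> `|expR a - expR b| <= `|a - b|.
Proof.
suff h (x y : R) : x <= y -> y <= 0 -> expR y - expR x <= y - x.
  move=> a0 b0; have [ab|/ltW ab] := leP a b.
    by rewrite distrC (distrC a) !ger0_norm ?subr_ge0 ?ler_expR// h.
  by rewrite !ger0_norm ?subr_ge0 ?ler_expR// h.
move=> xy y0; have h1 : expR x = expR y * expR (x - y) by rewrite -expRD addrC subrK.
have h2 := expR_ge1Dx (x - y); have h3 : expR y <= 1 by rewrite -expR0 ler_expR.
by have h4 := expR_ge0 y; rewrite h1; nra.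
Qed.

Lemma gap_dist p q x : `|gap x p - gap x q| ^+ 2 <= 2 * gap p q.
Proof.
rewrite real_normK ?num_real// -dotBB_gap.
rewrite [leLHS](_ : _ = dot (e x) (e p - e q) ^+ 2); first exact: dot_CS.
rewrite !gapE (dotC (e x) (e p - e q)) !dot3 !mxE; ring.
Qed.

Lemma inv_sq_dist (b y z : R) : 0 < b -> 0 <= y -> 0 <= z ->
  `|(b + y)^-1 ^+ 2 - (b + z)^-1 ^+ 2| <= 2 * b^-1 ^+ 3 * `|y - z|.
Proof.
move=> b0 y0 z0; have hy : 0 < b + y by lra. have hz : 0 < b + z by lra.
have iy : (b + y)^-1 <= b^-1 by rewrite lef_pV2 ?posrE//; lra.
have iz : (b + z)^-1 <= b^-1 by rewrite lef_pV2 ?posrE//; lra.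
have E : (b + y)^-1 ^+ 2 - (b + z)^-1 ^+ 2 =
    (b + y)^-1 * (b + z)^-1 * ((b + y)^-1 + (b + z)^-1) * (z - y).
  by field; rewrite !gt_eqF.
have i1 : 0 < (b + y)^-1 by rewrite invr_gt0.
have i2 : 0 < (b + z)^-1 by rewrite invr_gt0.
rewrite E normrM (distrC z) ler_wpM2r// ger0_norm; last first.
  by apply: mulr_ge0; [apply: mulr_ge0|apply: addr_ge0]; exact: ltW.
have -> : 2 * b^-1 ^+ 3 = b^-1 * b^-1 * (b^-1 + b^-1) by ring.
apply: ler_pM; [by apply: mulr_ge0; exact: ltW|by apply: addr_ge0; exact: ltW| |].
  by apply: ler_pM => //; exact: ltW.
exact: lerD.
Qed.

Lemma kappa_sq b p q : 0 < b -> kappa b p q = b * (2 + b) * (b + gap p q)^-1 ^+ 2.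
Proof. by move=> b0; rewrite kappaE -(rr8 p q b0) -exprM. Qed.

Lemma st_lip (b : R) : 0 < b <= 1 ->
  exists2 l : R, 0 <= l & forall p q, `|st b p - st b q| <= l * Num.sqrt (2 * gap p q).
Proof.
move=> b01; have b0 : 0 < b by case/andP: b01.
have [c cE] : exists c : R, c = b * (2 + b) * (2 * b^-1 ^+ 3) by eexists.
have c0 : 0 <= c.
  rewrite cE; apply: mulr_ge0; first by apply: mulr_ge0; lra.
  by rewrite mulr_ge0 ?exprn_ge0// invr_ge0 ltW.
exists (A^-1 * (c * Int (fun p => `|u p|))).
  apply: mulr_ge0; first by rewrite invr_ge0 ltW.
  by apply: mulr_ge0 => //; apply: Int_ge0.
move=> p q; rewrite /st -mulrBr normrM ger0_norm ?invr_ge0 ?(ltW A_gt0)// -mulrA.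
rewrite ler_wpM2l ?invr_ge0 ?(ltW A_gt0)//.
have Lk r := L1_kappaM r b0 Lu.
rewrite -(IntB (Lk p) (Lk q)) (le_trans (Int_norm (L1B (Lk p) (Lk q))))//.
rewrite mulrAC -(IntZ _ (L1_norm Lu)); apply: Int_le => [||x].
- exact: L1_norm (L1B (Lk p) (Lk q)).
- by apply: L1Z; exact: L1_norm.
rewrite -mulrBl normrM ler_wpM2r// !kappa_sq// -mulrBr normrM ger0_norm; last first.
  by apply: mulr_ge0; lra.
rewrite cE -[leRHS]mulrA; apply: ler_wpM2l; first by apply: mulr_ge0; lra.
apply: (le_trans (inv_sq_dist b0 (gap_ge0 x p) (gap_ge0 x q))).
rewrite ler_wpM2l ?mulr_ge0 ?exprn_ge0 ?invr_ge0 ?(ltW b0)//.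
rewrite -(@ler_pXn2r _ 2) ?nnegrE ?sqrtr_ge0// sqr_sqrtr ?mulr_ge0 ?gap_ge0//.
exact: gap_dist.
Qed.

(** With [b] fixed, [st b] is Lipschitz and bounded below by [- umin], so the normalized weight is a
    legitimate test function for [mollify_weak] while [t] tends to 0. *)
Lemma admissible_st (b : R) : 0 < b <= 1 ->
  admissible (fun q => expR (- st b q - umin)).
Proof.
move=> b01; have b0 : 0 < b by case/andP: b01.
have neg p : - st b p - umin <= 0 by have := st_ge p b01; lra.
split.
- apply: measurableT_comp => //; apply: measurable_funB; last exact: measurable_cst.
  by apply: measurable_funN; exact: measurable_st.
- by move=> p; rewrite ger0_norm ?expR_ge0// -expR0 ler_expR.
have [l l0 hl] := st_lip b01; exists (l ^+ 2 * 2) => [|p q].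
  by rewrite mulr_ge0// sqr_ge0.
have h : `|expR (- st b p - umin) - expR (- st b q - umin)| <= l * Num.sqrt (2 * gap p q).
  apply: (le_trans (expR_dist (neg p) (neg q))).
  have -> : - st b p - umin - (- st b q - umin) = st b q - st b p.
    by move: (st b p) (st b q) umin => x y z; ring.
  by rewrite distrC.
rewrite -mulrA -[2 * _]sqr_sqrtr ?mulr_ge0 ?gap_ge0// -exprMn.
by rewrite lerXn2r ?nnegrE// mulr_ge0 ?sqrtr_ge0.
Qed.

Lemma nsq_pt_cvg : {ae mu, forall q, (fun n => nsq (pt (tn n) q)) @ \oo --> nsq (psi q)}.
Proof.
have h01 : {ae mu, forall q, (fun n => pt (tn n) q 0 0) @ \oo --> psi q 0 0 /\
    (fun n => pt (tn n) q 1 0) @ \oo --> psi q 1 0}.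
  by apply: filterS2 (pt_cvg 0) (pt_cvg 1) => q.
apply: filterS3 h01 (pt_cvg 2%:R) (pt_cvg 3%:R) => q [h0 h1] h2 h3.
rewrite /nsq ip4; under eq_fun do rewrite ip4.
by apply: cvgD; [apply: cvgD; [apply: cvgD|]|]; apply: cvgM.
Qed.

Lemma Tf_ge0 b q : 0 < b -> 0 <= Tf b q.
Proof.
move=> b0; apply: mulr_ge0; first by rewrite invr_ge0 ltW.
by apply: Int_ge0 => p; apply: mulr_ge0; [exact: kappa_ge0|exact: f0_ge0].
Qed.

Lemma measurable_Tf b : 0 < b -> measurable_fun setT (Tf b).
Proof.
move=> b0; apply: (measurable_funM (f := cst _)) => //.
by have [_ /L1_measurable] := Fubini_Int (L1prod_kappa b0 Lf0).
Qed.

Lemma expR_st_le b q : 0 < b <= 1 -> expR (- st b q) <= expR umin.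
Proof. by move=> b01; rewrite ler_expR lerNl st_ge. Qed.

Lemma measurable_expR_st b : 0 < b -> measurable_fun setT (fun q => expR (- st b q)).
Proof.
by move=> b0; apply: measurableT_comp => //; apply: measurable_funN; exact: measurable_st.
Qed.

(** Fatou on the left. On the right [nsq_Spt_le] produces a mollification of [P ^+ 2 |psi|^2], whose
    integral against the Lipschitz weight converges by [mollify_weak]. *)
Lemma limit_t (b : R) : 0 < b <= 1 ->
  L1 (fun q => expR (- st b q) * (Tf b q * nsq (psi q))) /\
  Int (fun q => expR (- st b q) * (Tf b q * nsq (psi q))) <=
  Int (fun q => expR (- st b q) * (P q ^+ 2 * nsq (psi q))).
Proof.
move=> b01; have b0 : 0 < b by case/andP: b01.
have mE := measurable_expR_st b0; have mT := measurable_Tf b0.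
have [||||||H1 H2] := @fatou_Int _ _ _ mu
  (fun n q => expR (- st b q) * (Tf b q * nsq (pt (tn n) q)))
  (fun q => expR (- st b q) * (Tf b q * nsq (psi q)))
  (Int (fun q => expR (- st b q) * (P q ^+ 2 * nsq (psi q)))); last by split.
- by move=> n; have [] := star_limit b01 (tn01 n).
- apply: measurable_funM => //; apply: measurable_funM => //; exact: measurable_nsq.
- move=> n q; apply: mulr_ge0; first exact: expR_ge0.
  by apply: mulr_ge0; [exact: Tf_ge0|exact: nsq_ge0].
- move=> q; apply: mulr_ge0; first exact: expR_ge0.
  by apply: mulr_ge0; [exact: Tf_ge0|exact: nsq_ge0].
- by apply: filterS nsq_pt_cvg => q h; apply: cvgMr; apply: cvgMr.
have ag := admissible_st b01.
have gE q : expR (- st b q) = expR umin * expR (- st b q - umin).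
  by rewrite -expRD addrC subrK.
have [mg g1 _] := ag.
have W := mollify_weak LPpsi ag.
have Lg : L1 (fun q => expR (- st b q - umin) * (P q ^+ 2 * nsq (psi q))).
  exact: (@L1M_bounded _ _ _ mu _ _ 1 LPpsi).
have key n : Int (fun q => expR (- st b q) * (Tf b q * nsq (pt (tn n) q))) <=
    expR umin * A^-1 * Int (fun q => expR (- st b q - umin) *
      Int (fun p => kappa (tn n) p q * (P p ^+ 2 * nsq (psi p)))).
  have [_ LS h] := star_limit b01 (tn01 n).
  have [_ LK _] := Fubini_Int (L1prod_kappa (tn_gt0 n) LPpsi).
  have LgK := @L1M_bounded _ _ _ mu _ _ 1 LK mg g1.
  apply: (le_trans h); rewrite -(IntZ _ LgK); apply: Int_le => //; first exact: L1Z.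
  move=> q; rewrite gE -!mulrA ler_wpM2l ?expR_ge0// mulrCA ler_wpM2l ?expR_ge0//.
  exact: nsq_Spt_le (tn01 n).
have lim : (fun n => expR umin * A^-1 * Int (fun q => expR (- st b q - umin) *
      Int (fun p => kappa (tn n) p q * (P p ^+ 2 * nsq (psi p))))) @ \oo -->
    Int (fun q => expR (- st b q) * (P q ^+ 2 * nsq (psi q))).
  rewrite [X in _ --> X](_ : _ = expR umin * A^-1 * (A * Int (fun q =>
      expR (- st b q - umin) * (P q ^+ 2 * nsq (psi q))))).
    by apply: cvgMr; exact: W.
  rewrite mulrA mulfVK ?gt_eqF// -(IntZ _ Lg); apply: eq_Int => q.
  by rewrite [RHS]mulrA -gE.
move=> eps eps0; have /cvgrPdist_le /(_ _ eps0) := lim.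
apply: filterS => n hn; apply: (le_trans (key n)).
by move: hn; rewrite distrC ler_distl => /andP[_].
Qed.

(** Jensen's inequality for the average of [e^(2u)], [nsq_pt_young] for that of [|psi|^2], and
    [P >= c1 e^(- umin)] almost everywhere. The bound is expressed through [st] and [pt] because
    their almost everywhere limits are known. *)
Lemma Tf_ge (b : R) q : 0 < b <= 1 ->
  m * expR (2 * st b q) + c1 * expR (- umin) * nsq (pt b q) <= Tf b q.
Proof.
move=> b01; have b0 : 0 < b by case/andP: b01.
have c0 : 0 <= c1 * expR (- umin) by rewrite mulr_ge0 ?expR_ge0// ltW.
have LE := L1_kappaM q b0 Lexp; have LN := L1_kappaM q b0 Lpsi.
have Lu' := L1_kappaM q b0 Lu; have Lk := L1_kappa q b0.
have J : A * expR (2 * st b q) <= Int (fun p => kappa b p q * expR (2 * u p)).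
  set s := st b q.
  (* The tangent line of the exponential at [2 s], integrated against [kappa]: its linear part
     averages to zero. *)
  have -> : A * expR (2 * s) = Int (fun p => expR (2 * s) * (1 - 2 * s) * kappa b p q +
      expR (2 * s) * 2 * (kappa b p q * u p)).
    rewrite (IntD (L1Z _ Lk) (L1Z _ Lu')) (IntZ _ Lk) (IntZ _ Lu') (Int_kappa q b01).
    have -> : Int (fun p => kappa b p q * u p) = A * s by rewrite /s /st mulVKf ?gt_eqF.
    by ring.
  apply: Int_le => //; first by apply: L1D; exact: L1Z.
  move=> p; have h := expR_ge1Dx (2 * u p - 2 * s).
  have -> : expR (2 * u p) = expR (2 * s) * expR (2 * u p - 2 * s).
    by rewrite -expRD addrC subrK.
  move: h (kappa_ge0 p q b0) (expR_ge0 (2 * s)).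
  move: (kappa b p q) (expR (2 * s)) (expR _) => x y z h x0 y0.
  rewrite [leLHS](_ : _ = x * (y * (1 + (2 * u p - 2 * s)))); last by ring.
  by apply: ler_wpM2l => //; apply: ler_wpM2l.
have Y := nsq_pt_young q b01.
have K : Int (fun p => m * (kappa b p q * expR (2 * u p)) +
    c1 * expR (- umin) * (kappa b p q * nsq (psi p))) <= Int (fun p => kappa b p q * f0 p).
  apply: Int_ae_le; [by apply: L1D; exact: L1Z|exact: L1_kappaM|].
  apply: filterS u_ge => p hp; have k0 := kappa_ge0 p q b0.
  have h1 : c1 * expR (- umin) * nsq (psi p) <= P p * nsq (psi p).
    rewrite ler_wpM2r ?nsq_ge0// (le_trans _ (P_ge p))// ler_wpM2l ?ler_expR//.
    exact: ltW.
  rewrite (_ : _ + _ = kappa b p q * (m * expR (2 * u p) +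
    c1 * expR (- umin) * nsq (psi p))); last by ring.
  apply: ler_wpM2l => //; apply: le_trans (f0_ge p); exact: lerD.
move: K; rewrite (IntD (L1Z _ LE) (L1Z _ LN)) (IntZ _ LE) (IntZ _ LN) => K.
rewrite /Tf -(ler_pM2l A_gt0) mulVKf ?gt_eqF//; apply: le_trans K.
rewrite mulrDr mulrCA; apply: lerD; first exact: ler_wpM2l.
rewrite mulrCA; apply: ler_wpM2l => //.
by rewrite -(ler_pM2l A_gt0) mulVKf ?gt_eqF// in Y.
Qed.

(** Fatou on the left again. On the right the weights are bounded by [expR umin], and [LPpsi]
    provides the dominating function. *)
Lemma limit_b : let g q := expR (- u q) *
    ((m * expR (2 * u q) + c1 * expR (- umin) * nsq (psi q)) * nsq (psi q)) in
  L1 g /\ Int g <= Int (fun q => expR (- u q) * (P q ^+ 2 * nsq (psi q))).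
Proof.
have c0 : 0 <= c1 * expR (- umin) by rewrite mulr_ge0 ?expR_ge0// ltW.
have mu_ := L1_measurable Lu; have mn := measurable_nsq.
have mst n : measurable_fun setT (st (tn n)) by apply: measurable_st; exact: tn_gt0.
have m2 (f : T -> R) : measurable_fun setT f ->
    measurable_fun setT (fun q => expR (2 * f q)).
  by move=> mf; apply: measurableT_comp => //; exact: (measurable_funM (f := cst 2)).
have m1 (f : T -> R) : measurable_fun setT f ->
    measurable_fun setT (fun q => expR (- f q)).
  by move=> mf; apply: measurableT_comp => //; exact: measurable_funN.
have mfun (f h : T -> R) : measurable_fun setT f -> measurable_fun setT h ->
    measurable_fun setT (fun q => expR (- f q) * ((m * expR (2 * f q) +
      c1 * expR (- umin) * h q) * nsq (psi q))).
  move=> mf mh; apply: measurable_funM; first exact: m1.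
  apply: measurable_funM => //; apply: measurable_funD.
    by apply: (measurable_funM (f := cst m)) => //; exact: m2.
  by apply: (measurable_funM (f := cst (c1 * expR (- umin)))).
have ge0 (f h : R) q : 0 <= h -> 0 <= expR (- f) * ((m * expR (2 * f) +
      c1 * expR (- umin) * h) * nsq (psi q)).
  move=> h0; apply: mulr_ge0; first exact: expR_ge0.
  apply: mulr_ge0; last exact: nsq_ge0.
  by apply: addr_ge0; apply: mulr_ge0 => //; exact: expR_ge0.
have le n q : expR (- st (tn n) q) * ((m * expR (2 * st (tn n) q) +
      c1 * expR (- umin) * nsq (pt (tn n) q)) * nsq (psi q)) <=
    expR (- st (tn n) q) * (Tf (tn n) q * nsq (psi q)).
  rewrite ler_wpM2l ?expR_ge0// ler_wpM2r ?nsq_ge0//; exact: Tf_ge (tn01 n).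
have Lf n : L1 (fun q => expR (- st (tn n) q) * ((m * expR (2 * st (tn n) q) +
      c1 * expR (- umin) * nsq (pt (tn n) q)) * nsq (psi q))).
  have [L _] := limit_t (tn01 n); apply: L1_le L.
    by apply: mfun => //; apply: measurable_nsq_pt; exact: tn_gt0.
  by move=> q; rewrite ger0_norm ?le// ge0// nsq_ge0.
have [|||||_ lim] := @dominated_Int _ _ _ mu
  (fun n q => expR (- st (tn n) q) * (P q ^+ 2 * nsq (psi q)))
  (fun q => expR (- u q) * (P q ^+ 2 * nsq (psi q)))
  (fun q => expR umin * (P q ^+ 2 * nsq (psi q))).
- move=> n; apply: measurable_funM; first exact: m1.
  exact: L1_measurable LPpsi.
- apply: measurable_funM; first exact: m1.
  exact: L1_measurable LPpsi.
- by apply: L1Z; exact: LPpsi.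
- apply: aeW => q n; rewrite ger0_norm ?expR_P2_ge0//.
  by rewrite ler_wpM2r ?expR_st_le ?tn01// mulr_ge0 ?sqr_ge0 ?nsq_ge0.
- apply: filterS st_cvg => q h; apply: cvgMl; apply: cvg_expR; exact: cvgN.
apply: (fatou_Int Lf).
- exact: mfun.
- by move=> n q; apply: ge0; exact: nsq_ge0.
- by move=> q; apply: ge0; exact: nsq_ge0.
- apply: filterS2 st_cvg nsq_pt_cvg => q h1 h2.
  apply: cvgM; first by apply: cvg_expR; exact: cvgN.
  apply: cvgMl; apply: cvgD; last exact: cvgMr.
  by apply: cvgMr; apply: cvg_expR; exact: cvgMr.
move=> eps eps0; have /cvgrPdist_le /(_ _ eps0) := lim.
apply: filterS => n hn; have [L h] := limit_t (tn01 n).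
apply: (le_trans (Int_le (Lf n) L (le n))); apply: (le_trans h).
by move: hn; rewrite distrC ler_distl => /andP[_].
Qed.

Theorem spinor_vanishes : M ^+ 2 <= m -> {ae mu, forall q, nsq (psi q) = 0}.
Proof.
move=> Mm; have [Lg hg] := limit_b.
have c0 : 0 < c1 * expR (- umin) by rewrite mulr_gt0 ?expR_gt0.
have LE : L1 (fun q => expR (u q) * nsq (psi q)).
  apply: (@L1_le _ _ _ _ _ (fun q => c1^-1 * (P q * nsq (psi q)))).
  - apply: measurable_funM; last exact: measurable_nsq.
    by apply: measurableT_comp => //; exact: L1_measurable Lu.
  - move=> q; rewrite ger0_norm ?mulr_ge0 ?expR_ge0 ?nsq_ge0// mulrA.
    by rewrite ler_wpM2r ?nsq_ge0// ler_pdivlMl// P_ge.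
  - by apply: L1Z; exact: LPnsq.
(* Since [e^(-u) e^(2u) = e^u], the terms with [m] cancel and only the quartic term in [psi]
   remains. *)
have gE q : expR (- u q) * ((m * expR (2 * u q) + c1 * expR (- umin) * nsq (psi q)) *
    nsq (psi q)) - m * (expR (u q) * nsq (psi q)) =
    c1 * expR (- umin) * (expR (- u q) * nsq (psi q) ^+ 2).
  have -> : expR (2 * u q) = expR (u q) ^+ 2 by rewrite expRM_natl.
  have : expR (- u q) * expR (u q) = 1 by rewrite -expRD addNr expR0.
  move: (expR (- u q)) (expR (u q)) (expR (- umin)) (nsq _) => x y z w xy.
  rewrite [LHS](_ : _ = m * (x * y) * y * w - m * y * w + c1 * z * x * w ^+ 2); last by ring.
  by rewrite xy; ring.
have le q : expR (- u q) * (P q ^+ 2 * nsq (psi q)) <= M ^+ 2 * (expR (u q) * nsq (psi q)).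
  rewrite mulrA mulrA ler_wpM2r ?nsq_ge0// mulrC.
  have -> : M ^+ 2 * expR (u q) = (M * expR (u q)) ^+ 2 * expR (- u q).
    have : expR (- u q) * expR (u q) = 1 by rewrite -expRD addNr expR0.
    move: (expR (- u q)) (expR (u q)) => x y xy.
    by rewrite [RHS](_ : _ = M ^+ 2 * y * (x * y)); [rewrite xy mulr1|ring].
  rewrite ler_wpM2r ?expR_ge0// lerXn2r ?nnegrE ?P_le ?(ltW (P_gt0 q))//.
  by rewrite (le_trans (ltW (P_gt0 q)))// P_le.
have L := L1B Lg (L1Z m LE).
have ge0 q : 0 <= c1 * expR (- umin) * (expR (- u q) * nsq (psi q) ^+ 2).
  by apply: mulr_ge0; [exact: ltW|rewrite mulr_ge0 ?expR_ge0 ?sqr_ge0].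
have L2' : L1 (fun q => c1 * expR (- umin) * (expR (- u q) * nsq (psi q) ^+ 2)).
  exact: (eq_L1 gE L).
have I0 : Int (fun q => c1 * expR (- umin) * (expR (- u q) * nsq (psi q) ^+ 2)) = 0.
  apply/eqP; rewrite eq_le; apply/andP; split; last exact: Int_ge0.
  rewrite -(eq_Int _ gE) (IntB Lg (L1Z m LE)) (IntZ _ LE) subr_le0 (le_trans hg)//.
  rewrite -(IntZ _ LE); apply: Int_le.
  - apply: (@L1_le _ _ _ _ _ (fun q => M ^+ 2 * (expR (u q) * nsq (psi q)))).
    + apply: measurable_funM; last exact: L1_measurable LPpsi.
      apply: measurableT_comp => //; apply: measurable_funN; exact: L1_measurable Lu.
    + move=> q; rewrite ger0_norm ?expR_P2_ge0//.
    + exact: L1Z.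
  - exact: L1Z.
  - move=> q; apply: (le_trans (le q)); rewrite ler_wpM2r//.
    by rewrite mulr_ge0 ?expR_ge0 ?nsq_ge0.
apply: filterS (Int_eq0_ae L2' ge0 I0) => q /eqP.
rewrite mulf_eq0 (gt_eqF c0)/= mulf_eq0 (gt_eqF (expR_gt0 _))/=.
by rewrite expf_eq0 /= => /eqP.
Qed.

End Solution.

End Kernels.

(** * Smooth functions *)

Lemma near_eq_differentiable (R : numFieldType) (V W : normedModType R)
    (f g : V -> W) (x : V) :
  (\forall y \near x, f y = g y) -> differentiable f x -> differentiable g x.
Proof.
move=> fg /diff_locallyP [dfc Ef].
have fgx : f x = g x := nbhs_singleton fg.
have Eg : g \o shift x = cst (g x) + 'd f x +o_ 0 id.
  apply/eqaddoP => eps eps0; have /eqaddoP/(_ eps eps0) := Ef.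
  have h0 : \forall h \near (0 : V), f (h + x) = g (h + x).
    by move: fg; rewrite (near_shift 0) subr0.
  apply: filterS2 h0 => h fgh.
  by rewrite /= !fctE /= fgx fgh.
by apply/diff_locallyP; rewrite (diff_unique dfc Eg).
Qed.

Section SmoothFunctions.
Context {R : realType}.
Local Notation E := 'rV[R]_3.
Implicit Types (f g : E -> R) (x v : E).

Lemma differentiable_comp1 (h : R -> R) f x (h' : R) :
  differentiable f x -> is_derive (f x) 1 h h' ->
  differentiable (fun y => h (f y)) x /\
  forall v, 'D_v (fun y => h (f y)) x = h' * 'D_v f x.
Proof.
move=> df [dh eh].
have dh' : differentiable h (f x) by apply/derivable1_diffP.
have dc : differentiable (h \o f) x by exact: differentiable_comp.
split => // v; rewrite (deriveE v dc) (deriveE v df) (diff_comp df dh') /=.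
rewrite -eh (@deriveE _ _ _ h (f x) (1 : R) dh') -[in LHS](mulr1 ('d f x v)).
by rewrite -[_ * 1]/('d f x v *: (1 : R)) linearZ /= [LHS]mulrC mulrC.
Qed.

(* Closed under directional derivatives, hence smooth on [U]. *)
Inductive Sm (U : set E) : (E -> R) -> Prop :=
| Sm_cst (c : R) : Sm U (fun _ => c)
| Sm_coord j : Sm U (fun x => x 0 j)
| SmD f g : Sm U f -> Sm U g -> Sm U (fun x => f x + g x)
| SmM f g : Sm U f -> Sm U g -> Sm U (fun x => f x * g x)
| Sm_expR f : Sm U f -> Sm U (fun x => expR (f x))
| Sm_ln f : Sm U f -> (forall x, U x -> 0 < f x) -> Sm U (fun x => ln (f x))
| Sm_eq f g : Sm U f -> (forall x, U x -> g x = f x) -> Sm U g.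

Lemma derive_coord v x j : 'D_v (fun y : E => y 0 j) x = v 0 j.
Proof.
have h : derivable (id : E -> E) x v by exact: derivable_id.
by have := derive_mx h; rewrite derive_id => /(congr1 (fun M : E => M 0 j)); rewrite mxE.
Qed.

Section Open.
Variable U : set E.
Hypothesis oU : open U.

Lemma near_open_eq f g x : U x -> (forall y, U y -> g y = f y) ->
  {near x, f =1 g}.
Proof.
by move=> Ux fg; near=> y; apply/esym/fg; near: y; exact: open_nbhs_nbhs.
Unshelve. all: by end_near. Qed.

Lemma derive_eq_on f g v x : U x -> (forall y, U y -> g y = f y) ->
  'D_v g x = 'D_v f x.
Proof.
have [->|v0] := eqVneq v 0; first by rewrite !derive0.
by move=> Ux fg; apply: near_eq_derive => //; apply: near_open_eq => // y Uy; rewrite fg.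
Qed.

Lemma differentiable_eq_on f g x : U x -> (forall y, U y -> g y = f y) ->
  differentiable f x -> differentiable g x.
Proof.
move=> Ux fg; apply: near_eq_differentiable; exact: near_open_eq.
Qed.

Lemma Sm_differentiable f x : Sm U f -> U x -> differentiable f x.
Proof.
move=> Sf Ux; elim: Sf => {f}.
- by move=> c; exact: differentiable_cst.
- by move=> j; exact: differentiable_coord.
- by move=> f g _ df _ dg; exact: differentiableD.
- by move=> f g _ df _ dg; exact: differentiableM.
- by move=> f _ df; exact: (differentiable_comp1 df (is_derive_expR _)).1.
- move=> f _ df f0; exact: (differentiable_comp1 df (is_derive1_ln (f0 _ Ux))).1.
- by move=> f g _ df fg; exact: differentiable_eq_on df.
Qed.

Lemma SmDE f g v x : Sm U f -> Sm U g -> U x ->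
  'D_v (fun y => f y + g y) x = 'D_v f x + 'D_v g x.
Proof.
by move=> Sf Sg Ux; apply: deriveD; apply: diff_derivable; exact: Sm_differentiable.
Qed.

Lemma SmME f g v x : Sm U f -> Sm U g -> U x ->
  'D_v (fun y => f y * g y) x = f x * 'D_v g x + g x * 'D_v f x.
Proof.
by move=> Sf Sg Ux; apply: deriveM; apply: diff_derivable; exact: Sm_differentiable.
Qed.

Lemma Sm_expRE f v x : Sm U f -> U x ->
  'D_v (fun y => expR (f y)) x = expR (f x) * 'D_v f x.
Proof.
move=> Sf Ux.
exact: (differentiable_comp1 (Sm_differentiable Sf Ux) (is_derive_expR _)).2.
Qed.

Lemma Sm_lnE f v x : Sm U f -> U x -> 0 < f x ->
  'D_v (fun y => ln (f y)) x = (f x)^-1 * 'D_v f x.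
Proof.
move=> Sf Ux f0.
exact: (differentiable_comp1 (Sm_differentiable Sf Ux) (is_derive1_ln f0)).2.
Qed.

Lemma SmN f : Sm U f -> Sm U (fun x => - f x).
Proof.
move=> Sf; apply: (Sm_eq (SmM (Sm_cst U (-1)) Sf)) => x _; by rewrite mulN1r.
Qed.

Lemma SmB f g : Sm U f -> Sm U g -> Sm U (fun x => f x - g x).
Proof. by move=> Sf Sg; apply: SmD => //; exact: SmN. Qed.

Lemma SmZ (c : R) f : Sm U f -> Sm U (fun x => c * f x).
Proof. by move=> Sf; apply: SmM => //; exact: Sm_cst. Qed.

(** [1 / f] is [exp (- ln f)] for positive [f], which keeps inverses out of the constructors of
    [Sm]. *)
Lemma SmV f : Sm U f -> (forall x, U x -> 0 < f x) -> Sm U (fun x => (f x)^-1).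
Proof.
move=> Sf f0; apply: (Sm_eq (Sm_expR (SmN (Sm_ln Sf f0)))) => x Ux.
by rewrite expRN lnK// posrE f0.
Qed.

Lemma Sm_sum (I : Type) (r : seq I) (F : I -> E -> R) :
  (forall i, Sm U (F i)) -> Sm U (fun x => \sum_(i <- r) F i x).
Proof.
move=> SF; elim: r => [|i r IH].
  by apply: (Sm_eq (Sm_cst U 0)) => x _; rewrite big_nil.
by apply: (Sm_eq (SmD (SF i) IH)) => x _; rewrite big_cons.
Qed.

Lemma Sm_derive f v : Sm U f -> Sm U ('D_v f).
Proof.
elim=> {f}.
- by move=> c; apply: (Sm_eq (Sm_cst U 0)) => x _; exact: derive_cst.
- by move=> j; apply: (Sm_eq (Sm_cst U (v 0 j))) => x _; exact: derive_coord.
- by move=> f g Sf Sf' Sg Sg'; apply: (Sm_eq (SmD Sf' Sg')) => x; exact: SmDE.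
- move=> f g Sf Sf' Sg Sg'; apply: (Sm_eq (SmD (SmM Sf Sg') (SmM Sg Sf'))) => x.
  exact: SmME.
- move=> f Sf Sf'; apply: (Sm_eq (SmM (Sm_expR Sf) Sf')) => x; exact: Sm_expRE.
- move=> f Sf Sf' f0; apply: (Sm_eq (SmM (SmV Sf f0) Sf')) => x Ux.
  by apply: Sm_lnE => //; exact: f0.
- move=> f g Sf Sf' fg; apply: (Sm_eq Sf') => x Ux; exact: derive_eq_on.
Qed.

Lemma Sm_smooth_on f : Sm U f -> smooth_on U f.
Proof.
move=> Sf s x Ux; apply: Sm_differentiable => //.
by elim: s => //= v s IH; exact: Sm_derive.
Qed.

End Open.

Lemma Sm_curve f (c : R -> E) (c' : E) (s : R) : Sm setT f ->
  (forall j, is_derive s 1 (fun r => c r 0 j) (c' 0 j)) ->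
  is_derive s 1 (fun r => f (c r)) ('D_c' f (c s)).
Proof.
have oT : open [set: E] by exact: openT.
move=> Sf dc; elim: Sf => {f}.
- by move=> k; rewrite derive_cst; exact: is_derive_cst.
- by move=> j; rewrite derive_coord; exact: dc.
- move=> f g Sf df Sg dg; rewrite (SmDE oT) //; exact: is_deriveD.
- move=> f g Sf df Sg dg; rewrite (SmME oT) //; exact: is_deriveM.
- move=> f Sf df; rewrite (Sm_expRE oT)//.
  exact: (@is_derive1_comp _ expR (fun r => f (c r)) s _ _ (is_derive_expR _) df).
- move=> f Sf df f0; have f0' := f0 (c s) I; rewrite (Sm_lnE oT)//.
  exact: (@is_derive1_comp _ (@ln R) (fun r => f (c r)) s _ _ (is_derive1_ln f0') df).
- move=> f g Sf df fg; have -> : g = f by apply/funext => x; exact: fg.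
  exact: df.
Qed.

Lemma Sm_measurable d (T : measurableType d) (c : T -> E) f : Sm setT f ->
  (forall j, measurable_fun setT (fun p => c p 0 j)) ->
  measurable_fun setT (fun p => f (c p)).
Proof.
move=> Sf mc; elim: Sf => {f}.
- by move=> k; exact: measurable_cst.
- by move=> j; exact: mc.
- by move=> f g _ mf _ mg; exact: measurable_funD.
- by move=> f g _ mf _ mg; exact: measurable_funM.
- by move=> f _ mf; exact: measurableT_comp.
- by move=> f _ mf _; exact: measurableT_comp.
- by move=> f g Sf mf fg; have -> : g = f by apply/funext => x; exact: fg.
Qed.

Lemma Sm_continuous f : Sm setT f -> continuous f.
Proof.
move=> Sf x; apply: differentiable_continuous.
exact: (Sm_differentiable openT Sf I).
Qed.

End SmoothFunctions.

(** * The area measure *)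

Section Rectangle.
Context {R : realType}.
Local Notation lam := (@lebesgue_measure R).
Local Notation T2 := (measurableTypeR R * measurableTypeR R)%type.
Local Notation m2 := (lam \x lam : {measure set T2 -> \bar R})%E.
Implicit Types (p : T2) (a A : T2 -> R).

Lemma measurable_rect : measurable (rect : set T2).
Proof. by apply: measurableX; exact: measurable_itv. Qed.

Lemma leb2_rect_fin : (m2 (rect : set T2) < +oo)%E.
Proof.
rewrite [X in (X < _)%E](_ : _ = lam `[0%R, pi]%classic * lam `[0%R, (2 * pi)%R]%classic)%E; last first.
  by apply: product_measure1E; exact: measurable_itv.
rewrite [lam `[0%R, pi]%classic]lebesgue_measure_itv [lam `[0%R, (2 * pi)%R]%classic]lebesgue_measure_itv /=.
by do 2 case: ifP => _; rewrite ?mule0 ?mul0e// ltry.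
Qed.

Lemma integrable_rect a (c : R) : measurable_fun [set: T2] a ->
  (forall p, rect p -> `|a p| <= c) ->
  m2.-integrable [set: T2] (fun p => (\1_rect p * a p)%:E).
Proof.
move=> ma ac.
have mr : measurable_fun [set: T2] (\1_rect : T2 -> R).
  by apply: measurable_indic; exact: measurable_rect.
apply: (@le_integrable _ T2 _ m2 _ measurableT _ (fun p => (c%:E * (\1_rect p)%:E)%E)).
- by apply: measurableT_comp => //; exact: measurable_funM.
- move=> p _; rewrite -EFinM !abse_EFin lee_fin !normrM mulrC indicE.
  have [/set_mem pr|_] := boolP (p \in rect); last by rewrite normr0 !mulr0.
  by rewrite normr1 !mulr1 (le_trans (ac _ pr))// ler_norm.
- apply: integrableZl => //; apply/integrableP; split; first by apply/measurable_EFinP.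
  under eq_integral => p _ do rewrite /= ger0_norm//.
  rewrite (integral_indic m2 measurableT measurable_rect) setIT; exact: leb2_rect_fin.
Qed.

Lemma integral_derive_closed (f F : R -> R) (a b : R) : a < b ->
  (forall x : R, is_derive x (1 : R) F (f x)) -> continuous f -> F a = F b ->
  (\int[lam]_x (\1_(`[a, b]) x * f x)%:E = 0)%E.
Proof.
move=> ab dF cf FE.
have cF : continuous F.
  by move=> x; apply: differentiable_continuous; apply/derivable1_diffP; exact: ex_derive.
have H : (\int[lam]_(x in `[a, b]) (f x)%:E = (F b)%:E - (F a)%:E)%E.
  apply: continuous_FTC2 => //.
  - by apply: continuous_subspaceT.
  - split; first by move=> x _; exact: ex_derive.
    + by apply: cvg_at_right_filter; exact: cF.
    + by apply: cvg_at_left_filter; exact: cF.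
  - by move=> x _; rewrite derive1E; exact: derive_val.
move: H; rewrite FE subee// => <-.
rewrite [RHS]integral_mkcond; apply: eq_integral => x _.
rewrite patchE indicE; case: ifP => _; by rewrite ?mul1r ?mul0r.
Qed.

Lemma indic_rect p : \1_rect p = \1_(`[0, pi]) p.1 * \1_(`[0, 2 * pi]) p.2 :> R.
Proof. by rewrite /rect !indicE in_setX; case: (_ \in _); case: (_ \in _); rewrite ?mulr0 ?mulr1 ?mul0r. Qed.

Lemma integral_dtheta a A (c : R) : measurable_fun [set: T2] a ->
  (forall p, rect p -> `|a p| <= c) ->
  (forall x y : R, is_derive x (1 : R) (fun s => A (s, y)) (a (x, y))) ->
  (forall y, continuous (fun s => a (s, y))) ->
  (forall y, A (0, y) = A (pi, y)) ->
  (\int[m2]_p (\1_rect p * a p)%:E = 0)%E.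
Proof.
move=> ma ac dA ca AE.
rewrite -(integral21_prod_meas1 (integrable_rect ma ac)).
apply: integral0_eq => y _; rewrite /fubini_G.
have -> : (fun x => (\1_rect (x, y) * a (x, y))%:E) =
    (fun x => (\1_(`[0, 2 * pi]) y)%:E * (\1_(`[0, pi]) x * a (x, y))%:E)%E.
  by apply/funext => x; rewrite indic_rect -EFinM /=; congr (_%:E); ring.
rewrite indicE; case: (_ \in _); last first.
  by apply: integral0_eq => x _; rewrite mul0e.
under eq_integral do rewrite mul1e.
by apply: (integral_derive_closed (F := fun s => A (s, y))) => //; exact: pi_gt0.
Qed.

Lemma integral_dphi a A (c : R) : measurable_fun [set: T2] a ->
  (forall p, rect p -> `|a p| <= c) ->
  (forall x y : R, is_derive y (1 : R) (fun s => A (x, s)) (a (x, y))) ->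
  (forall x, continuous (fun s => a (x, s))) ->
  (forall x, A (x, 0) = A (x, 2 * pi)) ->
  (\int[m2]_p (\1_rect p * a p)%:E = 0)%E.
Proof.
move=> ma ac dA ca AE.
rewrite -(integral12_prod_meas1 (integrable_rect ma ac)).
apply: integral0_eq => x _; rewrite /fubini_F.
have -> : (fun y => (\1_rect (x, y) * a (x, y))%:E) =
    (fun y => (\1_(`[0, pi]) x)%:E * (\1_(`[0, 2 * pi]) y * a (x, y))%:E)%E.
  by apply/funext => y; rewrite indic_rect -EFinM /=; congr (_%:E); ring.
rewrite indicE; case: (_ \in _); last first.
  by apply: integral0_eq => y _; rewrite mul0e.
under eq_integral do rewrite mul1e.
apply: (integral_derive_closed (F := fun s => A (x, s))) => //.
by rewrite mulr_gt0// pi_gt0.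
Qed.

(** The area density in the chart, set to 0 off the rectangle so that all integrals run over the
    whole plane. *)
Definition wgt p : R := \1_rect p * sin p.1.

Lemma measurable_wgt : measurable_fun [set: T2] wgt.
Proof.
apply: measurable_funM; first by apply: measurable_indic; exact: measurable_rect.
apply: measurableT_comp => //; apply: continuous_measurable_fun; exact: continuous_sin.
Qed.

Lemma wgt_ge0 p : 0 <= wgt p.
Proof.
rewrite /wgt indicE; have [/set_mem|_] := boolP (p \in rect); last by rewrite mul0r.
case=> /=; rewrite in_itv /= => /andP[h0 h1] _; rewrite mul1r.
by apply: sin_ge0_pi; rewrite h0 h1.
Qed.

Lemma wgt_fin : (\int[m2]_p (wgt p)%:E < +oo)%E.
Proof.
have ms : measurable_fun [set: T2] (fun p : T2 => sin p.1).
  apply: measurableT_comp => //; apply: continuous_measurable_fun; exact: continuous_sin.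
have h : forall p, rect p -> `|sin p.1 : R| <= 1 by move=> p _; rewrite ler_norml sin_geN1 sin_le1.
have /integrableP[_] := integrable_rect ms h.
rewrite (_ : (\int[m2]_p (wgt p)%:E = \int[m2]_x `|(\1_rect x * sin x.1)%R%:E|)%E)//.
by apply: eq_integral => p _; rewrite abse_EFin ger0_norm//; exact: wgt_ge0.
Qed.

Definition area : {finite_measure set T2 -> \bar R} :=
  density measurable_wgt wgt_ge0 wgt_fin.

(** [F] may differ from [f \o coord] off the rectangle: global measurability is asked of [F]
    only. *)
Lemma sint_area (f : 'rV[R]_3 -> R) (F : T2 -> R) :
  measurable_fun [set: T2] F -> (forall p, rect p -> F p = f (coord p)) ->
  sint f = (\int[area]_p (F p)%:E)%E.
Proof.
move=> mF Ff; rewrite /sint (integral_density measurable_wgt wgt_ge0 wgt_fin mF).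
rewrite [LHS]integral_mkcond; apply: eq_integral => p _.
rewrite patchE /wgt indicE; have [/set_mem pr|_] := boolP (p \in rect).
  by rewrite mul1r Ff.
by rewrite mul0r mulr0.
Qed.

End Rectangle.

(** * Rotation fields *)

Section Rotations.
Context {R : realType}.
Local Notation E := 'rV[R]_3.
Local Notation SmT := (Sm [set: E]).
Implicit Types (f g G : E -> R) (x X Y : E).

Definition cross X Y : E := \row_k
  [:: X 0 1 * Y 0 2%:R - X 0 2%:R * Y 0 1;
      X 0 2%:R * Y 0 0 - X 0 0 * Y 0 2%:R;
      X 0 0 * Y 0 1 - X 0 1 * Y 0 0]`_k.

(* The derivative along the rotation field [e_j x x], sealed so that
   unification never unfolds it. *)
Fact rder_sig : {r : 'I_3 -> (E -> R) -> E -> R |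
  forall j f x, r j f x = 'D_(cross (e_ j) x) f x}.
Proof. by exists (fun j f x => 'D_(cross (e_ j) x) f x). Qed.
Definition rder (j : 'I_3) f x : R := sval rder_sig j f x.

Lemma rderE j f x : rder j f x = 'D_(cross (e_ j) x) f x.
Proof. exact: (svalP rder_sig). Qed.

Lemma derive_sum_coord f v x : SmT f ->
  'D_v f x = v 0 0 * 'D_(e_ 0) f x + v 0 1 * 'D_(e_ 1) f x +
             v 0 2%:R * 'D_(e_ 2%:R) f x.
Proof.
move=> Sf; have df := Sm_differentiable openT Sf (I : setT x).
rewrite !(deriveE _ df).
have {1}-> : v = v 0 0 *: e_ 0 + v 0 1 *: e_ 1 + v 0 2%:R *: e_ 2%:R.
  by rewrite {1}(matrix_sum_delta v) big_ord1 big_ord3.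
by rewrite !linearD !linearZ.
Qed.

Lemma e_E (i j : 'I_3) : (e_ i : E) 0 j = (i == j)%:R.
Proof. by rewrite mxE eqxx eq_sym. Qed.

Lemma rder0E f x : SmT f ->
  rder 0 f x = x 0 1 * 'D_(e_ 2%:R) f x - x 0 2%:R * 'D_(e_ 1) f x.
Proof.
move=> Sf; rewrite rderE derive_sum_coord//.
by move: ('D_(e_ 0) f x) ('D_(e_ 1) f x) ('D_(e_ 2%:R) f x) => a b c; rewrite !mxE /=; ring.
Qed.

Lemma rder1E f x : SmT f ->
  rder 1 f x = x 0 2%:R * 'D_(e_ 0) f x - x 0 0 * 'D_(e_ 2%:R) f x.
Proof.
move=> Sf; rewrite rderE derive_sum_coord//.
by move: ('D_(e_ 0) f x) ('D_(e_ 1) f x) ('D_(e_ 2%:R) f x) => a b c; rewrite !mxE /=; ring.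
Qed.

Lemma rder2E f x : SmT f ->
  rder 2%:R f x = x 0 0 * 'D_(e_ 1) f x - x 0 1 * 'D_(e_ 0) f x.
Proof.
move=> Sf; rewrite rderE derive_sum_coord//.
by move: ('D_(e_ 0) f x) ('D_(e_ 1) f x) ('D_(e_ 2%:R) f x) => a b c; rewrite !mxE /=; ring.
Qed.

Lemma ord3P (P : 'I_3 -> Prop) : P 0 -> P 1 -> P 2%:R -> forall k, P k.
Proof.
move=> P0 P1 P2 [[|[|[|//]]] h].
- by rewrite (_ : Ordinal h = 0) //; apply: val_inj.
- by rewrite (_ : Ordinal h = 1) //; apply: val_inj.
- by rewrite (_ : Ordinal h = 2%:R) //; apply: val_inj.
Qed.

Lemma Sm_rder j f : SmT f -> SmT (rder j f).
Proof.
move=> Sf; have oT := @openT E; have SD v := Sm_derive oT v Sf.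
move: j; apply: ord3P.
- apply: (Sm_eq (SmB (SmM (Sm_coord _ 1) (SD (e_ 2%:R))) (SmM (Sm_coord _ 2%:R) (SD (e_ 1))))).
  by move=> x _; exact: rder0E.
- apply: (Sm_eq (SmB (SmM (Sm_coord _ 2%:R) (SD (e_ 0))) (SmM (Sm_coord _ 0) (SD (e_ 2%:R))))).
  by move=> x _; exact: rder1E.
- apply: (Sm_eq (SmB (SmM (Sm_coord _ 0) (SD (e_ 1))) (SmM (Sm_coord _ 1) (SD (e_ 0))))).
  by move=> x _; exact: rder2E.
Qed.

Lemma rder_cst j (c : R) x : rder j (fun _ => c) x = 0.
Proof. by rewrite rderE; exact: derive_cst. Qed.

Lemma rder_coord j k x : rder j (fun y => y 0 k) x = cross (e_ j) x 0 k.
Proof. by rewrite rderE; exact: derive_coord. Qed.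

Lemma rderD j f g x : SmT f -> SmT g ->
  rder j (fun y => f y + g y) x = rder j f x + rder j g x.
Proof. by move=> Sf Sg; rewrite !rderE; exact: (SmDE openT). Qed.

Lemma rderM j f g x : SmT f -> SmT g ->
  rder j (fun y => f y * g y) x = f x * rder j g x + g x * rder j f x.
Proof. by move=> Sf Sg; rewrite !rderE; exact: (SmME openT). Qed.

Lemma rderZ j (c : R) f x : SmT f -> rder j (fun y => c * f y) x = c * rder j f x.
Proof. by move=> Sf; rewrite rderM// ?rder_cst ?mulr0 ?addr0//; exact: Sm_cst. Qed.

Lemma rderN j f x : SmT f -> rder j (fun y => - f y) x = - rder j f x.
Proof.
move=> Sf; rewrite -mulN1r -rderZ//; congr rder; apply/funext => y.
by rewrite mulN1r.
Qed.

Lemma rderB j f g x : SmT f -> SmT g ->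
  rder j (fun y => f y - g y) x = rder j f x - rder j g x.
Proof. by move=> Sf Sg; rewrite rderD ?rderN//; exact: SmN. Qed.

Lemma rder_expR j f x : SmT f ->
  rder j (fun y => expR (f y)) x = expR (f x) * rder j f x.
Proof. by move=> Sf; rewrite !rderE; exact: (Sm_expRE openT). Qed.

Lemma rder_ln j f x : SmT f -> 0 < f x ->
  rder j (fun y => ln (f y)) x = (f x)^-1 * rder j f x.
Proof. by move=> Sf; rewrite !rderE; exact: (Sm_lnE openT). Qed.

Lemma rder_sum j (I : Type) (r : seq I) (F : I -> E -> R) x :
  (forall i, SmT (F i)) ->
  rder j (fun y => \sum_(i <- r) F i y) x = \sum_(i <- r) rder j (F i) x.
Proof.
move=> SF; elim: r => [|i r IH].
  rewrite big_nil -[RHS](rder_cst j 0 x); congr rder; apply/funext => y.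
  by rewrite big_nil.
rewrite big_cons -IH -rderD//; last exact: Sm_sum.
by congr rder; apply/funext => y; rewrite big_cons.
Qed.

Lemma rder_inv j f x : SmT f -> (forall y, 0 < f y) ->
  rder j (fun y => (f y)^-1) x = - (f x)^-1 ^+ 2 * rder j f x.
Proof.
move=> Sf f0; have SL : SmT (fun y => - ln (f y)) by apply: SmN; exact: Sm_ln.
have -> : (fun y => (f y)^-1) = (fun y => expR (- ln (f y))).
  by apply/funext => y; rewrite expRN lnK// posrE.
rewrite rder_expR// rderN; last exact: Sm_ln.
by rewrite rder_ln// expRN lnK ?posrE//; ring.
Qed.

(** The Lie algebra of rotations. A commutator of derivations is a derivation, so induction over
    [Sm] reduces the identities to coordinate functions, where they are a computation with
    [cross]. *)
Lemma rder_comm f : SmT f ->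
  [/\ forall x, rder 0 (rder 1 f) x - rder 1 (rder 0 f) x = - rder 2%:R f x,
      forall x, rder 1 (rder 2%:R f) x - rder 2%:R (rder 1 f) x = - rder 0 f x &
      forall x, rder 2%:R (rder 0 f) x - rder 0 (rder 2%:R f) x = - rder 1 f x].
Proof.
have rext i (a b : E -> R) x : a =1 b -> rder i a x = rder i b x.
  by move=> ab; congr rder; apply/funext.
have key (i j k : 'I_3) : (forall l x, rder i (rder j (fun y => y 0 l)) x -
    rder j (rder i (fun y => y 0 l)) x = - rder k (fun y => y 0 l) x) ->
    SmT f -> forall x, rder i (rder j f) x - rder j (rder i f) x = - rder k f x.
  move=> H.
  have Ec g y : (forall x, rder i (rder j g) x - rder j (rder i g) x = - rder k g x) ->
      rder i (rder j g) y = rder j (rder i g) y - rder k g y.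
    by move=> /(_ y) <-; rewrite addrC subrK.
  elim=> {f}.
  - move=> c x.
    by rewrite !(rext _ _ (fun=> 0) x (rder_cst _ c)) !rder_cst subrr oppr0.
  - by move=> l x; exact: H.
  - move=> f g Sf Hf Sg Hg x; have Sr := Sm_rder.
    rewrite (rext i _ _ x (fun y => rderD j y Sf Sg)) (rext j _ _ x (fun y => rderD i y Sf Sg)).
    rewrite !rderD//; try exact: Sm_rder.
    by rewrite (Ec _ x Hf) (Ec _ x Hg); ring.
  - move=> f g Sf Hf Sg Hg x.
    have S1 l := Sm_rder l Sf; have S2 l := Sm_rder l Sg.
    rewrite (rext i _ _ x (fun y => rderM j y Sf Sg)) (rext j _ _ x (fun y => rderM i y Sf Sg)).
    rewrite !rderD; try exact: SmM.
    rewrite !rderM//.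
    by rewrite (Ec _ x Hf) (Ec _ x Hg); ring.
  - move=> f Sf Hf x; have S1 l := Sm_rder l Sf; have S2 := Sm_expR Sf.
    rewrite (rext i _ _ x (fun y => rder_expR j y Sf)) (rext j _ _ x (fun y => rder_expR i y Sf)).
    by rewrite !rderM// !rder_expR// (Ec _ x Hf); ring.
  - move=> f Sf Hf f0 x; have S1 l := Sm_rder l Sf; have S2 := SmV Sf f0.
    have p0 y : 0 < f y by exact: f0.
    rewrite (rext i _ _ x (fun y => rder_ln j Sf (p0 y))) (rext j _ _ x (fun y => rder_ln i Sf (p0 y))).
    by rewrite !rderM// !rder_inv// rder_ln// (Ec _ x Hf); ring.
  - by move=> f g Sf Hf fg; have -> : g = f by apply/funext => x; exact: fg.
have rc i j l x : rder i (rder j (fun y : E => y 0 l)) x =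
    rder i (fun y => cross (e_ j) y 0 l) x.
  by apply: rext => y; exact: rder_coord.
have rcr i j l x : rder i (fun y => cross (e_ j) y 0 l) x = cross (e_ j) (cross (e_ i) x) 0 l.
  have cE y : cross (e_ j) y 0 l = \sum_k cross (e_ j) (e_ k) 0 l * y 0 k.
    move: l; apply: ord3P; rewrite big_ord3 !mxE /= ?e_E; move: j; apply: ord3P; rewrite /=; ring.
  rewrite (rext _ _ _ x cE) rder_sum; last by move=> k; apply: SmZ; exact: Sm_coord.
  rewrite cE; apply: eq_bigr => k _; rewrite rderZ ?rder_coord//; exact: Sm_coord.
move=> Sf; split; apply: key => // l x; rewrite !rc !rcr rder_coord;
  move: l; apply: ord3P; rewrite !mxE /=; ring.
Qed.

End Rotations.

(** * Spherical coordinates and integration along rotation fields *)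

Section SphericalCoordinates.
Context {R : realType}.
Local Notation E := 'rV[R]_3.
Local Notation T2 := (measurableTypeR R * measurableTypeR R)%type.
Local Notation SmT := (Sm [set: E]).
Implicit Types (f G : E -> R) (p : T2).

Lemma coord_sphere (p : T2) : dot (coord p) (coord p) = 1 :> R.
Proof.
rewrite dot3 !mxE /=; have := cos2Dsin2 p.1; have := cos2Dsin2 p.2.
move: (cos p.1) (sin p.1) (cos p.2) (sin p.2) => a b c d h1 h2.
by rewrite [LHS](_ : _ = b ^+ 2 * (c ^+ 2 + d ^+ 2) + a ^+ 2); [rewrite h1 mulr1 addrC|ring].
Qed.

Definition coord_theta (p : R * R) : E :=
  \row_j [:: cos p.1 * cos p.2; cos p.1 * sin p.2; - sin p.1]`_j.

Definition coord_phi (p : R * R) : E :=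
  \row_j [:: - (sin p.1 * sin p.2); sin p.1 * cos p.2; 0]`_j.

Definition dtheta f p : R := 'D_(coord_theta p) f (coord p).
Definition dphi f p : R := 'D_(coord_phi p) f (coord p).

Lemma dthetaE f p : SmT f -> dtheta f p =
  cos p.1 * cos p.2 * 'D_(e_ 0) f (coord p) + cos p.1 * sin p.2 * 'D_(e_ 1) f (coord p)
  - sin p.1 * 'D_(e_ 2%:R) f (coord p).
Proof.
move=> Sf; rewrite /dtheta (derive_sum_coord _ _ Sf).
move: ('D_(e_ 0) f _) ('D_(e_ 1) f _) ('D_(e_ 2%:R) f _) => a b c.
by rewrite !mxE /= mulNr.
Qed.

Lemma dphiE f p : SmT f -> dphi f p =
  - (sin p.1 * sin p.2) * 'D_(e_ 0) f (coord p) + sin p.1 * cos p.2 * 'D_(e_ 1) f (coord p).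
Proof.
move=> Sf; rewrite /dphi (derive_sum_coord _ _ Sf).
move: ('D_(e_ 0) f _) ('D_(e_ 1) f _) ('D_(e_ 2%:R) f _) => a b c.
by rewrite !mxE /= mul0r addr0.
Qed.

Lemma is_derive_theta f x y : SmT f ->
  is_derive x (1 : R) (fun s => f (coord (s, y))) (dtheta f (x, y)).
Proof.
move=> Sf; apply: (Sm_curve (c := fun s => coord (s, y))) => //.
apply: ord3P; rewrite mxE /=.
- rewrite (_ : (fun r => _) = (fun r => sin r * cos y)); last by apply/funext => r; rewrite mxE.
  by apply: is_derive_eq; rewrite scaler0 add0r [LHS]mulrC.
- rewrite (_ : (fun r => _) = (fun r => sin r * sin y)); last by apply/funext => r; rewrite mxE.
  by apply: is_derive_eq; rewrite scaler0 add0r [LHS]mulrC.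
- by rewrite (_ : (fun r => _) = cos); [exact: is_derive_cos|apply/funext => r; rewrite mxE].
Qed.

Lemma is_derive_phi f x y : SmT f ->
  is_derive y (1 : R) (fun s => f (coord (x, s))) (dphi f (x, y)).
Proof.
move=> Sf; apply: (Sm_curve (c := fun s => coord (x, s))) => //.
apply: ord3P; rewrite mxE /=.
- rewrite (_ : (fun r => _) = (fun r => sin x * cos r)); last by apply/funext => r; rewrite mxE.
  apply: (is_derive_eq (@is_deriveZ _ _ _ cos (sin x) y 1 _ (is_derive_cos y))).
  exact: mulrN.
- rewrite (_ : (fun r => _) = (fun r => sin x * sin r)); last by apply/funext => r; rewrite mxE.
  exact: (@is_deriveZ _ _ _ sin (sin x) y 1 _ (is_derive_sin y)).
- by rewrite (_ : (fun r => _) = cst (cos x)); [exact: is_derive_cst|apply/funext => r; rewrite mxE].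
Qed.

Lemma derive_continuous (F : R -> R) (dF : R -> R) :
  (forall x, is_derive x (1 : R) F (dF x)) -> continuous F.
Proof.
move=> dF' x; apply: differentiable_continuous; apply/derivable1_diffP.
by have [] := dF' x.
Qed.

Lemma continuous_theta f y : SmT f -> continuous (fun s => f (coord (s, y))).
Proof. move=> Sf; apply: derive_continuous => x; exact: is_derive_theta. Qed.

Lemma continuous_phi f x : SmT f -> continuous (fun s => f (coord (x, s))).
Proof. move=> Sf; apply: derive_continuous => y; exact: is_derive_phi. Qed.

Lemma continuousD_fun (F G : R -> R) : continuous F -> continuous G ->
  continuous (fun x => F x + G x).
Proof. by move=> cF cG x; apply: cvgD; [exact: cF|exact: cG]. Qed.

Lemma continuousM_fun (F G : R -> R) : continuous F -> continuous G ->
  continuous (fun x => F x * G x).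
Proof. by move=> cF cG x; apply: cvgM; [exact: cF|exact: cG]. Qed.

Lemma continuousN_fun (F : R -> R) : continuous F -> continuous (fun x => - F x).
Proof. by move=> cF x; apply: cvgN; exact: cF. Qed.

Lemma continuous_derive_theta f y : SmT f ->
  continuous (fun s => dtheta f (s, y)).
Proof.
move=> Sf; have SD v := Sm_derive openT v Sf.
rewrite (_ : (fun s => _) = fun s => cos s * cos y * 'D_(e_ 0) f (coord (s, y)) +
   cos s * sin y * 'D_(e_ 1) f (coord (s, y)) + - sin s * 'D_(e_ 2%:R) f (coord (s, y))).
  have cc : continuous (@cos R) := @continuous_cos R.
  have cs : continuous (@sin R) := @continuous_sin R.
  have ck (k : R) : continuous (fun _ : R => k) by move=> x; exact: cvg_cst.
  have cD v := @continuous_theta _ y (SD v).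
  apply: continuousD_fun; last first.
    by apply: continuousM_fun; [apply: continuousN_fun|exact: cD].
  by apply: continuousD_fun; (apply: continuousM_fun; last exact: cD);
    apply: continuousM_fun.
by apply/funext => s; rewrite dthetaE// mulNr.
Qed.

Lemma continuous_derive_phi f x : SmT f ->
  continuous (fun s => dphi f (x, s)).
Proof.
move=> Sf; have SD v := Sm_derive openT v Sf.
rewrite (_ : (fun s => _) = fun s => - (sin x * sin s) * 'D_(e_ 0) f (coord (x, s)) +
   sin x * cos s * 'D_(e_ 1) f (coord (x, s))).
  have cc : continuous (@cos R) := @continuous_cos R.
  have cs : continuous (@sin R) := @continuous_sin R.
  have ck (k : R) : continuous (fun _ : R => k) by move=> y; exact: cvg_cst.
  have cD v := @continuous_phi _ x (SD v).
  apply: continuousD_fun; (apply: continuousM_fun; last exact: cD).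
    by apply: continuousN_fun; apply: continuousM_fun.
  exact: continuousM_fun.
by apply/funext => s; rewrite dphiE.
Qed.

Lemma measurable_coord j : measurable_fun [set: T2] (fun p => coord p 0 j).
Proof.
have ms : measurable_fun [set: R] (@sin R).
  by apply: continuous_measurable_fun; exact: continuous_sin.
have mc : measurable_fun [set: R] (@cos R).
  by apply: continuous_measurable_fun; exact: continuous_cos.
have s1 : measurable_fun [set: T2] (fun p => sin p.1) by apply: measurableT_comp.
have s2 : measurable_fun [set: T2] (fun p => sin p.2) by apply: measurableT_comp.
have c1 : measurable_fun [set: T2] (fun p => cos p.1) by apply: measurableT_comp.
have c2 : measurable_fun [set: T2] (fun p => cos p.2) by apply: measurableT_comp.
move: j; apply: ord3P.
- rewrite (_ : (fun p => _) = fun p : T2 => sin p.1 * cos p.2); first exact: measurable_funM.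
  by apply/funext => p; rewrite mxE.
- rewrite (_ : (fun p => _) = fun p : T2 => sin p.1 * sin p.2); first exact: measurable_funM.
  by apply/funext => p; rewrite mxE.
- by rewrite (_ : (fun p => _) = fun p : T2 => cos p.1) //; apply/funext => p; rewrite mxE.
Qed.

Lemma measurable_Sm f : SmT f -> measurable_fun [set: T2] (fun p => f (coord p)).
Proof. by move=> Sf; apply: Sm_measurable => //; exact: measurable_coord. Qed.

Lemma Sm_dot (v : E) : SmT (fun x => dot v x).
Proof.
apply: Sm_sum => j; apply: SmZ; exact: Sm_coord.
Qed.

Lemma Sm_dotxx : SmT (fun x => dot x x).
Proof. by apply: Sm_sum => j; apply: SmM; exact: Sm_coord. Qed.

Lemma compact_sphere : compact (sphere : set E).
Proof.
apply: bounded_closed_compact.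
  exists 1; split => // M M1 x /= x1; apply: le_trans (ltW M1).
  rewrite [leLHS]/Num.Def.normr/= mx_normrE (bigmax_le _ ler01)// => -[i j] _ /=.
  rewrite ord1 -(@ler_pXn2r _ 2) ?nnegrE// real_normK ?num_real// expr1n.
  rewrite -x1 /dot (bigD1 j)//= expr2 lerDl.
  by apply: sumr_ge0 => k _; rewrite -expr2 sqr_ge0.
rewrite (_ : sphere = (fun x : E => dot x x) @^-1` [set 1])//.
apply: closed_comp; last exact: closed_eq.
by move=> x _; exact: Sm_continuous Sm_dotxx x.
Qed.

Lemma sphere_neq0 : (sphere : set E) !=set0.
Proof. by exists (coord (0, 0)); exact: coord_sphere. Qed.

Lemma sphere_bounded f : {in sphere, continuous f} ->
  exists c : R, forall x, sphere x -> `|f x| <= c.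
Proof.
move=> cf; have cf' : {within sphere, continuous f} by apply: continuous_in_subspaceT.
have [a _ Ha] := @compact_EVT_max _ R f sphere sphere_neq0 compact_sphere cf'.
have [b _ Hb] := @compact_EVT_min _ R f sphere sphere_neq0 compact_sphere cf'.
exists (`|f a| + `|f b|) => x /mem_set xs; have := Ha x xs; have := Hb x xs.
move: (f a) (f b) (f x) => u v w h1 h2; rewrite ler_norml.
have := ler_norm u; have := ler_norm (- v); rewrite normrN.
by have := normr_ge0 u; have := normr_ge0 v; move=> *; apply/andP; split; lra.
Qed.

Lemma Sm_bounded f : SmT f -> exists c : R, forall p, `|f (coord p)| <= c.
Proof.
move=> Sf; have [|c h] := @sphere_bounded f.
  by move=> x _; exact: Sm_continuous.
by exists c => p; apply: h; exact: coord_sphere.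
Qed.

Local Notation lam := (@lebesgue_measure R).
Local Notation m2 := (lam \x lam : {measure set T2 -> \bar R})%E.

Definition mb (a : T2 -> R) : Prop :=
  measurable_fun [set: T2] a /\ exists c : R, forall p, `|a p| <= c.

Lemma eq_mb a b : a =1 b -> mb a -> mb b.
Proof. by move=> /funext <-. Qed.

Lemma mbD a b : mb a -> mb b -> mb (fun p => a p + b p).
Proof.
move=> [ma [c ac]] [m' [d bd]]; split; first exact: measurable_funD.
by exists (c + d) => p; rewrite (le_trans (ler_normD _ _))// lerD.
Qed.

Lemma mbM a b : mb a -> mb b -> mb (fun p => a p * b p).
Proof.
move=> [ma [c ac]] [m' [d bd]]; split; first exact: measurable_funM.
by exists (c * d) => p; rewrite normrM ler_pM.
Qed.

Lemma mbN a : mb a -> mb (fun p => - a p).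
Proof.
move=> [ma [c ac]]; split; first exact: measurable_funN.
by exists c => p; rewrite normrN.
Qed.

Lemma mb_Sm f : SmT f -> mb (fun p => f (coord p)).
Proof. by move=> Sf; split; [exact: measurable_Sm|exact: Sm_bounded]. Qed.

Lemma mb_trig : [/\ mb (fun p => sin p.1), mb (fun p => cos p.1),
  mb (fun p => sin p.2) & mb (fun p => cos p.2)].
Proof.
have ms : measurable_fun [set: R] (@sin R).
  by apply: continuous_measurable_fun; exact: continuous_sin.
have mc : measurable_fun [set: R] (@cos R).
  by apply: continuous_measurable_fun; exact: continuous_cos.
by split; (split; [exact: measurableT_comp|exists 1 => p]); rewrite ?sin_max ?cos_max.
Qed.

Lemma mb_dtheta f : SmT f -> mb (dtheta f).
Proof.
move=> Sf; have SD v := mb_Sm (Sm_derive openT v Sf); have [s1 c1 s2 c2] := mb_trig.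
apply: (eq_mb (fun p => esym (dthetaE p Sf))).
by apply: mbD; [apply: mbD; (apply: mbM => //; exact: mbM)|apply: mbN; exact: mbM].
Qed.

Lemma mb_dphi f : SmT f -> mb (dphi f).
Proof.
move=> Sf; have SD v := mb_Sm (Sm_derive openT v Sf); have [s1 c1 s2 c2] := mb_trig.
apply: (eq_mb (fun p => esym (dphiE p Sf))).
by apply: mbD; apply: mbM => //; [apply: mbN|]; exact: mbM.
Qed.

(** The integrand is the theta-derivative of [g * sin theta * f], which vanishes at both poles. *)
Lemma integral_theta f (g : R -> R) : SmT f -> mb (fun p => g p.2) ->
  (\int[m2]_p (\1_rect p * (g p.2 * (cos p.1 * f (coord p) + sin p.1 * dtheta f p)))%:E = 0)%E.
Proof.
move=> Sf mg; have [s1 c1 s2 c2] := mb_trig.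
have [ma [c ac]] : mb (fun p => g p.2 * (cos p.1 * f (coord p) + sin p.1 * dtheta f p)).
  by apply: mbM => //; apply: mbD; apply: mbM => //; [exact: mb_Sm|exact: mb_dtheta].
apply: (integral_dtheta (A := fun p => g p.2 * (sin p.1 * f (coord p))) ma (c := c)).
- by move=> p _; exact: ac.
- move=> x y /=.
  have h := is_deriveZ (g y) (is_deriveM (is_derive_sin x) (is_derive_theta x y Sf)).
  apply: (is_derive_eq h); congr (_ * _); rewrite addrC; congr (_ + _).
  exact: mulrC.
- move=> y /=; have ck (k : R) : continuous (fun _ : R => k) by move=> x; exact: cvg_cst.
  apply: continuousM_fun => //; apply: continuousD_fun; apply: continuousM_fun.
  + exact: continuous_cos.
  + exact: continuous_theta.
  + exact: continuous_sin.
  + exact: continuous_derive_theta.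
- by move=> y /=; rewrite sin0 sinpi !mul0r.
Qed.

(** The integrand is the phi-derivative of [h * g * f], which takes equal values at 0 and [2 pi]. *)
Lemma integral_phi f (h g g' : R -> R) : SmT f ->
  mb (fun p => h p.1) -> mb (fun p => g p.2) -> mb (fun p => g' p.2) ->
  (forall y : R, is_derive y (1 : R) g (g' y)) -> continuous g' -> g 0 = g (2 * pi) ->
  (\int[m2]_p (\1_rect p * (h p.1 * (g' p.2 * f (coord p) + g p.2 * dphi f p)))%:E = 0)%E.
Proof.
move=> Sf mh mg mg' dg cg' gE.
have [ma [c ac]] : mb (fun p => h p.1 * (g' p.2 * f (coord p) + g p.2 * dphi f p)).
  by apply: mbM => //; apply: mbD; apply: mbM => //; [exact: mb_Sm|exact: mb_dphi].
apply: (integral_dphi (A := fun p => h p.1 * (g p.2 * f (coord p))) ma (c := c)).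
- by move=> p _; exact: ac.
- move=> x y /=.
  have H := is_deriveZ (h x) (is_deriveM (dg y) (is_derive_phi x y Sf)).
  apply: (is_derive_eq H); congr (_ * _); rewrite addrC; congr (_ + _).
  exact: mulrC.
- move=> x /=; have ck (k : R) : continuous (fun _ : R => k) by move=> y; exact: cvg_cst.
  apply: continuousM_fun => //; apply: continuousD_fun; apply: continuousM_fun => //.
  + exact: continuous_phi.
  + exact: derive_continuous dg.
  + exact: continuous_derive_phi.
- move=> x /=; rewrite gE; congr (_ * (_ * f _)); apply/matrixP => i j; rewrite !mxE /=.
  by rewrite [2 * pi]mulr_natl cos2pi sin2pi cos0 sin0.
Qed.

Local Notation Int := (Lint (@area R)).
Local Notation L1 := (L1fun (@area R)).

Lemma L1_mb (a : T2 -> R) : mb a -> L1 a.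
Proof. by move=> [ma [c ac]]; exact: (L1_bounded _ ma ac). Qed.

Lemma Int_area (a : T2 -> R) : mb a ->
  (Int a)%:E = (\int[m2]_p (\1_rect p * (sin p.1 * a p))%:E)%E.
Proof.
move=> ha; rewrite (Int_EFin (L1_mb ha)).
rewrite (integral_density measurable_wgt wgt_ge0 wgt_fin ha.1).
by apply: eq_integral => p _; rewrite /wgt mulrC mulrA.
Qed.

Lemma integral_rectD (a b : T2 -> R) : mb a -> mb b ->
  (\int[m2]_p (\1_rect p * (a p + b p))%:E =
   \int[m2]_p (\1_rect p * a p)%:E + \int[m2]_p (\1_rect p * b p)%:E)%E.
Proof.
move=> [ma [c ac]] [m' [d bd]].
have Ha := integrable_rect ma (fun p _ => ac p).
have Hb := integrable_rect m' (fun p _ => bd p).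
rewrite -(integralD measurableT Ha Hb); apply: eq_integral => p _.
by rewrite mulrDr EFinD.
Qed.

(** Rotations preserve area: multiplied by the density, [rder j G] becomes a sum of coordinate
    derivatives without boundary terms. *)
Lemma Int_rder j G : SmT G -> Int (fun p => rder j G (coord p)) = 0.
Proof.
move=> SG; have [s1 c1 s2 c2] := mb_trig.
have mr k : mb (fun p => rder k G (coord p)) by apply: mb_Sm; exact: Sm_rder.
have mt := mb_dtheta SG; have mp := mb_dphi SG; have mG := mb_Sm SG.
have mbns : mb (fun p => - sin p.2) := mbN s2.
have mbnc : mb (fun p => - cos p.2) := mbN c2.
have mbncy : mb (fun p => - cos p.1) := mbN c1.
have cc : continuous (@cos R) := @continuous_cos R.
have cs : continuous (@sin R) := @continuous_sin R.
have mb1 : mb (fun=> 1) by split; [exact: measurable_cst|by exists 1 => p; rewrite normr1].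
have mb0 : mb (fun=> 0) by split; [exact: measurable_cst|by exists 0 => p; rewrite normr0].
have e2 : (2 : R) * pi = pi *+ 2 by rewrite mulr_natl.
have mbT (g : R -> R) : mb (fun p => g p.2) ->
    mb (fun p => g p.2 * (cos p.1 * G (coord p) + sin p.1 * dtheta G p)).
  by move=> mg; apply: mbM => //; apply: mbD; apply: mbM.
have mbP (h g g' : R -> R) : mb (fun p => h p.1) -> mb (fun p => g p.2) ->
    mb (fun p => g' p.2) ->
    mb (fun p => h p.1 * (g' p.2 * G (coord p) + g p.2 * dphi G p)).
  by move=> mh mg mg'; apply: mbM => //; apply: mbD; apply: mbM.
have trig (p : T2) : cos p.2 ^+ 2 + sin p.2 ^+ 2 = 1 :> R by exact: cos2Dsin2.
have cos2pi' : cos (2 * pi) = 1 :> R by rewrite e2 cos2pi.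
have sin2pi' : sin (2 * pi) = 0 :> R by rewrite e2 sin2pi.
suff H : ((Int (fun p => rder j G (coord p)))%:E = 0%:E)%E by move: H => [].
rewrite Int_area//; move: j; apply: ord3P.
(* [sin theta R_0 G = d_theta (- sin phi sin theta G) + d_phi (- cos theta cos phi G)]; the
   zero-order terms cancel. *)
- have H1 := integral_theta (g := fun y => - sin y) SG mbns.
  have H2 := integral_phi (h := fun x => - cos x) (g := cos) (g' := fun y => - sin y)
    SG mbncy c2 mbns (@is_derive_cos R) (continuousN_fun cs) (etrans (@cos0 R) (esym cos2pi')).
  have H3 : forall x a b : \bar R, x = (a + b)%E -> a = 0%E -> b = 0%E -> x = 0%E.
    by move=> x a b -> -> ->; rewrite adde0.
  rewrite -[RHS](H3 _ _ _ (integral_rectD (mbT (fun y => - sin y) mbns) (mbP (fun x => - cos x) cos (fun y => - sin y) mbncy c2 mbns)) H1 H2) {H1 H2 H3}; apply: eq_integral => p _; congr (_ * _)%:E.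
  rewrite (rder0E _ SG) (dthetaE _ SG) (dphiE _ SG).
  move: ('D_(e_ 0) G _) ('D_(e_ 1) G _) ('D_(e_ 2%:R) G _) (G _) (trig p) => a b c g.
  rewrite !mxE /=; move: (cos p.1) (sin p.1) (cos p.2) (sin p.2) => x y z w h.
  apply/eqP; rewrite -subr_eq0; apply/eqP.
  rewrite [LHS](_ : _ = x * y * b * (z ^+ 2 + w ^+ 2 - 1)); last by ring.
  by rewrite h subrr mulr0.
(* [sin theta R_1 G = d_theta (cos phi sin theta G) + d_phi (- cos theta sin phi G)]. *)
- have H1 := integral_theta (g := cos) SG c2.
  have H2 := integral_phi (h := fun x => - cos x) (g := sin) (g' := cos)
    SG mbncy s2 c2 (@is_derive_sin R) cc (etrans (@sin0 R) (esym sin2pi')).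
  have H3 : forall x a b : \bar R, x = (a + b)%E -> a = 0%E -> b = 0%E -> x = 0%E.
    by move=> x a b -> -> ->; rewrite adde0.
  rewrite -[RHS](H3 _ _ _ (integral_rectD (mbT cos c2) (mbP (fun x => - cos x) sin cos mbncy s2 c2)) H1 H2) {H1 H2 H3}; apply: eq_integral => p _; congr (_ * _)%:E.
  rewrite (rder1E _ SG) (dthetaE _ SG) (dphiE _ SG).
  move: ('D_(e_ 0) G _) ('D_(e_ 1) G _) ('D_(e_ 2%:R) G _) (G _) (trig p) => a b c g.
  rewrite !mxE /=; move: (cos p.1) (sin p.1) (cos p.2) (sin p.2) => x y z w h.
  apply/eqP; rewrite -subr_eq0; apply/eqP.
  rewrite [LHS](_ : _ = x * y * a * (1 - (z ^+ 2 + w ^+ 2))); last by ring.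
  by rewrite h subrr mulr0.
(* The rotation about the axis is [d_phi], and [sin theta] does not depend on phi. *)
- have c1' : continuous (fun _ : R => 0 : R) by move=> y; exact: cvg_cst.
  rewrite -[RHS](integral_phi (h := sin) (g := fun=> 1) (g' := fun=> 0) SG s1 mb1 mb0
    (fun y => is_derive_cst _ _ _) c1' erefl).
  apply: eq_integral => p _; congr (_ * _)%:E; rewrite (rder2E _ SG) (dphiE _ SG).
  move: ('D_(e_ 0) G _) ('D_(e_ 1) G _) (G _) => a b g.
  by rewrite !mxE /=; ring.
Qed.

End SphericalCoordinates.

(** * The rotation inequality *)

Section RotationInequality.
Context {R : realType}.
Local Notation E := 'rV[R]_3.
Local Notation SmT := (Sm [set: E]).
Local Notation T2 := (measurableTypeR R * measurableTypeR R)%type.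
Local Notation Int := (Lint (@area R)).
Local Notation L1 := (L1fun (@area R)).
Implicit Types (f : E -> R) (x y : E) (v w : 'cV[R]_4).

Definition Smv (psi : E -> 'cV[R]_4) : Prop := forall k, SmT (fun x => psi x k 0).

Definition rderv j (psi : E -> 'cV[R]_4) x : 'cV[R]_4 :=
  \col_k rder j (fun y => psi y k 0) x.

Definition ev (j : 'I_3) v : 'cV[R]_4 := qmul (e_ j) v.

Lemma rder_ext j f g x : f =1 g -> rder j f x = rder j g x.
Proof. by move=> /funext ->. Qed.

Lemma Smv_rderv j psi : Smv psi -> Smv (rderv j psi).
Proof.
move=> Sp k; apply: (Sm_eq (Sm_rder j (Sp k))) => x _; by rewrite mxE.
Qed.

Lemma evE j v : ev j v = \col_k \sum_l ev j (delta_mx l 0) k 0 * v l 0.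
Proof.
by apply/matrixP => k i; rewrite ord1 [RHS]mxE; exact: qmul_delta.
Qed.

Lemma Smv_ev j psi : Smv psi -> Smv (fun x => ev j (psi x)).
Proof.
move=> Sp k; apply: (@Sm_eq _ _ (fun x => \sum_l ev j (delta_mx l 0) k 0 * psi x l 0)).
  by apply: Sm_sum => l; exact: SmZ.
by move=> x _; rewrite evE mxE.
Qed.

Lemma rderv_ev i j psi x : Smv psi ->
  rderv i (fun y => ev j (psi y)) x = ev j (rderv i psi x).
Proof.
move=> Sp; apply/matrixP => k z; rewrite ord1 mxE [RHS](qmul_delta _ (rderv i psi x) k).
rewrite (@rder_ext _ _ (fun x => \sum_l ev j (delta_mx l 0) k 0 * psi x l 0)); last first.
  by move=> y; rewrite evE mxE.
rewrite rder_sum; last by move=> l; exact: SmZ.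
by apply: eq_bigr => l _; rewrite rderZ// [rderv i psi x l 0]mxE.
Qed.

Lemma Sm_ip psi phi : Smv psi -> Smv phi -> SmT (fun x => ip (psi x) (phi x)).
Proof. by move=> Sp Sf; apply: Sm_sum => k; exact: SmM. Qed.

Lemma rder_ip j psi phi x : Smv psi -> Smv phi ->
  rder j (fun y => ip (psi y) (phi y)) x =
  ip (rderv j psi x) (phi x) + ip (psi x) (rderv j phi x).
Proof.
move=> Sp Sf; rewrite rder_sum; last by move=> k; exact: SmM.
rewrite /ip -big_split; apply: eq_bigr => k _.
by rewrite rderM// !mxE addrC [X in X + _]mulrC.
Qed.

Lemma ipDl v w z : ip (v + w) z = ip v z + ip w z.
Proof. by rewrite !ip4 !mxE; ring. Qed.

Lemma ipC v w : ip v w = ip w v.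
Proof. by rewrite !ip4; ring. Qed.

Lemma ipDr v w z : ip z (v + w) = ip z v + ip z w.
Proof. by rewrite !(ipC z) ipDl. Qed.

Lemma ipZl (c : R) v w : ip (c *: v) w = c * ip v w.
Proof. by rewrite ipC ipZr ipC. Qed.

Lemma ipNr v w : ip v (- w) = - ip v w.
Proof. by rewrite -scaleN1r ipZr mulN1r. Qed.

Lemma ipNl v w : ip (- v) w = - ip v w.
Proof. by rewrite ipC ipNr ipC. Qed.

Lemma nsqD v w : nsq (v + w) = nsq v + nsq w + 2 * ip v w.
Proof. by rewrite /nsq !ipDl !ipDr (ipC w v); ring. Qed.

Definition curl3 (a b c : 'cV[R]_4) : 'cV[R]_4 := ev 0 a + ev 1 b + ev 2%:R c.

Lemma ev_mul v : [/\ ev 0 (ev 1 v) = - ev 2%:R v, ev 1 (ev 2%:R v) = - ev 0 v &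
  ev 2%:R (ev 0 v) = - ev 1 v].
Proof.
by split; apply/matrixP => k i; rewrite ord1; move: k; apply: ord4P;
  rewrite !mxE /=; ring.
Qed.

Lemma dot_e (i j : 'I_3) : dot (e_ i) (e_ j) = (i == j)%:R :> R.
Proof.
by rewrite dot3 !e_E; move: i j; do 2 apply: ord3P => /=; ring.
Qed.

Lemma ev_mulN v : [/\ ev 1 (ev 0 v) = ev 2%:R v, ev 2%:R (ev 1 v) = ev 0 v &
  ev 0 (ev 2%:R v) = ev 1 v].
Proof.
have h i j : i != j -> ev i (ev j v) = - ev j (ev i v).
  move=> ij; apply/eqP; rewrite -addr_eq0 /ev qmulAC dot_e (negbTE ij).
  by rewrite mulr0 scale0r.
by have [h1 h2 h3] := ev_mul v; split; rewrite h// ?h1 ?h2 ?h3 opprK.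
Qed.

Lemma ev_sq j v : ev j (ev j v) = - v.
Proof. by rewrite /ev qmul_sq dot_e eqxx scaleN1r. Qed.

Lemma ip_ev j v w : ip (ev j v) w = - ip v (ev j w).
Proof. exact: ip_qmul. Qed.

Lemma nsq_ev j v : nsq (ev j v) = nsq v.
Proof. by rewrite /ev nsq_qmul dot_e eqxx mul1r. Qed.

(** Each [I_j] is an isometry, and a product of two distinct ones is plus or minus the third. The
    mixed terms are written antisymmetrically, the form in which they will be a divergence up to
    commutators. *)
Lemma nsq_curl3 a b c : nsq (curl3 a b c) = nsq a + nsq b + nsq c +
  (ip a (ev 2%:R b) - ip a (ev 1 c) + (ip b (ev 0 c) - ip b (ev 2%:R a)) +
   (ip c (ev 1 a) - ip c (ev 0 b))).
Proof.
rewrite /curl3 !nsqD ipDl !nsq_ev !ip_ev.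
have [-> _ _] := ev_mul b; have [_ -> _] := ev_mul c; have [_ _ ->] := ev_mulN c.
rewrite !ipNr.
have E1 : ip b (ev 2%:R a) = - ip a (ev 2%:R b) by rewrite ipC ip_ev.
have E2 : ip c (ev 1 a) = - ip a (ev 1 c) by rewrite ipC ip_ev.
have E3 : ip c (ev 0 b) = - ip b (ev 0 c) by rewrite ipC ip_ev.
by rewrite E1 E2 E3; ring.
Qed.

Lemma nsq_curl3_arith (i1 i2 i3 i4 i5 i6 y0 y1 y2 n na nb nc : R) :
  i1 + i2 + i3 = n -> i4 + i5 + i6 = 0 -> y0 + y1 + y2 = 1 ->
  0 <= na + (1 - y0) * (4^-1 * n) - i1 + i4 + (nb + (1 - y1) * (4^-1 * n) - i2 + i5) +
    (nc + (1 - y2) * (4^-1 * n) - i3 + i6) ->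
  n <= 2 * (na + nb + nc).
Proof.
move=> EF XF X1 H.
have Y : (1 - y0) * (4^-1 * n) + (1 - y1) * (4^-1 * n) + (1 - y2) * (4^-1 * n) = 2^-1 * n.
  by rewrite -!mulrDl (_ : 1 - y0 + (1 - y1) + (1 - y2) = 2); [field|lra].
lra.
Qed.

(* Decompose [v_j + (I_j - x_j I(x)) w] with [w = F / 2]. *)
Lemma nsq_curl3_le x a b c : dot x x = 1 ->
  x 0 0 *: a + x 0 1 *: b + x 0 2%:R *: c = 0 ->
  nsq (curl3 a b c) <= 2 * (nsq a + nsq b + nsq c).
Proof.
move=> x1 xv; set F := curl3 a b c.
have h j v : nsq (v + qmul (e_ j - x 0 j *: x) (2^-1 *: F)) =
    nsq v + (1 - x 0 j ^+ 2) * (4^-1 * nsq F) - ip (ev j v) F + ip (qmul x (x 0 j *: v)) F.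
  rewrite nsqD nsq_qmul nsqZ ipC ip_qmul ipZl ipC qmulBl qmulZl.
  have -> : dot (e_ j - x 0 j *: x) (e_ j - x 0 j *: x) = 1 - x 0 j ^+ 2 :> R.
    rewrite dotBB !dotZl (dotC x (_ *: x)) (dotC (e_ j) (_ *: x)) !dotZl x1.
    have -> : dot (e_ j) (e_ j) = 1 :> R.
      by rewrite dot3 !e_E; move: j; apply: ord3P => /=; ring.
    have -> : dot x (e_ j) = x 0 j :> R.
      by rewrite dot3 !e_E; move: j; apply: ord3P => /=; ring.
    by ring.
  have -> : (2^-1 : R) ^+ 2 = 4^-1 by rewrite exprVn -natrX.
  by rewrite ipDl ipNl ipZl qmulZr ipZl /ev; field.
have H : 0 <= nsq (a + qmul (e_ 0 - x 0 0 *: x) (2^-1 *: F)) +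
    nsq (b + qmul (e_ 1 - x 0 1 *: x) (2^-1 *: F)) +
    nsq (c + qmul (e_ 2%:R - x 0 2%:R *: x) (2^-1 *: F)).
  by rewrite !addr_ge0 ?nsq_ge0.
have EF : ip (ev 0 a) F + ip (ev 1 b) F + ip (ev 2%:R c) F = nsq F.
  by rewrite -!ipDl.
have XF : ip (qmul x (x 0 0 *: a)) F + ip (qmul x (x 0 1 *: b)) F +
    ip (qmul x (x 0 2%:R *: c)) F = 0.
  have -> : ip (qmul x (x 0 0 *: a)) F + ip (qmul x (x 0 1 *: b)) F +
      ip (qmul x (x 0 2%:R *: c)) F =
      ip (qmul x (x 0 0 *: a + x 0 1 *: b + x 0 2%:R *: c)) F.
    by rewrite !qmulDr !ipDl.
  by rewrite xv -(scale0r (0 : 'cV[R]_4)) qmulZr ipZl mul0r.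
have X1 : x 0 0 ^+ 2 + x 0 1 ^+ 2 + x 0 2%:R ^+ 2 = 1 by rewrite -x1 dot3.
by move: H; rewrite (h 0 a) (h 1 b) (h 2%:R c); exact: nsq_curl3_arith EF XF X1.
Qed.

(** The same combination of the rotation fields is [cross x x = 0]. *)
Lemma rder_radial psi x : Smv psi ->
  x 0 0 *: rderv 0 psi x + x 0 1 *: rderv 1 psi x + x 0 2%:R *: rderv 2%:R psi x = 0.
Proof.
move=> Sp; apply/matrixP => k i; rewrite ord1 !mxE rder0E// rder1E// rder2E//.
by move: ('D_(e_ 0) _ x) ('D_(e_ 1) _ x) ('D_(e_ 2%:R) _ x) => a b c; ring.
Qed.

Lemma rder_radial1 f x : SmT f ->
  x 0 0 * rder 0 f x + x 0 1 * rder 1 f x + x 0 2%:R * rder 2%:R f x = 0.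
Proof.
move=> Sf; rewrite rder0E// rder1E// rder2E//.
by move: ('D_(e_ 0) _ x) ('D_(e_ 1) _ x) ('D_(e_ 2%:R) _ x) => a b c; ring.
Qed.

Lemma curl3B a b c a' b' c' :
  curl3 a b c - curl3 a' b' c' = curl3 (a - a') (b - b') (c - c').
Proof. by rewrite /curl3 /ev !qmulBr !opprD; apply/matrixP => i j; rewrite !mxE; ring. Qed.

Lemma curl3_scale (a b c : R) v x : x 0 0 = a -> x 0 1 = b -> x 0 2%:R = c ->
  curl3 (a *: v) (b *: v) (c *: v) = qmul x v.
Proof.
move=> <- <- <-; apply/matrixP => k i; rewrite ord1 /curl3 /ev.
by move: k; apply: ord4P; rewrite !mxE /=; ring.
Qed.

(** Used with [s_j] the derivatives of [s]: it rewrites the terms created when a derivative falls on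
    the weight [e^(-s)]. The diagonal products [I_j I_j = -1] account for the subtracted sum. *)
Lemma curl3_cross (s0 s1 s2 : R) psi a b c :
  s0 * (ip psi (ev 2%:R b) - ip psi (ev 1 c)) + s1 * (ip psi (ev 0 c) - ip psi (ev 2%:R a)) +
  s2 * (ip psi (ev 1 a) - ip psi (ev 0 b)) =
  ip (curl3 (s0 *: psi) (s1 *: psi) (s2 *: psi)) (curl3 a b c) -
  (s0 * ip psi a + s1 * ip psi b + s2 * ip psi c).
Proof.
rewrite /curl3 /ev !qmulZr -![qmul (e_ _) _]/(ev _ _) !(ipDl, ipDr) !ipZl !ip_ev !ev_sq.
have [-> _ _] := ev_mul b; have [_ -> _] := ev_mul c; have [_ _ ->] := ev_mul a.
have [-> _ _] := ev_mulN a; have [_ -> _] := ev_mulN b; have [_ _ ->] := ev_mulN c.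
by rewrite !ipNr; ring.
Qed.

Definition lap f x : R :=
  rder 0 (rder 0 f) x + rder 1 (rder 1 f) x + rder 2%:R (rder 2%:R f) x.

Definition Sop (psi : E -> 'cV[R]_4) x : 'cV[R]_4 :=
  psi x - curl3 (rderv 0 psi x) (rderv 1 psi x) (rderv 2%:R psi x).

Lemma nsqBE v w : nsq (v - w) = nsq v + nsq w - 2 * ip v w.
Proof. by rewrite nsqD ipNr -scaleN1r nsqZ; ring. Qed.

Lemma ip_evB j v a b : ip v (ev j (a - b)) = ip v (ev j a) - ip v (ev j b).
Proof. by rewrite /ev qmulBr ipDr ipNr. Qed.

(** * The weighted integral inequality *)

Section Inequality.
Variables (s : E -> R) (psi : E -> 'cV[R]_4).
Hypotheses (Ss : SmT s) (Sp : Smv psi).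

Let w x := expR (- s x).
Let r j := rderv j psi.
(** The mixed terms of [nsq_curl3] with one derivative taken off. Applying [rder j] and summing
    cyclically restores them, along with second derivatives that pair into commutators. *)
Let c3 (j k l : 'I_3) x := ip (psi x) (ev l (r k x)) - ip (psi x) (ev k (r l x)).
Let V (j k l : 'I_3) x := w x * c3 j k l x.
(** Its divergence along the rotation fields supplies the term with [lap s]. *)
Let Z j x := w x * (rder j s x * nsq (psi x)).

Let Sw : SmT w. Proof. by apply: Sm_expR; exact: SmN. Qed.

Let Sr j : Smv (r j). Proof. exact: Smv_rderv. Qed.

Let Sc3 j k l : SmT (c3 j k l).
Proof. by apply: SmB; apply: Sm_ip => //; apply: Smv_ev. Qed.

Let SV j k l : SmT (V j k l). Proof. exact: SmM. Qed.

Let Snsq : SmT (fun x => nsq (psi x)). Proof. exact: Sm_ip. Qed.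

Let SZ j : SmT (Z j).
Proof. by apply: SmM => //; apply: SmM => //; exact: Sm_rder. Qed.

Let rder_w j x : rder j w x = - w x * rder j s x.
Proof. by rewrite rder_expR ?rderN//; [rewrite mulrN mulNr|exact: SmN]. Qed.

Let rder_V j k l x : rder j (V j k l) x = w x * (- rder j s x * c3 j k l x +
  (ip (r j x) (ev l (r k x)) - ip (r j x) (ev k (r l x))) +
  (ip (psi x) (ev l (rderv j (r k) x)) - ip (psi x) (ev k (rderv j (r l) x)))).
Proof.
have Se a b : Smv (fun x => ev a (r b x)) by exact: Smv_ev.
rewrite rderM// rder_w rderB; [|exact: Sm_ip|exact: Sm_ip].
by rewrite !rder_ip// !rderv_ev//; ring.
Qed.

Let rder_Z j x : rder j (Z j) x = w x * (- rder j s x ^+ 2 * nsq (psi x) +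
  rder j (rder j s) x * nsq (psi x) + 2 * (rder j s x * ip (psi x) (r j x))).
Proof.
have Sj := Sm_rder j Ss; rewrite rderM//; last exact: SmM.
by rewrite rder_w rderM// rder_ip// (ipC (rderv j psi x)) -/(r j) /nsq; ring.
Qed.

Let rderv_comm j k l x :
  (forall f, SmT f -> rder j (rder k f) x - rder k (rder j f) x = - rder l f x) ->
  rderv j (r k) x = rderv k (r j) x - r l x.
Proof.
move=> H; apply/matrixP => a b; rewrite ord1 [LHS]mxE [RHS]mxE [X in X + _]mxE [X in _ + X]mxE [r l x a 0]mxE.
rewrite -(H _ (Sp a)) addrC.
rewrite (@rder_ext j _ (rder k (fun y => psi y a 0))); last by move=> y; rewrite mxE.
by rewrite (@rder_ext k _ (rder j (fun y => psi y a 0))) ?subrK// => y; rewrite mxE.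
Qed.

Let F x := curl3 (r 0 x) (r 1 x) (r 2%:R x).
(** The defect in [nsq_curl3_le] for the derivatives [e^s R_j (e^(-s) psi)], written out. *)
Let G x := 2 * (nsq (r 0 x - rder 0 s x *: psi x) + nsq (r 1 x - rder 1 s x *: psi x) +
  nsq (r 2%:R x - rder 2%:R s x *: psi x)) -
  nsq (F x - curl3 (rder 0 s x *: psi x) (rder 1 s x *: psi x) (rder 2%:R s x *: psi x)).

Let G_ge0 x : sphere x -> 0 <= G x.
Proof.
move=> xs; rewrite subr_ge0 curl3B; apply: (nsq_curl3_le xs).
have H1 := rder_radial x Sp; have H2 := rder_radial1 x Ss.
rewrite [LHS](_ : _ = x 0 0 *: r 0 x + x 0 1 *: r 1 x + x 0 2%:R *: r 2%:R x -
  (x 0 0 * rder 0 s x + x 0 1 * rder 1 s x + x 0 2%:R * rder 2%:R s x) *: psi x).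
  by rewrite H1 H2 scale0r subr0.
move: (rder 0 s x) (rder 1 s x) (rder 2%:R s x) (r 0 x) (r 1 x) (r 2%:R x) (psi x) => a b c u v z t.
by apply/matrixP => i j; rewrite !mxE; ring.
Qed.

Let divV x := rder 0 (V 0 1 2%:R) x + rder 1 (V 1 2%:R 0) x + rder 2%:R (V 2%:R 0 1) x.
Let divZ x := rder 0 (Z 0) x + rder 1 (Z 1) x + rder 2%:R (Z 2%:R) x.

(** Second derivatives of [psi] occur antisymmetrically, and [rder_comm] reduces them to
    [- ip (psi x) (F x)]. This is where the curvature of the sphere enters. *)
Let divVE x : divV x = w x * (nsq (F x) - (nsq (r 0 x) + nsq (r 1 x) + nsq (r 2%:R x))
  - ip (curl3 (rder 0 s x *: psi x) (rder 1 s x *: psi x) (rder 2%:R s x *: psi x)) (F x)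
  + (rder 0 s x * ip (psi x) (r 0 x) + rder 1 s x * ip (psi x) (r 1 x) +
     rder 2%:R s x * ip (psi x) (r 2%:R x)) - ip (psi x) (F x)).
Proof.
rewrite /divV !rder_V -!mulrDr; congr (_ * _).
have h := rder_comm.
rewrite (@rderv_comm 0 1 2%:R); last by move=> f /h[].
rewrite (@rderv_comm 1 2%:R 0); last by move=> f /h[].
rewrite (@rderv_comm 2%:R 0 1); last by move=> f /h[].
rewrite [in RHS]/F nsq_curl3.
have := curl3_cross (rder 0 s x) (rder 1 s x) (rder 2%:R s x) (psi x) (r 0 x) (r 1 x) (r 2%:R x).
move=> /eqP; rewrite -subr_eq0 => /eqP hc.
have hF : ip (psi x) (curl3 (r 0 x) (r 1 x) (r 2%:R x)) = ip (psi x) (ev 0 (r 0 x)) +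
    ip (psi x) (ev 1 (r 1 x)) + ip (psi x) (ev 2%:R (r 2%:R x)) by rewrite !ipDr.
rewrite hF !ip_evB /c3.
by rewrite -[LHS]addr0 -hc; ring.
Qed.

Let Sop_E x : Sop psi x = psi x - F x. Proof. by []. Qed.

Let Smv_Sop : Smv (Sop psi).
Proof.
move=> k; apply: (@Sm_eq _ _ (fun x => psi x k 0 - (ev 0 (r 0 x) k 0 +
  ev 1 (r 1 x) k 0 + ev 2%:R (r 2%:R x) k 0))).
  by apply: SmB => //; do 2 (apply: SmD; last by apply: Smv_ev); apply: Smv_ev.
by move=> x _; rewrite Sop_E /F /curl3; move: (ev 0 _) (ev 1 _) (ev 2%:R _) => a b c; rewrite !mxE.
Qed.

Let Slap : SmT (lap s).
Proof. by do 2 (apply: SmD; last by do 2 apply: Sm_rder); do 2 apply: Sm_rder. Qed.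

(** Subtracting [divV] twice cancels the products of [psi] with [F] and changes [|F|^2] into
    [- |F|^2], as the defect [G] requires; [divZ] absorbs [lap s]. *)
Let difference x : w x * nsq (Sop psi x) - w x * ((1 - lap s x) * nsq (psi x)) -
  (2 * divV x + divZ x) = w x * G x.
Proof.
rewrite divVE /divZ !rder_Z Sop_E /G /lap !nsqBE !nsqZ !ipZr.
rewrite (ipC (F x)) (ipC (r 0 x)) (ipC (r 1 x)) (ipC (r 2%:R x)).
have -> : nsq (curl3 (rder 0 s x *: psi x) (rder 1 s x *: psi x) (rder 2%:R s x *: psi x)) =
    (rder 0 s x ^+ 2 + rder 1 s x ^+ 2 + rder 2%:R s x ^+ 2) * nsq (psi x).
  have [X [X0 X1 X2]] : exists X : E, [/\ X 0 0 = rder 0 s x, X 0 1 = rder 1 s x &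
      X 0 2%:R = rder 2%:R s x].
    exists (\row_j [:: rder 0 s x; rder 1 s x; rder 2%:R s x]`_j).
    by split; rewrite mxE.
  rewrite (curl3_scale _ X0 X1 X2) nsq_qmul dot3 X0 X1 X2; ring.
ring.
Qed.

(* [nsq_curl3_le] for the twisted derivatives [r_j - (rder j s) psi]; the
   remaining terms are divergences along rotation fields, and integrate to 0. *)
Lemma rotation_inequality :
  Int (fun p => expR (- s (coord p)) * ((1 - lap s (coord p)) * nsq (psi (coord p)))) <=
  Int (fun p => expR (- s (coord p)) * nsq (Sop psi (coord p))).
Proof.
have L f : SmT f -> L1 (fun p => f (coord p)) by move=> Sf; apply: L1_mb; exact: mb_Sm.
have S1 : SmT (fun x => w x * nsq (Sop psi x)) by apply: SmM => //; exact: Sm_ip.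
have S2 : SmT (fun x => w x * ((1 - lap s x) * nsq (psi x))).
  by apply: SmM => //; apply: SmM => //; apply: SmB => //; exact: Sm_cst.
have SdV : SmT divV by apply: SmD; [apply: SmD|]; exact: Sm_rder.
have SdZ : SmT divZ by apply: SmD; [apply: SmD|]; exact: Sm_rder.
have sum0 (f g h : E -> R) : SmT f -> SmT g -> SmT h ->
    Int (fun p => rder 0 f (coord p) + rder 1 g (coord p) + rder 2%:R h (coord p)) = 0.
  move=> Sf Sg Sh; have Lf := L _ (Sm_rder 0 Sf); have Lg := L _ (Sm_rder 1 Sg).
  have Lh := L _ (Sm_rder 2%:R Sh).
  by rewrite (IntD (L1D Lf Lg) Lh) (IntD Lf Lg) !Int_rder// !addr0.
have IV : Int (fun p => divV (coord p)) = 0 by apply: sum0.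
have IZ : Int (fun p => divZ (coord p)) = 0 by apply: sum0.
have H : 0 <= Int (fun p => w (coord p) * G (coord p)).
  apply: Int_ge0 => p; rewrite mulr_ge0 ?expR_ge0// G_ge0//; exact: coord_sphere.
move: H; rewrite -(eq_Int _ (fun p : T2 => difference (coord p))).
rewrite (IntB (L1B (L _ S1) (L _ S2)) (L1D (L1Z 2 (L _ SdV)) (L _ SdZ))).
rewrite (IntB (L _ S1) (L _ S2)) (IntD (L1Z 2 (L _ SdV)) (L _ SdZ)) (IntZ _ (L _ SdV)).
by rewrite IV IZ mulr0 addr0 subr0 subr_ge0.
Qed.

End Inequality.

End RotationInequality.

(** * Kernels on the sphere *)

Section SphereKernels.
Context {R : realType}.
Local Notation E := 'rV[R]_3.
Local Notation SmT := (Sm [set: E]).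
Local Notation T2 := (measurableTypeR R * measurableTypeR R)%type.
Local Notation coordT := (coord : T2 -> E).
Local Notation Int := (Lint (@area R)).
Local Notation L1 := (L1fun (@area R)).
Implicit Types (x y : E) (p q : T2) (t b : R).

(* Equal to [1 + t - <x, y>] on the sphere, and positive everywhere. *)
Fact zz_sig : {z : R -> E -> E -> R |
  forall t y x, z t y x = t + ((dot y y + dot x x) / 2 - dot y x)}.
Proof. by exists (fun t y x => t + ((dot y y + dot x x) / 2 - dot y x)). Qed.
Definition zz t y x : R := sval zz_sig t y x.

Lemma zzE t y x : zz t y x = t + ((dot y y + dot x x) / 2 - dot y x).
Proof. exact: (svalP zz_sig). Qed.

Lemma zz_gt0 t y x : 0 < t -> 0 < zz t y x.
Proof.
move=> t0; rewrite zzE ltr_wpDr//; have := dot_ge0 (y - x); rewrite dotBB => h.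
by lra.
Qed.

Lemma zz_sphere t y x : sphere x -> sphere y -> zz t y x = t + (1 - dot y x).
Proof. by rewrite zzE /sphere /= => -> ->; congr (_ + (_ - _)); lra. Qed.

Lemma Sm_zz t y : SmT (zz t y).
Proof.
apply: (@Sm_eq _ _ (fun x => t + (dot y y / 2 + 2^-1 * dot x x - dot y x))).
  apply: SmD; first exact: Sm_cst.
  apply: SmB; last exact: Sm_dot.
  by apply: SmD; [exact: Sm_cst|apply: SmZ; exact: Sm_dotxx].
by move=> x _; rewrite zzE mulrDl [_ * dot x x]mulrC.
Qed.

Lemma Sm_lnzz t y : 0 < t -> SmT (fun x => ln (zz t y x)).
Proof. by move=> t0; apply: Sm_ln => [|x _]; [exact: Sm_zz|exact: zz_gt0]. Qed.

Lemma Sm_zzV t y : 0 < t -> SmT (fun x => (zz t y x)^-1).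
Proof. by move=> t0; apply: SmV => [|x _]; [exact: Sm_zz|exact: zz_gt0]. Qed.

Definition tor j y x : R := dot y (cross (e_ j) x).

Lemma rder_dot j y x : rder j (fun z => dot y z) x = tor j y x.
Proof.
rewrite rder_sum; last by move=> k; apply: SmZ; exact: Sm_coord.
by apply: eq_bigr => k _; rewrite rderZ ?rder_coord//; exact: Sm_coord.
Qed.

Lemma dot_cross j x : dot x (cross (e_ j) x) = 0.
Proof. by rewrite dot3 !mxE /=; move: j; apply: ord3P => /=; ring. Qed.

Lemma rder_dotxx j x : rder j (fun z => dot z z) x = 0.
Proof.
rewrite rder_sum; last by move=> k; apply: SmM; exact: Sm_coord.
rewrite (eq_bigr (fun k => 2 * (x 0 k * cross (e_ j) x 0 k))).
  by rewrite -mulr_sumr -/(dot _ _) dot_cross mulr0.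
by move=> k _; rewrite rderM ?rder_coord; [ring|exact: Sm_coord|exact: Sm_coord].
Qed.

Lemma rder_zz j t y x : rder j (zz t y) x = - tor j y x.
Proof.
have Sd : SmT (fun x => dot y x) := Sm_dot y; have Sdd : SmT (fun x => dot x x) := Sm_dotxx.
rewrite (@rder_ext _ _ _ (fun x => (t + dot y y / 2) + (2^-1 * dot x x - dot y x))); last first.
  by move=> z; rewrite zzE mulrDl [dot z z * _]mulrC !addrA.
rewrite rderD; [|exact: Sm_cst|by apply: SmB => //; exact: SmZ].
by rewrite rder_cst rderB ?rderZ ?rder_dot ?rder_dotxx ?mulr0 ?add0r//; exact: SmZ.
Qed.

Lemma Sm_tor j y : SmT (tor j y).
Proof.
apply: (@Sm_eq _ _ (rder j (fun z => dot y z))); first by apply: Sm_rder; exact: Sm_dot.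
by move=> x _; rewrite rder_dot.
Qed.

Lemma rder_tor j y x : rder j (tor j y) x = tor j y (cross (e_ j) x).
Proof.
have h z : tor j y z = dot (cross y (e_ j)) z.
  by rewrite /tor !dot3 !mxE /=; ring.
by rewrite (rder_ext j x h) rder_dot h.
Qed.

Lemma tor0E y x : tor 0 y x = y 0 2%:R * x 0 1 - y 0 1 * x 0 2%:R.
Proof. by rewrite /tor dot3 !mxE /=; ring. Qed.

Lemma tor1E y x : tor 1 y x = y 0 0 * x 0 2%:R - y 0 2%:R * x 0 0.
Proof. by rewrite /tor dot3 !mxE /=; ring. Qed.

Lemma tor2E y x : tor 2%:R y x = y 0 1 * x 0 0 - y 0 0 * x 0 1.
Proof. by rewrite /tor dot3 !mxE /=; ring. Qed.

Lemma sum_tor2 y x : sphere x -> sphere y ->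
  tor 0 y x ^+ 2 + tor 1 y x ^+ 2 + tor 2%:R y x ^+ 2 = 1 - dot y x ^+ 2.
Proof.
move=> xs ys; have <- : dot y y * dot x x = 1 by rewrite xs ys mulr1.
by rewrite tor0E tor1E tor2E !dot3; ring.
Qed.

Lemma sum_torr y x : tor 0 y (cross (e_ 0) x) + tor 1 y (cross (e_ 1) x) +
  tor 2%:R y (cross (e_ 2%:R) x) = - 2 * dot y x.
Proof. by rewrite tor0E tor1E tor2E dot3 !mxE /=; ring. Qed.

(** From [Delta <y, x> = - 2 <y, x>] and [|grad <y, x>|^2 = 1 - <y, x>^2]. The outcome is a point
    charge smeared at scale [t] over a uniform background of opposite sign. *)
Lemma lap_ln t y x : 0 < t -> sphere x -> sphere y ->
  lap (fun z => ln (zz t y z)) x = t * (2 + t) * (t + (1 - dot y x))^-1 ^+ 2 - 1.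
Proof.
move=> t0 xs ys; have z0 z := zz_gt0 y z t0.
have SV := Sm_zzV y t0; have ST j := Sm_tor j y.
have h j : rder j (rder j (fun z => ln (zz t y z))) x =
    - ((zz t y x)^-1 * tor j y (cross (e_ j) x) + (zz t y x)^-1 ^+ 2 * tor j y x ^+ 2).
  rewrite (@rder_ext _ _ _ (fun z => - ((zz t y z)^-1 * tor j y z))).
    rewrite rderN ?rderM ?rder_inv ?rder_zz ?rder_tor//; [ring|exact: Sm_zz|exact: SmM].
  by move=> z; rewrite rder_ln ?rder_zz ?mulrN//; exact: Sm_zz.
rewrite /lap !h -zz_sphere//; have := sum_torr y x; have := sum_tor2 xs ys.
move: (tor 0 y _) (tor 1 y _) (tor 2%:R y _) (tor 0 y _) (tor 1 y _) (tor 2%:R y _).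
move=> a b c a' b' c' h1 h2; have := z0 x; rewrite (zz_sphere t xs ys) => zp.
rewrite [LHS](_ : _ = - ((t + (1 - dot y x))^-1 * (a + b + c) +
  (t + (1 - dot y x))^-1 ^+ 2 * (a' ^+ 2 + b' ^+ 2 + c' ^+ 2))); last by ring.
by rewrite h1 h2; field; rewrite gt_eqF.
Qed.

Lemma L1_coord f : SmT f -> L1 (fun p => f (coord p)).
Proof. by move=> Sf; apply: L1_mb; exact: mb_Sm. Qed.

Lemma Sm_lap f : SmT f -> SmT (lap f).
Proof. by move=> Sf; do 2 (apply: SmD; last by do 2 apply: Sm_rder); do 2 apply: Sm_rder. Qed.

Lemma Int_rder3 (f g h : E -> R) : SmT f -> SmT g -> SmT h ->
  Int (fun p => rder 0 f (coord p) + rder 1 g (coord p) + rder 2%:R h (coord p)) = 0.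
Proof.
move=> Sf Sg Sh; have Lf := L1_coord (Sm_rder 0 Sf).
have Lg := L1_coord (Sm_rder 1 Sg); have Lh := L1_coord (Sm_rder 2%:R Sh).
by rewrite (IntD (L1D Lf Lg) Lh) (IntD Lf Lg) !Int_rder// !addr0.
Qed.

Lemma zz_gap t p q : zz t (coord q) (coord p) = t + gap coordT p q.
Proof. by rewrite gapE zz_sphere ?(dotC (coord q))//; exact: coord_sphere. Qed.

Lemma rr8_zz t p q : 0 < t -> rr coordT t p q ^+ 8 = (zz t (coord q) (coord p))^-1.
Proof. by move=> t0; rewrite zz_gap; apply: rr8 => //; exact: coord_sphere. Qed.

Lemma kappa_lap t p q : 0 < t ->
  lap (fun z => ln (zz t (coord q) z)) (coord p) = kappa coordT t p q - 1.
Proof.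
move=> t0; rewrite lap_ln ?kappaE//; try exact: coord_sphere.
rewrite (_ : rr coordT t p q ^+ 16 = (rr coordT t p q ^+ 8) ^+ 2); last by rewrite -exprM.
by rewrite rr8_zz// zz_sphere//; exact: coord_sphere.
Qed.

Lemma kappa_mass t q : 0 < t <= 1 ->
  Int (fun p => t * (2 + t) * rr coordT t p q ^+ 16) = fine (area [set: T2]).
Proof.
move=> /andP[t0 _]; have SL := Sm_lnzz (coord q) t0.
have LL := L1_coord (Sm_lap SL).
rewrite (@eq_Int _ _ _ _ _ (fun p => lap (fun z => ln (zz t (coord q) z)) (coord p) + cst 1 p)).
  rewrite (IntD LL (L1_cst _ 1)) Int_cst mul1r (_ : Int _ = 0) ?add0r//.
  by apply: Int_rder3; exact: Sm_rder.
by move=> p; rewrite kappa_lap// kappaE subrK.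
Qed.

(** [z >= 1 - c] gives [(1 - c^2) / z <= 1 + c], and [2 c - 3/4 (1 + c) = 1/2 - 5/4 (1 - c)]. The
    leading 1/2 is positive because the power 3/4 is below 1. *)
Lemma pow34_arith (z c G t : R) : 0 < t -> z = t + (1 - c) -> -1 <= c -> c <= 1 -> 0 <= G ->
  2^-1 * G - 5 / 4 * (G * z) <= G * (2 * c) - 3 / 4 * (G * z^-1 * (1 - c ^+ 2)).
Proof.
move=> t0 zE c1 c2 G0; have z0 : 0 < z by rewrite zE; lra.
have h : z^-1 * (1 - c ^+ 2) <= 1 + c.
  rewrite mulrC ler_pdivrMr// (_ : 1 - c ^+ 2 = (1 + c) * (1 - c)); last by ring.
  by apply: ler_wpM2l; lra.
rewrite [leLHS](_ : _ = G * (2^-1 - 5 / 4 * z)); last by ring.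
rewrite [leRHS](_ : _ = G * (2 * c - 3 / 4 * (z^-1 * (1 - c ^+ 2)))); last by ring.
apply: ler_wpM2l => //; lra.
Qed.

(** The divergence of [z^(-3/4) grad <y, x>] integrates to zero, and by [pow34_arith] this controls
    the integral of [z^(-3/4)] by that of [z^(1/4)], uniformly in [t]. With [z <= 3] the latter
    function is at most 4, and [10 = 2 * (5/4) * 4]. *)
Lemma rr6_le t q : 0 < t <= 1 ->
  Int (fun p => rr coordT t p q ^+ 6) <= 10 * fine (area [set: T2]).
Proof.
move=> /andP[t0 t1]; set y := coord q.
pose G x := expR (- (3 / 4) * ln (zz t y x)).
have SL := Sm_lnzz y t0; have SG : SmT G by apply: Sm_expR; exact: SmZ.
have ST j := Sm_tor j y; have z0 x := zz_gt0 y x t0.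
pose D x := rder 0 (fun z => G z * tor 0 y z) x + rder 1 (fun z => G z * tor 1 y z) x +
  rder 2%:R (fun z => G z * tor 2%:R y z) x.
have DI : Int (fun p => D (coord p)) = 0 by apply: Int_rder3; exact: SmM.
have DE p : D (coord p) = - (G (coord p) * (2 * dot y (coord p)) -
    3 / 4 * (G (coord p) * (zz t y (coord p))^-1 * (1 - dot y (coord p) ^+ 2))).
  rewrite -(sum_tor2 (coord_sphere p) (coord_sphere q)) -/y.
  have h j x : rder j (fun z => G z * tor j y z) x =
     G x * tor j y (cross (e_ j) x) + 3 / 4 * (G x * (zz t y x)^-1 * tor j y x ^+ 2).
    rewrite rderM// rder_tor rder_expR; last exact: SmZ.
    rewrite (rderZ j (- (3 / 4)) x SL) rder_ln; [|exact: Sm_zz|exact: z0].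
    by rewrite rder_zz -/(G x); ring.
  rewrite /D !h; have := sum_torr y (coord p).
  move: (tor 0 y _) (tor 1 y _) (tor 2%:R y _) (tor 0 y _) (tor 1 y _) (tor 2%:R y _).
  move=> a b c a' b' c' h1.
  have -> : 2 * dot y (coord p) = - (a' + b' + c') by rewrite h1; ring.
  ring.
have GE p : rr coordT t p q ^+ 6 = G (coord p) by rewrite rr6E /G zz_gap.
have LG := L1_coord SG; have LD : L1 (fun p => D (coord p)).
  by apply: L1_coord; apply: SmD; [apply: SmD|]; apply: Sm_rder; exact: SmM.
have Gz p : G (coord p) * zz t y (coord p) <= 4.
  have -> : G (coord p) * zz t y (coord p) = expR (4^-1 * ln (zz t y (coord p))).
    rewrite -[X in _ * X]lnK ?posrE// -expRD; congr expR; lra.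
  have zle : zz t y (coord p) <= 3.
    rewrite zz_gap; apply: (@le_trans _ _ (t + 2)); last by lra.
    by rewrite lerD2l gap_le2//; exact: coord_sphere.
  have [l0|l0] := leP (ln (zz t y (coord p))) 0.
    apply: (@le_trans _ _ (expR 0)); first by rewrite ler_expR; lra.
    by rewrite expR0; lra.
  apply: (@le_trans _ _ (expR (ln (zz t y (coord p))))); first by rewrite ler_expR; lra.
  by rewrite lnK ?posrE//; lra.
have H : Int (fun p => 2^-1 * G (coord p) + D (coord p)) <= Int (fun=> 5 / 4 * 4 : R).
  apply: Int_le => [||p]; [by apply: L1D => //; exact: L1Z|exact: L1_cst|].
  rewrite DE; have := sphere_dot_geN1 (coord_sphere q) (coord_sphere p).
  have := sphere_dot_le1 (coord_sphere q) (coord_sphere p); rewrite -/y => c1 c2.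
  have := pow34_arith t0 (zz_sphere t (coord_sphere p) (coord_sphere q)) c2 c1 (expR_ge0 _ : 0 <= G (coord p)).
  have := Gz p; rewrite -/y; lra.
rewrite (eq_Int _ GE); move: H; rewrite (IntD (L1Z _ LG) LD) DI addr0 (IntZ _ LG) Int_cst.
move: (Int _) (fine _) => a b; lra.
Qed.

Lemma qmul_lin X (v : 'cV[R]_4) : qmul X v = X 0 0 *: ev 0 v + X 0 1 *: ev 1 v + X 0 2%:R *: ev 2%:R v.
Proof.
rewrite /ev -!qmulZl -!qmulDl; congr (qmul _ v).
apply/matrixP => i j; rewrite ord1 !mxE; move: j; apply: ord3P => /=; ring.
Qed.

Lemma Smv_qmul (v : 'cV[R]_4) : Smv (fun x => qmul x v).
Proof.
move=> k; apply: (@Sm_eq _ _ (fun x => ev 0 v k 0 * x 0 0 + ev 1 v k 0 * x 0 1 +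
   ev 2%:R v k 0 * x 0 2%:R)).
  by do 2 (apply: SmD; last by apply: SmZ; exact: Sm_coord); apply: SmZ; exact: Sm_coord.
move=> x _; rewrite qmul_lin; move: (ev 0 v) (ev 1 v) (ev 2%:R v) => a b c.
by rewrite !mxE [_ * x 0 0]mulrC [_ * x 0 1]mulrC [_ * x 0 2%:R]mulrC.
Qed.

Lemma rderv_qmul j (v : 'cV[R]_4) x : rderv j (fun x => qmul x v) x = qmul (cross (e_ j) x) v.
Proof.
apply/matrixP => k i; rewrite ord1 mxE.
rewrite (@rder_ext _ _ _ (fun x => ev 0 v k 0 * x 0 0 + ev 1 v k 0 * x 0 1 +
   ev 2%:R v k 0 * x 0 2%:R)); last first.
  move=> z; rewrite qmul_lin; move: (ev 0 v) (ev 1 v) (ev 2%:R v) => a b c.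
  by rewrite !mxE [_ * z 0 0]mulrC [_ * z 0 1]mulrC [_ * z 0 2%:R]mulrC.
have Sc l (c : R) : SmT (fun x => c * x 0 l) by apply: SmZ; exact: Sm_coord.
have Sc' l := Sm_coord [set: E] l.
rewrite rderD//; last exact: SmD.
rewrite rderD// !rderZ// !rder_coord qmul_lin.
move: (ev 0 v) (ev 1 v) (ev 2%:R v) (cross _ x) => a b c d.
by rewrite !mxE; ring.
Qed.

(** Up to a constant factor, the Green kernel of the Dirac operator with pole [y], regularized by
    [t]. *)
Definition spk t y (v : 'cV[R]_4) x : 'cV[R]_4 := (zz t y x)^-1 *: qmul (y - x) v.

Lemma Smv_spk t y v : 0 < t -> Smv (spk t y v).
Proof.
move=> t0 k; apply: (@Sm_eq _ _ (fun x => (zz t y x)^-1 * (qmul y v k 0 - qmul x v k 0))).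
  apply: SmM; first exact: Sm_zzV.
  by apply: SmB; [exact: Sm_cst|exact: Smv_qmul].
by move=> x _; rewrite /spk qmulBl; move: (qmul y v) (qmul x v) => a b; rewrite !mxE.
Qed.

Lemma rderv_spk j t y v x : 0 < t -> rderv j (spk t y v) x =
  ((zz t y x)^-1 ^+ 2 * tor j y x) *: qmul (y - x) v - (zz t y x)^-1 *: qmul (cross (e_ j) x) v.
Proof.
move=> t0; apply/matrixP => k i; rewrite ord1 mxE.
rewrite (@rder_ext _ _ _ (fun x => (zz t y x)^-1 * (qmul y v k 0 - qmul x v k 0))); last first.
  by move=> z; rewrite /spk qmulBl; move: (qmul y v) (qmul z v) => a b; rewrite !mxE.
have Sq := Smv_qmul v k; have z0 z := zz_gt0 y z t0.
rewrite rderM; [|exact: Sm_zzV|by apply: SmB => //; exact: Sm_cst].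
rewrite rderB//; last exact: Sm_cst.
rewrite rder_cst rder_inv//; last exact: Sm_zz.
have := rderv_qmul j v x => /(congr1 (fun M : 'cV[R]_4 => M k 0)); rewrite mxE => ->.
rewrite rder_zz qmulBl; move: (qmul _ v) (qmul _ v) (qmul _ v) => a b c.
by rewrite !mxE; ring.
Qed.

Lemma qmul_cross1 X Y (v : 'cV[R]_4) :
  qmul (cross X Y) (qmul Y v) = dot Y Y *: qmul X v - dot X Y *: qmul Y v.
Proof.
apply/matrixP => k i; rewrite ord1 !dot3.
by move: k; apply: ord4P; rewrite !mxE /=; ring.
Qed.

Lemma qmul_cross2 X Y (v : 'cV[R]_4) :
  qmul (cross X Y) (qmul X v) = dot X Y *: qmul X v - dot X X *: qmul Y v.
Proof.
apply/matrixP => k i; rewrite ord1 !dot3.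
by move: k; apply: ord4P; rewrite !mxE /=; ring.
Qed.

Lemma curl3_qmul x (v : 'cV[R]_4) : curl3 (qmul (cross (e_ 0) x) v)
  (qmul (cross (e_ 1) x) v) (qmul (cross (e_ 2%:R) x) v) = 2 *: qmul x v.
Proof.
have h j : ev j (qmul (cross (e_ j) x) v) = qmul x v - x 0 j *: ev j v.
  have d0 : dot (e_ j) (cross (e_ j) x) = 0 by rewrite dot3 !mxE /=; ring.
  have := qmulAC (e_ j) (cross (e_ j) x) v; rewrite d0 mulr0 scale0r => /eqP.
  rewrite addr_eq0 => /eqP; rewrite -/(ev _ _) => ->.
  rewrite qmul_cross2 dot_e eqxx scale1r opprB (_ : dot (e_ j) x = x 0 j)//.
  by rewrite dot3 !e_E; move: j {d0}; apply: ord3P => /=; ring.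
rewrite /curl3 !h [in RHS]qmul_lin qmul_lin.
move: (ev 0 v) (ev 1 v) (ev 2%:R v) => a b c.
by apply/matrixP => i j; rewrite !mxE; ring.
Qed.

Lemma curl3Z (c : R) (a b d : 'cV[R]_4) : curl3 (c *: a) (c *: b) (c *: d) = c *: curl3 a b d.
Proof. by rewrite /curl3 /ev !qmulZr !scalerDr. Qed.

(** The derivatives of [z^-1] contribute [z^-2 (1 - <y, x>) I(y + x) v], and the remaining terms
    [z^-1 I(y + x) v]. As [1 - <y, x> = z - t], the singular parts cancel up to a factor [t]. *)
Lemma Sop_spk t y v x : 0 < t -> sphere x -> sphere y ->
  Sop (spk t y v) x = (t * (zz t y x)^-1 ^+ 2) *: qmul (y + x) v.
Proof.
move=> t0 xs ys; rewrite /Sop !rderv_spk// -curl3B curl3Z curl3_qmul.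
set b := (zz t y x)^-1; set w := qmul (y - x) v.
have -> : curl3 ((b ^+ 2 * tor 0 y x) *: w) ((b ^+ 2 * tor 1 y x) *: w)
    ((b ^+ 2 * tor 2%:R y x) *: w) = b ^+ 2 *: qmul (cross x y) w.
  rewrite -!(scalerA (b ^+ 2)) curl3Z; congr (_ *: _).
  have H0 : (cross x y) 0 0 = tor 0 y x by rewrite tor0E mxE /=; ring.
  have H1 : (cross x y) 0 1 = tor 1 y x by rewrite tor1E mxE /=; ring.
  have H2 : (cross x y) 0 2%:R = tor 2%:R y x by rewrite tor2E mxE /=; ring.
  exact: curl3_scale.
have -> : qmul (cross x y) w = (1 - dot y x) *: qmul (y + x) v.
  rewrite /w qmulBl qmulBr qmul_cross1 qmul_cross2 xs ys (dotC x y) !qmulDl.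
  move: (qmul x v) (qmul y v) => a c.
  by apply/matrixP => i j; rewrite !mxE; ring.
have hb : b * (t + (1 - dot y x)) = 1.
  by rewrite /b -zz_sphere// mulVf// gt_eqF// zz_gt0.
rewrite /spk -/b -/w /w qmulBl qmulDl.
move: (qmul x v) (qmul y v) => a c; apply/matrixP => i j; rewrite !mxE.
move: (a i j) (c i j) => a' c'.
have -> : t * b ^+ 2 = b * (b * (t + (1 - dot y x))) - b ^+ 2 * (1 - dot y x) by ring.
by rewrite hb; ring.
Qed.

Lemma star_sphere (I : finType) (x : I -> T2) (ms : I -> R)
    (eta : I -> 'cV[R]_4) (cs b t : R) :
  0 < b <= 1 -> 0 < t <= 1 -> \sum_i ms i = 0 ->
  let s q := cs - \sum_i ms i * ln (b + gap coordT (x i) q) in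
  Int (fun q => expR (- s q) * ((1 + \sum_i ms i * kappa coordT b (x i) q) *
    nsq (\col_k \sum_i rr coordT t (x i) q ^+ 8 * qmul (coord (x i) - coord q) (eta i) k 0))) <=
  Int (fun q => expR (- s q) *
    nsq (\col_k \sum_i t * rr coordT t (x i) q ^+ 16 *
                       qmul (coord (x i) + coord q) (eta i) k 0)).
Proof.
move=> b01 t01 ms0; cbv zeta; pose s q := cs - \sum_i ms i * ln (b + gap coordT (x i) q).
have /andP[b0 _] := b01; have /andP[t0 _] := t01.
pose y i : E := coord (x i).
pose S z := cs - \sum_i ms i * ln (zz b (y i) z).
pose Psi z : 'cV[R]_4 := \col_k \sum_i spk t (y i) (eta i) z k 0.
have SL i := Sm_lnzz (y i) b0.
have SSum : SmT (fun z => \sum_i ms i * ln (zz b (y i) z)) by apply: Sm_sum => i; exact: SmZ.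
have SS : SmT S by apply: SmB => //; exact: Sm_cst.
have Sk i := Smv_spk (y i) (eta i) t0.
have SP : Smv Psi.
  move=> k; apply: (@Sm_eq _ _ (fun z => \sum_i spk t (y i) (eta i) z k 0)).
    by apply: Sm_sum => i; exact: Sk.
  by move=> z _; rewrite mxE.
have sE q : S (coord q) = s q.
  by rewrite /S /s; congr (_ - _); apply: eq_bigr => i _; rewrite zz_gap gapC.
have kC p q : kappa coordT b p q = kappa coordT b q p by apply: kappaC.
have lapE q : 1 - lap S (coord q) = 1 + \sum_i ms i * kappa coordT b (x i) q.
  have h j z : rder j (rder j S) z = - \sum_i ms i * rder j (rder j (fun z => ln (zz b (y i) z))) z.
    rewrite (@rder_ext _ _ _ (fun z => - \sum_i ms i * rder j (fun z => ln (zz b (y i) z)) z)).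
      rewrite rderN; last by apply: Sm_sum => i; apply: SmZ; exact: Sm_rder.
      rewrite rder_sum; last by move=> i; apply: SmZ; exact: Sm_rder.
      by congr (- _); apply: eq_bigr => i _; rewrite rderZ//; exact: Sm_rder.
    move=> w; rewrite rderB//; last exact: Sm_cst.
    rewrite rder_cst sub0r rder_sum; last by move=> i; exact: SmZ.
    by congr (- _); apply: eq_bigr => i _; rewrite rderZ.
  rewrite /lap !h -!opprD opprK -!big_split /=; congr (_ + _).
  (* Neutrality of the charges removes the background [-1] of each [kappa_lap]. *)
  have -> : \sum_i ms i * kappa coordT b (x i) q =
      \sum_i ms i * kappa coordT b (x i) q - \sum_i ms i by rewrite ms0 subr0.
  rewrite -sumrB; apply: eq_bigr => i _.
  rewrite -!mulrDr -[X in _ * X]/(lap _ _) kappa_lap// kC; ring.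
have PE q : Psi (coord q) = \col_k \sum_i rr coordT t (x i) q ^+ 8 *
    qmul (coord (x i) - coord q) (eta i) k 0.
  apply/matrixP => k i; rewrite !mxE; apply: eq_bigr => j _.
  rewrite rrC rr8_zz// /spk; move: (qmul _ (eta j)) => v.
  by rewrite [LHS]mxE.
have SoE q : Sop Psi (coord q) = \col_k \sum_i t * rr coordT t (x i) q ^+ 16 *
    qmul (coord (x i) + coord q) (eta i) k 0.
  have rP j z : rderv j Psi z = \sum_i rderv j (spk t (y i) (eta i)) z.
    apply/matrixP => k l; rewrite ord1 mxE summxE.
    rewrite (@rder_ext _ _ _ (fun z => \sum_i spk t (y i) (eta i) z k 0)).
      rewrite rder_sum; last by move=> i; exact: Sk.
      by apply: eq_bigr => i _; rewrite mxE.
    by move=> w; rewrite mxE.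
  have -> : Sop Psi (coord q) = \sum_i Sop (spk t (y i) (eta i)) (coord q).
    rewrite /Sop !rP sumrB; congr (_ - _).
      by apply/matrixP => k l; rewrite ord1 mxE summxE.
    rewrite /curl3 !big_split /=.
    have evs j (F : I -> 'cV[R]_4) : ev j (\sum_i F i) = \sum_i ev j (F i).
      apply: (big_morph (ev j)) => [a c|]; first exact: qmulDr.
      by rewrite -[X in ev j X](scale0r (0 : 'cV[R]_4)) /ev qmulZr scale0r.
    by rewrite !evs.
  apply/matrixP => k l; rewrite ord1 summxE mxE; apply: eq_bigr => i _.
  rewrite Sop_spk//; try exact: coord_sphere.
  have -> : rr coordT t (x i) q ^+ 16 = (rr coordT t (x i) q ^+ 8) ^+ 2 by rewrite -exprM.
  rewrite [in RHS]rrC rr8_zz//; move: (qmul _ (eta i)) => v.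
  by rewrite [LHS]mxE.
have := rotation_inequality SS SP.
rewrite (@eq_Int _ _ _ _ _ (fun q => expR (- s q) * ((1 + \sum_i ms i * kappa coordT b (x i) q) *
    nsq (\col_k \sum_i rr coordT t (x i) q ^+ 8 * qmul (coord (x i) - coord q) (eta i) k 0)))); last first.
  by move=> q; rewrite sE lapE PE.
rewrite [X in _ <= X -> _](@eq_Int _ _ _ _ _ (fun q => expR (- s q) *
    nsq (\col_k \sum_i t * rr coordT t (x i) q ^+ 16 *
                       qmul (coord (x i) + coord q) (eta i) k 0))) //.
by move=> q; rewrite sE SoE.
Qed.

End SphereKernels.

(** * Functions separated by Lipschitz tests *)

Section Separation.
Context {R : realType}.
Local Notation E := 'rV[R]_3.
Local Notation T2 := (measurableTypeR R * measurableTypeR R)%type.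
Local Notation lam := (@lebesgue_measure R).
Local Notation m2 := (lam \x lam : {measure set T2 -> \bar R})%E.
Local Notation Int := (Lint (@area R)).
Local Notation L1 := (L1fun (@area R)).
Local Notation admissible := (admissible (coord : T2 -> E)).
Implicit Types (v x : E) (p q : T2) (w g : T2 -> R).

Lemma area_null (N : set T2) : measurable N -> m2 N = 0%E -> area N = 0%E.
Proof.
move=> mN N0; apply: (null_set_integral mN _ N0).
by apply/measurable_EFinP; apply: measurable_funTS; exact: measurable_wgt.
Qed.

Lemma area_line (c : R) : {ae (@area R), forall p, p.2 != c}.
Proof.
exists (setT `*` [set c]); split.
- by apply: measurableX => //; exact: measurable_set1.
- apply: area_null; first by apply: measurableX => //; exact: measurable_set1.
  rewrite [LHS](_ : _ = lam setT * lam [set c])%E.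
    by rewrite [lam [set c]]lebesgue_measure_set1 mule0.
  by apply: product_measure1E => //; exact: measurable_set1.
- by move=> p /= /negP; rewrite negbK => /eqP.
Qed.

Lemma area_pos : {ae (@area R), forall p, 0 < wgt p}.
Proof.
exists [set p | wgt p = 0]; have mN : measurable [set p : T2 | wgt p = 0].
  have := measurable_wgt measurableT (measurable_set1 (0 : R)); rewrite setTI.
  by congr measurable; apply/seteqP; split => p.
split => //.
- by apply: integral0_eq => p /= ->.
- by move=> p /= /negP; rewrite -leNgt => h; apply/eqP; rewrite eq_le h wgt_ge0.
Qed.

(** Almost every point of the rectangle: the excluded lines are those where the trigonometric
    comparisons with meridians and poles could become equalities. *)
Definition good (c : R) p : Prop :=
  [/\ 0 < p.1 < pi, 0 < p.2 < 2 * pi, 0 < sin p.1, p.2 != pi & p.2 != c].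

Lemma good_ae c : {ae (@area R), forall p, good c p}.
Proof.
have H1 : {ae (@area R), forall p, p.2 != 0 /\ p.2 != 2 * pi}.
  by apply: filterS2 (area_line 0) (area_line (2 * pi)) => p.
have H2 : {ae (@area R), forall p, p.2 != pi /\ p.2 != c}.
  by apply: filterS2 (area_line pi) (area_line c) => p.
apply: filterS3 area_pos H1 H2 => p + [p0 p2] [p3 p4].
rewrite /wgt indicE; have [/set_mem|_] := boolP (p \in rect); last by rewrite mul0r ltxx.
rewrite mul1r => -[/=]; rewrite !in_itv /= => /andP[a1 a2] /andP[b1 b2] s0.
split => //; apply/andP; split; rewrite lt_neqAle ?a1 ?a2 ?b1 ?b2 ?andbT//.
- by apply/eqP => h; move: s0; rewrite -h sin0 ltxx.
- by apply/eqP => h; move: s0; rewrite h sinpi ltxx.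
- by rewrite eq_sym.
Qed.

(** The indicator of an open spherical cap. The Lipschitz functions [ramp] approximate it from
    below. *)
Definition hs v (r : R) p : R := if r < dot v (coord p) then 1 else 0.

Definition ramp (n : nat) v (r : R) p : R :=
  Num.min 1 (Num.max 0 (n%:R * (dot v (coord p) - r))).

Lemma ramp_ge0 n v r p : 0 <= ramp n v r p.
Proof. by rewrite /ramp le_min ler01 le_max lexx. Qed.

Lemma ramp_le1 n v r p : ramp n v r p <= 1.
Proof. by rewrite /ramp ge_min lexx. Qed.

Lemma ramp_norm n v r p : `|ramp n v r p| <= 1.
Proof. by rewrite ger0_norm ?ramp_ge0// ramp_le1. Qed.

Lemma clip_lip (a b : R) :
  `|Num.min 1 (Num.max 0 a) - Num.min 1 (Num.max 0 b)| <= `|a - b|.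
Proof.
have h1 := ler_norm (a - b); have h2 : b - a <= `|a - b| by rewrite distrC ler_norm.
move: h1 h2 (normr_ge0 (a - b)); move: `|a - b| => z h1 h2 z0.
rewrite ler_norml /Num.min /Num.max.
by case: (ltP 0 a) => ha; case: (ltP 0 b) => hb; case: ltP => h3; case: ltP => h4;
  apply/andP; split; lra.
Qed.

Lemma measurable_dot v : measurable_fun [set: T2] (fun p => dot v (coord p)).
Proof. by apply: measurable_Sm; exact: Sm_dot. Qed.

Lemma admissible_ramp n v r : dot v v = 1 -> admissible (ramp n v r).
Proof.
move=> v1; split.
- apply: measurable_minr; first exact: measurable_cst.
  apply: measurable_maxr; first exact: measurable_cst.
  apply: (measurable_funM (f := cst n%:R)) => //.
  by apply: measurable_funB => //; exact: measurable_dot.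
- by move=> p; exact: ramp_norm.
exists (n%:R ^+ 2 * 2) => [|p q]; first by rewrite mulr_ge0// sqr_ge0.
have h : `|ramp n v r p - ramp n v r q| <= n%:R * `|dot v (coord p - coord q)|.
  apply: (le_trans (clip_lip _ _)); rewrite -mulrBr normrM (ger0_norm (ler0n _ n)).
  rewrite ler_wpM2l// le_eqVlt; apply/orP; left; apply/eqP; congr (`|_|).
  by rewrite !dot3 !mxE /=; ring.
apply: (@le_trans _ _ ((n%:R * `|dot v (coord p - coord q)|) ^+ 2)).
  by rewrite lerXn2r ?nnegrE// mulr_ge0.
rewrite exprMn -mulrA ler_wpM2l ?sqr_ge0// real_normK ?num_real//.
by apply: (le_trans (dot_CS _ v1)); rewrite -(dotBB_gap (@coord_sphere R)).
Qed.

Lemma admissibleM f g : admissible f -> admissible g -> admissible (fun p => f p * g p).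
Proof.
move=> [mf f1 [l l0 fl]] [mg g1 [k k0 gk]]; split.
- exact: measurable_funM.
- by move=> p; rewrite normrM mulr_ile1.
exists (2 * (l + k)) => [|p q]; first by rewrite mulr_ge0// addr_ge0.
have h : `|f p * g p - f q * g q| <= `|f p - f q| + `|g p - g q|.
  have -> : f p * g p - f q * g q = (f p - f q) * g p + f q * (g p - g q) by ring.
  apply: (le_trans (ler_normD _ _)); rewrite !normrM lerD//.
    by rewrite ler_piMr.
  by rewrite ler_piMl.
have := fl p q; have := gk p q; move: h (normr_ge0 (f p * g p - f q * g q)).
move: (normr_ge0 (f p - f q)) (normr_ge0 (g p - g q)).
move: `|f p * g p - f q * g q| `|f p - f q| `|g p - g q| (gap _ p q) => a b c d.
by move=> b0 c0 abc a0 hc hb; have := sqr_ge0 (b - c); nra.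
Qed.

Lemma ramp_cvg v r p : (fun n => ramp n v r p) @ \oo --> hs v r p.
Proof.
rewrite /hs; have [h|h] := ltP r (dot v (coord p)); last first.
  rewrite (_ : (fun n => _) = fun=> 0); first exact: cvg_cst.
  apply/funext => n; rewrite /ramp (max_idPl _); last first.
    by rewrite mulr_ge0_le0// subr_le0.
  by rewrite (min_idPr _).
have d0 : 0 < dot v (coord p) - r by rewrite subr_gt0.
apply/cvgrPdist_le => eps eps0; near=> n.
have h1 : 1 <= n%:R * (dot v (coord p) - r).
  by rewrite -ler_pdivrMr// div1r; near: n; exact: nbhs_infty_ger.
rewrite /ramp (max_idPr _) ?(le_trans _ h1)//.
by rewrite (min_idPl _)// subrr normr0 ltW.
Unshelve. all: by end_near. Qed.

(** Three factors: a cap around the north pole for theta, and two hemispheres for phi. *)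
Lemma Int_hs w v1 v2 v3 r1 r2 r3 : L1 w ->
  (forall g, admissible g -> Int (fun q => g q * w q) = 0) ->
  dot v1 v1 = 1 -> dot v2 v2 = 1 -> dot v3 v3 = 1 ->
  L1 (fun q => hs v1 r1 q * hs v2 r2 q * hs v3 r3 q * w q) /\
  Int (fun q => hs v1 r1 q * hs v2 r2 q * hs v3 r3 q * w q) = 0.
Proof.
move=> Lw H V1 V2 V3.
have ag n := admissibleM (admissibleM (admissible_ramp n r1 V1) (admissible_ramp n r2 V2))
  (admissible_ramp n r3 V3).
have cv p : (fun n => ramp n v1 r1 p * ramp n v2 r2 p * ramp n v3 r3 p) @ \oo -->
    hs v1 r1 p * hs v2 r2 p * hs v3 r3 p.
  by apply: cvgM; [apply: cvgM|]; exact: ramp_cvg.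
have mh : measurable_fun [set: T2] (fun p => hs v1 r1 p * hs v2 r2 p * hs v3 r3 p).
  have mf n : measurable_fun [set: T2]
      (fun p => ramp n v1 r1 p * ramp n v2 r2 p * ramp n v3 r3 p) by have [] := ag n.
  by apply: (measurable_fun_cvg mf) => p _; exact: cv.
have [|||||L lim] := @dominated_Int _ _ _ (@area R)
  (fun n p => ramp n v1 r1 p * ramp n v2 r2 p * ramp n v3 r3 p * w p)
  (fun q => hs v1 r1 q * hs v2 r2 q * hs v3 r3 q * w q) (fun q => `|w q|).
- by move=> n; have [m _ _] := ag n; apply: measurable_funM => //; exact: L1_measurable Lw.
- by apply: measurable_funM => //; exact: L1_measurable Lw.
- exact: L1_norm.
- apply: aeW => p n; have [_ b _] := ag n.
  by rewrite normrM ler_piMl.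
- by apply: aeW => p; apply: cvgMl; exact: cv.
split => //; have := cvg_lim (@Rhausdorff R) lim => <-.
by under eq_fun do rewrite (H _ (ag _)); exact: lim_cst.
Qed.

(** Cosine decreases on [[0, pi]], so the condition on theta cuts out a cap at height [cos a]; the
    heights 2 and -2 make the cap empty or full. *)
Lemma hs_theta (a : R) : exists r : R, forall c p, good c p ->
  (if p.1 < a then 1 else 0) = hs (e_ 2%:R) r p.
Proof.
have d p : dot (e_ 2%:R) (coord p) = cos p.1 :> R.
  by rewrite dot3 !e_E !mxE /=; ring.
have pi0 := @pi_gt0 R.
have [a0|a0] := leP a 0.
  exists 2 => c p [/andP[h1 h2] _ _ _ _]; rewrite /hs d !ifF//.
    by apply/negbTE; rewrite -leNgt (le_trans (cos_le1 _))// ler1n.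
  by apply/negbTE; rewrite -leNgt (le_trans a0)// ltW.
have [api|api] := ltP pi a.
  exists (-2) => c p [/andP[h1 h2] _ _ _ _]; rewrite /hs d !ifT//.
    by rewrite (lt_le_trans _ (cos_geN1 _))// ltrN2 ltr1n.
  exact: lt_trans api.
exists (cos a) => c p [/andP[h1 h2] _ _ _ _]; rewrite /hs d.
rewrite (_ : (cos a < cos p.1) = (p.1 < a))//; apply: ltr_cos; rewrite in_itv /=.
  by apply/andP; split => //; exact: ltW.
by rewrite (ltW a0) api.
Qed.

(** The meridians 0 and [c] bound a lune, the intersection of two hemispheres if [c <= pi]; for
    larger [c] the lune is the complement of such an intersection. *)
Lemma hs_phi (c : R) : exists k0 k1 : R, exists v1 v2 : E,
  [/\ dot v1 v1 = 1, dot v2 v2 = 1 & forall p, good c p ->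
    (if p.2 < c then 1 else 0) = k0 + k1 * (hs v1 0 p * hs v2 0 p)].
Proof.
have pi0 := @pi_gt0 R.
have e1 : dot (e_ 1) (e_ 1) = 1 :> R by rewrite dot_e.
have [c0|c0] := leP c 0.
  exists 0, 0, (e_ 1), (e_ 1); split => // p [_ /andP[h1 h2] _ _ _].
  by rewrite mul0r addr0 ifF//; apply/negbTE; rewrite -leNgt (le_trans c0) ?ltW.
have [cpi|cpi] := leP (2 * pi) c.
  exists 1, 0, (e_ 1), (e_ 1); split => // p [_ /andP[h1 h2] _ _ _].
  by rewrite mul0r addr0 ifT//; exact: lt_le_trans cpi.
pose v : E := \row_j [:: sin c; - cos c; 0]`_j.
have v1 : dot v v = 1.
  by rewrite dot3 !mxE /= mulrNN mulr0 addr0 -!expr2 addrC cos2Dsin2.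
have dv p : dot v (coord p) = sin p.1 * sin (c - p.2).
  by rewrite dot3 !mxE /= sinB; ring.
have d1 p : dot (e_ 1) (coord p) = sin p.1 * sin p.2.
  by rewrite dot3 !e_E !mxE /=; ring.
have dN (x y : E) : dot (- x) y = - dot x y by rewrite -scaleN1r dotZl mulN1r.
have sneg (y : R) : - pi < y -> y < 0 -> sin y < 0.
  by move=> h1 h2; rewrite -oppr_gt0 -sinN; apply: sin_gt0_pi; apply/andP; split; lra.
have spos (y : R) : 0 < y -> y < pi -> 0 < sin y.
  by move=> h1 h2; apply: sin_gt0_pi; rewrite h1 h2.
have sneg2 (y : R) : pi < y -> y < 2 * pi -> sin y < 0.
  move=> h1 h2; rewrite -(subrK pi y) sinDpi oppr_lt0; apply: sin_gt0_pi.
  by apply/andP; split; lra.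
have [cl|cl] := leP c pi.
  exists 0, 1, (e_ 1), v; split => // p [_ /andP[h1 h2] s0 npi nc].
  rewrite /hs d1 dv !pmulr_rgt0// add0r mul1r.
  have [h|] := ltP p.2 c.
    by rewrite !spos ?mulr1//; lra.
  rewrite le_eqVlt eq_sym (negbTE nc) /= => h.
  have [h3|] := ltP p.2 pi.
    by rewrite [X in _ * X]ifF ?mulr0//; apply/negbTE; rewrite -leNgt ltW// sneg//; lra.
  rewrite le_eqVlt eq_sym (negbTE npi) /= => h3.
  by rewrite [X in X * _]ifF ?mul0r//; apply/negbTE; rewrite -leNgt ltW// sneg2.
exists 1, (-1), (- e_ 1), (- v); split; [by rewrite !dN dotC dN opprK|by rewrite !dN dotC dN opprK|].
move=> p [_ /andP[h1 h2] s0 npi nc].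
rewrite /hs !dN d1 dv -!mulrN !pmulr_rgt0// !oppr_gt0 mulN1r.
have [h|] := ltP p.2 c.
  have [h3|] := ltP p.2 pi.
    rewrite [X in X * _]ifF ?mul0r ?subr0//; apply/negbTE; rewrite -leNgt ltW// spos//.
  rewrite le_eqVlt eq_sym (negbTE npi) /= => h3.
  by rewrite [X in _ * X]ifF ?mulr0 ?subr0//; apply/negbTE; rewrite -leNgt ltW// spos//; lra.
rewrite le_eqVlt eq_sym (negbTE nc) /= => h.
by rewrite !ifT ?mulr1 ?subrr//; [apply: sneg; lra|apply: sneg2; lra].
Qed.

Definition corner (a c : R) : set T2 := [set p | p.1 < a] `&` [set p | p.2 < c].

Lemma measurable_corner a c : measurable (corner a c).
Proof.
rewrite [corner a c](_ : _ = `]-oo, a[%classic `*` `]-oo, c[%classic).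
  by apply: measurableX; exact: measurable_itv.
by apply/seteqP; split => p; rewrite /corner /= !in_itv.
Qed.

(** Half-planes generate the product sigma-algebra, and each is a countable union of corners. *)
Lemma measurable_corners :
  @measurable _ T2 = <<s [set A | exists a c, A = corner a c] >>.
Proof.
apply/seteqP; split; last first.
  apply: smallest_sub; first exact: sigma_algebra_measurable.
  by move=> _ [a [c ->]]; exact: measurable_corner.
have cup1 (a : R) : [set p : T2 | p.1 < a] = \bigcup_n corner a n%:R.
  apply/seteqP; split => p; last by case=> n _ [].
  move=> pa; exists (Num.truncn p.2).+1 => //; split => //=.
  exact: truncnS_gt.
have cup2 (a : R) : [set p : T2 | p.2 < a] = \bigcup_n corner n%:R a.
  apply/seteqP; split => p; last by case=> n _ [].
  move=> pa; exists (Num.truncn p.1).+1 => //; split => //=.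
  exact: truncnS_gt.
have sub (f : T2 -> R) :
    (forall a : R, <<s [set A | exists a c, A = corner a c] >> [set p | f p < a]) ->
    preimage_set_system setT f (@measurable _ (measurableTypeR R)) `<=`
    <<s [set A | exists a c, A = corner a c] >>.
  move=> H; rewrite [X in preimage_set_system _ _ X]RGenInftyO.measurableE.
  rewrite -g_sigma_preimageE; apply: smallest_sub; first exact: smallest_sigma_algebra.
  move=> _ [_ [x ->] <-]; rewrite setTI.
  by have := H x; congr (<<s _ >> _); apply/seteqP; split => p /=; rewrite in_itv.
apply: smallest_sub; first exact: smallest_sigma_algebra.
rewrite subUset; split; apply: sub => a.
- rewrite cup1; apply: sigma_algebra_bigcup => n.
  by apply: sub_sigma_algebra; exists a, n%:R.
- rewrite cup2; apply: sigma_algebra_bigcup => n.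
  by apply: sub_sigma_algebra; exists n%:R, a.
Qed.

Section Orthogonal.
Variable w : T2 -> R.
Hypothesis Lw : L1 w.
Hypothesis Hw : forall g, admissible g -> Int (fun q => g q * w q) = 0.

Let L1_indic (A : set T2) : measurable A -> L1 (fun q => \1_A q * w q).
Proof.
move=> mA; apply: (@L1M_bounded _ _ _ _ _ _ 1 Lw) => [|q].
  exact: measurable_indic.
by rewrite indicE; case: (_ \in _); rewrite ?normr1 ?normr0.
Qed.

Let corner0 a c : Int (fun q => \1_(corner a c) q * w q) = 0.
Proof.
have [r hr] := hs_theta a; have [k0 [k1 [v1 [v2 [V1 V2 hk]]]]] := hs_phi c.
have V3 : dot (e_ 2%:R) (e_ 2%:R) = 1 :> R by rewrite dot_e.
(* [hs] is idempotent, so the same three-factor statement covers the constant term [k0]. *)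
have [L I0] := Int_hs r r r Lw Hw V3 V3 V3.
have [L' I1] := Int_hs r 0 0 Lw Hw V3 V1 V2.
have mc := measurable_corner a c.
rewrite -[RHS](_ : Int (fun q => k0 * (hs (e_ 2%:R) r q * hs (e_ 2%:R) r q * hs (e_ 2%:R) r q * w q) +
    k1 * (hs (e_ 2%:R) r q * hs v1 0 q * hs v2 0 q * w q)) = 0); last first.
  by rewrite (IntD (L1Z _ L) (L1Z _ L')) (IntZ _ L) (IntZ _ L') I0 I1 !mulr0 addr0.
apply: ae_Int.
- exact: L1_measurable (L1_indic mc).
- exact: L1_measurable (L1D (L1Z k0 L) (L1Z k1 L')).
apply: filterS (good_ae c) => p gp.
have -> : \1_(corner a c) p = (if p.1 < a then 1 else 0) * (if p.2 < c then 1 else 0) :> R.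
  rewrite indicE; have [/set_mem [/= -> ->]|] := boolP (p \in corner a c); first by rewrite mulr1.
  move=> /negP h; case: ifP => // h1; rewrite ?mul0r//; case: ifP => // h2; rewrite ?mulr0//.
  by exfalso; apply: h; apply/mem_set.
rewrite (hr _ _ gp) (hk _ gp).
have -> : hs (e_ 2%:R) r p * hs (e_ 2%:R) r p * hs (e_ 2%:R) r p = hs (e_ 2%:R) r p.
  by rewrite /hs; case: ifP; rewrite ?mulr1 ?mulr0.
by ring.
Qed.

(** Dynkin's argument: corners are stable under intersection and generate the Borel sets, and
    orthogonality to [w] passes to complements and disjoint unions. *)
Lemma orthogonal_indic A : measurable A -> Int (fun q => \1_A q * w q) = 0.
Proof.
move=> mA; have Iw : Int w = 0.
  rewrite -[RHS](Hw (g := cst 1)); first by apply: eq_Int => q; rewrite mul1r.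
  split; [exact: measurable_cst|by move=> p; rewrite normr1|].
  by exists 0 => // p q; rewrite subrr normr0 mul0r expr0n.
apply: (@dynkin_induction _ T2 _ (fun A => Int (fun q => \1_A q * w q) = 0)
  measurable_corners _ _ _ _ _ A).
- move=> _ _ [a [c ->]] [a' [c' ->]]; exists (Num.min a a'), (Num.min c c').
  apply/seteqP; split => p /=; rewrite /corner /= !lt_min.
    by case=> -[-> ->] [-> ->].
  by case=> /andP[-> ->] /andP[-> ->].
- by rewrite -[RHS]Iw; apply: eq_Int => q; rewrite indicT mul1r.
- by move=> _ [a [c ->]]; exact: corner0.
- move=> B mB IB; rewrite (@eq_Int _ _ _ _ _ (fun q => w q - \1_B q * w q)).
    by rewrite (IntB Lw (L1_indic mB)) Iw IB subrr.
  by move=> q; rewrite !indicE in_setC; case: (_ \in B) => /=; ring.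
- move=> F mF tF IF.
  have cv p : (fun n => \sum_(k < n) \1_(F k) p) @ \oo --> (\1_(\bigcup_k F k) p : R).
    rewrite [X in _ --> X]indicE; have [/set_mem [k _ Fk]|] := boolP (p \in _); last first.
      move=> /negP h; rewrite (_ : (fun n => _) = fun=> 0); first exact: cvg_cst.
      apply/funext => n; apply: big1 => k _; rewrite indicE.
      by case: (boolP (p \in F k)) => // /set_mem Fk; exfalso; apply: h; apply/mem_set; exists k.
    apply/cvgrPdist_le => eps eps0; near=> n.
    have kn : (k < n)%N by near: n; exists k.+1.
    rewrite (bigD1 (Ordinal kn))//= indicE mem_set// big1 ?addr0 ?subrr ?normr0 ?ltW//.
    move=> j jk; rewrite indicE memNset// => Fj.
    move/negP: jk; apply; apply/eqP/val_inj => /=.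
    by apply: (tF j k) => //; exists p.
  have mc n : measurable_fun [set: T2] (fun p => \sum_(k < n) \1_(F k) p : R).
    by apply: measurable_sum => k; exact: measurable_indic.
  have Ls n : L1 (fun p => (\sum_(k < n) \1_(F k) p) * w p).
    apply: (@eq_L1 _ _ _ _ (fun p => \sum_(k < n) \1_(F k) p * w p)).
      by move=> p; rewrite mulr_suml.
    by apply: L1_sum => k; exact: L1_indic.
  have I0 n : Int (fun p => (\sum_(k < n) \1_(F k) p) * w p) = 0.
    rewrite (@eq_Int _ _ _ _ _ (fun p => \sum_(k < n) \1_(F k) p * w p)); last first.
      by move=> p; rewrite mulr_suml.
    rewrite Int_sum; last by move=> k; exact: L1_indic.
    by apply: big1 => k _; exact: IF.
  have b1 n p : `|\sum_(k < n) \1_(F k) p : R| <= 1.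
    rewrite ger0_norm; last by apply: sumr_ge0.
    case: (pselect (exists k : 'I_n, F k p)) => [[k Fk]|h].
      rewrite (bigD1 k)//= indicE mem_set// big1 ?addr0// => j jk.
      rewrite indicE memNset// => Fj; move/negP: jk; apply; apply/eqP/val_inj => /=.
      by apply: (tF j k) => //; exists p.
    rewrite big1 // => k _; rewrite indicE memNset// => Fk; apply: h; by exists k.
  have [|||||_ lim] := @dominated_Int _ _ _ (@area R)
    (fun n p => (\sum_(k < n) \1_(F k) p) * w p) (fun p => \1_(\bigcup_k F k) p * w p) (fun q => `|w q|).
  + by move=> n; exact: L1_measurable (Ls n).
  + by apply: L1_measurable; apply: L1_indic; exact: bigcupT_measurable.
  + exact: L1_norm.
  + by apply: aeW => p n; rewrite normrM ler_piMl.
  + by apply: aeW => p; apply: cvgMl; exact: cv.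
  have := cvg_lim (@Rhausdorff R) lim => <-.
  by under eq_fun do rewrite I0; exact: lim_cst.
- by rewrite -measurable_corners.
Unshelve. all: by end_near. Qed.

(** Test against the indicators of [w > 0] and of [w < 0]. *)
Lemma separating_area : {ae (@area R), forall q, w q = 0}.
Proof.
have mw := L1_measurable Lw.
have key (s : R) : s != 0 -> {ae (@area R), forall q, ~ (0 < s * w q)}.
  move=> s0; have mA : measurable [set q : T2 | 0 < s * w q].
    have h : measurable_fun [set: T2] (fun q => s * w q).
      exact: (measurable_funM (f := cst s)).
    have := h measurableT _ (measurable_itv `]0, +oo[); rewrite setTI.
    by congr measurable; apply/seteqP; split => q /=; rewrite in_itv /= andbT.
  have I0 := orthogonal_indic mA.
  have L := L1Z s (L1_indic mA).
  have h : forall q, 0 <= s * (\1_[set q | 0 < s * w q] q * w q).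
    move=> q; rewrite indicE; have [/set_mem /= h|_] := boolP (_ \in _).
      by rewrite mul1r ltW.
    by rewrite mul0r mulr0.
  have I1 : Int (fun q => s * (\1_[set q | 0 < s * w q] q * w q)) = 0.
    by rewrite (IntZ _ (L1_indic mA)) I0 mulr0.
  apply: filterS (Int_eq0_ae L h I1) => q + hq.
  by rewrite indicE mem_set// mul1r => h0; rewrite h0 ltxx in hq.
have n1 : (- 1 : R) != 0 by rewrite oppr_eq0 oner_neq0.
apply: filterS2 (key 1 (oner_neq0 _)) (key (-1) n1) => q.
rewrite mul1r mulN1r => /negP h1 /negP h2; apply/eqP; rewrite eq_le.
by rewrite leNgt h1 /= leNgt -oppr_gt0 h2.
Qed.

End Orthogonal.

End Separation.

(** * Gradient, divergence and Dirac operator of smooth functions *)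

Section Radial.
Context {R : realType}.
Local Notation E := 'rV[R]_3.
Local Notation SmT := (Sm [set: E]).
Local Notation U := [set y : E | y != 0].
Implicit Types (f g : E -> R) (x y X : E).

Lemma dot_gt0 y : y != 0 -> 0 < dot y y.
Proof.
move=> y0; rewrite lt_neqAle dot_ge0 andbT eq_sym; apply: contra y0 => /eqP h.
apply/eqP/matrixP => i j; rewrite ord1 mxE; apply/eqP; rewrite -sqrf_eq0.
have := dot_ge0 y; move: h; rewrite dot3 => h _.
have := sqr_ge0 (y 0 0); have := sqr_ge0 (y 0 1); have := sqr_ge0 (y 0 2%:R).
by move: h; rewrite -!expr2 => h h2 h1 h0; apply/eqP; move: j; apply: ord3P; lra.
Qed.

Lemma open_neq0 : open U.
Proof.
rewrite (_ : U = (fun y : E => dot y y) @^-1` [set r | 0 < r]).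
  apply: open_comp; last exact: open_gt.
  by move=> x _; exact: Sm_continuous Sm_dotxx x.
apply/seteqP; split => y /=; first exact: dot_gt0.
by apply: contraTneq => ->; rewrite dot3 !mxE mul0r !addr0 ltxx.
Qed.

(** [1 / |y|], written with [expR] and [ln] so that it belongs to [Sm] away from the origin. *)
Definition rnorm y : R := expR (- 2^-1 * ln (dot y y)).

Lemma rnormE y : y != 0 -> (Num.sqrt (dot y y))^-1 = rnorm y.
Proof.
move=> /dot_gt0 d0; rewrite /rnorm mulNr expRN; congr (_^-1).
rewrite -{1}(lnK d0) -(powR12_sqrt (expR_ge0 _)) /powR gt_eqF ?expR_gt0//.
by rewrite expRK.
Qed.

Lemma Sm_rnorm : Sm U rnorm.
Proof.
apply: Sm_expR; apply: SmZ; apply: Sm_ln => [|y /= /dot_gt0//].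
by apply: Sm_sum => j; apply: SmM; exact: Sm_coord.
Qed.

Lemma Sm_radial_coord j : Sm U (radial (fun x => x 0 j)).
Proof.
apply: (Sm_eq (SmM Sm_rnorm (Sm_coord U j))) => y /= y0.
by rewrite /radial mxE rnormE.
Qed.

Lemma radial_sphere f x : sphere x -> radial f x = f x.
Proof. by rewrite /radial /sphere /= => ->; rewrite sqrtr1 invr1 scale1r. Qed.

Lemma Sm_radial f : SmT f -> Sm U (radial f).
Proof.
elim=> {f}.
- by move=> c; exact: Sm_cst.
- exact: Sm_radial_coord.
- by move=> f g _ Sf _ Sg; exact: SmD Sf Sg.
- by move=> f g _ Sf _ Sg; exact: SmM Sf Sg.
- by move=> f _ Sf; exact: Sm_expR Sf.
- by move=> f _ Sf f0; apply: (Sm_ln Sf) => x _; exact: f0.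
- by move=> f g _ Sf fg; have -> : g = f by apply/funext => x; exact: fg.
Qed.

Lemma smooth_Sm f : SmT f -> smooth f.
Proof. by move=> Sf; apply: Sm_smooth_on; [exact: open_neq0|exact: Sm_radial]. Qed.

Lemma sphere_neq0_point x : sphere x -> x != 0.
Proof.
move=> xs; apply/eqP => x0; move: xs; rewrite /sphere /= x0 dot3 !mxE !mul0r !addr0.
by move=> /eqP; rewrite eq_sym oner_eq0.
Qed.

Lemma derive_dotxx x X : 'D_X (fun z : E => dot z z) x = 2 * dot x X.
Proof.
rewrite derive_sum_coord; last exact: Sm_dotxx.
have h k : 'D_(e_ k) (fun z : E => dot z z) x = 2 * x 0 k.
  have S l : SmT (fun z : E => z 0 l * z 0 l) by apply: SmM; exact: Sm_coord.
  rewrite (_ : (fun z : E => dot z z) = fun z => (z 0 0 * z 0 0 + z 0 1 * z 0 1) + z 0 2%:R * z 0 2%:R).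
    rewrite (SmDE openT) //; last exact: SmD.
    rewrite (SmDE openT) // !(SmME openT) //; try exact: Sm_coord.
    by rewrite !derive_coord !e_E; move: k; apply: ord3P => /=; ring.
  by apply/funext => z; rewrite dot3.
by rewrite !h dot3; ring.
Qed.

(** Both sides obey the same rules, so only coordinate functions carry content: at a point of the
    sphere the differential of [y / |y|] fixes tangent vectors. *)
Lemma sder_Sm f x X : SmT f -> sphere x -> dot X x = 0 -> sder f x X = 'D_X f x.
Proof.
move=> Sf xs Xx; have Ux := sphere_neq0_point xs; have oU := open_neq0.
rewrite /sder; elim: Sf => {f}.
- by move=> c; rewrite /radial !derive_cst.
- move=> j; rewrite derive_coord.
  rewrite (derive_eq_on (U := U) (f := fun y => rnorm y * y 0 j) oU X Ux); last first.
    by move=> y y0; rewrite /radial mxE rnormE.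
  rewrite (SmME oU) //; [|exact: Sm_rnorm|exact: Sm_coord].
  have SD : Sm U (fun z => dot z z) by apply: Sm_sum => k; apply: SmM; exact: Sm_coord.
  have SL : Sm U (fun z => ln (dot z z)) by apply: Sm_ln => // y /= /dot_gt0.
  rewrite (Sm_expRE oU)//; last exact: SmZ.
  rewrite (SmME oU) //; last exact: Sm_cst.
  rewrite derive_cst (Sm_lnE oU)// ?derive_dotxx ?derive_coord; last by rewrite xs.
  rewrite (dotC x X) Xx /rnorm xs ln1 mulr0 expR0; ring.
- move=> f g Sf Hf Sg Hg; have Rf := Sm_radial Sf; have Rg := Sm_radial Sg.
  by rewrite [RHS](SmDE openT X Sf Sg I) -Hf -Hg; exact: (SmDE oU X Rf Rg Ux).
- move=> f g Sf Hf Sg Hg; have Rf := Sm_radial Sf; have Rg := Sm_radial Sg.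
  rewrite [RHS](SmME openT X Sf Sg I) -Hf -Hg -(radial_sphere f xs) -(radial_sphere g xs).
  exact: (SmME oU X Rf Rg Ux).
- move=> f Sf Hf; have Rf := Sm_radial Sf.
  rewrite [RHS](Sm_expRE openT X Sf I) -Hf -(radial_sphere f xs); exact: (Sm_expRE oU X Rf Ux).
- move=> f Sf Hf f0; have Rf := Sm_radial Sf.
  rewrite [RHS](Sm_lnE openT X Sf I (f0 _ I)) -Hf -(radial_sphere f xs); apply: (Sm_lnE oU X Rf Ux).
  by rewrite radial_sphere//; exact: f0.
- by move=> f g Sf Hf fg; have -> : g = f by apply/funext => z; exact: fg.
Qed.

Lemma tproj_tangent x X : sphere x -> dot (tproj x X) x = 0.
Proof.
move=> xs; rewrite /tproj dotDl -scaleN1r !dotZl xs; ring.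
Qed.

Lemma tprojE x (j k : 'I_3) : tproj x (e_ j) 0 k = (j == k)%:R - x 0 j * x 0 k.
Proof.
rewrite /tproj !mxE eq_sym; congr (_%:R - _ * _).
by rewrite dot3 !e_E; move: j; apply: ord3P => /=; ring.
Qed.

Definition nab f x : E := \row_k 'D_(e_ k) f x.

Lemma derive_nab f x X : SmT f -> 'D_X f x = dot (nab f x) X.
Proof.
move=> Sf; have N k : nab f x 0 k = 'D_(e_ k) f x by rewrite mxE.
by rewrite derive_sum_coord// dot3 !N; ring.
Qed.

(** The projections of an orthonormal basis of R^3 form a Parseval frame of the tangent plane. *)
Lemma sum_tproj_vec (x a : E) : sphere x ->
  \sum_j dot a (tproj x (e_ j)) *: tproj x (e_ j) = tproj x a.
Proof.
rewrite big_ord3 /sphere /= dot3 => x1.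
apply/matrixP => i k; rewrite ord1.
have M (u v w : E) : (u + v + w) 0 k = u 0 k + v 0 k + w 0 k by rewrite !mxE.
have Z (c : R) (u : E) : (c *: u) 0 k = c * u 0 k by rewrite mxE.
have T : tproj x a 0 k = a 0 k - dot a x * x 0 k by rewrite /tproj !mxE.
rewrite M !Z T !dot3 !tprojE.
have -> : a 0 k - (a 0 0 * x 0 0 + a 0 1 * x 0 1 + a 0 2%:R * x 0 2%:R) * x 0 k =
  a 0 k - (a 0 0 * x 0 0 + a 0 1 * x 0 1 + a 0 2%:R * x 0 2%:R) * x 0 k +
  (a 0 0 * x 0 0 + a 0 1 * x 0 1 + a 0 2%:R * x 0 2%:R) * x 0 k *
  (x 0 0 * x 0 0 + x 0 1 * x 0 1 + x 0 2%:R * x 0 2%:R - 1) by rewrite x1 subrr mulr0 addr0.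
by clear; move: k; apply: ord3P => /=; ring.
Qed.

Lemma grad_Sm f x : SmT f -> sphere x -> grad f x = tproj x (nab f x).
Proof.
move=> Sf xs; rewrite /grad.
rewrite (eq_bigr (fun j => dot (nab f x) (tproj x (e_ j)) *: tproj x (e_ j))); last first.
  by move=> j _; rewrite sder_Sm ?tproj_tangent// derive_nab.
exact: sum_tproj_vec.
Qed.

End Radial.

(** * Logarithmic and spinorial test functions *)

Section TestFunctions.
Context {R : realType}.
Local Notation E := 'rV[R]_3.
Local Notation C := (R[i]).
Local Notation SmT := (Sm [set: E]).
Local Notation T2 := (measurableTypeR R * measurableTypeR R)%type.
Implicit Types (f g : E -> R) (x y X : E) (t : R) (v : 'cV[R]_4).

Lemma derive_dot y x X : 'D_X (fun z : E => dot y z) x = dot y X.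
Proof.
have S l : SmT (fun z : E => y 0 l * z 0 l) by apply: SmZ; exact: Sm_coord.
rewrite (_ : (fun z : E => dot y z) = fun z => (y 0 0 * z 0 0 + y 0 1 * z 0 1) + y 0 2%:R * z 0 2%:R).
  rewrite (SmDE openT) //; last exact: SmD.
  rewrite (SmDE openT) // !(SmME openT) //; try exact: Sm_coord; try exact: Sm_cst.
  by rewrite !derive_coord !derive_cst dot3; ring.
by apply/funext => z; rewrite dot3.
Qed.

Lemma derive_zz t y x X : 'D_X (zz t y) x = dot x X - dot y X.
Proof.
have Sd := Sm_dot y; have Sdd := @Sm_dotxx R.
rewrite (_ : zz t y = fun x => (t + dot y y / 2) + (2^-1 * dot x x - dot y x)); last first.
  by apply/funext => z; rewrite zzE mulrDl [dot z z * _]mulrC !addrA.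
have S2 : SmT (fun x => 2^-1 * dot x x) by exact: SmZ.
rewrite (SmDE openT)//; [|exact: Sm_cst|exact: SmB].
rewrite derive_cst add0r (SmDE openT)//; last exact: SmN.
have -> : 'D_X (fun z : E => - dot y z) x = - dot y X.
  rewrite (_ : (fun z : E => - dot y z) = fun z => -1 * dot y z).
    by rewrite (SmME openT)// ?derive_cst ?derive_dot; [ring|exact: Sm_cst].
  by apply/funext => z; rewrite mulN1r.
rewrite (SmME openT)//; last exact: Sm_cst.
by rewrite derive_cst derive_dotxx; field.
Qed.

Lemma derive_zzV t y x X : 0 < t ->
  'D_X (fun z => (zz t y z)^-1) x = (zz t y x)^-1 ^+ 2 * (dot y X - dot x X).
Proof.
move=> t0; have z0 z := zz_gt0 y z t0; have SL := Sm_lnzz y t0.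
have -> : (fun z => (zz t y z)^-1) = (fun z => expR (- 1 * ln (zz t y z))).
  by apply/funext => z; rewrite mulN1r expRN lnK// posrE.
rewrite (Sm_expRE openT)//; last exact: SmZ.
rewrite (SmME openT)//; last exact: Sm_cst.
rewrite derive_cst (Sm_lnE openT)//; last exact: Sm_zz.
by rewrite derive_zz mulN1r expRN lnK ?posrE//; ring.
Qed.

(** The gradient of [ln z] on the sphere in closed form, so that its coordinates belong to [Sm]. *)
Definition gradk t y x : E := - (zz t y x)^-1 *: (y - dot y x *: x).

Lemma gradkE t y x k : gradk t y x 0 k = - (zz t y x)^-1 * (y 0 k - dot y x * x 0 k).
Proof. by rewrite !mxE. Qed.

Lemma Sm_gradk t y k : 0 < t -> SmT (fun x => gradk t y x 0 k).
Proof.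
move=> t0; have SV := Sm_zzV y t0; have Sd := Sm_dot y.
apply: (@Sm_eq _ _ (fun x => - (zz t y x)^-1 * (y 0 k - dot y x * x 0 k))).
  apply: SmM; first exact: SmN.
  by apply: SmB; [exact: Sm_cst|apply: SmM => //; exact: Sm_coord].
by move=> x _; rewrite gradkE.
Qed.

Lemma smooth_field_gradk t y : 0 < t -> smooth_field (gradk t y).
Proof.
move=> t0; split; first by move=> k; apply: smooth_Sm; exact: Sm_gradk.
move=> x xs; have := xs; rewrite /sphere /= /gradk dotZl -scaleNr dotDl dotZl => ->; ring.
Qed.

Lemma grad_lnzz t y x : 0 < t -> sphere x ->
  grad (fun z => ln (zz t y z)) x = gradk t y x.
Proof.
move=> t0 xs; have z0 := zz_gt0 y x t0; rewrite grad_Sm//; last exact: Sm_lnzz.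
have -> : nab (fun z => ln (zz t y z)) x = (zz t y x)^-1 *: (x - y).
  apply/matrixP => i k; rewrite ord1 mxE (Sm_lnE openT)//; last exact: Sm_zz.
  rewrite derive_zz [RHS]mxE [(x - y) 0 k]mxE [(- y) 0 k]mxE.
  congr (_ * (_ - _)); rewrite dot3 !e_E; move: k; apply: ord3P => /=; ring.
rewrite /tproj /gradk dotZl dotDl -scaleN1r dotZl xs.
by apply/matrixP => i k; rewrite !mxE; ring.
Qed.

Lemma sum_tproj x y : sphere x ->
  \sum_j dot y (tproj x (e_ j)) ^+ 2 = dot y y - dot y x ^+ 2.
Proof.
rewrite /sphere /= => xs; have x1 := xs; rewrite dot3 in x1.
have h j : dot y (tproj x (e_ j)) = y 0 j - x 0 j * dot y x.
  rewrite [LHS]dot3 !tprojE dot3; clear; move: j; apply: ord3P => /=; ring.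
under eq_bigr do rewrite h.
rewrite big_ord3; have -> : dot y y - dot y x ^+ 2 = dot y y - dot y x ^+ 2 +
    dot y x ^+ 2 * (x 0 0 * x 0 0 + x 0 1 * x 0 1 + x 0 2%:R * x 0 2%:R - 1).
  by rewrite x1 subrr mulr0 addr0.
rewrite !dot3; ring.
Qed.

Lemma sum_tproj_sq x : sphere x ->
  \sum_j dot (tproj x (e_ j)) (tproj x (e_ j)) = 2.
Proof.
rewrite /sphere /= => xs; have x1 := xs; rewrite dot3 in x1.
have h j : dot (tproj x (e_ j)) (tproj x (e_ j)) = 1 - x 0 j ^+ 2.
  have -> : 1 - x 0 j ^+ 2 = 1 - x 0 j ^+ 2 +
    x 0 j ^+ 2 * (x 0 0 * x 0 0 + x 0 1 * x 0 1 + x 0 2%:R * x 0 2%:R - 1).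
    by rewrite x1 subrr mulr0 addr0.
  rewrite dot3 !tprojE; clear; move: j; apply: ord3P => /=; ring.
rewrite (eq_bigr _ (fun j _ => h j)) big_ord3; move: x1; rewrite -!expr2; lra.
Qed.

(** The value found in [lap_ln], recomputed because the weak equation is stated with [grad] and
    [div] and not with rotation fields. *)
Lemma div_gradk t y x : 0 < t -> sphere x -> sphere y ->
  div (gradk t y) x = t * (2 + t) * (t + (1 - dot y x))^-1 ^+ 2 - 1.
Proof.
move=> t0 xs ys; have z0 := zz_gt0 y x t0; have SV := Sm_zzV y t0; have Sd := Sm_dot y.
have h (j : 'I_3) : dot (\row_k sder (fun z => gradk t y z 0 k) x (tproj x (e_ j))) (tproj x (e_ j)) =
    - (zz t y x)^-1 ^+ 2 * dot y (tproj x (e_ j)) ^+ 2 +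
    (zz t y x)^-1 * dot y x * dot (tproj x (e_ j)) (tproj x (e_ j)).
  have Xx := tproj_tangent (e_ j) xs; move: (tproj x (e_ j)) Xx => X Xx.
  have hk k : sder (fun z => gradk t y z 0 k) x X =
      - ((zz t y x)^-1 ^+ 2 * dot y X) * (y 0 k - dot y x * x 0 k) +
      (zz t y x)^-1 * (dot y X * x 0 k + dot y x * X 0 k).
    have Sk := Sm_gradk y k t0; rewrite sder_Sm//.
    rewrite (_ : (fun z => gradk t y z 0 k) = fun z => (zz t y z)^-1 * (dot y z * z 0 k + - y 0 k)).
      have S1 : SmT (fun z : E => dot y z * z 0 k) by apply: SmM => //; exact: Sm_coord.
      rewrite (SmME openT)//; last by apply: SmD => //; exact: Sm_cst.
      rewrite (SmDE openT)//; last exact: Sm_cst.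
      rewrite derive_cst (SmME openT)//; last exact: Sm_coord.
      rewrite derive_coord derive_dot derive_zzV// (dotC x X) Xx; ring.
    by apply/funext => z; rewrite gradkE; ring.
  rewrite dot3 !mxE !hk; move: Xx; rewrite [dot X x]dot3 => Xx.
  have -> : dot y X = y 0 0 * X 0 0 + y 0 1 * X 0 1 + y 0 2%:R * X 0 2%:R by rewrite dot3.
  rewrite [dot X X]dot3; move: (dot y x) ((zz t y x)^-1) => c z.
  set Y := y 0 0 * X 0 0 + y 0 1 * X 0 1 + y 0 2%:R * X 0 2%:R.
  rewrite [LHS](_ : _ = - z ^+ 2 * Y ^+ 2 + z * c * (X 0 0 * X 0 0 + X 0 1 * X 0 1 + X 0 2%:R * X 0 2%:R) +
    (z ^+ 2 * c * Y + z * Y) * (X 0 0 * x 0 0 + X 0 1 * x 0 1 + X 0 2%:R * x 0 2%:R)).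
    by rewrite Xx mulr0 addr0.
  by rewrite /Y; ring.
rewrite /div (eq_bigr _ (fun j _ => h j)) big_split /= -!mulr_sumr sum_tproj// sum_tproj_sq// ys.
have := z0; rewrite (zz_sphere t xs ys) => zp; field; by rewrite gt_eqF.
Qed.

Definition cplx v : 'cV[C]_2 :=
  \col_k (if k == 0 then v 0 0 +i* v 1 0 else v 2%:R 0 +i* v 3%:R 0)%C.

Definition rvec (s : 'cV[C]_2) : 'cV[R]_4 := \col_k
  [:: complex.Re (s 0 0); complex.Im (s 0 0); complex.Re (s 1 0); complex.Im (s 1 0)]`_k.

Lemma ord2P (P : 'I_2 -> Prop) : P 0 -> P 1 -> forall k, P k.
Proof.
move=> P0 P1 [[|[|//]] h].
- by rewrite (_ : Ordinal h = 0) //; apply: val_inj.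
- by rewrite (_ : Ordinal h = 1) //; apply: val_inj.
Qed.

Lemma rvec_cplx v : rvec (cplx v) = v.
Proof.
by apply/matrixP => k i; rewrite ord1; move: k; apply: ord4P; rewrite !mxE /=.
Qed.

Lemma rvec_eq0 s : rvec s = 0 -> s = 0.
Proof.
move=> /matrixP h; have := h 0 0; have := h 1 0; have := h 2%:R 0; have := h 3%:R 0.
rewrite !mxE /= => h3 h2 h1 h0; apply/matrixP => k i; rewrite ord1 [RHS]mxE.
move: k; apply: ord2P; apply/eqP; rewrite eq_complex /=; apply/andP; split; exact/eqP.
Qed.

Lemma Re_hdot s s' : complex.Re (hdot s s') = ip (rvec s) (rvec s').
Proof.
rewrite /hdot big_ord_recr big_ord1 /= ip4 !mxE /=.
rewrite (_ : widen_ord _ _ = 0); last exact: val_inj.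
rewrite (_ : ord_max = 1); last exact: val_inj.
case: (s 0 0) (s 1 0) (s' 0 0) (s' 1 0) => [a b] [c d] [a' b'] [c' d'] /=; ring.
Qed.

Lemma sqnorm_rvec s : sqnorm s = nsq (rvec s).
Proof. by rewrite /sqnorm Re_hdot. Qed.

Lemma cplxD v w : cplx (v + w) = cplx v + cplx w.
Proof.
by apply/matrixP => k i; rewrite ord1; move: k; apply: ord2P; rewrite !mxE /=; simpc.
Qed.

Lemma cplxZ (c : R) v : cplx (c *: v) = (c%:C)%C *: cplx v.
Proof.
by apply/matrixP => k i; rewrite ord1; move: k; apply: ord2P; rewrite !mxE /=; simpc.
Qed.

Lemma clifford_cplx X v : clifford X (cplx v) = cplx (qmul X v).
Proof.
apply/matrixP => k i; rewrite ord1 /clifford !mxE !big_ord_recr big_ord0 /= !mxE /= add0r.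
by move: k; apply: ord2P => /=; simpc; congr (_ +i* _)%C; ring.
Qed.

(** Each [clifford] carries a factor [i], and [i^2 = -1] accounts for the sign. *)
Lemma conn_clifford2 x X s : conn x X s = ((- 2^-1)%:C)%C *: clifford x (clifford X s).
Proof.
have -> : ((- 2^-1 : R)%:C)%C = - 2%:R^-1 by rewrite rmorphN fmorphV rmorph_nat.
rewrite /conn /clifford -!scalemxAr !scalerA; congr (_ *: _).
have -> : (0 +i* 1)%C = 'i%C :> C by [].
by rewrite -mulrA -expr2 sqr_i mulrN1 opprK.
Qed.

Definition derv X (Phi : E -> 'cV[R]_4) x : 'cV[R]_4 :=
  \col_k 'D_X (fun z => Phi z k 0) x.

Lemma spinor_der_cplx Phi x X : Smv Phi -> sphere x -> dot X x = 0 ->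
  spinor_der (fun z => cplx (Phi z)) x X = cplx (derv X Phi x).
Proof.
move=> SP xs Xx; apply/matrixP => k i; rewrite ord1 !mxE.
have h l : sder (fun z => Phi z l 0) x X = 'D_X (fun z => Phi z l 0) x by rewrite sder_Sm.
by move: k; apply: ord2P => /=; rewrite -!h; congr (sder _ _ _ +i* sder _ _ _)%C; apply/funext => z;
  rewrite mxE.
Qed.

Lemma smooth_spinor_cplx Phi : Smv Phi -> smooth_spinor (fun z => cplx (Phi z)).
Proof.
move=> SP; apply: ord2P; split; apply: smooth_Sm.
- by apply: (Sm_eq (SP 0)) => z _; rewrite mxE.
- by apply: (Sm_eq (SP 1)) => z _; rewrite mxE.
- by apply: (Sm_eq (SP 2%:R)) => z _; rewrite mxE.
- by apply: (Sm_eq (SP 3%:R)) => z _; rewrite mxE.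
Qed.

(** For tangent [X] the connection term contributes [- 1/2 |X|^2 I(x) psi], because [I(X)] and
    [I(x)] anticommute; the squared lengths of the projected basis vectors add up to 2. *)
Lemma dirac_cplx Phi x : Smv Phi -> sphere x ->
  dirac (fun z => cplx (Phi z)) x =
  cplx (\sum_j qmul (tproj x (e_ j)) (derv (tproj x (e_ j)) Phi x) - qmul x (Phi x)).
Proof.
move=> SP xs; rewrite /dirac.
rewrite (eq_bigr (fun j => cplx (qmul (tproj x (e_ j)) (derv (tproj x (e_ j)) Phi x) -
    (2^-1 * dot (tproj x (e_ j)) (tproj x (e_ j))) *: qmul x (Phi x)))); last first.
  move=> j _; have Xx := tproj_tangent (e_ j) xs; move: (tproj x (e_ j)) Xx => X Xx.
  rewrite /nabla spinor_der_cplx// conn_clifford2 !clifford_cplx -cplxZ -cplxD clifford_cplx.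
  congr cplx; rewrite qmulDr; congr (_ + _).
  rewrite qmulZr; have := qmulAC X x (qmul X (Phi x)); rewrite Xx mulr0 scale0r.
  move=> /eqP; rewrite addr_eq0 => /eqP ->; rewrite qmul_sq qmulZr.
  by move: (qmul x (Phi x)) => w; apply/matrixP => i k; rewrite !mxE; ring.
have cplx0 : cplx 0 = 0 by rewrite -(scale0r (0 : 'cV[R]_4)) cplxZ scale0r.
rewrite -(big_morph cplx cplxD cplx0); congr cplx.
by rewrite sumrB -scaler_suml -mulr_sumr sum_tproj_sq// mulVf ?scale1r.
Qed.

Lemma derv_spk t y v x X : 0 < t -> dot X x = 0 ->
  derv X (spk t y v) x = ((zz t y x)^-1 ^+ 2 * dot y X) *: qmul (y - x) v -
    (zz t y x)^-1 *: qmul X v.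
Proof.
move=> t0 Xx; have SV := Sm_zzV y t0; apply/matrixP => k i; rewrite ord1 mxE.
rewrite (_ : (fun z => spk t y v z k 0) = fun z => (zz t y z)^-1 *
   ((qmul y v k 0 + -1 * (ev 0 v k 0 * z 0 0 + ev 1 v k 0 * z 0 1 + ev 2%:R v k 0 * z 0 2%:R)))); last first.
  apply/funext => z; rewrite /spk qmulBl (qmul_lin z).
  move: (qmul y v) (ev 0 v) (ev 1 v) (ev 2%:R v) => a b c d; rewrite !mxE; ring.
have Sc l (c : R) : SmT (fun x => c * x 0 l) by apply: SmZ; exact: Sm_coord.
have S2 : SmT (fun z => ev 0 v k 0 * z 0 0 + ev 1 v k 0 * z 0 1) by exact: SmD.
have S3 : SmT (fun z => ev 0 v k 0 * z 0 0 + ev 1 v k 0 * z 0 1 + ev 2%:R v k 0 * z 0 2%:R).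
  exact: SmD.
have S4 := SmZ (-1) S3.
rewrite (SmME openT)//; last by apply: SmD => //; exact: Sm_cst.
rewrite (SmDE openT)//; last exact: Sm_cst.
rewrite derive_cst (SmME openT)//; last exact: Sm_cst.
rewrite derive_cst (SmDE openT)// (SmDE openT)//.
have hc l (c : R) : 'D_X (fun z : E => c * z 0 l) x = c * X 0 l.
  rewrite (SmME openT)//; [|exact: Sm_cst|exact: Sm_coord].
  by rewrite derive_cst derive_coord mulr0 addr0.
rewrite !hc derive_zzV// (dotC x X) Xx qmulBl (qmul_lin x) (qmul_lin X).
move: (qmul y v) (ev 0 v) (ev 1 v) (ev 2%:R v) => a b c d; rewrite !mxE; ring.
Qed.

(** As for [Sop_spk], [1 - <y, x> = z - t] cancels the singular parts and leaves a factor [t]: the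
    kernel solves the Dirac equation up to a smeared point source. *)
Lemma dirac_spk t y v x : 0 < t -> sphere x -> sphere y ->
  dirac (fun z => cplx (spk t y v z)) x =
  cplx ((t * (zz t y x)^-1 ^+ 2) *: (v - qmul x (qmul y v))).
Proof.
move=> t0 xs ys; rewrite dirac_cplx//; last exact: Smv_spk.
congr cplx; set b := (zz t y x)^-1.
have Eb : b * (t + (1 - dot y x)) = 1.
  by rewrite /b -zz_sphere// mulVf// gt_eqF// zz_gt0.
rewrite (eq_bigr (fun j => b ^+ 2 *: qmul (dot y (tproj x (e_ j)) *: tproj x (e_ j)) (qmul (y - x) v) +
   (b * dot (tproj x (e_ j)) (tproj x (e_ j))) *: v)); last first.
  move=> j _; rewrite derv_spk// ?tproj_tangent// -/b qmulBr !qmulZr qmulZl qmul_sq.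
  by rewrite scaleNr scalerN opprK !scalerA.
have qs (F : 'I_3 -> E) w : \sum_j qmul (F j) w = qmul (\sum_j F j) w.
  by rewrite !big_ord3 !qmulDl.
have Py := sum_tproj_vec y xs; rewrite /tproj -/(tproj _ _) in Py.
rewrite big_split /= -scaler_sumr qs Py -scaler_suml -mulr_sumr sum_tproj_sq//.
have yx : qmul y (qmul x v) = - (2 * dot y x) *: v - qmul x (qmul y v).
  by rewrite -[LHS](addrK (qmul x (qmul y v))) qmulAC mulNr.
rewrite /spk -/b !qmulZr !qmulBl !qmulBr qmulZl !qmul_sq xs ys yx.
rewrite qmulZl qmul_sq xs.
have -> : t * b ^+ 2 = b * (b * (t + (1 - dot y x))) - b ^+ 2 * (1 - dot y x) by ring.
rewrite Eb; move: (qmul x (qmul y v)) => w.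
by apply/matrixP => i k; rewrite !mxE; ring.
Qed.

End TestFunctions.

(** * Weak solutions *)

Section WeakSolution.
Context {R : realType}.
Local Notation E := 'rV[R]_3.
Local Notation SmT := (Sm [set: E]).
Local Notation T2 := (measurableTypeR R * measurableTypeR R)%type.
Local Notation m2 := (lebesgue_measure \x lebesgue_measure : {measure set T2 -> \bar R})%E.
Local Notation coordT := (coord : T2 -> E).
Local Notation L1 := (L1fun (@area R)).
Local Notation Int := (Lint (@area R)).
Implicit Types (f g h : E -> R) (x y : E) (p q : T2).

(** Cut off outside the rectangle, where [smeasurable] gives no information. *)
Definition lift f : T2 -> R := fun p => \1_rect p * f (coord p).

Lemma lift_rect f p : rect p -> lift f p = f (coord p).
Proof. by move=> pr; rewrite /lift indicE mem_set// mul1r. Qed.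

Lemma measurable_lift f : smeasurable f -> measurable_fun [set: T2] (lift f).
Proof.
move=> mf; have mr : measurable (rect : set T2) by exact: measurable_rect.
have /(measurable_restrictT _ mr).1 : measurable_fun (rect : set T2) (f \o coord : T2 -> R) by exact: mf.
congr measurable_fun; apply/funext => p; rewrite patchE /lift indicE.
by case: ifP => _; rewrite ?mul1r ?mul0r.
Qed.

Lemma fine_sint f (F : T2 -> R) : measurable_fun [set: T2] F ->
  (forall p, rect p -> F p = f (coord p)) -> fine (sint f) = Int F.
Proof. by move=> mF Ff; rewrite (sint_area mF Ff) LintE. Qed.

Lemma eq_sint f g : (forall x, sphere x -> f x = g x) -> sint f = sint g.
Proof.
move=> fg; rewrite /sint; apply: eq_integral => p _; rewrite fg//.
exact: coord_sphere.
Qed.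

Lemma L1_sq f : L2 f -> L1 (fun p => lift f p ^+ 2).
Proof.
case=> mf ff; have mF : measurable_fun [set: T2] (fun p => lift f p ^+ 2).
  by apply: measurable_funX; exact: measurable_lift.
apply/integrableP; split; first exact/measurable_EFinP.
rewrite (@sint_area _ _ _ mF) in ff; last by move=> p pr; rewrite lift_rect.
apply: le_lt_trans ff; apply: ge0_le_integral => //.
- by apply: measurableT_comp => //; exact/measurable_EFinP.
- exact/measurable_EFinP.
- by move=> p _; rewrite /= lee_fin ger0_norm// sqr_ge0.
Qed.

Lemma cvg_rV (u : nat -> E) (l : E) : (forall j, (fun n => u n 0 j) @ \oo --> l 0 j) ->
  u @ \oo --> l.
Proof.
move=> ul A [P Pl PA]; apply: (@filterS _ \oo _ [set n | forall j, P 0 j (u n 0 j)]).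
  by move=> n Pn; apply: PA => i j; rewrite ord1.
apply: (@filter_forall _ _ (fun j n => P 0 j (u n 0 j)) \oo _) => j; exact: (ul j _ (Pl 0 j)).
Qed.

Lemma smooth_continuous h : smooth h -> {in sphere, continuous (radial h)}.
Proof.
move=> sh x /set_mem xs; apply: differentiable_continuous.
exact: (sh [::] x (sphere_neq0_point xs)).
Qed.

(** By continuity of the radial extension, [h] is the pointwise limit of its values at the nodes of
    ever finer cells, which are step functions. *)
Lemma measurable_smooth h : smooth h -> measurable_fun [set: T2] (fun p => h (coord p)).
Proof.
move=> sh; pose e : T2 -> E := coord.
pose hn n p : R := h (e (node e (cell e n.+1 p))).
apply: (@measurable_realfun.measurable_fun_cvg _ _ _ _ hn).
  move=> n; rewrite (_ : hn n = fun p => \sum_i (cell e n.+1 p == i)%:R * h (e (node e i))).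
    apply: measurable_sum => i; apply: measurable_funM => //.
    by apply: measurable_cell; [exact: coord_sphere|exact: measurable_coord].
  apply/funext => p; rewrite (bigD1 (cell e n.+1 p))//= eqxx mul1r big1 ?addr0//.
  by move=> i /negPf; rewrite eq_sym => ->; rewrite mul0r.
move=> p _; rewrite -(radial_sphere h (coord_sphere p)).
have -> : hn ^~ p = fun n => radial h (e (node e (cell e n.+1 p))).
  by apply/funext => n; rewrite radial_sphere//; exact: coord_sphere.
apply: continuous_cvg; first by apply: smooth_continuous => //; apply/mem_set; exact: coord_sphere.
apply: cvg_rV => j; apply: node_cvg; exact: coord_sphere.
Qed.

Lemma smooth_bounded h : smooth h -> exists c : R, forall x, sphere x -> `|h x| <= c.
Proof.
move=> sh; have [c hc] := sphere_bounded (smooth_continuous sh).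
by exists c => x xs; rewrite -(radial_sphere h xs); exact: hc.
Qed.

Lemma smooth_min h : smooth h -> (forall x, sphere x -> 0 < h x) ->
  exists2 c : R, 0 < c & forall x, sphere x -> c <= h x.
Proof.
move=> sh h0; have [||c cs hc] := @compact_EVT_min _ R (radial h) sphere sphere_neq0.
- exact: compact_sphere.
- apply: continuous_in_subspaceT; exact: smooth_continuous.
exists (h c); first by apply: h0; exact: set_mem.
move=> x xs; have := hc x (mem_set xs).
by rewrite !radial_sphere//; exact: set_mem.
Qed.

Lemma grad_cst (c : R) x : sphere x -> grad (cst c) x = 0.
Proof.
move=> xs; rewrite grad_Sm//; last exact: Sm_cst.
rewrite (_ : nab _ x = 0).
  by rewrite /tproj sub0r -scaleNr dot3 !mxE !mul0r !addr0 oppr0 scale0r.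
by apply/matrixP => i j; rewrite !mxE derive_cst.
Qed.

Section Fixed.
Variables (h1 h2 u : E -> R) (psi : E -> 'cV[R[i]]_2).
Hypotheses (sh1 : smooth h1) (sh2 : smooth h2).
Hypotheses (h1_gt0 : forall x, sphere x -> 0 < h1 x) (h2_gt0 : forall x, sphere x -> 0 < h2 x).
Hypothesis (weak : weak_solution h1 h2 u psi).

Definition rho x : R := h1 x * expR (2 * u x) - 1 + h2 x * expR (u x) * sqnorm (psi x).
Definition lu : T2 -> R := lift u.
Definition lpsi p : 'cV[R]_4 := \col_k lift (fun x => rvec (psi x) k 0) p.
Definition lP p : R := h2 (coord p) * expR (lu p).
Definition lf p : R := h1 (coord p) * expR (2 * lu p) + lP p * nsq (lpsi p).

Lemma lpsi_rect p : rect p -> lpsi p = rvec (psi (coord p)).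
Proof. by move=> pr; apply/matrixP => k i; rewrite ord1 mxE lift_rect. Qed.

Lemma L2_rvec k : L2 (fun x => rvec (psi x) k 0).
Proof.
have [_ [Lpsi _] _ _] := weak; have [a b] := Lpsi 0; have [c d] := Lpsi 1.
apply: (@ord4P (fun k => L2 (fun x => rvec (psi x) k 0))).
- by move: a; congr L2; apply/funext => x; rewrite mxE.
- by move: b; congr L2; apply/funext => x; rewrite mxE.
- by move: c; congr L2; apply/funext => x; rewrite mxE.
- by move: d; congr L2; apply/funext => x; rewrite mxE.
Qed.

Lemma measurable_lu : measurable_fun [set: T2] lu.
Proof. by have [[[mu _] _] _ _ _] := weak; exact: measurable_lift. Qed.

Lemma measurable_lpsi k : measurable_fun [set: T2] (fun p => lpsi p k 0).
Proof.
have [m _] := L2_rvec k; move: (measurable_lift m); congr measurable_fun.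
by apply/funext => p; rewrite [RHS]mxE.
Qed.

Lemma measurable_expR_lu (c : R) : measurable_fun [set: T2] (fun p => expR (c * lu p)).
Proof. by apply: measurableT_comp => //; apply: measurable_funM => //; exact: measurable_lu. Qed.

Lemma measurable_lP : measurable_fun [set: T2] lP.
Proof.
apply: measurable_funM; first exact: measurable_smooth.
by apply: measurableT_comp => //; exact: measurable_lu.
Qed.

Lemma measurable_nsq_lpsi : measurable_fun [set: T2] (fun p => nsq (lpsi p)).
Proof. by apply: measurable_sum => k; apply: measurable_funM; exact: measurable_lpsi. Qed.

Lemma measurable_lf : measurable_fun [set: T2] lf.
Proof.
apply: measurable_funD; apply: measurable_funM.
- exact: measurable_smooth.
- exact: measurable_expR_lu.
- exact: measurable_lP.
- exact: measurable_nsq_lpsi.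
Qed.

Lemma lf_rect p : rect p -> lf p - 1 = rho (coord p).
Proof.
move=> pr; rewrite /lf /rho /lP /lu lift_rect// lpsi_rect// -sqnorm_rvec; ring.
Qed.

Lemma lP_gt0 p : 0 < lP p.
Proof. by rewrite mulr_gt0 ?expR_gt0// h2_gt0//; exact: coord_sphere. Qed.

Lemma lf_ge0 p : 0 <= lf p.
Proof.
by rewrite addr_ge0// mulr_ge0 ?expR_ge0 ?nsq_ge0 ?(ltW (lP_gt0 p))// ltW// h1_gt0//; exact: coord_sphere.
Qed.

(** The weak gradient of [u] appears in the equation paired with [grad f]; its definition, with [W]
    as test field, moves the derivative off [u]. *)
Lemma weak_div f (W : E -> E) : smooth f -> smooth_field W ->
  (forall x, sphere x -> grad f x = W x) ->
  sint (fun x => - (u x * div W x)) = sint (fun x => rho x * f x).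
Proof.
move=> sf sW fW; have [_ _ [V [_ _ VW] H] _] := weak.
rewrite -(VW _ sW) -(H _ sf); apply: eq_sint => x xs; by rewrite fW.
Qed.

(** The test function 1 gives integral zero in [\bar R]. As [lf >= 0], the negative part of [lf - 1]
    is at most 1, so the positive part cannot have infinite integral. *)
Lemma L1_lf : L1 lf /\ Int lf = fine ((@area R) setT).
Proof.
have mf := measurable_lf.
have mg : measurable_fun [set: T2] (fun p => lf p - 1) by exact: measurable_funB.
have H : (\int[@area R]_p (lf p - 1)%:E = 0)%E.
  have [_ _ [V _ H] _] := weak; have := H (cst 1) (smooth_Sm (Sm_cst _ _)).
  have -> : sint (fun x => dot (V x) (grad (cst 1) x)) = 0%E.
    rewrite (@eq_sint _ (fun=> 0)).
      by rewrite /sint; apply: integral0_eq => p _; rewrite mul0r.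
    by move=> x xs; rewrite grad_cst// dot3 !mxE !mulr0 !addr0.
  move=> ->; apply/esym; apply: sint_area => // p pr.
  by rewrite lf_rect// mulr1.
have Lg : L1 (fun p => lf p - 1).
  have mgE : measurable_fun [set: T2] (EFin \o (fun p => lf p - 1)) by exact/measurable_EFinP.
  have Hneg : (\int[@area R]_p (EFin \o (fun p => (lf p - 1)%R))^\- p < +oo)%E.
    apply: (@le_lt_trans _ _ (\int[@area R]_p (cst 1 p)%:E)%E).
      apply: ge0_le_integral => //; [exact: measurable_funeneg|by apply/measurable_EFinP|].
      move=> p _; rewrite funeneg.unlock /= -?EFinN -EFin_max lee_fin.
      by have := lf_ge0 p; rewrite ge_max; lra.
    have /integrableP[_] := L1_cst (@area R) 1.
    by under eq_integral do rewrite /= normr1.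
  have Hn0 : (0 <= \int[@area R]_p (EFin \o (fun p => (lf p - 1)%R))^\- p)%E by exact: integral_ge0.
  apply/integrableP; split => //.
  under eq_integral => p _ do rewrite -[(`|_|)%E]/((abse \o (EFin \o (fun p => lf p - 1))) p) fune_abse.
  rewrite ge0_integralD//; [|exact: measurable_funepos|exact: measurable_funeneg].
  move: H; rewrite [X in X = _ -> _]integralE; move: Hneg Hn0.
  move: (\int[_]_x (_)^\- x)%E (\int[_]_x (_)^\+ x)%E => [r||]// [s||]// _ _ _.
  by rewrite -EFinD ltry.
have L : L1 lf by apply: eq_L1 (L1D Lg (L1_cst (@area R) 1)) => p; rewrite /= subrK.
split=> //; have := IntB L (L1_cst (@area R) 1); rewrite Int_cst mul1r => h.
by move: H; rewrite -(Int_EFin Lg) h => -[] /eqP; rewrite subr_eq0 => /eqP.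
Qed.

Lemma L1_lu : L1 lu.
Proof.
have [[Lu _] _ _ _] := weak.
apply: (@L1_le _ _ _ _ _ (fun p => 1 + lift u p ^+ 2)).
- exact: measurable_lu.
- move=> p; rewrite /lu; move: (lift u p) => a.
  have := sqr_ge0 (`|a| - 2^-1); rewrite -[a ^+ 2]real_normK ?num_real//; nra.
- by apply: L1D; [exact: L1_cst|exact: L1_sq].
Qed.

Lemma L1_lpsi : L1 (fun p => nsq (lpsi p)).
Proof.
apply: (@eq_L1 _ _ _ _ (fun p => \sum_k lift (fun x => rvec (psi x) k 0) p ^+ 2)).
  by move=> p; rewrite /nsq /ip; apply: eq_bigr => k _; rewrite mxE expr2.
by apply: L1_sum => k; apply: L1_sq; exact: L2_rvec.
Qed.

Lemma L1_expR_lu : L1 (fun p => expR (2 * lu p)).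
Proof.
have [c c0 hc] := smooth_min sh1 h1_gt0; have [L _] := L1_lf.
apply: (L1_le _ _ (L1Z c^-1 L)); first exact: measurable_expR_lu.
move=> p; rewrite ger0_norm ?expR_ge0// [leRHS]mulrC ler_pdivlMr// /lf mulrC.
apply: (@le_trans _ _ (h1 (coord p) * expR (2 * lu p))).
  by rewrite ler_wpM2r ?expR_ge0// hc//; exact: coord_sphere.
by rewrite lerDl mulr_ge0 ?nsq_ge0// ltW// lP_gt0.
Qed.

Lemma lu_repr (t : R) q : 0 < t <= 1 ->
  Int (fun p => kappa coordT t p q * lu p) =
  Int lu - Int (fun p => (lf p - 1) * ln (t + gap coordT p q)).
Proof.
move=> /andP[t0 t1]; pose y : E := coord q.
have H := weak_div (smooth_Sm (Sm_lnzz y t0)) (smooth_field_gradk y t0)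
  (fun x => @grad_lnzz _ t y x t0).
have SV := Sm_zzV y t0.
have mbK : mb (fun p => kappa coordT t p q).
  have : mb (fun p : T2 => (fun x => (t * (2 + t)) * ((zz t y x)^-1 * (zz t y x)^-1)) (coord p)).
    apply: (@mb_Sm _ (fun x => (t * (2 + t)) * ((zz t y x)^-1 * (zz t y x)^-1))).
    by apply: SmZ; exact: SmM.
  congr mb; apply/funext => p.
  by rewrite /kappa (_ : 16 = 8 * 2)%N// exprM rr8_zz// expr2.
have LK : L1 (fun p => kappa coordT t p q * lu p).
  by have [mK [c Kc]] := mbK; exact: L1M_bounded L1_lu mK Kc.
have E1 : fine (sint (fun x => - (u x * div (gradk t y) x))) =
    Int (fun p => - (kappa coordT t p q * lu p - lu p)).
  apply: fine_sint; first by apply: measurable_funN; apply: L1_measurable (L1B LK L1_lu).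
  move=> p pr; rewrite /lu lift_rect// (div_gradk t0 (coord_sphere p) (coord_sphere q)).
  rewrite /kappa (_ : 16 = 8 * 2)%N// exprM rr8_zz// zz_gap gapE dotC; ring.
have E2 : fine (sint (fun x => rho x * ln (zz t y x))) =
    Int (fun p => (lf p - 1) * ln (t + gap coordT p q)).
  have Eg p : ln (t + gap coordT p q) = ln (zz t y (coord p)) by rewrite -zz_gap.
  apply: fine_sint; last by move=> p pr; rewrite lf_rect// Eg.
  apply: measurable_funM; first by apply: measurable_funB => //; exact: measurable_lf.
  under eq_fun do rewrite Eg.
  by apply: (@measurable_Sm _ (fun x => ln (zz t y x))); exact: Sm_lnzz.
move: H => /(congr1 fine); rewrite E1 E2 (IntN (L1B LK L1_lu)) (IntB LK L1_lu).
by move=> <-; ring.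
Qed.

Lemma lpsi_repr (t : R) q (k : 'I_4) : 0 < t <= 1 ->
  Int (fun p => t * rr coordT t p q ^+ 16 *
    (lpsi p - qmul (coord q) (qmul (coord p) (lpsi p))) k 0) =
  Int (fun p => rr coordT t p q ^+ 8 * (lP p * qmul (coord p - coord q) (lpsi p) k 0)).
Proof.
move=> /andP[t0 t1]; pose y : E := coord q; have ys : sphere y := coord_sphere q.
(* With a real basis vector as spinor, the real part of the equation reads off coordinate [k] once
   the Clifford multiplications are moved onto [psi]. *)
pose eta : 'cV[R]_4 := delta_mx k 0.
have subE n (v w : 'cV[R]_n) l : (v - w) l 0 = v l 0 - w l 0 by rewrite !mxE.
have ipk v : ip v eta = v k 0.
  rewrite /ip (bigD1 k)//= big1 ?addr0 => [|i /negPf ik]; rewrite !mxE ?eqxx ?mulr1//.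
  by rewrite ik mulr0.
have Ss : smooth_spinor (fun z => cplx (spk t y eta z)).
  by apply: smooth_spinor_cplx; exact: Smv_spk.
have [_ _ _ W] := weak; have {W} := congr1 (@complex.Re R) (W _ Ss).
rewrite /L2dot /csint /=.
have mc j : measurable_fun [set: T2] (fun p => coord p 0 j) := measurable_coord j.
have mzz : measurable_fun [set: T2] (fun p => (zz t y (coord p))^-1).
  by apply: (@measurable_Sm _ (fun x => (zz t y x)^-1)); exact: Sm_zzV.
have rz p : rr coordT t p q ^+ 8 = (zz t y (coord p))^-1 by rewrite rr8_zz.
have rz2 p : rr coordT t p q ^+ 16 = (zz t y (coord p))^-1 * (zz t y (coord p))^-1.
  by rewrite (_ : 16 = 8 * 2)%N// exprM rz expr2.
rewrite (fine_sint (F := fun p => t * rr coordT t p q ^+ 16 *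
    (lpsi p - qmul (coord q) (qmul (coord p) (lpsi p))) k 0)); last 2 first.
- under eq_fun do rewrite rz2 subE.
  apply: measurable_funM; first by apply: measurable_funM => //; exact: measurable_funM.
  apply: measurable_funB; first exact: measurable_lpsi.
  apply: (@measurable_qmul R _ _ (fun=> coord q) (fun p : T2 => qmul (coord p) (lpsi p))) => [j|].
    exact: measurable_cst.
  by apply: (@measurable_qmul R _ _ (fun p : T2 => coord p) lpsi) => //; exact: measurable_lpsi.
- move=> p pr; rewrite dirac_spk//; last exact: coord_sphere.
  rewrite Re_hdot rvec_cplx -lpsi_rect// rz2 ipZr expr2; congr (_ * _).
  rewrite -ipk ipDr ipNr ipDl ipNl; congr (_ - _).
  by rewrite !ip_qmul opprK.
rewrite (fine_sint (F := fun p => rr coordT t p q ^+ 8 *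
    (lP p * qmul (coord p - coord q) (lpsi p) k 0))) //.
- under eq_fun do rewrite rz; apply: measurable_funM => //.
  apply: measurable_funM; first exact: measurable_lP.
  apply: (@measurable_qmul R _ _ (fun p : T2 => coord p - coord q) lpsi); last exact: measurable_lpsi.
  move=> j; rewrite (_ : (fun p => _) = fun p => coord p 0 j - coord q 0 j).
    by apply: measurable_funB.
  by apply/funext => p; move: (coord p) (coord q) => a b; rewrite !mxE.
- move=> p pr; rewrite rz -ipk.
  have -> (c : R) (z : R[i]) : complex.Re ((c%:C)%C * z) = c * complex.Re z.
    by case: z => a b; simpc.
  rewrite Re_hdot rvec_cplx -lpsi_rect// /lP /lu lift_rect// /spk ipZr -/y.
  by rewrite (ip_qmul (coord p - y)) -ipNr !qmulBl opprB mulrCA.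
Qed.

Lemma lpsi_vanishes : sup [set h2 x | x in sphere] ^+ 2 <= inf [set h1 x | x in sphere] ->
  {ae (@area R), forall p, nsq (lpsi p) = 0}.
Proof.
move=> h12; have [x0 x0s] := @sphere_neq0 R.
have [c1 c1_gt0 h1c] := smooth_min sh1 h1_gt0.
have [c2 c2_gt0 h2c] := smooth_min sh2 h2_gt0.
have [C2 h2C] := smooth_bounded sh2.
have h2M x : sphere x -> h2 x <= sup [set h2 x | x in sphere].
  move=> xs; apply: ub_le_sup; last by exists x.
  by exists C2 => _ [z zs <-]; rewrite (le_trans (ler_norm _))// h2C.
have h1m x : sphere x -> inf [set h1 x | x in sphere] <= h1 x.
  move=> xs; apply: ge_inf; last by exists x.
  by exists c1 => _ [z zs <-]; exact: h1c.
have m0 : 0 <= inf [set h1 x | x in sphere].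
  apply: lb_le_inf; first by exists (h1 x0), x0.
  by move=> _ [z zs <-]; exact/ltW/h1_gt0.
have [Llf Ilf] := L1_lf.
(* A vanishing area would make the conclusion trivial, and the constants ask only for a positive
   one. *)
have [A0|A0] := eqVneq (fine ((@area R) setT)) 0.
  exists setT; split=> //; rewrite -[LHS]fineK ?A0//; exact: fin_num_measure.
have {}A0 : 0 < fine ((@area R) setT) by rewrite lt_neqAle eq_sym A0 fine_ge0.
apply: (@spinor_vanishes _ _ _ (@area R) coord (@coord_sphere R) (@measurable_coord R)
  _ (@rr6_le R) (@kappa_mass R) (@separating_area R) lu lf lP lpsi _ _ c2 A0
  measurable_lpsi measurable_lP L1_lu L1_expR_lu Llf Ilf m0 _ c2_gt0 _ _ L1_lpsi
  lu_repr lpsi_repr (@star_sphere R) h12).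
- by move=> p; rewrite /lf; apply: lerD => //; rewrite ler_wpM2r ?expR_ge0// h1m//; exact: coord_sphere.
- by move=> p; rewrite /lP ler_wpM2r ?expR_ge0// h2c//; exact: coord_sphere.
- by move=> p; rewrite /lP ler_wpM2r ?expR_ge0// h2M//; exact: coord_sphere.
Qed.

(** Within the rectangle the density [sin theta] vanishes only on the lines [theta = 0] and
    [theta = pi], which are null. *)
Lemma ae_area_sae (Q : T2 -> Prop) : {ae (@area R), forall p, Q p} ->
  {ae m2, forall p, rect p -> Q p}.
Proof.
move=> [N [mN N0 QN]].
have H1 : {ae m2, forall p, N p -> (wgt p)%:E = 0%E}.
  apply/(ae_eq_integral_abs m2 mN).
    by apply/measurable_EFinP; apply: measurable_funTS; exact: measurable_wgt.
  rewrite -[RHS]N0; apply: eq_integral => p _.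
  by rewrite /= ger0_norm// wgt_ge0.
have line (c : R) : {ae m2, forall p, p.1 != c}.
  exists ([set c] `*` setT); split.
  - by apply: measurableX => //; exact: measurable_set1.
  - rewrite [LHS](_ : _ = (lebesgue_measure [set c] * lebesgue_measure [set: R])%E).
      by rewrite lebesgue_measure_set1 mul0e.
    by apply: product_measure1E => //; exact: measurable_set1.
  - by move=> p /= /negP; rewrite negbK => /eqP.
apply: filterS3 H1 (line 0) (line pi) => p Np p0 p1 pr.
apply: contrapT => nQ; have /eqP := Np (QN p nQ).
rewrite /wgt indicE mem_set// mul1r eqe; apply/negP; rewrite gt_eqF//.
case: pr => /=; rewrite in_itv /= => /andP[a b] _.
by apply: sin_gt0_pi; rewrite !lt_neqAle a b eq_sym p0 p1.
Qed.

Lemma psi_vanishes : sup [set h2 x | x in sphere] ^+ 2 <= inf [set h1 x | x in sphere] ->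
  sae (fun x => psi x = 0).
Proof.
move=> /lpsi_vanishes /ae_area_sae; apply: filterS => p H pr.
apply: rvec_eq0; rewrite -lpsi_rect//; exact: nsq_eq0 (H pr).
Qed.

End Fixed.
End WeakSolution.

Theorem theorem1p13 (R : realType) (h1 h2 : 'rV[R]_3 -> R)
    (h1_smooth : smooth h1) (h2_smooth : smooth h2)
    (h1_gt0 : forall x, sphere x -> 0 < h1 x)
    (h2_gt0 : forall x, sphere x -> 0 < h2 x)
    (solvable : exists (u : 'rV[R]_3 -> R) (psi : 'rV[R]_3 -> 'cV[R[i]%C]_2),
       weak_solution h1 h2 u psi /\ ~ sae (fun x => psi x = 0)) :
  inf [set h1 x | x in sphere] < sup [set h2 x | x in sphere] ^+ 2.
Proof.
have [u [psi [weak psi_neq0]]] := solvable; rewrite ltNge; apply/negP => h12.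
exact: psi_neq0 (psi_vanishes h1_smooth h2_smooth h1_gt0 h2_gt0 weak h12).
Qed.
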